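(* Let $0<H\leq \frac12$ and let $M\subset \mathbb{H}^2\times\mathbb{R}$ be a surface (possibly with boundary) with constant mean curvature $H$ and at least one properly embedded annular end. Then $M$ cannot be contained in the horizontal slab $\mathbb{H}^2\times[0,L]$, for any $L>0$. In particular, for $0<H\leq\frac12$, there is no properly embedded surface (without boundary) of constant mean curvature $H$ and finite topology contained in a horizontal slab of $\mathbb{H}^2\times\mathbb{R}$.
   Context: $\mathbb{H}^2$ is the hyperbolic plane of constant curvature $-1$, and $\mathbb{H}^2\times\mathbb{R}$ carries the product metric $g_{-1}+dt^2$. The mean curvature is the average (half the trace of the second fundamental form) of the principal curvatures, so that a vertical cylinder $\gamma\times\mathbb{R}$ over a curve $\gamma\subset\mathbb{H}^2$ of constant geodesic curvature $2H$ has mean curvature $H$. A surface has constant mean curvature $H>0$ if its mean curvature vector is $\overrightarrow{H}=HN$ for a unit normal field $N$. A properly embedded annular end of $M$ is a subset $E\subset M$ that is the image of a proper embedding into $\mathbb{H}^2\times\mathbb{R}$ of the half-open annulus $\mathbb{S}^1\times[0,+\infty)$; in particular $E$ has compact boundary $\partial E$ (one closed curve). A surface without boundary has finite topology if it is homeomorphic to a compact surface (without boundary) with finitely many points removed. A horizontal slab is a set of the form $\mathbb{H}^2\times[a,b]$ with $a<b$ real numbers. *)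

(* Defs.v *)
From HB Require Import structures.
From mathcomp Require Import all_boot all_order all_algebra.
From mathcomp Require Import all_classical all_reals all_analysis.

Set Implicit Arguments.
Unset Strict Implicit.
Unset Printing Implicit Defensive.

Import Order.TTheory GRing.Theory Num.Theory numFieldNormedType.Exports.
Local Open Scope classical_set_scope.
Local Open Scope ring_scope.

Section TopologicalNotions.

Definition embedding (S T : topologicalType) (f : S -> T) : Prop :=
  [/\ continuous f, injective f &
      forall O : set S, open O ->
        exists2 V : set T, open V & f @` O = V `&` range f].

Definition proper_map (S T : topologicalType) (f : S -> T) : Prop :=
  continuous f /\ forall K : set T, compact K -> compact (f @^-1` K).

Variable R : realType.

Definition half_plane : set 'rV[R]_2 := [set a | 0 <= a 0 1].

(* D is the model domain (the plane or the closed half-plane): the parameters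
   are the points of the relatively open subset U `&` D of D, on which c is an
   open embedding. *)
Definition is_chart (T : topologicalType) (D U : set 'rV[R]_2)
    (c : 'rV[R]_2 -> T) : Prop :=
  [/\ open U,
      {within U `&` D, continuous c},
      {in U `&` D &, injective c} &
      forall V, open V -> open (c @` (V `&` (U `&` D)))].

Definition surface_without_boundary (S : topologicalType) : Prop :=
  [/\ hausdorff_space S, @second_countable S &
      forall x : S, exists U c,
        @is_chart S setT U c /\ exists2 a, U a & c a = x].

Definition finite_topology (T : topologicalType) : Prop :=
  exists (S : topologicalType) (F : set S) (h : T -> S),
    [/\ surface_without_boundary S, compact [set: S], finite_set F,
        embedding h & range h = ~` F].

Definition circle : set (R * R) := [set z | z.1 ^+ 2 + z.2 ^+ 2 = 1].

Definition half_line : set R := [set s | 0 <= s].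

Definition half_open_annulus : topologicalType := (circle * half_line)%type.

End TopologicalNotions.

Section AmbientSpace.
Variable R : realType.

(* Upper half-plane model: the coordinates 0, 1, 2 of a point are x, y, t, with
   y > 0 and metric (dx^2 + dy^2) / y^2 + dt^2. *)
Definition half_space : set 'rV[R]_3 := [set p | 0 < p 0 1].

Definition H2R : topologicalType := set_type half_space.

Definition coords (q : H2R) : 'rV[R]_3 := set_val q.

Definition slab (a b : R) : set H2R := [set q | a <= coords q 0 2 <= b].

Definition metric (p : 'rV[R]_3) : 'M[R]_3 :=
  diag_mx (\row_i if i == 2 then 1 else (p 0 1 ^+ 2)^-1).

Definition inner (p v w : 'rV[R]_3) : R := (v *m metric p *m w^T) 0 0.

(* Christoffel symbol Gamma^k_ij of the Levi-Civita connection of metric. *)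
Definition christoffel (p : 'rV[R]_3) (k i j : 'I_3) : R :=
  let dg l m n := 'D_(delta_mx 0 l) (fun q => metric q m n) p in
  2^-1 * \sum_l invmx (metric p) k l * (dg i j l + dg j i l - dg l i j).

End AmbientSpace.

Section LocalGeometry.
Variable R : realType.
Implicit Types (X : 'rV[R]_2 -> 'rV[R]_3) (a : 'rV[R]_2).

Definition partial (i : 'I_2) X : 'rV[R]_2 -> 'rV[R]_3 :=
  fun a => 'D_(delta_mx 0 i) X a.

Fixpoint Ck (k : nat) (U : set 'rV[R]_2) X : Prop :=
  if k is k'.+1 then
    forall i : 'I_2,
      (forall a, U a -> derivable X a (delta_mx 0 i)) /\ Ck k' U (partial i X)
  else forall a, U a -> {for a, continuous X}.

Definition smooth_on (U : set 'rV[R]_2) X : Prop := forall k, Ck k U X.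

Definition first_form X a : 'M[R]_2 :=
  \matrix_(i, j) inner (X a) (partial i X a) (partial j X a).

(* Covariant derivative of partial j X in the direction of partial i X. *)
Definition covariant X a (i j : 'I_2) : 'rV[R]_3 :=
  \row_k (partial i (partial j X) a 0 k +
          \sum_l \sum_m christoffel (X a) k l m *
                        partial i X a 0 l * partial j X a 0 m).

Definition normal_part X a (v : 'rV[R]_3) : 'rV[R]_3 :=
  v - \sum_i \sum_j (invmx (first_form X a) i j *
                     inner (X a) v (partial i X a)) *: partial j X a.

(* Half the trace, with respect to the first fundamental form, of the
   vector-valued second fundamental form. *)
Definition mean_curvature_vector X a : 'rV[R]_3 :=
  2^-1 *: \sum_i \sum_j invmx (first_form X a) i j *:
                        normal_part X a (covariant X a i j).

End LocalGeometry.

Section Surfaces.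
Variables (R : realType) (T : topologicalType) (f : T -> H2R R).

(* X is f in the chart c; it is smooth on all of U, so that at the boundary
   points of D smoothness means, as usual, having a smooth extension. *)
Definition local_parametrization (D U : set 'rV[R]_2) (c : 'rV[R]_2 -> T)
    (X : 'rV[R]_2 -> 'rV[R]_3) : Prop :=
  [/\ is_chart D U c,
      smooth_on U X &
      forall a, (U `&` D) a ->
        X a = coords (f (c a)) /\ row_free (\matrix_(i < 2) partial i X a)].

Definition parametrized_at (D : set 'rV[R]_2) (x : T) : Prop :=
  exists U c X,
    local_parametrization D U c X /\ exists2 a, (U `&` D) a & c a = x.

(* An immersed surface, possibly with boundary: T is the abstract surface and
   f is the immersion. The local parametrizations determine the smooth structure
   of T, since an immersion is locally a smooth embedding. An embedded surface M
   is the case of the inclusion set_val of a subset M of H2R, with its induced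
   topology. *)
Definition immersed_surface : Prop :=
  [/\ hausdorff_space T, @second_countable T &
      forall x, parametrized_at setT x \/ parametrized_at (@half_plane R) x].

Definition immersed_surface_without_boundary : Prop :=
  [/\ hausdorff_space T, @second_countable T &
      forall x, parametrized_at setT x].

Definition has_constant_mean_curvature (H : R) : Prop :=
  exists2 N : T -> 'rV[R]_3, continuous N &
    forall D U c X, D = setT \/ D = @half_plane R ->
      local_parametrization D U c X ->
      forall a, (U `&` D) a ->
        [/\ inner (X a) (N (c a)) (N (c a)) = 1,
            forall i, inner (X a) (N (c a)) (partial i X a) = 0 &
            mean_curvature_vector X a = H *: N (c a)].

(* The annulus is parametrized inside the abstract surface T, so that E does not
   switch between sheets of a surface with self-intersections. For an embedded
   surface this only says that E is a subset of it. *)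
Definition properly_embedded_annular_end (E : set (H2R R)) : Prop :=
  exists e : half_open_annulus R -> T,
    [/\ continuous e, embedding (f \o e), proper_map (f \o e) &
        E = range (f \o e)].

End Surfaces.

(* Main.v *)
(* Idea of the proof.  Let E be the end, with compact boundary E0, in a slab.
   Sweeping by graphs of functions of the hyperbolic distance to a point p, and
   the maximum principle, show that where E0 is far from the vertical line over p
   the top and the bottom of the slab are on the same side of any subset of E that
   is open and closed in a neighbourhood of that line.  Hence the parity of the
   number of intersections of E with the vertical line over p yields a Z/2-valued
   cocycle on E, whose variation with p is, away from p, the coboundary of an
   explicit function.  An annular end retracts to infinity, so between two
   neighbouring points of a grid this variation is the coboundary of a function k
   on E that vanishes far away, and k is locally constant off a neighbourhood of
   p.  Around the boundary of a large rectangle the explicit functions add up to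
   the indicator of the rectangle, so k cannot vanish on E0 for all pairs: for p
   arbitrarily far, some bounded piece of E contains E0 and has its frontier near
   the vertical line over p.  Comparing two such pieces for distant points p1 and
   p2 gives a compact piece of E without boundary except near the vertical lines
   over p1 and p2.  Let s be the distance to the geodesic through p1 and p2.  The
   graphs of - cosh s have mean curvature 1 / 2, and perturbing t + cosh s gives
   a function without local maximum on the piece but, when p1 and p2 are far
   enough apart, larger in the middle of it than near its frontier.

   A surface of finite topology is compact, and then the distance to a vertical
   line has a local maximum, or it has a puncture, and then an annular end. *)

Require Import Defs.
From mathcomp Require Import all_boot all_order all_algebra.
From mathcomp Require Import all_classical all_reals all_analysis.
From mathcomp Require Import ring lra.

Set Implicit Arguments.
Unset Strict Implicit.
Unset Printing Implicit Defensive.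

Import Order.TTheory GRing.Theory Num.Theory numFieldNormedType.Exports.
Local Open Scope classical_set_scope.
Local Open Scope ring_scope.

(** * Lifting cocycles along homotopies *)

(** The value [1 / 2] is critical: for it the graphs of [- cosh s] solve the equation exactly, so a
    contradiction at a contact point needs a strict margin, and the margin available depends on an
    upper bound for [s]. That bound has to be independent of [p1] and [p2]; it is obtained first, by
    comparison with the cylinders over the curves equidistant from the geodesic. Once the margin is
    fixed, subtracting a small multiple of the logarithm of the sum of the hyperbolic cosines of the
    distances to [p1] and [p2] is harmless at contact points. Between the middle and the lines this
    logarithm changes by an amount that is unbounded in the distance of [p1] and [p2], and this
    decides. On the topological side the end need not separate the slab, so there is no inside to
    compare with; a cohomology class modulo 2 replaces it. Cochains are plain functions of two
    nearby points, cocycles are additive on small sets, and integration along a path is a finite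
    sum, so that the topology reduces to compactness, connectedness and invariance of domain. *)

Lemma compact_uniform_radius (R : realType) (X : pseudoMetricType R)
    (K : set X) (P : X -> R -> Prop) :
  compact K ->
  (forall x, K x -> exists2 e : R, 0 < e &
     forall y d, ball x e y -> 0 < d -> d < e -> P y d) ->
  exists2 e : R, 0 < e & forall x, K x -> P x e.
Proof.
move=> /compact_near_coveringP cK loc.
have /cK : forall x, K x ->
    \forall y \near x & d \near (0 : R)^'+, (fun d y => P y d) d y.
  move=> x /loc[e e0 eP]; exists (ball x e, [set d | 0 < d < e]) => /=.
    split; first exact: nbhsx_ballx.
    by apply: filterS2 (nbhs_right_gt 0) (nbhs_right_lt e0) => d d0 de; apply/andP.
  by move=> [y d] /= [xy /andP[d0 de]]; exact: eP.
move=> near0.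
have [d d0 dP] : exists2 d : R, 0 < d & K `<=` (fun x => P x d).
  near (0 : R)^'+ => d; exists d => //.
  by near: d; exact: near0.
by exists d.
Unshelve. all: by end_near.
Qed.

(** The cocycle condition for an Alexander-Spanier 1-cochain. No continuity of [c] is involved, so
    that step functions with values in [bool] or [int] serve. *)
Definition additive_on (Y : Type) (G : zmodType) (c : Y -> Y -> G)
    (S : set Y) : Prop :=
  forall u v w, S u -> S v -> S w -> c u v + c v w = c u w.

Lemma additive_onS (Y : Type) (G : zmodType) (c : Y -> Y -> G) (S S' : set Y) :
  S `<=` S' -> additive_on c S' -> additive_on c S.
Proof. by move=> SS' ad u v w /SS' u' /SS' v' /SS' w'; exact: ad. Qed.

Lemma additive_on_id (Y : Type) (G : zmodType) (c : Y -> Y -> G) (S : set Y) u :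
  additive_on c S -> S u -> c u u = 0.
Proof. by move=> ad Su; apply: (addrI (c u u)); rewrite addr0 ad. Qed.

(** The integral of the cocycle [c] along the path [H x], for a subdivision so fine that only the
    local additivity of [c] matters. *)
Definition lift_along (R : realType) (X Y : Type) (G : zmodType) (H : X -> R -> Y)
    (c : Y -> Y -> G) (N : nat) (x : X) : G :=
  \sum_(j < N) c (H x (j%:R / N%:R)) (H x (j.+1%:R / N%:R)).

(* Each quadrilateral with vertices H x s, H x s', H y s', H y s is so small that
   c sums to 0 along its boundary. *)
Lemma homotopy_lift (R : realType) (X : pseudoMetricType R) (K : set X)
    (Y : Type) (G : zmodType) (H : X -> R -> Y) (c : Y -> Y -> G) :
  compact K ->
  (forall x s, K x -> 0 <= s <= 1 -> exists2 e : R, 0 < e &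
     additive_on c ((fun p : X * R => H p.1 p.2) @`
       [set p | [/\ K p.1, 0 <= p.2 <= 1, ball x e p.1 & `|s - p.2| < e]])) ->
  exists2 N : nat, (0 < N)%N & exists2 e : R, 0 < e &
    forall x y, K x -> K y -> ball x e y ->
    lift_along H c N y - lift_along H c N x =
      c (H x 1) (H y 1) - c (H x 0) (H y 0).
Proof.
move=> cK loc.
have cKI : compact (K `*` `[(0 : R), 1]).
  by apply: compact_setX => //; exact: segment_compact.
pose P (q : X * R) (e : R) :=
  additive_on c ((fun p : X * R => H p.1 p.2) @`
       [set p | [/\ K p.1, 0 <= p.2 <= 1, ball q.1 e p.1 & `|q.2 - p.2| < e]]).
have [e e0 eP] : exists2 e : R, 0 < e & forall q, (K `*` `[(0 : R), 1]) q -> P q e.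
  apply: compact_uniform_radius => // -[x s] /= [Kx].
  rewrite in_itv /= => s01; have [e e0 eP] := loc _ _ Kx s01.
  exists (e / 2); first by rewrite divr_gt0.
  move=> [y r] d [/= xy sr] d0 de; apply: additive_onS eP => _ /= [[z t] /= [Kz t01 yz rt]] <-.
  exists (z, t) => //=; split => //.
    rewrite (splitr e); apply: (ball_triangle xy).
    by apply: le_ball yz; exact: ltW.
  rewrite (splitr e); apply: (le_lt_trans (ler_distD r _ _)).
  by rewrite ltrD// (lt_trans rt).
have [N N0 Ne] : exists2 N : nat, (0 < N)%N & N%:R^-1 < e.
  have [N _ /(_ _ (leqnn N)) NP] := near_infty_natSinv_lt (PosNum e0).
  by exists N.+1.
exists N => //; exists e => // x y Kx Ky xy.
have Nr : 0 < N%:R :> R by rewrite ltr0n.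
have j01 (j : nat) : (j <= N)%N -> 0 <= (j%:R / N%:R : R) <= 1.
  by move=> jN; rewrite divr_ge0//= ler_pdivrMr// mul1r ler_nat.
have quad (j : nat) : (j < N)%N ->
    c (H y (j%:R / N%:R)) (H y (j.+1%:R / N%:R)) -
    c (H x (j%:R / N%:R)) (H x (j.+1%:R / N%:R)) =
    c (H x (j.+1%:R / N%:R)) (H y (j.+1%:R / N%:R)) -
    c (H x (j%:R / N%:R)) (H y (j%:R / N%:R)).
  move=> jN.
  have ad := eP (x, j%:R / N%:R) (conj Kx (j01 j (ltnW jN))).
  have dj : `|(j%:R / N%:R : R) - j.+1%:R / N%:R| < e.
    rewrite -mulrBl -natr1 opprD addrA subrr sub0r mulN1r normrN.
    by rewrite ger0_norm// invr_ge0.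
  have in1 : ((fun p : X * R => H p.1 p.2) @`
       [set p | [/\ K p.1, 0 <= p.2 <= 1, ball x e p.1 & `|j%:R / N%:R - p.2| < e]])
       (H x (j.+1%:R / N%:R)).
    by exists (x, j.+1%:R / N%:R) => //; split => //=; [exact: j01|exact: ballxx].
  have in0 : ((fun p : X * R => H p.1 p.2) @`
       [set p | [/\ K p.1, 0 <= p.2 <= 1, ball x e p.1 & `|j%:R / N%:R - p.2| < e]])
       (H x (j%:R / N%:R)).
    exists (x, j%:R / N%:R) => //; split => //=; first exact/j01/ltnW.
    - exact: ballxx.
    - by rewrite subrr normr0.
  have in3 : ((fun p : X * R => H p.1 p.2) @`
       [set p | [/\ K p.1, 0 <= p.2 <= 1, ball x e p.1 & `|j%:R / N%:R - p.2| < e]])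
       (H y (j.+1%:R / N%:R)).
    by exists (y, j.+1%:R / N%:R) => //; split => //=; exact: j01.
  have in2 : ((fun p : X * R => H p.1 p.2) @`
       [set p | [/\ K p.1, 0 <= p.2 <= 1, ball x e p.1 & `|j%:R / N%:R - p.2| < e]])
       (H y (j%:R / N%:R)).
    exists (y, j%:R / N%:R) => //; split => //=; first exact/j01/ltnW.
    by rewrite subrr normr0.
  apply/eqP; rewrite subr_eq addrAC eq_sym subr_eq addrC; apply/eqP.
  by rewrite ad// addrC ad.
rewrite /lift_along -sumrB.
under eq_bigr => j _ do rewrite quad//.
rewrite -(big_mkord xpredT (fun j => c (H x (j.+1%:R / N%:R)) (H y (j.+1%:R / N%:R)) -
    c (H x (j%:R / N%:R)) (H y (j%:R / N%:R)))).
rewrite (telescope_sumr (fun j => c (H x (j%:R / N%:R)) (H y (j%:R / N%:R))))//.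
by rewrite divff ?gt_eqF// mul0r.
Qed.

Section PointwiseContinuity.
Variables (R : realType) (T : topologicalType) (p : T).

Lemma cont_cst (U : topologicalType) (c : U) : {for p, continuous (fun _ : T => c)}.
Proof. exact: cvg_cst. Qed.

Lemma near_cont (U : topologicalType) (f : T -> U) (P : set U) :
  {for p, continuous f} -> (\forall z \near f p, P z) -> \forall q \near p, P (f q).
Proof. by move=> fc h; exact: (fc P h). Qed.

Lemma cont_id : {for p, continuous (fun q : T => q)}.
Proof. exact: cvg_id. Qed.

Lemma cont_pair (U V : topologicalType) (f : T -> U) (g : T -> V) :
  {for p, continuous f} -> {for p, continuous g} ->
  {for p, continuous (fun q => (f q, g q))}.
Proof. by move=> fc gc; exact: (cvg_pair fc gc). Qed.

Lemma cont_comp (U V : topologicalType) (f : T -> U) (g : U -> V) :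
  {for p, continuous f} -> {for f p, continuous g} ->
  {for p, continuous (fun q => g (f q))}.
Proof. by move=> fc gc; exact: (continuous_comp fc gc). Qed.

Lemma contD (V : normedModType R) (f g : T -> V) :
  {for p, continuous f} -> {for p, continuous g} ->
  {for p, continuous (fun q => f q + g q)}.
Proof. by move=> fc gc; exact: (cvgD fc gc). Qed.

Lemma contB (V : normedModType R) (f g : T -> V) :
  {for p, continuous f} -> {for p, continuous g} ->
  {for p, continuous (fun q => f q - g q)}.
Proof. by move=> fc gc; exact: (cvgB fc gc). Qed.

Lemma contN (V : normedModType R) (f : T -> V) :
  {for p, continuous f} -> {for p, continuous (fun q => - f q)}.
Proof. by move=> fc; exact: (cvgN fc). Qed.

Lemma contZ (V : normedModType R) (f : T -> R) (g : T -> V) :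
  {for p, continuous f} -> {for p, continuous g} ->
  {for p, continuous (fun q => f q *: g q)}.
Proof. by move=> fc gc; exact: (cvgZ fc gc). Qed.

Lemma contM (f g : T -> R) :
  {for p, continuous f} -> {for p, continuous g} ->
  {for p, continuous (fun q => f q * g q)}.
Proof. by move=> fc gc; exact: (cvgM fc gc). Qed.

Lemma contV (f : T -> R) : f p != 0 ->
  {for p, continuous f} -> {for p, continuous (fun q => (f q)^-1)}.
Proof. by move=> f0 fc; exact: (cvgV f0 fc). Qed.

Lemma contX (f : T -> R) n :
  {for p, continuous f} -> {for p, continuous (fun q => f q ^+ n)}.
Proof.
move=> fc; apply: (cont_comp (g := fun x : R => x ^+ n)) => //.
exact: exprn_continuous.
Qed.

Lemma cont_norm (V : normedModType R) (f : T -> V) :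
  {for p, continuous f} -> {for p, continuous (fun q => `|f q|)}.
Proof. by move=> fc; exact: (cvg_norm fc). Qed.

End PointwiseContinuity.

(** * Invariance of domain in the plane *)

Lemma loc_const_connected (X : topologicalType) (Y : Type) (A : set X)
    (f : X -> Y) :
  connected A -> (forall x, A x -> \forall y \near x, A y -> f y = f x) ->
  forall x y, A x -> A y -> f y = f x.
Proof.
move=> cA loc x y Ax Ay.
pose B := [set z | A z /\ f z = f x].
suff BA : B = A by have [] : B y by rewrite BA.
apply: cA; first by exists x.
- exists (interior [set z | A z -> f z = f x]); first exact: open_interior.
  apply/seteqP; split => z [Az].
  + by move=> fz; split => //; apply: filterS (loc z Az) => w /[apply] ->.
  + by move=> /interior_subset /(_ Az) fz; split.
- exists (~` interior [set z | A z -> f z <> f x]).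
    exact/open_closedC/open_interior.
  apply/seteqP; split => z [Az].
  + by move=> fz; split => //= /interior_subset /(_ Az).
  + move=> /= nz; split => //; apply: contrapT => fz; apply: nz.
    by apply: filterS (loc z Az) => w /[apply] ->.
Qed.

(** * Winding numbers modulo 2 in the punctured plane *)

Section PlaneCut.
Variable R : realType.
Implicit Types u v w : R * R.

(** The boundary line is divided so that exactly one of [u] and [- u] belongs to the set when
    [u != 0]. *)
Definition upper_half u : bool := (0 < u.2) || ((u.2 == 0) && (0 < u.1)).

(** Crossings of the positive horizontal axis. Since only short steps matter, the sign of the first
    coordinate is tested at [u] alone. *)
Definition cut u w : bool := (upper_half u (+) upper_half w) && (0 < u.1).

Lemma ball_pairE u w (e : R) :
  ball u e w <-> `|u.1 - w.1| < e /\ `|u.2 - w.2| < e.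
Proof. by []. Qed.

(** To the left of the vertical axis [cut] vanishes, to the right it is the coboundary of
    [upper_half], and near a point of the vertical axis other than 0 [upper_half] is constant. *)
Lemma cut_additive u : u != 0 ->
  exists2 e : R, 0 < e & additive_on (G := bool) cut (ball u e).
Proof.
case: u => a b ab0.
have [a0|a0|a0] := ltgtP a 0.
- exists (- a); first by lra.
  move=> u v w /ball_pairE[/=/ltr_normlP[u1a u1] _] /ball_pairE[/=/ltr_normlP[v1a v1] _] _.
  have -> : cut u v = false by rewrite /cut (_ : 0 < u.1 = false) ?andbF//; apply/negbTE; rewrite -leNgt; lra.
  have -> : cut v w = false by rewrite /cut (_ : 0 < v.1 = false) ?andbF//; apply/negbTE; rewrite -leNgt; lra.
  by rewrite /cut (_ : 0 < u.1 = false) ?andbF//; apply/negbTE; rewrite -leNgt; lra.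
- exists a => //.
  move=> u v w /ball_pairE[/=/ltr_normlP[u1 u1b] _] /ball_pairE[/=/ltr_normlP[v1 v1b] _] _.
  rewrite /cut (_ : 0 < u.1); last by lra.
  rewrite (_ : 0 < v.1); last by lra.
  by rewrite !andbT; case: (upper_half u); case: (upper_half v); case: (upper_half w).
- have b0 : b != 0 by apply: contra ab0 => /eqP ->; rewrite a0.
  exists `|b|; first by rewrite normr_gt0.
  have hs u : ball (a, b) `|b| u -> upper_half u = (0 < b).
    move=> /ball_pairE[_ /=]; rewrite /upper_half.
    have [b1|b1|/eqP] := ltgtP b 0; last by rewrite (negbTE b0).
    + rewrite (ltr0_norm b1) => /ltr_normlP[u2a u2].
      rewrite [0 < u.2](_ : _ = false); last by apply/negbTE; rewrite -leNgt; lra.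
      by rewrite (_ : u.2 == 0 = false)//; apply/negbTE; rewrite lt_eqF//; lra.
    + rewrite (gtr0_norm b1) => /ltr_normlP[u2 u2b].
      by rewrite (_ : 0 < u.2)//; lra.
  by move=> u v w /hs hu /hs hv /hs hw; rewrite /cut hu hv hw addbb.
Qed.

Lemma upper_halfN u : u != 0 -> upper_half (- u) = ~~ upper_half u.
Proof.
case: u => a b ab0; rewrite /upper_half/= !oppr_gt0 oppr_eq0.
have [b0|b0|b0]//= := ltgtP b 0.
have [a0|a0|a0]//= := ltgtP a 0.
by rewrite a0 b0 eqxx in ab0.
Qed.

(** Exactly one of [u] and [- u] is to the right of the vertical axis and contributes; near that
    axis [upper_half] is constant and both sides vanish. *)
Lemma cut_opp u : u != 0 -> exists2 e : R, 0 < e &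
  forall w, ball u e w ->
    cut u w (+) cut (- u) (- w) = upper_half u (+) upper_half w.
Proof.
case: u => a b ab0.
have [a0|a0|a0] := ltgtP a 0.
- exists (- a); first by lra.
  move=> w /ball_pairE[/=/ltr_normlP[w1a w1] _].
  have w0 : w != 0 by apply/eqP => w0; rewrite w0 /= in w1a; lra.
  rewrite /cut/= !upper_halfN//= (_ : 0 < a = false); last first.
    by apply/negbTE; rewrite -leNgt ltW.
  by rewrite oppr_gt0 a0 andbF andbT; case: (upper_half w); case: (upper_half (a, b)).
- exists a => //.
  move=> w /ball_pairE[/=/ltr_normlP[w1 w1b] _].
  rewrite /cut/= a0 oppr_gt0 (_ : a < 0 = false); last first.
    by apply/negbTE; rewrite -leNgt ltW.
  by rewrite andbF andbT addbF.
- have b0 : b != 0 by apply: contra ab0 => /eqP ->; rewrite a0.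
  have [e e0 _] := cut_additive ab0.
  exists `|b|; first by rewrite normr_gt0.
  move=> w /ball_pairE[_ /= w2].
  rewrite /cut/= a0 oppr0 ltxx !andbF/= /upper_half/=.
  have [b1|b1|/eqP] := ltgtP b 0; last by rewrite (negbTE b0).
  + move: w2; rewrite (ltr0_norm b1) => /ltr_normlP[w2a w2].
    rewrite [0 < w.2](_ : _ = false); last by apply/negbTE; rewrite -leNgt; lra.
    by rewrite (_ : w.2 == 0 = false)//; apply/negbTE; rewrite lt_eqF//; lra.
  + move: w2; rewrite (gtr0_norm b1) => /ltr_normlP[w2 w2b].
    by rewrite (_ : 0 < w.2)//; lra.
Qed.

End PlaneCut.

Section EvenLoop.
Variable R : realType.
Let T : R := 2 * pi.

Let T_ge0 : 0 <= T. Proof. by rewrite mulr_ge0// pi_ge0. Qed.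

(* A loop in the punctured plane has even winding number iff its crossings with
   the cut form a coboundary. *)
Definition even_loop (psi : R -> R * R) : Prop :=
  exists2 f : R -> bool, f T = f 0 &
    forall a, 0 <= a <= T -> exists2 e : R, 0 < e &
      forall b, 0 <= b <= T -> `|a - b| < e -> f b - f a = cut (psi a) (psi b).

(** The primitive [f] on the initial loop is carried along by adding the crossings on the track
    [H a] of each point; the tracks of [0] and [T] coincide, so the new primitive still closes
    up. *)
Lemma even_loop_homotopy (H : R -> R -> R * R) :
  (forall a s, 0 <= a <= T -> 0 <= s <= 1 -> H a s != 0) ->
  (forall a s, 0 <= a <= T -> 0 <= s <= 1 ->
     {for (a, s), continuous (fun p : R * R => H p.1 p.2)}) ->
  (forall s, 0 <= s <= 1 -> H T s = H 0 s) ->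
  even_loop (H^~ 0) -> even_loop (H^~ 1).
Proof.
move=> H0 Hc HT [f fT floc].
have cK : compact `[(0 : R), T] by exact: segment_compact.
have [|N N0 [d d0 dP]] := homotopy_lift (H := H) (c := @cut R) (G := bool) cK.
  move=> a s; rewrite /= in_itv /= => a01 s01.
  have [e e0 ead] := cut_additive (H0 _ _ a01 s01).
  have /(_ (nbhsx_ballx _ _ e0)) := Hc _ _ a01 s01 (ball (H a s) e).
  move=> /nbhs_ballP[d d0 dP]; exists d => //.
  apply: additive_onS ead => _ [[b t] /= [_ _ ab st] <-].
  by apply: (dP (b, t)); split.
exists (fun a => f a + lift_along H (cut (R := R) : _ -> _ -> bool) N a).
  rewrite fT; congr (_ + _); apply: eq_bigr => j _.
  have j01 (i : nat) : (i <= N)%N -> 0 <= (i%:R / N%:R : R) <= 1.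
    by move=> iN; rewrite divr_ge0//= ler_pdivrMr ?ltr0n// mul1r ler_nat.
  by rewrite !HT//; apply: j01 => //; apply: ltnW.
move=> a a01; have [e e0 eP] := floc a a01.
exists (Num.min d e); first by rewrite lt_min d0.
move=> b b01; rewrite lt_min => /andP[bd be].
rewrite opprD addrACA eP// dP ?in_itv//=.
by rewrite addrC subrK.
Qed.

(** By [cut_opp] the function [k] below is locally constant on the half circle. Equality of its
    values at [0] and [pi] would put [psi 0] and [psi pi = - psi 0] in the same half-plane. *)
Lemma odd_loop (psi : R -> R * R) :
  (forall a, 0 <= a <= T -> psi a != 0) ->
  (forall a, 0 <= a <= T -> {for a, continuous psi}) ->
  (forall a, 0 <= a <= pi -> psi (a + pi) = - psi a) ->
  ~ even_loop psi.
Proof.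
move=> psi0 psic psiN [f fT floc].
pose k a := f a (+) f (a + pi) (+) upper_half (psi a).
have pi0 : 0 < pi :> R by exact: pi_gt0.
have TE : T = pi + pi by rewrite /T; lra.
have : k pi = k 0.
  apply: (@loc_const_connected R _ `[0, pi] k).
  - exact: segment_connected.
  - move=> a; rewrite /= in_itv/= => /andP[a0 api].
    have aT : 0 <= a <= T by rewrite TE; apply/andP; split; lra.
    have aT' : 0 <= a + pi <= T by rewrite TE; apply/andP; split; lra.
    have [e e0 eP] := floc a aT.
    have [e' e'0 e'P] := floc (a + pi) aT'.
    have [d d0 dP] := cut_opp (psi0 a aT).
    have /(_ (nbhsx_ballx _ _ d0)) := psic _ aT (ball (psi a) d).
    move=> nd; near=> b; rewrite in_itv/= => /andP[b0 bpi].
    have bT : 0 <= b <= T by rewrite TE; apply/andP; split; lra.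
    have bT' : 0 <= b + pi <= T by rewrite TE; apply/andP; split; lra.
    have ab : `|a - b| < e by near: b; exact: nbhsx_ballx.
    have ab' : `|(a + pi) - (b + pi)| < e'.
      by rewrite opprD addrACA subrr addr0; near: b; exact: nbhsx_ballx.
    have bd : ball (psi a) d (psi b) by near: b.
    have := dP _ bd; rewrite -!psiN ?b0 ?a0// -eP// -e'P// /k.
    change (fun x y : bool => x - y) with addb.
    by case: (f a); case: (f b); case: (f (a + pi)); case: (f (b + pi));
      case: (upper_half (psi a)); case: (upper_half (psi b)).
  - by rewrite /= in_itv/= lexx ltW.
  - by rewrite /= in_itv/= lexx ltW.
rewrite /k add0r -TE fT -[X in psi X]add0r psiN ?lexx ?ltW// upper_halfN; last first.
  by apply: psi0; rewrite lexx.
by case: (f 0); case: (f pi); case: (upper_half (psi 0)).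
Unshelve. all: by end_near.
Qed.

End EvenLoop.

Section InvarianceOfDomain.
Variable R : realType.

Definition disc (rho : R) : set (R * R) := [set p | p.1 ^+ 2 + p.2 ^+ 2 <= rho ^+ 2].

Let polar (r a : R) : R * R := (r * cos a, r * sin a).

Let polar_cont (g : R * R -> R) (p : R * R) : {for p, continuous g} ->
  {for p, continuous (fun q : R * R => polar (g q) q.1)}.
Proof.
move=> gc; have c1 : {for p, continuous (fun q : R * R => q.1)} by exact: cvg_fst.
have h1 : {for p, continuous (fun q : R * R => cos q.1)}.
  exact: (continuous_comp c1 (@continuous_cos R _)).
have h2 : {for p, continuous (fun q : R * R => sin q.1)}.
  exact: (continuous_comp c1 (@continuous_sin R _)).
by apply: cont_pair; exact: contM.
Qed.

Let polar_disc (rho r a : R) : 0 < rho -> `|r| <= rho -> disc rho (polar r a).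
Proof.
move=> rho0 rrho; rewrite /disc/polar/= !exprMn -mulrDr cos2Dsin2 mulr1.
by rewrite -(real_normK (num_real r)) ler_sqr ?nnegrE// ltW.
Qed.

Let polar0 (r a : R) : polar r a = 0 -> r = 0.
Proof.
move=> [rc rs]; apply/eqP; rewrite -sqrf_eq0 -[_ ^+ 2]mulr1 -(cos2Dsin2 a).
by rewrite mulrDr -!exprMn rc rs expr0n addr0.
Qed.

(* If q near phi 0 were omitted, the loop phi - q on the boundary circle would be
   both contractible in the punctured plane and, by injectivity, homotopic to
   the odd loop a |-> phi (a / 2) - phi (- a / 2). *)
Theorem plane_invariance_of_domain (phi : R * R -> R * R) (rho : R) :
  0 < rho -> {in disc rho, continuous phi} -> {in disc rho &, injective phi} ->
  exists2 e : R, 0 < e & forall q, ball (phi 0) e q -> exists2 p, disc rho p & phi p = q.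
Proof.
move=> rho0 phic phii.
have T0 : 0 <= 2 * pi :> R by rewrite mulr_ge0// pi_ge0.
have D0 : disc rho 0 by rewrite /disc/= expr0n addr0 sqr_ge0.
have phiinj p q : disc rho p -> disc rho q -> phi p = phi q -> p = q.
  by move=> dp dq; apply: phii; rewrite inE.
have phicont (g : R * R -> R) p : {for p, continuous g} -> `|g p| <= rho ->
    {for p, continuous (fun q => phi (polar (g q) q.1))}.
  move=> gc gp; apply: (@continuous_comp _ _ _ (fun q => polar (g q) q.1) phi).
    exact: polar_cont.
  by apply: phic; rewrite inE; exact: polar_disc.
have [m m0 mP] : exists2 m : R, 0 < m & forall a, 0 <= a <= 2 * pi ->
    m <= `|phi (polar rho a) - phi 0|.
  have cf : continuous (fun a => `|phi (polar rho a) - phi 0|).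
    move=> a; apply: (@continuous_comp _ _ _ (fun a => phi (polar rho a) - phi 0) (fun x => `|x|)).
      apply: contB; last exact: cont_cst.
      have /= := @phicont (fun=> rho) (a, a) (@cont_cst _ _ _ rho) _; rewrite gtr0_norm// lexx => /(_ isT) h.
      apply: (@continuous_comp _ _ _ (fun a => (a, a) : R * R)
                (fun q : R * R => phi (polar rho q.1))) => //.
      by apply: cont_pair; exact: cont_id.
    exact: norm_continuous.
  have [|c c01 cP] := EVT_min (f := fun a => `|phi (polar rho a) - phi 0|) T0.
    exact: continuous_subspaceT.
  exists `|phi (polar rho c) - phi 0|; last by move=> a a01; apply: cP; rewrite in_itv.
  rewrite normr_gt0 subr_eq0; apply/eqP => /phiinj h.
  suff : rho = 0 by move/eqP; rewrite gt_eqF.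
  by apply: (@polar0 _ c); apply: h => //; apply: polar_disc => //; rewrite gtr0_norm.
exists m => // q; rewrite -ball_normE /= => qm.
apply: contrapT => nq.
have nq' p : disc rho p -> phi p != q by move=> dp; apply/eqP => pq; apply: nq; exists p.
have sle (s : R) : 0 <= s <= 1 -> `|s * rho| <= rho.
  by move=> /andP[s0 s1]; rewrite ger0_norm ?mulr_ge0 ?(ltW rho0)// ler_piMl// ltW.
have cont2 (p : R * R) : {for p, continuous (fun q : R * R => q.2)} by exact: cvg_snd.
(* [H1] contracts the boundary circle, which omits [q]. [H2] moves [q] to [phi 0], which is allowed
   because [q] is closer to [phi 0] than the image of the circle is. [H3] slides a pair of points at
   distance [rho] along a diameter until they are antipodal; injectivity keeps their images
   apart. *)
pose H1 (a s : R) : R * R := phi (polar (s * rho) a) - q.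
pose H2 (a s : R) : R * R := phi (polar rho a) - (q + (s * (phi 0 - q).1, s * (phi 0 - q).2)).
pose H3 (a s : R) : R * R :=
  phi (polar ((1 + s)^-1 * rho) a) - phi (polar (- (s * (1 + s)^-1) * rho) a).
have polarT r : polar r (2 * pi) = polar r 0.
  by rewrite /polar (_ : 2 * pi = pi *+ 2) ?cos2pi ?sin2pi ?cos0 ?sin0// mulrC mulr_natr.
have E0 : even_loop (H1^~ 0).
  exists (fun=> false) => // a _; exists 1 => // b _ _.
  by rewrite /H1 !mul0r /polar !mul0r /cut addbb.
have E1 : even_loop (H1^~ 1).
  apply: even_loop_homotopy E0.
  - by move=> a s _ /sle ss; rewrite subr_eq0; apply/nq'/polar_disc.
  - move=> a s _ /sle ss; apply: contB; last exact: cont_cst.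
    apply: (phicont (fun q => q.2 * rho) (a, s)) => //.
    by apply: contM; [exact: cont2|exact: cont_cst].
  - by move=> s _; rewrite /H1 polarT.
have E2 : even_loop (H2^~ 1).
  apply: even_loop_homotopy.
  - move=> a s /mP ma /andP[s0 s1]; rewrite /H2; apply/eqP => h.
    have : `|phi (polar rho a) - phi 0| < m; last by rewrite ltNge ma.
    apply: le_lt_trans qm.
    have -> : phi (polar rho a) - phi 0 =
        ((s - 1) * (phi 0 - q).1, (s - 1) * (phi 0 - q).2).
      move/eqP: h; rewrite subr_eq0 => /eqP ->.
      by rewrite [phi 0]surjective_pairing [q]surjective_pairing /=; congr pair => /=; ring.
    rewrite !prod_normE /= !normrM.
    have s1' : `|s - 1| <= 1 by rewrite ler_norml; apply/andP; split; lra.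
    rewrite ge_max !le_max; apply/andP; split; apply/orP.
      by left; rewrite ler_piMl.
    by right; rewrite ler_piMl.
  - move=> a s _ s01; apply: contB.
      by apply: (phicont (fun=> rho) (a, s)); [exact: cont_cst|rewrite gtr0_norm].
    apply: contD; first exact: cont_cst.
    by apply: cont_pair => /=; apply: contM; [exact: cont2|exact: cont_cst|exact: cont2|exact: cont_cst].
  - by move=> s _; rewrite /H2 polarT.
  - rewrite (_ : H2^~ 0 = H1^~ 1)//; apply/funext => a; rewrite /H1 /H2 mul1r !mul0r.
    by congr (_ - _); rewrite [q in RHS]surjective_pairing [q in LHS]surjective_pairing;
       congr pair; rewrite /= addr0.
have E3 : even_loop (H3^~ 1).
  have s1 (s : R) : 0 <= s <= 1 -> 0 < 1 + s by move=> /andP[s0 _]; lra.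
  have b1 (s : R) : 0 <= s <= 1 -> `|(1 + s)^-1 * rho| <= rho.
    move=> s01; apply: sle; rewrite invr_ge0 ltW ?s1//= invf_le1 ?s1//.
    by case/andP: s01 => s0 _; lra.
  have b2 (s : R) : 0 <= s <= 1 -> `|- (s * (1 + s)^-1) * rho| <= rho.
    move=> s01; rewrite mulNr normrN; apply: sle.
    case/andP: (s01) => s0 _; rewrite mulr_ge0 ?invr_ge0 ?(ltW (s1 _ s01))//=.
    by rewrite ler_pdivrMr ?s1//; lra.
  have c1 (a s : R) : 0 <= s <= 1 -> {for (a, s), continuous (fun q : R * R => (1 + q.2)^-1)}.
    move=> s01; apply: contV; first by rewrite gt_eqF// s1.
    by apply: contD; [exact: cont_cst|exact: cont2].
  apply: even_loop_homotopy.
  - move=> a s _ s01; rewrite /H3 subr_eq0; apply/eqP => /phiinj h.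
    have : polar rho a = 0.
      have [h1 h2] := h (polar_disc a rho0 (b1 s s01)) (polar_disc a rho0 (b2 s s01)).
      have sn : 1 + s != 0 by rewrite gt_eqF// s1.
      have h1' : rho * cos a = 0.
        by move: h1 => /eqP; rewrite -subr_eq0 => /eqP <-; field.
      have h2' : rho * sin a = 0.
        by move: h2 => /eqP; rewrite -subr_eq0 => /eqP <-; field.
      by rewrite /polar h1' h2'.
    by move/polar0/eqP; rewrite gt_eqF.
  - move=> a s _ s01; apply: contB.
      apply: (phicont (fun q => (1 + q.2)^-1 * rho) (a, s)); last exact: b1.
      by apply: contM; [exact: c1|exact: cont_cst].
    apply: (phicont (fun q => - (q.2 * (1 + q.2)^-1) * rho) (a, s)); last exact: b2.
    apply: contM; last exact: cont_cst.
    by apply: contN; apply: contM; [exact: cont2|exact: c1].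
  - by move=> s _; rewrite /H3 !polarT.
  - rewrite (_ : H3^~ 0 = H2^~ 1)//; apply/funext => a.
    rewrite /H2 /H3 addr0 invr1 !mul1r !mul0r oppr0 mul0r; congr (_ - _).
      rewrite [RHS](_ : _ = phi 0); first by congr phi; rewrite /polar !mul0r.
      by rewrite [phi 0]surjective_pairing [q]surjective_pairing; congr pair => /=; ring.
have e2 : (1 + 1)^-1 = 2^-1 :> R by [].
apply: odd_loop E3.
- move=> a _; rewrite /H3 subr_eq0; apply/eqP => /phiinj h.
  have : polar rho a = 0.
    have g1 : `|(1 + 1)^-1 * rho| <= rho by rewrite e2 ger0_norm; lra.
    have g2 : `|- (1 * (1 + 1)^-1) * rho| <= rho by rewrite e2 mul1r mulNr normrN ger0_norm; lra.
    have [h1 h2] := h (polar_disc a rho0 g1) (polar_disc a rho0 g2); rewrite e2 in h1 h2.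
    have h1' : rho * cos a = 0 by lra.
    have h2' : rho * sin a = 0 by lra.
    by rewrite /polar h1' h2'.
  by move/polar0/eqP; rewrite gt_eqF.
- move=> a _.
  have cc (k : R) : `|k * rho| <= rho -> {for a, continuous (fun a => phi (polar (k * rho) a))}.
    move=> kk; apply: (@continuous_comp _ _ _ (fun a => (a, a) : R * R)
              (fun q : R * R => phi (polar (k * rho) q.1))) => //.
      by apply: cont_pair; exact: cont_id.
    by apply: (phicont (fun=> k * rho) (a, a)) => //; exact: cont_cst.
  apply: contB; apply: cc.
    by rewrite e2 ger0_norm; lra.
  by rewrite e2 mul1r mulNr normrN ger0_norm; lra.
- move=> a _; rewrite /H3 opprB.
  have pp r : polar r (a + pi) = polar (- r) a.
    by rewrite /polar cosDpi sinDpi !mulrN !mulNr.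
  rewrite !pp; congr (phi _ - phi _); congr polar; lra.
Qed.

End InvarianceOfDomain.

(** * Second derivatives and the maximum principle *)

Section OneVariable.
Variable R : realType.
Implicit Types f g : R -> R.

Lemma der_continuous f (x a : R) : is_derive x 1 f a -> {for x, continuous f}.
Proof. by case=> df _; apply: differentiable_continuous; exact/derivable1_diffP. Qed.

Lemma derD f g (x a b : R) : is_derive x 1 f a -> is_derive x 1 g b ->
  is_derive x 1 (fun y => f y + g y) (a + b).
Proof. by move=> fa gb; exact: (is_deriveD fa gb). Qed.

Lemma derM f g (x a b : R) : is_derive x 1 f a -> is_derive x 1 g b ->
  is_derive x 1 (fun y => f y * g y) (a * g x + f x * b).
Proof.
move=> fa gb; apply: is_derive_eq (is_deriveM fa gb) _.
by rewrite addrC /GRing.scale/= [g x * a]mulrC.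
Qed.

Lemma der_cst (c x : R) : is_derive x 1 (fun=> c : R) 0.
Proof. exact: is_derive_cst. Qed.

Lemma der_comp f g (x a b : R) : is_derive (g x) 1 f a -> is_derive x 1 g b ->
  is_derive x 1 (fun y => f (g y)) (a * b).
Proof. by move=> fa gb; exact: (is_derive1_comp fa gb). Qed.

Lemma der_mono f (x a : R) : is_derive x 1 f a -> 0 < a ->
  \forall y \near x^'+, f x < f y.
Proof.
move=> /is_derive1_caratheodory[g [gE gc gx]] a0.
have ng : \forall y \near x, 0 < g y.
  apply: (near_cont (P := fun z : R => 0 < z) gc).
  by apply: open_nbhs_nbhs; split; [exact: open_gt|rewrite /= gx].
have ng' : \forall y \near x^'+, 0 < g y by exact: cvg_within.
near=> y.
have xy : x < y by near: y; exact: nbhs_right_gt.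
have : 0 < f y - f x.
  by rewrite gE; apply: mulr_gt0; [near: y|rewrite subr_gt0].
by rewrite subr_gt0.
Unshelve. all: by end_near.
Qed.

(** Second derivatives as a relation: it is stable under sums, products and substitution, so that
    derivatives along a curve are computed by algebra. *)
Definition jet2 f (v0 v1 v2 : R) : Prop :=
  f 0 = v0 /\ exists2 f' : R -> R, (\forall s \near (0 : R), is_derive (s : R) 1 f (f' s)) &
    f' 0 = v1 /\ is_derive (0 : R) 1 f' v2.

Lemma jet2_cst (c : R) : jet2 (fun=> c) c 0 0.
Proof.
split=> //; exists (fun=> 0); first by near=> s; exact: der_cst.
by split => //; exact: der_cst.
Unshelve. all: by end_near.
Qed.

Lemma jet2D f g v0 v1 v2 w0 w1 w2 : jet2 f v0 v1 v2 -> jet2 g w0 w1 w2 ->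
  jet2 (fun s => f s + g s) (v0 + w0) (v1 + w1) (v2 + w2).
Proof.
move=> [f0 [f' f'P [f'0 f'']]] [g0 [g' g'P [g'0 g'']]].
split; first by rewrite f0 g0.
exists (fun s => f' s + g' s); first by apply: filterS2 f'P g'P => s; exact: derD.
by rewrite f'0 g'0; split => //; exact: derD.
Unshelve. all: by end_near.
Qed.

Lemma jet2M f g v0 v1 v2 w0 w1 w2 : jet2 f v0 v1 v2 -> jet2 g w0 w1 w2 ->
  jet2 (fun s => f s * g s) (v0 * w0) (v1 * w0 + v0 * w1)
    (v2 * w0 + 2 * v1 * w1 + v0 * w2).
Proof.
move=> [f0 [f' f'P [f'0 f'']]] [g0 [g' g'P [g'0 g'']]].
split; first by rewrite f0 g0.
exists (fun s => f' s * g s + f s * g' s); first by apply: filterS2 f'P g'P => s; exact: derM.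
rewrite f'0 g'0 f0 g0; split => //.
have fd := nbhs_singleton f'P; have gd := nbhs_singleton g'P.
apply: is_derive_eq (derD (derM f'' gd) (derM fd g'')) _.
by rewrite f'0 g'0 f0 g0; ring.
Unshelve. all: by end_near.
Qed.

Lemma jet2_comp (h h' : R -> R) f v0 v1 v2 h2 :
  (\forall z \near v0, is_derive (z : R) 1 h (h' z)) -> is_derive v0 1 h' h2 ->
  jet2 f v0 v1 v2 ->
  jet2 (fun s => h (f s)) (h v0) (h' v0 * v1) (h2 * v1 ^+ 2 + h' v0 * v2).
Proof.
move=> hd h'd [f0 [f' f'P [f'0 f'']]].
have fc : {for 0, continuous f} by exact: der_continuous (nbhs_singleton f'P).
split; first by rewrite f0.
exists (fun s => h' (f s) * f' s).
  have : \forall s \near (0 : R), is_derive (f s) 1 h (h' (f s)).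
    by apply: (near_cont (P := fun z : R => is_derive (z : R) 1 h (h' z)) fc); rewrite f0.
  by move=> hfs; apply: filterS2 hfs f'P => s; exact: der_comp.
rewrite f0 f'0; split=> //.
have fd := nbhs_singleton f'P.
have h'd' : is_derive (f 0) 1 h' h2 by rewrite f0.
apply: is_derive_eq (derM (der_comp h'd' fd) f'') _.
by rewrite f'0 f0; ring.
Unshelve. all: by end_near.
Qed.

Lemma der_inv (x : R) : x != 0 -> is_derive x 1 (fun y : R => y^-1) (- x ^- 2).
Proof.
move=> x0; have := @is_deriveV R id x 1 1 x0 (is_derive_id _ _).
by rewrite /GRing.scale/= mulr1.
Qed.


Lemma jet2V f v0 v1 v2 : v0 != 0 -> jet2 f v0 v1 v2 ->
  jet2 (fun s => (f s)^-1) (v0^-1) (- v1 / v0 ^+ 2)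
    (2 * v1 ^+ 2 / v0 ^+ 3 - v2 / v0 ^+ 2).
Proof.
move=> v00 jf.
have hd : \forall z \near v0, is_derive (z : R) 1 (fun y : R => y^-1) (-1 * (z^-1 * z^-1)).
  have : \forall z \near v0, z != 0.
    by apply: open_nbhs_nbhs; split; [exact: open_neq|].
  by apply: filterS => z /der_inv; rewrite expr2 invfM mulN1r.
have h'd : is_derive v0 1 (fun z : R => -1 * (z^-1 * z^-1)) (2 / v0 ^+ 3).
  have d := derM (der_inv v00) (der_inv v00).
  by apply: (is_derive_eq (derM (der_cst (-1) v0) d)) => /=; field.
have := jet2_comp hd h'd jf.
rewrite (_ : -1 * (v0^-1 * v0^-1) * v1 = - v1 / v0 ^+ 2); last by field.
by rewrite (_ : 2 / v0 ^+ 3 * v1 ^+ 2 + -1 * (v0^-1 / v0) * v2 =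
  2 * v1 ^+ 2 / v0 ^+ 3 - v2 / v0 ^+ 2)//; field.
Qed.

Lemma jet2_max f v0 v1 v2 : jet2 f v0 v1 v2 ->
  (\forall s \near (0 : R), f s <= f 0) -> v1 = 0 /\ v2 <= 0.
Proof.
move=> [_ [f' f'P [f'0 f'']]] fmax.
have v10 : v1 = 0.
  have fd := nbhs_singleton f'P; rewrite f'0 in fd.
  have [v1n|v1p|//] := ltgtP v1 0.
  - pose g s := f (-1 * s).
    have fd' : is_derive (-1 * 0 : R) 1 f v1 by rewrite mulr0.
    have dm : is_derive (0 : R) 1 (fun s : R => -1 * s) (0 * 0 + -1 * 1).
      exact: (derM (der_cst _ _) (is_derive_id _ _)).
    have gd : is_derive (0 : R) 1 g (- v1).
      have := der_comp (g := fun s => -1 * s) fd' dm.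
      by rewrite mul0r add0r mulr1 mulrN1.
    have nmax : \forall s \near (0 : R), g s <= g 0.
      rewrite /g mulr0; have c : {for 0, continuous (fun s : R => -1 * s)}.
        exact: der_continuous dm.
      by apply: (near_cont (P := fun z : R => f z <= f 0) c); rewrite mulr0.
    have nmax' : \forall y \near (0 : R)^'+, g y <= g 0 by exact: cvg_within.
    have gm : \forall y \near (0 : R)^'+, g 0 < g y by apply: der_mono gd _; rewrite oppr_gt0.
    have [y /= []] : exists y, g 0 < g y /\ g y <= g 0.
      by near (0 : R)^'+ => y; exists y; split; near: y.
    by move=> h1 h2; rewrite ltNge h2 in h1.
  - have nmax' : \forall y \near (0 : R)^'+, f y <= f 0 by exact: cvg_within.
    have gm := der_mono fd v1p.
    have [y /= []] : exists y, f 0 < f y /\ f y <= f 0.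
      by near (0 : R)^'+ => y; exists y; split; near: y.
    by move=> h1 h2; rewrite ltNge h2 in h1.
(* A positive second derivative makes [f'] positive on some []0, e]], and the mean value theorem
   then gives [f 0 < f e]. *)
split=> //; rewrite leNgt; apply/negP => v2p.
have /(_ v2p) gm := der_mono f'' _.
have [d d0 dP] : exists2 d : R, 0 < d & forall s, `|s| < d -> is_derive (s : R) 1 f (f' s) /\ f s <= f 0.
  have : nbhs (0 : R) (fun s => is_derive (s : R) 1 f (f' s) /\ f s <= f 0).
    by apply: filterS2 f'P fmax => s.
  move=> /nbhs_ballP[d /= d0 dP].
  by exists d => // s sd; apply: dP; rewrite /= -ball_normE /= sub0r normrN.
have [e [e0 ed eP]] : exists e : R, [/\ 0 < e, e < d & forall s, 0 < s <= e -> 0 < f' s].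
  move: gm; rewrite f'0 v10 => /nbhs_ballP[e /= e0 eP].
  exists (Num.min (e / 2) (d / 2)); split.
  - by rewrite lt_min !divr_gt0.
  - by rewrite gt_min; apply/orP; right; lra.
  - move=> s /andP[s0]; rewrite le_min => /andP[se _].
    by apply: (eP s _ s0); rewrite /= -ball_normE /= sub0r normrN gtr0_norm//; lra.
have [c /[!in_itv]/= /andP[c0 ce] E] : exists2 c, c \in `]0, e[ & f e - f 0 = f' c * (e - 0).
  apply: MVT => //.
  - move=> s /[!in_itv]/= /andP[s0 se]; apply: (dP s _).1.
    by rewrite gtr0_norm//; lra.
  - apply: derivable_within_continuous => s /[!in_itv]/= /andP[s0 se].
    have [|[]//] := dP s _.
    by rewrite ger0_norm//; lra.
have : f e <= f 0 by apply: (dP e _).2; rewrite gtr0_norm.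
have : 0 < f e - f 0 by rewrite E subr0 mulr_gt0//; apply: eP; rewrite c0 ltW.
lra.
Unshelve. all: by end_near.
Qed.

End OneVariable.

Section TwoVariables.
Variable R : realType.

Lemma der_of_bound (g : R -> R) (s d : R) :
  (forall e : R, 0 < e -> exists2 r : R, 0 < r &
    forall h, `|h| < r -> `|g (s + h) - g s - h * d| <= e * `|h|) ->
  is_derive s 1 g d.
Proof.
move=> gP; apply/is_derive1_caratheodory.
exists (fun z => if z == s then d else (g z - g s) / (z - s)); split.
- move=> z; case: eqVneq => [->|zs]; first by rewrite !subrr mulr0.
  by rewrite divfK// subr_eq0.
- apply/cvgrPdist_le => e e0 /=; rewrite eqxx.
  have [r r0 rP] := gP e e0.
  apply/nbhs_ballP; exists r => //= z; rewrite /ball/= distrC => zr.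
  case: eqVneq => [_|zs]; first by rewrite subrr normr0 ltW.
  have zs0 : z - s != 0 by rewrite subr_eq0.
  have := rP (z - s) zr; rewrite addrCA subrr addr0 => le.
  rewrite distrC -(ler_pM2r (_ : 0 < `|z - s|)) ?normr_gt0// -normrM mulrBl divfK//.
  by rewrite [d * _]mulrC.
- by rewrite eqxx.
Qed.

Lemma mvt_bound (g g' : R -> R) (m e s : R) :
  (forall t, `|t| <= `|s| -> is_derive (t : R) 1 g (g' t)) ->
  (forall t, `|t| <= `|s| -> `|g' t - m| <= e) ->
  `|g s - g 0 - s * m| <= e * `|s|.
Proof.
move=> gd gm.
have cw a b : `|a| <= `|s| -> `|b| <= `|s| -> {within `[a, b], continuous g}.
  move=> /ler_normlP[a1 a2] /ler_normlP[b1 b2].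
  apply: derivable_within_continuous => t /[!in_itv]/= /andP[t0 ts].
  have /gd[//] : `|t| <= `|s| by apply/ler_normlP; split; lra.
have [s0|s0|->] := ltgtP s 0.
- have [c /[!in_itv]/= /andP[c0 cs] E] : exists2 c, c \in `]s, 0[ & g 0 - g s = g' c * (0 - s).
    apply: MVT => //; last by apply: cw => //; rewrite normr0.
    move=> t /[!in_itv]/= /andP[t0 ts]; apply: gd.
    by rewrite !ltr0_norm//; lra.
  rewrite (_ : g s - g 0 - s * m = (g' c - m) * s); last by lra.
  by rewrite normrM ler_wpM2r// gm// !ltr0_norm//; lra.
- have [c /[!in_itv]/= /andP[c0 cs] E] : exists2 c, c \in `]0, s[ & g s - g 0 = g' c * (s - 0).
    apply: MVT => //; last by apply: cw => //; rewrite normr0.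
    move=> t /[!in_itv]/= /andP[t0 ts]; apply: gd.
    by rewrite !gtr0_norm//; lra.
  rewrite (_ : g s - g 0 - s * m = (g' c - m) * s); last by lra.
  by rewrite normrM ler_wpM2r// gm// !gtr0_norm//; lra.
- by rewrite subrr mul0r subr0 normr0 mulr0.
Qed.

Lemma is_derive_line (V : normedModType R) (f : V -> R) (c v : V) (s d : R) :
  is_derive (c + s *: v) v f d -> is_derive s 1 (fun t : R => f (c + t *: v)) d.
Proof.
move=> [fd fv].
have E : (fun h : R => h^-1 *: ((fun t : R => f (c + t *: v)) (h *: 1 + s) - f (c + s *: v)))
       = (fun h : R => h^-1 *: (f (h *: v + (c + s *: v)) - f (c + s *: v))).
  apply/funext => h; congr (_ *: (f _ - _)).
  by rewrite [h *: 1]mulr1 scalerDl addrCA.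
by split; rewrite ?/derivable /derive E.
Qed.

Lemma normr_coord n (v : 'rV[R]_n) i : `|v 0 i| <= `|v|.
Proof. by rewrite /Num.norm/= mx_normrE (le_bigmax _ (fun ij => `|v ij.1 ij.2|) (0, i)). Qed.

Lemma row2E (v : 'rV[R]_2) :
  v = v 0 0 *: delta_mx 0 0 + v 0 1 *: delta_mx 0 1.
Proof.
apply/rowP => i; rewrite !mxE /=.
by case: i => -[|[|//]] lti /=; rewrite ?mulr1 ?mulr0 ?addr0 ?add0r; congr (v 0 _); apply/val_inj.
Qed.

Lemma normr_delta_row n (i : 'I_n) : `|delta_mx 0 i : 'rV[R]_n| <= 1.
Proof.
rewrite /Num.norm/= mx_normrE; apply/bigmax_leP; split => // -[j k] _ /=.
by rewrite mxE; case: (_ && _); rewrite ?normr1 ?normr0.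
Qed.

(** Join the two moving points by two coordinate segments and apply [mvt_bound] on each. This strict
    form of differentiability, needed to write a surface as a Lipschitz graph, follows from the
    continuity of the partial derivatives at the single point [a]. *)
Lemma C1_strict (f : 'rV[R]_2 -> R) (f_ : 'I_2 -> 'rV[R]_2 -> R)
    (a : 'rV[R]_2) (r : R) :
  0 < r ->
  (forall (b : 'rV[R]_2) i, ball a r b -> is_derive (b : 'rV[R]_2) (delta_mx 0 i) f (f_ i b)) ->
  (forall i, {for a, continuous (f_ i)}) ->
  forall e : R, 0 < e -> exists2 d : R, 0 < d &
    forall b b', ball a d b -> ball a d b' ->
    `|f b' - f b - \sum_i (b' - b) 0 i * f_ i a| <= e * `|b' - b|.
Proof.
move=> r0 fd fc e e0.
have e20 : 0 < e / 2 by rewrite divr_gt0.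
have fcP i : exists2 d : R, 0 < d & forall b, ball a d b -> `|f_ i b - f_ i a| <= e / 2.
  have /cvgrPdist_le/(_ _ e20)/nbhs_ballP[d /= d0 dP] := fc i.
  by exists d => // b /dP /=; rewrite distrC.
have [d0 d00 d0P] := fcP 0; have [d1 d10 d1P] := fcP 1.
pose d := Num.min r (Num.min d0 d1).
have dgt0 : 0 < d by rewrite !lt_min r0 d00 d10.
have dr b : ball a d b -> ball a r b by apply: le_ball; rewrite ge_min lexx.
have dP b i : ball a d b -> `|f_ i b - f_ i a| <= e / 2.
  move=> ab; case: i => -[|[|//]] lti.
  - rewrite (_ : Ordinal lti = 0); last exact/val_inj.
    by apply: d0P; apply: le_ball ab; rewrite !ge_min lexx !orbT.
  - rewrite (_ : Ordinal lti = 1); last exact/val_inj.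
    by apply: d1P; apply: le_ball ab; rewrite !ge_min lexx !orbT.
have step b i s : (forall t, `|t| <= `|s| -> ball a d (b + t *: delta_mx 0 i)) ->
    `|f (b + s *: delta_mx 0 i) - f b - s * f_ i a| <= e / 2 * `|s|.
  move=> bd.
  have -> : f b = f (b + 0 *: delta_mx 0 i) by rewrite scale0r addr0.
  apply: (@mvt_bound (fun t => f (b + t *: delta_mx 0 i))
     (fun t => f_ i (b + t *: delta_mx 0 i))).
  - by move=> t ts; apply: is_derive_line; apply/fd/dr/bd.
  - by move=> t ts; exact/dP/bd.
have nde (t : R) (i : 'I_2) : `|t *: (delta_mx 0 i : 'rV[R]_2)| <= `|t|.
  by rewrite normrZ ler_piMr// normr_delta_row.
(* Both coordinate steps are then shorter than [d / 4], and the broken line from [b] to [b'] stays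
   in the ball of radius [d]. *)
exists (d / 8); first by rewrite divr_gt0.
move=> b b'; rewrite -ball_normE /= => ab ab'.
have bb' : `|b' - b| < d / 4.
  rewrite (_ : b' - b = (a - b) - (a - b')); last by rewrite opprB [RHS]addrC addrA subrK.
  by apply: le_lt_trans (ler_normB _ _) _; lra.
set s0 := (b' - b) 0 0; set s1 := (b' - b) 0 1.
have s0b : `|s0| <= `|b' - b| := normr_coord _ _.
have s1b : `|s1| <= `|b' - b| := normr_coord _ _.
have st0 : `|f (b + s0 *: delta_mx 0 0) - f b - s0 * f_ 0 a| <= e / 2 * `|s0|.
  apply: step => t ts; rewrite -ball_normE /= opprD addrA.
  by apply: le_lt_trans (ler_normB _ _) _; have := nde t 0; lra.
have st1 : `|f b' - f (b + s0 *: delta_mx 0 0) - s1 * f_ 1 a| <= e / 2 * `|s1|.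
  have {1}-> : b' = b + s0 *: delta_mx 0 0 + s1 *: delta_mx 0 1.
    by rewrite -addrA -row2E addrC subrK.
  apply: step => t ts; rewrite -ball_normE /= !opprD !addrA.
  apply: le_lt_trans (ler_normB _ _) _; have := nde t 1.
  have := ler_normB (a - b) (s0 *: delta_mx 0 0); have := nde s0 0; lra.
rewrite big_ord_recl big_ord1 -/s0 (_ : lift ord0 ord0 = 1); last exact/val_inj.
rewrite -/s1.
rewrite (_ : f b' - f b - (s0 * f_ ord0 a + s1 * f_ 1 a) =
   (f b' - f (b + s0 *: delta_mx 0 0) - s1 * f_ 1 a) +
   (f (b + s0 *: delta_mx 0 0) - f b - s0 * f_ 0 a)); last by rewrite (_ : ord0 = 0)//; ring.
apply: le_trans (ler_normD _ _) _.
have := ler_wpM2l (ltW e20) s0b; have := ler_wpM2l (ltW e20) s1b.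
have -> : e * `|b' - b| = e / 2 * `|b' - b| + e / 2 * `|b' - b| by field.
lra.
Qed.

(** The chain rule along a line, used near [0] for [f] and only at [0] for its first partials;
    accordingly the second partials have to be continuous at [a] alone. *)
Lemma C2_jet_line (f : 'rV[R]_2 -> R) (f_ : 'I_2 -> 'rV[R]_2 -> R)
    (f__ : 'I_2 -> 'I_2 -> 'rV[R]_2 -> R) (a : 'rV[R]_2) (r : R) :
  0 < r ->
  (forall (b : 'rV[R]_2) i, ball a r b -> is_derive (b : 'rV[R]_2) (delta_mx 0 i) f (f_ i b)) ->
  (forall (b : 'rV[R]_2) i j, ball a r b -> is_derive (b : 'rV[R]_2) (delta_mx 0 j) (f_ i) (f__ j i b)) ->
  (forall (b : 'rV[R]_2) i, ball a r b -> {for b, continuous (f_ i)}) ->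
  (forall i j, {for a, continuous (f__ j i)}) ->
  forall w : 'rV[R]_2,
  jet2 (fun s => f (a + s *: w)) (f a) (\sum_i w 0 i * f_ i a)
    (\sum_i \sum_j w 0 i * w 0 j * f__ j i a).
Proof.
move=> r0 fd fdd fc fcc w.
have line (g : 'rV[R]_2 -> R) (g_ : 'I_2 -> 'rV[R]_2 -> R) b s rho :
    0 < rho ->
    (forall (b' : 'rV[R]_2) i, ball b rho b' -> is_derive (b' : 'rV[R]_2) (delta_mx 0 i) g (g_ i b')) ->
    (forall i, {for b, continuous (g_ i)}) -> b = a + s *: w ->
    is_derive s 1 (fun t => g (a + t *: w)) (\sum_i w 0 i * g_ i b).
  move=> rho0 gd gc bE; apply: der_of_bound => e e0.
  have [d d0 dP] := C1_strict rho0 gd gc (e := e / (1 + `|w|)) (divr_gt0 e0 (ltr_pwDl ltr01 (normr_ge0 w))).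
  exists (d / (1 + `|w|)); first by rewrite divr_gt0// ltr_pwDl.
  move=> h; rewrite ltr_pdivlMr ?ltr_pwDl// => hd.
  have bh : a + (s + h) *: w = b + h *: w by rewrite scalerDl addrA bE.
  rewrite bh -bE.
  have bb : ball b d b by exact: ballxx.
  have hw : `|h *: w| < d.
    rewrite normrZ; apply: le_lt_trans hd; apply: ler_wpM2l => //; lra.
  have bbh : ball b d (b + h *: w).
    by rewrite -ball_normE /= opprD addrA subrr sub0r normrN.
  have e1 : b + h *: w - b = h *: w by rewrite addrAC subrr add0r.
  have := dP _ _ bb bbh; rewrite e1 normrZ => le.
  rewrite mulr_sumr (_ : \sum_i h * (w 0 i * g_ i b) = \sum_i (h *: w) 0 i * g_ i b); last first.
    by apply: eq_bigr => i _; rewrite mxE mulrA.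
  apply: le_trans le _; rewrite -mulrA ler_wpM2l ?(ltW e0)//.
  rewrite ler_pdivrMl ?ltr_pwDl// mulrC ler_wpM2r//; lra.
have near_a : \forall s \near (0 : R), ball a r (a + s *: w).
  have c : {for 0, continuous (fun s : R => a + s *: w)}.
    by apply: contD; [exact: cont_cst|apply: contZ; [exact: cont_id|exact: cont_cst]].
  by apply: (near_cont (P := ball a r) c); rewrite scale0r addr0; exact: nbhsx_ballx.
split; first by rewrite scale0r addr0.
exists (fun s => \sum_i w 0 i * f_ i (a + s *: w)).
  apply: filterS near_a => s as_.
  have [rho rho0 rhoP] : exists2 rho : R, 0 < rho & ball (a + s *: w) rho `<=` ball a r.
    exists (r - `|a - (a + s *: w)|); first by move: as_; rewrite -ball_normE /= subr_gt0.
    move=> b; rewrite -!ball_normE /= ltrBrDl => h; apply: le_lt_trans h.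
    by apply: ler_distD.
  apply: (line f f_ (a + s *: w) s rho) => //.
  - by move=> b' i b'P; apply/fd/rhoP.
  - by move=> i; apply: fc.
split; first by apply: eq_bigr => i _; rewrite scale0r addr0.
have aE : a = a + 0 *: w by rewrite scale0r addr0.
have aa : ball a r a by exact: ballxx.
have D i : is_derive (0 : R) 1 (fun t => f_ i (a + t *: w)) (\sum_j w 0 j * f__ j i a).
  by apply: (line (f_ i) (f__^~ i) a 0 r) => // b' j b'P; exact: fdd.
rewrite !big_ord_recl !big_ord0 !addr0.
have -> : (fun s => \sum_i w 0 i * f_ i (a + s *: w)) =
   (fun s => w 0 0 * f_ 0 (a + s *: w) + w 0 1 * f_ 1 (a + s *: w)).
  apply/funext => s; rewrite big_ord_recl big_ord1; congr (_ + _ * f_ _ _); last exact/val_inj.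
  by congr (w _ _); apply/val_inj.
apply: is_derive_eq (derD (derM (der_cst (w 0 0) 0) (D 0)) (derM (der_cst (w 0 1) 0) (D 1))) _.
have l1 : lift ord0 ord0 = 1 :> 'I_2 by exact/val_inj.
rewrite !big_ord_recl !big_ord0 !l1 (_ : ord0 = 0 :> 'I_2)//.
by ring.
Qed.

End TwoVariables.

Section CoordinateJets.
Variable R : realType.

Lemma der_coord n (V : normedModType R) (M : V -> 'rV[R]_n) (t v : V) k :
  derivable M t v -> is_derive t v (fun q => M q 0 k) ('D_v M t 0 k).
Proof.
move=> Md; rewrite derive_mx// mxE; apply: DeriveDef => //.
by move/derivable_mxP: Md; exact.
Qed.

Variables (U : set 'rV[R]_2) (X : 'rV[R]_2 -> 'rV[R]_3) (a : 'rV[R]_2).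
Hypotheses (oU : open U) (Ua : U a) (sX : smooth_on U X).

Lemma smooth_radius : exists2 r : R, 0 < r & ball a r `<=` U.
Proof. by have /nbhs_ballP[r /= r0 rP] := open_nbhs_nbhs (conj oU Ua); exists r. Qed.

Lemma smooth_derivable b i : U b -> derivable X b (delta_mx 0 i).
Proof. by move=> Ub; have [] := sX 1 i => + _; exact. Qed.

Lemma smooth_partial i : smooth_on U (partial i X).
Proof. by move=> k; have [] := sX k.+1 i. Qed.

Lemma smooth_continuous b : U b -> {for b, continuous X}.
Proof. exact: (sX 0). Qed.

End CoordinateJets.

Lemma cont_coord (R : realType) (T : topologicalType) n (p : T) (f : T -> 'rV[R]_n) k :
  {for p, continuous f} -> {for p, continuous (fun q => f q 0 k)}.
Proof.
move=> fc; apply: (cont_comp (g := fun M : 'rV[R]_n => M 0 k) fc).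
exact: coord_continuous.
Qed.

Lemma smooth_jet (R : realType) (U : set 'rV[R]_2) (X : 'rV[R]_2 -> 'rV[R]_3)
    (a w : 'rV[R]_2) k :
  open U -> U a -> smooth_on U X ->
  jet2 (fun s : R => X (a + s *: w) 0 k) (X a 0 k)
    (\sum_i w 0 i * partial i X a 0 k)
    (\sum_i \sum_j w 0 i * w 0 j * partial j (partial i X) a 0 k).
Proof.
move=> oU Ua sX; have [r r0 rU] := smooth_radius oU Ua.
apply: (@C2_jet_line R (fun b => X b 0 k) (fun i b => partial i X b 0 k)
  (fun j i b => partial j (partial i X) b 0 k) a r r0).
- by move=> b i /rU Ub; apply: der_coord; exact: smooth_derivable sX _ _ Ub.
- move=> b i j /rU Ub; apply: der_coord.
  exact: smooth_derivable (smooth_partial sX i) _ _ Ub.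
- by move=> b i /rU Ub; apply/cont_coord/(smooth_continuous (smooth_partial sX i)).
- move=> i j; apply/cont_coord/(smooth_continuous (smooth_partial (smooth_partial sX i) j)).
  exact: Ua.
Qed.

(** * The Levi-Civita connection in the half-plane model *)

Section Metric.
Variable R : realType.
Implicit Types p u v : 'rV[R]_3.

Lemma metricE p m n : metric p m n =
  (if m == 2 then 1 else (p 0 1 ^+ 2)^-1) *+ (m == n).
Proof. by rewrite /metric !mxE. Qed.

Lemma metric_derive p (m n l : 'I_3) : p 0 1 != 0 ->
  'D_(delta_mx 0 l) (fun q : 'rV[R]_3 => metric q m n) p =
    (if [&& m == n, m != 2 & l == 1] then - 2 / p 0 1 ^+ 3 else 0).
Proof.
move=> y0; have [->|mn] := eqVneq m n; last first.
  rewrite (_ : (fun q => _) = cst 0) ?derive_cst//.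
  by apply/funext => q; rewrite metricE (negbTE mn).
have [->|n2] /= := eqVneq n 2.
  rewrite (_ : (fun q => _) = cst 1) ?derive_cst//.
  by apply/funext => q; rewrite metricE !eqxx.
rewrite (_ : (fun q => _) = (fun q : 'rV[R]_3 => (q 0 1 * q 0 1)^-1)); last first.
  by apply/funext => q; rewrite metricE (negbTE n2) eqxx expr2.
have d1 : is_derive p (delta_mx 0 l) (fun q : 'rV[R]_3 => q 0 1) ((delta_mx 0 l : 'rV[R]_3) 0 1).
  have -> : (delta_mx 0 l : 'rV[R]_3) 0 1 = 'D_(delta_mx 0 l) (@id 'rV[R]_3) p 0 1.
    by rewrite derive_id.
  exact: der_coord (@derivable_id _ _ _ _).
have [d2 d2E] := is_deriveM d1 d1.
have y20 : p 0 1 * p 0 1 != 0 by rewrite mulf_neq0.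
have dV := @deriveV R _ (fun q : 'rV[R]_3 => q 0 1 * q 0 1) p (delta_mx 0 l) y20 d2.
rewrite (_ : 'D_(delta_mx 0 l) (fun q : 'rV[R]_3 => (q 0 1 * q 0 1)^-1) p =
   - (p 0 1 * p 0 1) ^- 2 *: 'D_(delta_mx 0 l) (fun q : 'rV[R]_3 => q 0 1 * q 0 1) p)//.
rewrite (_ : 'D_(delta_mx 0 l) _ p = p 0 1 *: (delta_mx 0 l : 'rV[R]_3) 0 1 +
  p 0 1 *: (delta_mx 0 l : 'rV[R]_3) 0 1); last by rewrite -d2E.
rewrite mxE eqxx /= eq_sym; case: (l == 1) => /=; last by rewrite !scaler0 addr0 scaler0.
by rewrite /GRing.scale/=; field.
Qed.

Lemma invmx_metric p : p 0 1 != 0 ->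
  invmx (metric p) = diag_mx (\row_i if i == 2 then 1 else p 0 1 ^+ 2).
Proof.
move=> y0; have E : metric p *m diag_mx (\row_i if i == 2 then 1 else p 0 1 ^+ 2) = 1%:M.
  rewrite /metric mulmx_diag -diag_const_mx; congr diag_mx; apply/rowP => i.
  by rewrite !mxE; case: ifP => _; rewrite ?mulr1// mulVf// expf_neq0.
by rewrite -[RHS](mulKmx (proj1 (mulmx1_unit E))) E mulmx1.
Qed.

Definition gam p u v : 'rV[R]_3 :=
  \row_k \sum_l \sum_m christoffel p k l m * u 0 l * v 0 m.

Lemma gamE p u v : p 0 1 != 0 ->
  [/\ gam p u v 0 0 = - (u 0 0 * v 0 1 + u 0 1 * v 0 0) / p 0 1,
      gam p u v 0 1 = (u 0 0 * v 0 0 - u 0 1 * v 0 1) / p 0 1 &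
      gam p u v 0 2 = 0].
Proof.
move=> y0.
have o1 : lift ord0 ord0 = 1 :> 'I_3 by exact/val_inj.
have o2 : lift ord0 (lift ord0 ord0) = 2 :> 'I_3 by exact/val_inj.
have o0 : ord0 = 0 :> 'I_3 by [].
have E k l m : christoffel p k l m = 2^-1 * (if k == 2 then 1 else p 0 1 ^+ 2) *
  ((if [&& m == k, m != 2 & l == 1] then - 2 / p 0 1 ^+ 3 else 0) +
   (if [&& l == k, l != 2 & m == 1] then - 2 / p 0 1 ^+ 3 else 0) -
   (if [&& l == m, l != 2 & k == 1] then - 2 / p 0 1 ^+ 3 else 0)).
  rewrite /christoffel -mulrA; congr (_ * _).
  rewrite invmx_metric// (bigD1 k)//= big1 ?addr0; last first.
    by move=> i ik; rewrite !mxE [k == i]eq_sym (negbTE ik) mulr0n mul0r.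
  by rewrite !metric_derive// !mxE eqxx mulr1n.
by split; rewrite mxE !big_ord_recl !big_ord0 !o1 !o2 !o0 !E /=; field.
Qed.

End Metric.

(** * Linear algebra at a point of contact *)

Section FrameAlgebra.
Variable R : realType.

Definition dot n (u v : 'rV[R]_n) : R := (u *m v^T) 0 0.

Lemma dotE n (u v : 'rV[R]_n) : dot u v = \sum_i u 0 i * v 0 i.
Proof. by rewrite /dot mxE; apply: eq_bigr => i _; rewrite mxE. Qed.

Lemma dotC n (u v : 'rV[R]_n) : dot u v = dot v u.
Proof. by rewrite !dotE; apply: eq_bigr => i _; rewrite mulrC. Qed.

Lemma dotDl n (u u' v : 'rV[R]_n) : dot (u + u') v = dot u v + dot u' v.
Proof. by rewrite /dot mulmxDl mxE. Qed.

Lemma dotZl n (k : R) (u v : 'rV[R]_n) : dot (k *: u) v = k * dot u v.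
Proof. by rewrite /dot -scalemxAl mxE. Qed.

Lemma dot_suml n (I : finType) (F : I -> 'rV[R]_n) (v : 'rV[R]_n) :
  dot (\sum_i F i) v = \sum_i dot (F i) v.
Proof. by rewrite /dot mulmx_suml summxE. Qed.

Lemma dot_ge0 n (u : 'rV[R]_n) : 0 <= dot u u.
Proof. by rewrite dotE sumr_ge0// => i _; rewrite -expr2 sqr_ge0. Qed.

Lemma dot_eq0 n (u : 'rV[R]_n) : dot u u = 0 -> u = 0.
Proof.
rewrite dotE => /eqP; rewrite psumr_eq0; last by move=> i _; rewrite -expr2 sqr_ge0.
move=> /allP u0; apply/rowP => i; rewrite mxE; apply/eqP.
by have /implyP/(_ isT) := u0 i (mem_index_enum _); rewrite -expr2 sqrf_eq0.
Qed.

(** Completing the square: [J 0 0] times the sum is the form [Q] at the first row of [J] plus the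
    determinant of [J] times [Q 1 1]. *)
Lemma trace_nonpos (J Q : 'M[R]_2) : J^T = J ->
  (forall w : 'rV[R]_2, w != 0 -> 0 < dot (w *m J) w) ->
  (forall w : 'rV[R]_2, dot (w *m Q) w <= 0) ->
  \sum_i \sum_j J i j * Q i j <= 0.
Proof.
move=> Jsym Jpos Qneg.
have J10 : J 1 0 = J 0 1 by rewrite -[in LHS]Jsym mxE.
have form (A : 'M[R]_2) (w : 'rV[R]_2) : dot (w *m A) w =
    w 0 0 ^+ 2 * A 0 0 + w 0 0 * w 0 1 * (A 0 1 + A 1 0) + w 0 1 ^+ 2 * A 1 1.
  have o1 : lift ord0 ord0 = 1 :> 'I_2 by exact/val_inj.
  by rewrite dotE !big_ord_recl big_ord0 !mxE !big_ord_recl !big_ord0 !o1 (_ : ord0 = 0 :> 'I_2)//; ring.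
have o1 : lift ord0 ord0 = 1 :> 'I_2 by exact/val_inj.
rewrite !big_ord_recl !big_ord0 !o1 (_ : ord0 = 0 :> 'I_2)//.
pose mk (x y : R) : 'rV[R]_2 := \row_i if i == 0 then x else y.
have mk0 x y : mk x y 0 0 = x by rewrite mxE.
have mk1 x y : mk x y 0 1 = y by rewrite mxE.
have J00 : 0 < J 0 0.
  have := Jpos (mk 1 0); rewrite form mk0 mk1 => h.
  suff /h : mk 1 0 != 0 by lra.
  by apply/eqP => /rowP/(_ 0); rewrite mk0 mxE => /eqP; rewrite oner_eq0.
have Jdet : 0 < J 0 0 * J 1 1 - J 0 1 ^+ 2.
  have := Jpos (mk (- J 0 1) (J 0 0)); rewrite form mk0 mk1 J10 => h.
  have /h : mk (- J 0 1) (J 0 0) != 0.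
    by apply/eqP => /rowP/(_ 1); rewrite mk1 mxE => /eqP; rewrite gt_eqF.
  rewrite (_ : _ + _ + _ = J 0 0 * (J 0 0 * J 1 1 - J 0 1 ^+ 2)); last by ring.
  by rewrite pmulr_rgt0.
have q1 := Qneg (mk (J 0 0) (J 0 1)); have q2 := Qneg (mk 0 1).
rewrite form mk0 mk1 in q1; rewrite form mk0 mk1 in q2.
rewrite !addr0 J10.
suff : J 0 0 * (J 0 0 * Q 0 0 + J 0 1 * Q 0 1 + (J 0 1 * Q 1 0 + J 1 1 * Q 1 1)) <= 0.
  by rewrite pmulr_rle0.
have -> : J 0 0 * (J 0 0 * Q 0 0 + J 0 1 * Q 0 1 + (J 0 1 * Q 1 0 + J 1 1 * Q 1 1)) =
   (J 0 0 ^+ 2 * Q 0 0 + J 0 0 * J 0 1 * (Q 0 1 + Q 1 0) + J 0 1 ^+ 2 * Q 1 1)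
   + (J 0 0 * J 1 1 - J 0 1 ^+ 2) * Q 1 1 by ring.
have : (J 0 0 * J 1 1 - J 0 1 ^+ 2) * Q 1 1 <= 0 by rewrite pmulr_rle0//; lra.
lra.
Qed.

Variables (M : 'M[R]_(2, 3)) (nu : 'rV[R]_3).
Hypotheses (Mfree : row_free M) (nu1 : dot nu nu = 1) (nuM : nu *m M^T = 0).
Let I := M *m M^T.

Lemma gram_unit : I \in unitmx.
Proof.
rewrite -row_free_unit; apply: inj_row_free => w wI.
have : w *m M = 0.
  by apply: dot_eq0; rewrite /dot trmx_mul mulmxA -(mulmxA w) wI mul0mx mxE.
by move=> wM; apply: (row_free_inj Mfree); rewrite wM mul0mx.
Qed.

Lemma gram_sym : (invmx I)^T = invmx I.
Proof. by rewrite trmx_inv /I trmx_mul trmxK. Qed.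

Lemma gram_inv_pos (w : 'rV[R]_2) : w != 0 -> 0 < dot (w *m invmx I) w.
Proof.
move=> w0; rewrite lt_neqAle eq_sym; have E : dot (w *m invmx I) w =
    dot (w *m invmx I *m M) (w *m invmx I *m M).
  rewrite /dot !trmx_mul gram_sym !mulmxA -(mulmxA _ M) -/I.
  by rewrite mulmxKV// gram_unit.
rewrite E dot_ge0 andbT; apply: contra w0 => /eqP/dot_eq0 h.
have : w *m invmx I = 0 by apply: (row_free_inj Mfree); rewrite h mul0mx.
by move/(congr1 (mulmx^~ I)); rewrite mulmxKV ?gram_unit// mul0mx => ->.
Qed.

(** The orthogonal projections to the tangent plane and to the normal line. The stacked matrix of
    [M] and [nu] has an obvious right inverse, which is also a left inverse. *)
Lemma frame_resolution : M^T *m invmx I *m M + nu^T *m nu = 1%:M.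
Proof.
pose C : 'M[R]_(2 + 1, 3) := col_mx M nu.
pose D : 'M[R]_(2 + 1) := block_mx (invmx I) 0 0 1%:M.
have CC : C *m (C^T *m D) = 1%:M.
  rewrite mulmxA /C tr_col_mx mul_col_row -/I nuM.
  have -> : M *m nu^T = 0 by rewrite -(trmxK M) -trmx_mul nuM trmx0.
  have -> : nu *m nu^T = 1%:M by rewrite (mx11_scalar (nu *m nu^T)) -/(dot nu nu) nu1.
  by rewrite mulmx_block !mulmx0 !mul0mx !addr0 !add0r mulmxV ?gram_unit// mul1mx -scalar_mx_block.
have := mulmx1C CC.
by rewrite /C /D tr_col_mx mul_row_block !mulmx0 add0r addr0 mulmx1 mul_row_col.
Qed.

(* k i j stands for the covariant derivative of the j-th tangent vector in the
   direction of the i-th one, and B for the covariant Hessian of a function with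
   differential P, everything being expressed in an orthonormal frame. *)
Lemma frame_max_principle (P : 'rV[R]_3) (B : 'M[R]_3) (k : 'I_2 -> 'I_2 -> 'rV[R]_3) (h : R) :
  (forall w : 'rV[R]_2, dot (w *m M) P = 0) ->
  (forall w : 'rV[R]_2, dot (w *m M *m B) (w *m M) +
     \sum_i \sum_j w 0 i * w 0 j * dot (k i j) P <= 0) ->
  \sum_i \sum_j invmx I i j * dot (k i j) P = 2 * h * dot nu P ->
  exists2 lam : R, P = lam *: nu & \tr B - dot (nu *m B) nu + 2 * h * lam <= 0.
Proof.
move=> MP MB kP; exists (dot nu P).
  have MP0 : M *m P^T = 0.
    suff : (M *m P^T)^T = 0 by move/(congr1 trmx); rewrite trmxK trmx0.
    by apply: dot_eq0; rewrite /dot trmxK mulmxA; exact: MP.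
  apply: trmx_inj; rewrite -[LHS]mul1mx -frame_resolution mulmxDl -mulmxA MP0 mulmx0 add0r.
  rewrite -mulmxA (mx11_scalar (nu *m P^T)) -/(dot nu P) mul_mx_scalar.
  by rewrite linearZ.
pose Q : 'M[R]_2 := M *m B *m M^T + \matrix_(i, j) dot (k i j) P.
have Qneg (w : 'rV[R]_2) : dot (w *m Q) w <= 0.
  apply: le_trans (MB w); rewrite le_eqVlt; apply/orP; left; apply/eqP.
  rewrite /Q mulmxDr dotDl; congr (_ + _).
    by rewrite /dot trmx_mul !mulmxA.
  rewrite dotE exchange_big /=; apply: eq_bigr => j _; rewrite mxE mulr_suml.
  by apply: eq_bigr => i _; rewrite mxE; ring.
have := trace_nonpos gram_sym gram_inv_pos Qneg.
under eq_bigr => i _ do under eq_bigr => j _ do rewrite /Q mxE [X in _ * (_ + X)]mxE mulrDr.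
under eq_bigr => i _ do rewrite big_split /=.
rewrite big_split /= kP.
(* The sum is the trace of [B] over the tangent plane, and [frame_resolution] expresses it by the
   full trace and the normal entry. *)
suff -> : \sum_i \sum_j invmx I i j * (M *m B *m M^T) i j = \tr B - dot (nu *m B) nu by [].
transitivity (\tr (M *m B *m M^T *m invmx I)).
  rewrite /mxtrace; apply: eq_bigr => i _; rewrite mxE; apply: eq_bigr => j _.
  have -> : invmx I j i = invmx I i j by rewrite -[in LHS]gram_sym mxE.
  by rewrite mulrC.
rewrite -!mulmxA mxtrace_mulC -!mulmxA.
have -> : M^T *m (invmx I *m M) = 1%:M - nu^T *m nu by rewrite -frame_resolution mulmxA addrK.
rewrite mulmxBr mulmx1 linearB /=; congr (_ - _).
by rewrite mulmxA mxtrace_mulC mulmxA /dot /mxtrace big_ord1.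
Qed.

End FrameAlgebra.

Section MaximumPrinciple.
Variable R : realType.
Implicit Types x p u v k : 'rV[R]_3.

(** A square root of the metric: right multiplication turns coordinates of a vector into components
    in an orthonormal frame. *)
Definition frame p : 'M[R]_3 := diag_mx (\row_i if i == 2 then 1 else (p 0 1)^-1).

Lemma frame_metric p : frame p *m frame p = metric p.
Proof.
rewrite /frame mulmx_diag /metric; congr diag_mx; apply/rowP => i.
by rewrite !mxE; case: ifP => _; rewrite ?mulr1// -invfM expr2.
Qed.

Lemma frame_tr p : (frame p)^T = frame p.
Proof. exact: tr_diag_mx. Qed.

Lemma inner_frame p u v : inner p u v = dot (u *m frame p) (v *m frame p).
Proof. by rewrite /inner /dot trmx_mul frame_tr -frame_metric !mulmxA. Qed.

Lemma gamDl p u u' v : gam p (u + u') v = gam p u v + gam p u' v.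
Proof.
apply/rowP => i; rewrite !mxE -big_split; apply: eq_bigr => l _ /=.
by rewrite -big_split; apply: eq_bigr => m _ /=; rewrite mxE; ring.
Qed.

Lemma gamDr p u v v' : gam p u (v + v') = gam p u v + gam p u v'.
Proof.
apply/rowP => i; rewrite !mxE -big_split; apply: eq_bigr => l _ /=.
by rewrite -big_split; apply: eq_bigr => m _ /=; rewrite mxE; ring.
Qed.

Lemma gamZl p (c : R) u v : gam p (c *: u) v = c *: gam p u v.
Proof.
apply/rowP => i; rewrite !mxE mulr_sumr; apply: eq_bigr => l _ /=.
by rewrite mulr_sumr; apply: eq_bigr => m _ /=; rewrite mxE; ring.
Qed.

Lemma gamZr p (c : R) u v : gam p u (c *: v) = c *: gam p u v.
Proof.
apply/rowP => i; rewrite !mxE mulr_sumr; apply: eq_bigr => l _ /=.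
by rewrite mulr_sumr; apply: eq_bigr => m _ /=; rewrite mxE; ring.
Qed.

Lemma gam_comb p (w : 'I_2 -> R) (F : 'I_2 -> 'rV[R]_3) :
  gam p (\sum_i w i *: F i) (\sum_i w i *: F i) =
  \sum_i \sum_j (w i * w j) *: gam p (F i) (F j).
Proof.
rewrite !big_ord_recl !big_ord0 !addr0 !(gamDl, gamDr, gamZl, gamZr).
by rewrite !scalerDr !scalerA.
Qed.

(* P and B are the components, in the orthonormal frame at x, of the
   differential and of the covariant Hessian of phi at x. *)
Definition has_hessian (phi : 'rV[R]_3 -> R) x (P : 'rV[R]_3) (B : 'M[R]_3) : Prop :=
  forall (g : R -> 'rV[R]_3) u k,
    (forall i, jet2 (fun s => g s 0 i) (x 0 i) (u 0 i) (k 0 i)) ->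
    jet2 (fun s => phi (g s)) (phi x) (dot (u *m frame x) P)
      (dot (u *m frame x *m B) (u *m frame x) +
       dot ((k + gam x u u) *m frame x) P).

Lemma covariantE (X : 'rV[R]_2 -> 'rV[R]_3) a i j :
  covariant X a i j = partial i (partial j X) a + gam (X a) (partial i X a) (partial j X a).
Proof. by apply/rowP => k; rewrite !mxE. Qed.

(** The second derivative test on every line of parameters. The second partials of [X] combine with
    the Christoffel term of [has_hessian] into covariant derivatives, whose trace pairs with [P] as
    [2 * H] times the normal does. *)
Lemma cmc_max_principle (X : 'rV[R]_2 -> 'rV[R]_3) (U : set 'rV[R]_2)
    (a : 'rV[R]_2) (N P : 'rV[R]_3) (B : 'M[R]_3) (H : R) (phi : 'rV[R]_3 -> R) :
  open U -> U a -> smooth_on U X -> row_free (\matrix_(i < 2) partial i X a) ->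
  inner (X a) N N = 1 -> (forall i, inner (X a) N (partial i X a) = 0) ->
  mean_curvature_vector X a = H *: N ->
  has_hessian phi (X a) P B -> 0 < X a 0 1 ->
  (\forall b \near a, phi (X b) <= phi (X a)) ->
  exists2 lam : R, P = lam *: (N *m frame (X a)) &
    \tr B - dot (N *m frame (X a) *m B) (N *m frame (X a)) + 2 * H * lam <= 0.
Proof.
move=> oU Ua sX Xfree N1 NX XH phiPB y0 phimax.
set E := frame (X a); set M0 := \matrix_(i < 2) partial i X a.
have Eunit : E \in unitmx.
  rewrite unitmxE det_diag unitfE; apply/prodf_neq0 => i _; rewrite mxE.
  by case: ifP => _; rewrite ?oner_eq0// invr_eq0 gt_eqF.
have sumM0 (w : 'rV[R]_2) : w *m M0 = \sum_i w 0 i *: partial i X a.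
  by rewrite mulmx_sum_row; apply: eq_bigr => i _; rewrite rowK.
have jets (w : 'rV[R]_2) := phiPB (fun s => X (a + s *: w)) (w *m M0)
  (\sum_i \sum_j (w 0 i * w 0 j) *: partial j (partial i X) a).
have max (w : 'rV[R]_2) : dot (w *m (M0 *m E)) P = 0 /\
   dot (w *m (M0 *m E) *m B) (w *m (M0 *m E)) +
     \sum_i \sum_j w 0 i * w 0 j * dot (covariant X a i j *m E) P <= 0.
  have c : {for 0, continuous (fun s : R => a + s *: w)}.
    by apply: contD; [exact: cont_cst|apply: contZ; [exact: cont_id|exact: cont_cst]].
  have jw (k : 'I_3) : jet2 (fun s => X (a + s *: w) 0 k) (X a 0 k) ((w *m M0) 0 k)
     ((\sum_i \sum_j (w 0 i * w 0 j) *: partial j (partial i X) a) 0 k).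
    have := smooth_jet w k oU Ua sX; rewrite sumM0.
    rewrite (_ : \sum_i w 0 i * partial i X a 0 k =
      (\sum_i w 0 i *: partial i X a) 0 k); last first.
      by rewrite summxE; apply: eq_bigr => i _; rewrite mxE.
    rewrite (_ : \sum_i \sum_j w 0 i * w 0 j * partial j (partial i X) a 0 k =
      (\sum_i \sum_j (w 0 i * w 0 j) *: partial j (partial i X) a) 0 k)//.
    rewrite summxE; apply: eq_bigr => i _; rewrite summxE.
    by apply: eq_bigr => j _; rewrite mxE.
  have nmax : \forall s \near (0 : R), phi (X (a + s *: w)) <= phi (X (a + 0 *: w)).
    apply: (near_cont (P := fun b => phi (X b) <= phi (X (a + 0 *: w))) c).
    by rewrite scale0r addr0.
  have [] := jet2_max (jets w jw) nmax.
  rewrite -/E !mulmxA => -> le; split=> //.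
  apply: le_trans le; rewrite lerD2l le_eqVlt; apply/orP; left; apply/eqP.
  rewrite sumM0.
  rewrite [X in X + _]exchange_big gam_comb -big_split /= mulmx_suml dot_suml.
  apply: eq_bigr => i _; rewrite -big_split /= mulmx_suml dot_suml.
  apply: eq_bigr => j _; rewrite covariantE mulrC -[LHS]mulrC -dotZl scalemxAl.
  by rewrite scalerDr [w 0 j * _]mulrC.
apply: (@frame_max_principle R (M0 *m E) (N *m E) _ _ _ P B
  (fun i j => covariant X a i j *m E) H).
- apply: inj_row_free => w; rewrite mulmxA => /(congr1 (mulmx^~ (invmx E))).
  by rewrite mulmxK// mul0mx => wM; apply: (row_free_inj Xfree); rewrite wM mul0mx.
- by rewrite -inner_frame.
- apply/rowP => i; rewrite [RHS]mxE -(NX i) /inner trmx_mul !mulmxA frame_tr.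
  rewrite -(mulmxA N) frame_metric [LHS]mxE [RHS]mxE; apply: eq_bigr => l _.
  by rewrite !mxE.
- by move=> w; exact: (max w).1.
- by move=> w; exact: (max w).2.
- have fI : M0 *m E *m (M0 *m E)^T = first_form X a.
    rewrite trmx_mul frame_tr mulmxA -(mulmxA M0) frame_metric.
    apply/matrixP => i j; rewrite [RHS]mxE /inner mxE [RHS]mxE; apply: eq_bigr => l _.
    by rewrite !mxE; congr (_ * _); apply: eq_bigr => l' _; rewrite !mxE.
  (* At a maximum [P] vanishes on tangent vectors, so the projection inside the mean curvature
     vector is invisible to it. *)
  have nP (v : 'rV[R]_3) : dot (normal_part X a v *m E) P = dot (v *m E) P.
    rewrite /normal_part mulmxBl; rewrite {1}/dot mulmxBl mxE.
    rewrite [X in _ + X = _](_ : _ = 0) ?addr0//.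
    rewrite mxE -[X in - X]/(dot _ P) mulmx_suml dot_suml big1 ?oppr0// => i _.
    rewrite mulmx_suml dot_suml big1// => j _; rewrite -scalemxAl dotZl.
    have := (max (delta_mx 0 j)).1; rewrite mulmxA -rowE rowK => ->.
    by rewrite mulr0.
  have := congr1 (fun v => 2 * dot (v *m E) P) XH.
  rewrite /mean_curvature_vector -!scalemxAl !dotZl mulrA mulfV// mul1r mulrA => <-.
  rewrite fI mulmx_suml dot_suml; apply: eq_bigr => i _.
  rewrite mulmx_suml dot_suml; apply: eq_bigr => j _.
  by rewrite -scalemxAl dotZl nP.
Qed.

End MaximumPrinciple.

(** * Hessians of the comparison functions *)

Section Hessians.
Variable R : realType.
Implicit Types (x P : 'rV[R]_3) (B : 'M[R]_3) (phi : 'rV[R]_3 -> R).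

Definition row3 (a b c : R) : 'rV[R]_3 :=
  \row_i if i == 0 then a else if i == 1 then b else c.

Lemma row3E a b c : (row3 a b c 0 0 = a) * (row3 a b c 0 1 = b) * (row3 a b c 0 2 = c).
Proof. by rewrite !mxE. Qed.

Lemma dot3E (u v : 'rV[R]_3) : dot u v = u 0 0 * v 0 0 + u 0 1 * v 0 1 + u 0 2 * v 0 2.
Proof.
have o1 : lift ord0 ord0 = 1 :> 'I_3 by exact/val_inj.
have o2 : lift ord0 (lift ord0 ord0) = 2 :> 'I_3 by exact/val_inj.
by rewrite dotE !big_ord_recl big_ord0 !o1 !o2 (_ : ord0 = 0 :> 'I_3)// addr0 addrA.
Qed.

Lemma mul_frameE (u x : 'rV[R]_3) i :
  (u *m frame x) 0 i = u 0 i * (if i == 2 then 1 else (x 0 1)^-1).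
Proof. by rewrite /frame mul_mx_diag !mxE. Qed.

Definition horiz : 'M[R]_3 := diag_mx (row3 1 1 0).

Lemma horizE (u : 'rV[R]_3) : dot (u *m horiz) u = u 0 0 ^+ 2 + u 0 1 ^+ 2.
Proof. by rewrite dot3E /horiz mul_mx_diag !mxE /=; ring. Qed.

Lemma trace_horiz : \tr horiz = 2.
Proof.
have o1 : lift ord0 ord0 = 1 :> 'I_3 by exact/val_inj.
have o2 : lift ord0 (lift ord0 ord0) = 2 :> 'I_3 by exact/val_inj.
by rewrite /horiz mxtrace_diag !big_ord_recl big_ord0 !o1 !o2 !row3E; ring.
Qed.

Lemma outerE P (u : 'rV[R]_3) : dot (u *m (P^T *m P)) u = dot u P ^+ 2.
Proof.
rewrite {1}/dot mulmxA (mx11_scalar (u *m P^T)) mul_scalar_mx -scalemxAl mxE expr2.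
by rewrite -/(dot u P) -/(dot P u) (dotC P).
Qed.

Lemma trace_outer P : \tr (P^T *m P) = dot P P.
Proof. by rewrite mxtrace_mulC /mxtrace big_ord1. Qed.

Lemma jet2_eq (f : R -> R) v0 v1 v2 w0 w1 w2 :
  jet2 f v0 v1 v2 -> v0 = w0 -> v1 = w1 -> v2 = w2 -> jet2 f w0 w1 w2.
Proof. by move=> + <- <- <-. Qed.

Lemma has_hessianD phi phi' x P P' B B' :
  has_hessian phi x P B -> has_hessian phi' x P' B' ->
  has_hessian (fun y => phi y + phi' y) x (P + P') (B + B').
Proof.
move=> h h' g u k gj; apply: jet2_eq (jet2D (h g u k gj) (h' g u k gj)) _ _ _ => //.
  by rewrite dotC [dot _ P']dotC -dotDl dotC.
rewrite mulmxDr dotDl addrACA; congr (_ + _).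
by rewrite dotC [dot _ P']dotC -dotDl dotC.
Qed.

Definition twice_derivable (h h' : R -> R) (z h2 : R) : Prop :=
  (\forall y \near z, is_derive (y : R) 1 h (h' y)) /\ is_derive z 1 h' h2.

Lemma has_hessian_comp (h h' : R -> R) h2 phi x P B :
  twice_derivable h h' (phi x) h2 -> has_hessian phi x P B ->
  has_hessian (fun y => h (phi y)) x (h' (phi x) *: P)
    (h' (phi x) *: B + h2 *: (P^T *m P)).
Proof.
move=> [hd h'd] hphi g u k gj.
apply: jet2_eq (jet2_comp hd h'd (hphi g u k gj)) _ _ _ => //.
  by rewrite [in RHS]dotC dotZl dotC.
rewrite mulmxDr -!scalemxAr dotDl !dotZl outerE [dot _ (_ *: P)]dotC dotZl [dot P _]dotC.
by ring.
Qed.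

Lemma has_hessian_height x : x 0 1 != 0 ->
  has_hessian (fun y => y 0 2) x (row3 0 0 1) 0.
Proof.
move=> y0 g u k gj; have [_ _ g2] := gamE u u y0.
apply: jet2_eq (gj 2) _ _ _ => //.
  by rewrite dot3E !row3E !mul_frameE /=; ring.
rewrite mulmx0 !dot3E !row3E !mul_frameE /=.
have z (i : 'I_3) : (0 : 'rV[R]_3) 0 i = 0 by rewrite mxE.
by rewrite !z [(k + _) 0 2]mxE g2; ring.
Qed.

Definition lin (a b c : R) (x : 'rV[R]_3) : R :=
  (a * x 0 0 + b + c * (x 0 0 ^+ 2 + x 0 1 ^+ 2)) / x 0 1.

Definition dlin (a b c : R) (x : 'rV[R]_3) : 'rV[R]_3 :=
  row3 (a + 2 * c * x 0 0) (c * x 0 1 - (a * x 0 0 + b + c * x 0 0 ^+ 2) / x 0 1) 0.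

(** The constant [a ^+ 2 - 4 * b * c] is the Lorentzian norm of the linear function: -1 for the
    hyperbolic cosine of the distance to a point, 1 for the hyperbolic sine of the signed distance
    to a geodesic. *)
Lemma dlin_norm a b c x : x 0 1 != 0 ->
  dot (dlin a b c x) (dlin a b c x) = lin a b c x ^+ 2 + (a ^+ 2 - 4 * b * c).
Proof. by move=> y0; rewrite dot3E !row3E /lin; field. Qed.

(* lin a b c is the restriction to the hyperboloid of a linear function, hence
   its Hessian is lin a b c times the metric. *)
Lemma has_hessian_lin a b c x : x 0 1 != 0 ->
  has_hessian (lin a b c) x (dlin a b c x) (lin a b c x *: horiz).
Proof.
move=> y0 g u k gj; have [g0 g1 _] := gamE u u y0.
have j0 := gj 0; have j1 := gj 1.
have num := jet2D (jet2D (jet2M (jet2_cst a) j0) (jet2_cst b))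
  (jet2M (jet2_cst c) (jet2D (jet2M j0 j0) (jet2M j1 j1))).
apply: jet2_eq (jet2M num (jet2V y0 j1)) _ _ _.
- by rewrite /lin !expr2.
- by rewrite dot3E !row3E !mul_frameE /=; field.
- rewrite -scalemxAr dotZl horizE dot3E !row3E !mul_frameE /=.
  by rewrite [(k + _) 0 0]mxE [(k + _) 0 1]mxE g0 g1 /lin; field.
Qed.

Lemma lin_cont (a b c : R) x : 0 < x 0 1 -> {for x, continuous (lin a b c)}.
Proof.
move=> x1; have cc (i : 'I_3) : {for x, continuous (fun q : 'rV[R]_3 => q 0 i)}.
  exact: coord_continuous.
rewrite /lin; apply: contM.
  apply: contD; first by apply: contD; [apply: contM; [exact: cont_cst|exact: cc]|exact: cont_cst].
  by apply: contM; [exact: cont_cst|apply: contD; apply: contX; exact: cc].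
by apply: contV; [rewrite gt_eqF|exact: cc].
Qed.

Lemma twice_derivable_affine (a b z : R) :
  twice_derivable (fun y => a * y + b) (fun=> a) z 0.
Proof.
split; last exact: der_cst.
near=> y; apply: is_derive_eq (derD (derM (der_cst a y) (is_derive_id _ _)) (der_cst b y)) _.
by rewrite mul0r mulr1 addr0 add0r.
Unshelve. all: by end_near.
Qed.

Lemma twice_derivable_sqr (a c z : R) :
  twice_derivable (fun y => a * (y - c) ^+ 2) (fun y => 2 * a * (y - c)) z (2 * a).
Proof.
have d1 (y : R) : is_derive y 1 (fun t : R => t - c) 1.
  by have := derD (is_derive_id y 1) (der_cst (- c) y); rewrite addr0.
split.
  near=> y; apply: is_derive_eq (derM (der_cst a y) (derM (d1 y) (d1 y))) _.
  by ring.
by apply: is_derive_eq (derM (der_cst (2 * a) z) (d1 z)) _; ring.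
Unshelve. all: by end_near.
Qed.

Lemma twice_derivable_ln (a z : R) : 0 < z ->
  twice_derivable (fun y => a * ln y) (fun y => a / y) z (- a / z ^+ 2).
Proof.
move=> z0; split.
  have : \forall y \near z, 0 < y by apply: open_nbhs_nbhs; split; [exact: open_gt|].
  apply: filterS => y y0.
  apply: is_derive_eq (derM (der_cst a y) (is_derive1_ln y0)) _.
  by rewrite mul0r add0r.
have zn : z != 0 by rewrite gt_eqF.
apply: is_derive_eq (derM (der_cst a z) (der_inv zn)) _.
by field.
Qed.

(** For [y = sinh s] the function is [ln (cosh s)]. *)
Lemma twice_derivable_log_cosh (z : R) :
  twice_derivable (fun y => 2^-1 * ln (1 + y ^+ 2)) (fun y => y / (1 + y ^+ 2)) z
    ((1 - z ^+ 2) / (1 + z ^+ 2) ^+ 2).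
Proof.
have p (y : R) : 0 < 1 + y ^+ 2 by rewrite ltr_pwDl// sqr_ge0.
have pn (y : R) : 1 + y ^+ 2 != 0 by rewrite gt_eqF.
have d2 (y : R) : is_derive y 1 (fun t : R => 1 + t ^+ 2) (2 * y).
  apply: is_derive_eq (derD (der_cst 1 y) (derM (is_derive_id y 1) (is_derive_id y 1))) _.
  by rewrite mul1r mulr1 add0r; ring.
split.
  near=> y; apply: is_derive_eq (derM (der_cst 2^-1 y)
    (der_comp (g := fun t : R => 1 + t ^+ 2) (is_derive1_ln (p y)) (d2 y))) _.
  by field.
apply: is_derive_eq (derM (is_derive_id z 1)
   (der_comp (f := fun t : R => t^-1) (g := fun t : R => 1 + t ^+ 2) (der_inv (pn z)) (d2 z))) _.
by field.
Unshelve. all: by end_near.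
Qed.

(** For [y = sinh s] the function is [cosh s], perturbed by [m] times the square of [sinh s]. *)
Lemma twice_derivable_sqrt_sqr (m z : R) :
  twice_derivable (fun y => Num.sqrt (1 + y ^+ 2) + m * y ^+ 2)
    (fun y => y / Num.sqrt (1 + y ^+ 2) + 2 * m * y) z
    (Num.sqrt (1 + z ^+ 2) ^- 3 + 2 * m).
Proof.
have p (y : R) : 0 < 1 + y ^+ 2 by rewrite ltr_pwDl// sqr_ge0.
have sp (y : R) : Num.sqrt (1 + y ^+ 2) != 0 by rewrite gt_eqF// sqrtr_gt0.
have d2 (y : R) : is_derive y 1 (fun t : R => 1 + t ^+ 2) (2 * y).
  apply: is_derive_eq (derD (der_cst 1 y) (derM (is_derive_id y 1) (is_derive_id y 1))) _.
  by rewrite mul1r mulr1 add0r; ring.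
have ds (y : R) : is_derive y 1 (fun t : R => Num.sqrt (1 + t ^+ 2)) (y / Num.sqrt (1 + y ^+ 2)).
  apply: is_derive_eq (der_comp (g := fun t : R => 1 + t ^+ 2) (is_derive1_sqrt (p y)) (d2 y)) _.
  by field.
have dq (c y : R) : is_derive y 1 (fun t : R => c * t ^+ 2) (2 * c * y).
  apply: is_derive_eq (derM (der_cst c y) (derM (is_derive_id y 1) (is_derive_id y 1))) _.
  by rewrite mul1r mulr1 mul0r add0r; ring.
split; first by near=> y; exact: derD (ds y) (dq m y).
apply: is_derive_eq (derD (derM (is_derive_id z 1)
  (der_comp (f := fun t : R => t^-1) (g := fun t : R => Num.sqrt (1 + t ^+ 2)) (der_inv (sp z)) (ds z)))
  (derM (der_cst (2 * m) z) (is_derive_id z 1))) _.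
rewrite mul1r mulr1 mul0r add0r; congr (_ + _).
have s2 : Num.sqrt (1 + z ^+ 2) ^+ 2 = 1 + z ^+ 2 by rewrite sqr_sqrtr// ltW.
have -> : (Num.sqrt (1 + z ^+ 2))^-1 + z * (- Num.sqrt (1 + z ^+ 2) ^- 2 * (z / Num.sqrt (1 + z ^+ 2)))
  = (Num.sqrt (1 + z ^+ 2) ^+ 2 - z ^+ 2) / Num.sqrt (1 + z ^+ 2) ^+ 3 by field.
by rewrite s2 addrK mul1r.
Unshelve. all: by end_near.
Qed.

End Hessians.

(** * The sides of a surface *)

Section Segments.
Variables (R : realType) (V : normedModType R) (Y : Type).

Lemma ball_segment (v u w : V) (d t : R) : ball v d u -> ball v d w -> 0 <= t <= 1 ->
  ball v d (u + t *: (w - u)).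
Proof.
rewrite -!ball_normE /= => vu vw /andP[t0 t1].
rewrite (_ : v - _ = (1 - t) *: (v - u) + t *: (v - w)); last first.
  rewrite scalerBl scale1r -addrA [- _ + _]addrC -scalerBr opprD addrA -scalerN opprB.
  by congr (_ + _ *: _); rewrite opprB [RHS]addrC addrA subrK.
apply: le_lt_trans (ler_normD _ _) _; rewrite !normrZ !ger0_norm ?subr_ge0//.
apply: (@le_lt_trans _ _ (Num.max `|v - u| `|v - w|)); last by rewrite gt_max vu.
have m1 : `|v - u| <= Num.max `|v - u| `|v - w| by rewrite le_max lexx.
have m2 : `|v - w| <= Num.max `|v - u| `|v - w| by rewrite le_max lexx orbT.
have t1' : 0 <= 1 - t by rewrite subr_ge0.
have := ler_wpM2l t1' m1; have := ler_wpM2l t0 m2; lra.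
Qed.

Lemma segment_loc_const (f : V -> Y) (u v : V) (A : set V) :
  (forall t : R, 0 <= t <= 1 -> A (u + t *: (v - u))) ->
  (forall t : R, 0 <= t <= 1 -> let w := u + t *: (v - u) in
     \forall z \near w, A z -> f z = f w) ->
  f v = f u.
Proof.
move=> As loc.
have := @loc_const_connected R Y `[0, 1] (fun t => f (u + t *: (v - u)))
  (@segment_connected R 0 1).
have E1 : u + 1 *: (v - u) = v by rewrite scale1r addrC subrK.
have E0 : u + 0 *: (v - u) = u by rewrite scale0r addr0.
move=> /(_ _ 0 1); rewrite E1 E0; apply.
- move=> t; rewrite /= in_itv /= => t01.
  have c : {for t, continuous (fun t : R => u + t *: (v - u))}.
    by apply: contD; [exact: cont_cst|apply: contZ; [exact: cont_id|exact: cont_cst]].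
  have h := near_cont c (loc t t01).
  by apply: filterS h => s /= fs; rewrite in_itv /= => s01; apply/fs/As.
- by rewrite /= in_itv /= lexx ler01.
- by rewrite /= in_itv /= lexx ler01.
Qed.

End Segments.

Section Sides.
Variables (R : realType) (V : normedModType R).

(* sd x is a local equation of the closed set E in the ball of radius er x, and
   it increases in the direction of the normal vectors nrm z. *)
Definition two_sided (E : set V) (nrm : V -> V) (x : V) (sd : V -> R) (er : R) : Prop :=
  [/\ 0 < er,
      forall y, ball x er y -> {for y, continuous sd},
      forall y, ball x er y -> (sd y = 0 <-> E y) &
      forall z y t, E z -> ball x er z -> ball x er y -> 0 < t ->
        ball x er (y + t *: nrm z) -> sd y < sd (y + t *: nrm z)].

Variables (E : set V) (nrm : V -> V).

Lemma ball_line (x z n : V) (e : R) : ball x e z ->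
  exists2 d : R, 0 < d & forall t w, `|t| <= d -> ball z d w -> ball x e (w + t *: n).
Proof.
rewrite -ball_normE /= => xz.
have e0 : 0 < e - `|x - z| by rewrite subr_gt0.
have n1 : 0 < 2 * (1 + `|n|) by rewrite mulr_gt0// ltr_pwDl.
exists ((e - `|x - z|) / (2 * (1 + `|n|))); first by rewrite divr_gt0.
move=> t w; rewrite ler_pdivlMr// ltr_pdivlMr// => tn zw.
rewrite (_ : x - (w + t *: n) = (x - z) + (z - w) - t *: n); last by rewrite addrA subrK opprD addrA.
apply: le_lt_trans (ler_normB _ _) _.
apply: le_lt_trans (lerD (ler_normD _ _) (lexx _)) _; rewrite normrZ.
have t0 := normr_ge0 t; have n0 := normr_ge0 n; have z0 := normr_ge0 (z - w).
have : 0 <= `|z - w| * `|n| by rewrite mulr_ge0.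
nra.
Qed.

Section OneSide.
Variables (x : V) (sd : V -> R) (er : R) (z : V).
Hypotheses (sdP : two_sided E nrm x sd er) (Ez : E z) (xz : ball x er z).

(** The side of [w] is read off from the direction in which [E] is met along [nrm z], hence it does
    not depend on the local equation; [sides_agree] rests on this. *)
Lemma side_sign : exists2 d : R, 0 < d & forall w t, ball z d w -> `|t| <= d ->
  E (w + t *: nrm z) -> Num.sg (sd w) = - Num.sg t.
Proof.
case: sdP => er0 sdc sdE sdn.
have [d d0 dP] := ball_line (nrm z) xz; exists d => // w t zw td Ew.
have xw : ball x er w by rewrite -[w]addr0 -(scale0r (nrm z)); apply: dP; rewrite ?normr0 ?ltW.
have xw' : ball x er (w + t *: nrm z) by exact: dP.
have sw' : sd (w + t *: nrm z) = 0 by apply/sdE.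
have [t0|t0|t0] := ltgtP t 0.
- have : sd (w + t *: nrm z) < sd (w + t *: nrm z + (- t) *: nrm z).
    by apply: sdn => //; rewrite ?oppr_gt0// scaleNr addrK.
  by rewrite scaleNr addrK sw' (ltr0_sg t0) opprK => /gtr0_sg.
- have : sd w < sd (w + t *: nrm z) by exact: sdn.
  by rewrite sw' (gtr0_sg t0) => /ltr0_sg.
- by move: sw'; rewrite t0 scale0r addr0 sgr0 oppr0 => ->; rewrite sgr0.
Qed.

Lemma near_shift (P : set V) (t : R) (n : V) :
  (\forall y \near z + t *: n, P y) -> \forall w \near z, P (w + t *: n).
Proof.
move=> h; apply: (near_cont (f := fun w => w + t *: n)) h.
by apply: contD; [exact: cont_id|exact: cont_cst].
Qed.

Lemma sd_posE : \forall d \near (0 : R)^'+,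
  0 < sd (z + d *: nrm z) /\ sd (z + (- d) *: nrm z) < 0.
Proof.
case: sdP => er0 sdc sdE sdn; have sz : sd z = 0 by apply/sdE.
have [d d0 dP] := ball_line (nrm z) xz; near=> e.
have e0 : 0 < e by near: e; exact: nbhs_right_gt.
have ed : e <= d by near: e; exact: nbhs_right_le.
have zz : ball z d z by exact: ballxx.
split; first by rewrite -sz; apply: sdn => //; apply: dP; rewrite ?gtr0_norm.
have E1 : z + (- e) *: nrm z + e *: nrm z = z by rewrite scaleNr subrK.
have xm : ball x er (z + (- e) *: nrm z) by apply: dP => //; rewrite normrN gtr0_norm.
by have := sdn z _ e Ez xz xm e0; rewrite E1 sz; exact.
Unshelve. all: by end_near.
Qed.

Lemma near_sd (P : R -> Prop) (w : V) : ball x er w -> open P -> P (sd w) ->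
  \forall y \near w, P (sd y).
Proof.
case: sdP => er0 sdc _ _ xw oP Pw.
by apply: (near_cont (P := P) (sdc w xw)); exact: open_nbhs_nbhs.
Qed.

(** The intermediate value theorem on a short segment along [nrm z], whose ends stay on opposite
    sides when its centre moves a little. *)
Lemma side_meets (d : R) : 0 < d ->
  \forall w \near z, exists2 t : R, `|t| <= d & E (w + t *: nrm z).
Proof.
move=> d0; case: (sdP) => er0 sdc sdE sdn.
have [d1 d10 d1P] := ball_line (nrm z) xz.
have zz : ball z d1 z by exact: ballxx.
near (0 : R)^'+ => e.
have e0 : 0 < e by near: e; exact: nbhs_right_gt.
have ed : e <= d by near: e; exact: nbhs_right_le.
have ed1 : e <= d1 by near: e; exact: nbhs_right_le.
have [sp sn] : 0 < sd (z + e *: nrm z) /\ sd (z + (- e) *: nrm z) < 0.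
  by near: e; exact: sd_posE.
have np : \forall w \near z, 0 < sd (w + e *: nrm z).
  apply: (near_shift (P := fun y => 0 < sd y)).
  apply: (near_sd (P := fun r => 0 < r)); [|exact: open_gt|exact: sp].
  by apply: d1P => //; rewrite gtr0_norm.
have nn : \forall w \near z, sd (w + (- e) *: nrm z) < 0.
  apply: (near_shift (P := fun y => sd y < 0)).
  apply: (near_sd (P := fun r => r < 0)); [|exact: open_lt|exact: sn].
  by apply: d1P => //; rewrite normrN gtr0_norm.
have nb : \forall w \near z, ball z d1 w by exact: nbhsx_ballx.
near=> w.
have wp : 0 < sd (w + e *: nrm z) by near: w.
have wn : sd (w + (- e) *: nrm z) < 0 by near: w.
have wb : ball z d1 w by near: w.
have ee : - e <= e by rewrite ge0_cp// ltW.
have cw : {within `[(- e), e], continuous (fun t => sd (w + t *: nrm z))}.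
  apply: continuous_in_subspaceT => t; rewrite inE /= in_itv /= => te.
  have c : {for (t : R), continuous (fun t : R => w + t *: nrm z)}.
    by apply: contD; [exact: cont_cst|apply: contZ; [exact: cont_id|exact: cont_cst]].
  have c' : {for w + t *: nrm z, continuous sd}.
    by apply: sdc; apply: d1P => //; apply: le_trans ed1; rewrite ler_norml.
  exact: (cont_comp c c').
have [|t] := IVT (v := 0) ee cw.
  by rewrite ge_min le_max (ltW wn) (ltW wp) orbT.
rewrite in_itv /= => te st; exists t; first by apply: le_trans ed; rewrite ler_norml.
by apply/sdE => //; apply: d1P => //; apply: le_trans ed1; rewrite ler_norml.
Unshelve. all: by end_near.
Qed.

(* Each side of E is locally connected: push segments off E along nrm z. *)
Lemma side_loc_const (Y : Type) (f : V -> Y) (s : R) :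
  (s = 1 \/ s = -1) ->
  (\forall w \near z, ~ E w -> \forall y \near w, f y = f w) ->
  exists2 d : R, 0 < d & forall w w', ball z d w -> ball z d w' ->
    0 < s * sd w -> 0 < s * sd w' -> f w = f w'.
Proof.
move=> s1 /nbhs_ballP[d2 /= d20 fP]; case: (sdP) => er0 sdc sdE sdn.
have zz2 : ball z d2 z by exact: ballxx.
have [d3 d30 d3P] := ball_line (nrm z) zz2.
have [d1 d10 d1P] := ball_line (nrm z) xz.
have s0 : s != 0 by case: s1 => ->; rewrite ?oner_eq0// oppr_eq0 oner_eq0.
near (0 : R)^'+ => e.
have e0 : 0 < e by near: e; exact: nbhs_right_gt.
have ed3 : e <= d3 by near: e; exact: nbhs_right_le.
have ed1 : e <= d1 by near: e; exact: nbhs_right_le.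
have [sp sn] : 0 < sd (z + e *: nrm z) /\ sd (z + (- e) *: nrm z) < 0.
  by near: e; exact: sd_posE.
have nse (t : R) : 0 <= t <= 1 -> `|t * (s * e)| <= e.
  move=> /andP[t0 t1]; rewrite !normrM ger0_norm// (gtr0_norm e0).
  have -> : `|s| = 1 by case: s1 => ->; rewrite ?normrN normr1.
  by rewrite mul1r ler_piMl// ltW.
have nse1 : `|s * e| <= e by rewrite -[s * e]mul1r nse// ler01 lexx.
have ss : 0 < s * sd (z + (s * e) *: nrm z).
  by case: s1 => ->; rewrite ?mul1r// ?mulN1r oppr_gt0.
have sds (w : V) t : 0 <= t <= 1 -> ball z d1 w -> 0 < s * sd w ->
    0 < s * sd (w + (t * (s * e)) *: nrm z).
  move=> t01 zw sw; case/andP: (t01) => t0 t1.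
  have xw : ball x er w by rewrite -[w]addr0 -(scale0r (nrm z)); apply: d1P; rewrite ?normr0 ?ltW.
  have xw' : ball x er (w + (t * (s * e)) *: nrm z).
    by apply: d1P => //; apply: le_trans (nse _ t01) ed1.
  move: t0; rewrite le_eqVlt => /orP[/eqP<-|t0]; first by rewrite mul0r scale0r addr0.
  apply: (lt_trans sw); case: s1 xw' => -> xw'.
    by rewrite !mul1r; apply: sdn => //; [rewrite mulr_gt0|rewrite mul1r in xw'].
  have E1 : w + (t * (-1 * e)) *: nrm z + (t * e) *: nrm z = w.
    by rewrite mulN1r mulrN scaleNr subrK.
  rewrite !mulN1r ltrN2 -mulN1r; have := sdn z _ (t * e) Ez xz xw'.
  by rewrite E1; apply => //; rewrite mulr_gt0.
have near_ss : \forall y \near z + (s * e) *: nrm z, 0 < s * sd y.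
  apply: (near_sd (P := fun r => 0 < s * r)); last exact: ss.
    by apply: d1P; [exact: le_trans ed1|exact: ballxx].
  have cs : continuous (fun r : R => s * r) by move=> r; exact: mulrl_continuous.
  by apply: (open_comp _ (@open_gt R 0)) => r _; exact: cs.
have /nbhs_ballP[d4 /= d40 d4P] := near_ss.
exists (Num.min (Num.min d1 d3) d4); first by rewrite !lt_min d10 d30.
have leb w : ball z (Num.min (Num.min d1 d3) d4) w -> [/\ ball z d1 w, ball z d3 w & ball z d4 w].
  by move=> zw; split; apply: le_ball zw; rewrite !ge_min lexx ?orbT.
have nE w : ball x er w -> 0 < s * sd w -> ~ E w.
  by move=> xw + Ew; rewrite (_ : sd w = 0) ?mulr0 ?ltxx//; apply/sdE.
have up w : ball z (Num.min (Num.min d1 d3) d4) w -> 0 < s * sd w ->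
    f (w + (s * e) *: nrm z) = f w.
  move=> /leb[w1 w3 w4] sw; apply: (segment_loc_const (A := setT)) => // t t01 y.
  have yE : y = w + (t * (s * e)) *: nrm z by rewrite /y [w + _ - w]addrC addKr scalerA.
  have : \forall q \near y, f q = f y.
    apply: fP; first by rewrite yE; apply: d3P => //; apply: le_trans (nse _ t01) ed3.
    apply: nE; rewrite yE; last exact: sds.
    by apply: d1P => //; apply: le_trans (nse _ t01) ed1.
  by apply: filterS.
move=> w w' zw zw' sw sw'; rewrite -(up w)// -(up w')//.
case: (leb _ zw) (leb _ zw') => w1 w3 w4 [w1' w3' w4'].
apply: (segment_loc_const (A := setT)) => // t t01 y.
have yE : y = (w' + t *: (w - w')) + (s * e) *: nrm z.
  by rewrite /y opprD addrACA subrr addr0 addrAC.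
have conv d (zd : ball z d w) (zd' : ball z d w') := ball_segment zd' zd t01.
have : \forall q \near y, f q = f y.
  apply: fP; first by rewrite yE; apply: d3P; [exact: le_trans ed3|exact: conv].
  apply: nE.
    by rewrite yE; apply: d1P; [exact: le_trans ed1|exact: conv].
  apply: d4P; rewrite /= yE.
  have := conv _ w4 w4'; rewrite -!ball_normE /=.
  have -> // : z + (s * e) *: nrm z - (w' + t *: (w - w') + (s * e) *: nrm z) =
    z - (w' + t *: (w - w')).
  by rewrite [in LHS]opprD addrACA subrr addr0.
by apply: filterS.
Unshelve. all: by end_near.
Qed.

End OneSide.

Lemma sides_agree x sd er x' sd' er' z : two_sided E nrm x sd er ->
  two_sided E nrm x' sd' er' -> E z -> ball x er z -> ball x' er' z ->
  \forall w \near z, Num.sg (sd w) = Num.sg (sd' w).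
Proof.
move=> sdP sdP' Ez xz xz'.
have [d d0 dP] := side_sign sdP Ez xz; have [d' d'0 d'P] := side_sign sdP' Ez xz'.
have dd : 0 < Num.min d d' by rewrite lt_min d0.
have m := side_meets sdP Ez xz dd.
near=> w.
have [t] : exists2 t : R, `|t| <= Num.min d d' & E (w + t *: nrm z) by near: w.
rewrite le_min => /andP[td td'] Ew.
rewrite (dP w t)// ?(d'P w t)//; near: w; exact: nbhsx_ballx.
Unshelve. all: by end_near.
Qed.

End Sides.

(** * Functions with prescribed jumps across a surface *)

Section JumpFunction.
Variables (R : realType) (V : normedModType R).
Variables (E : set V) (nrm : V -> V) (sd : V -> V -> R) (er : V -> R).
Variables (X P : set V).

(* s increases by 1 when P is crossed in the direction of the normal. *)
Definition jump_function (s : V -> int) : Prop :=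
  forall x, X x ->
    (~ P x -> \forall w \near x, X w -> s w = s x) /\
    (P x -> \forall w \near x, X w -> s w = if 0 <= sd x w then s x else s x - 1).

Hypotheses (cX : compact X)
  (convX : forall u v (t : R), X u -> X v -> 0 <= t <= 1 -> X (u + t *: (v - u)))
  (sdP : forall x, X x -> P x -> two_sided E nrm x (sd x) (er x))
  (PE : P `<=` E)
  (Popen : forall x, X x -> P x -> \forall w \near x, E w -> P w)
  (Pclosed : forall x, X x -> ~ P x -> \forall w \near x, ~ P w).

Let g (x w : V) : int := if `[< P x >] && (0 <= sd x w) then 1 else 0.

Let gP x w : P x -> g x w = if 0 <= sd x w then 1 else 0.
Proof. by move=> Px; rewrite /g asboolT. Qed.

Let gNP x w : ~ P x -> g x w = 0.
Proof. by move=> Px; rewrite /g asboolF. Qed.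

Let good (x : V) (r : R) := [/\ 0 < r, P x -> ball x r `<=` ball x (er x),
   P x -> forall w, ball x r w -> E w -> P w & ~ P x -> forall w, ball x r w -> ~ P w].

Let good_radius x : X x -> exists r, good x r.
Proof.
move=> Xx; have [Px|nPx] := pselect (P x).
- have [er0 _ _ _] := sdP Xx Px.
  have /nbhs_ballP[r /= r0 rP] := Popen Xx Px.
  exists (Num.min r (er x)); split=> //; first by rewrite lt_min r0.
  + by move=> _ w; apply: le_ball; rewrite ge_min lexx orbT.
  + by move=> _ w xw; apply: rP; apply: le_ball xw; rewrite ge_min lexx.
- have /nbhs_ballP[r /= r0 rP] := Pclosed Xx nPx.
  by exists r; split.
Qed.

Let sg_ge0 (x y : R) : Num.sg x = Num.sg y -> (0 <= x) = (0 <= y).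
Proof. by move=> h; rewrite -sgr_ge0 h sgr_ge0. Qed.

Let g_loc_const x r u : X x -> good x r -> ball x r u -> ~ P u ->
  \forall w \near u, g x w = g x u.
Proof.
move=> Xx [r0 rer rE rN] xu nPu; have [Px|nPx] := pselect (P x); last first.
  by near=> w; rewrite !gNP.
have sx := sdP Xx Px; have xu' := rer Px _ xu.
have nEu : ~ E u by move=> /(rE Px _ xu).
have s0 : sd x u != 0.
  by apply/eqP => s0; apply: nEu; case: sx => _ _ h _; apply/h.
have [sn|sp|/eqP] := ltgtP (sd x u) 0; last by rewrite (negbTE s0).
- have h := near_sd (P := fun y : R => y < 0) sx xu' (@open_lt R 0) sn.
  by apply: filterS h => w sw; rewrite !gP// !leNgt sw sn.
- have h := near_sd (P := fun y : R => 0 < y) sx xu' (@open_gt R 0) sp.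
  by apply: filterS h => w sw; rewrite !gP// (ltW sw) (ltW sp).
Unshelve. all: by end_near.
Qed.

Let g_compat x r x' r' u : X x -> X x' -> good x r -> good x' r' ->
  ball x r u -> ball x' r' u ->
  \forall w \near u, g x w - g x' w = g x u - g x' u.
Proof.
move=> Xx Xx' gx gx' xu xu'; have [Pu|nPu] := pselect (P u).
- have Px : P x by apply: contrapT => nPx; case: gx => _ _ _ /(_ nPx _ xu).
  have Px' : P x' by apply: contrapT => nPx'; case: gx' => _ _ _ /(_ nPx' _ xu').
  have h := sides_agree (sdP Xx Px) (sdP Xx' Px') (PE Pu)
    (let: And4 _ h _ _ := gx in h Px _ xu) (let: And4 _ h _ _ := gx' in h Px' _ xu').
  have h0 := sg_ge0 (nbhs_singleton h).
  by apply: filterS h => w /sg_ge0 sw; rewrite !gP// sw h0 !subrr.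
- have h := g_loc_const Xx gx xu nPu; have h' := g_loc_const Xx' gx' xu' nPu.
  by apply: filterS2 h h' => w -> ->.
Qed.

(** Near every point there is a local solution [g x], and two of them differ by a locally constant
    function. Their increments therefore form a cocycle, which is integrated along the segments from
    a base point, [X] being convex. *)
Lemma jump_function_exists : X !=set0 -> exists s, jump_function s.
Proof.
move=> [b0 Xb0].
have [rho rhoP] : exists rho : V -> R, forall x, X x -> good x (rho x).
  exists (fun x => if pselect (X x) is left Xx then sval (cid (good_radius Xx)) else 0).
  by move=> x Xx; case: pselect => // Xx'; exact: svalP (cid (good_radius Xx')).
(* A Lebesgue number: one local solution serves on the whole ball of radius [lam] around any point
   of [X]. *)
have [lam lam0 lamP] : exists2 e : R, 0 < e & forall u, X u ->
    exists x, X x /\ ball u e `<=` ball x (rho x).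
  apply: compact_uniform_radius => // x Xx; have [r0 _ _ _] := rhoP x Xx.
  exists (rho x / 2); first by rewrite divr_gt0.
  move=> y d xy d0 dr; exists x; split=> // w yw.
  by rewrite (splitr (rho x)); apply: ball_triangle xy (le_ball (ltW dr) yw).
have [xx xxP] : exists xx : V -> V, forall u, X u ->
    X (xx u) /\ ball u lam `<=` ball (xx u) (rho (xx u)).
  exists (fun u => if pselect (X u) is left Xu then sval (cid (lamP u Xu)) else 0).
  by move=> u Xu; case: pselect => // Xu'; exact: svalP (cid (lamP u Xu')).
pose c (u w : V) : int := g (xx u) w - g (xx u) u.
have l20 : 0 < lam / 2 by rewrite divr_gt0.
have l2l : lam / 2 <= lam by lra.
have ball_half (v u w : V) : ball v (lam / 2) u -> ball v (lam / 2) w -> ball u lam w.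
  move=> vu vw; rewrite (splitr lam); apply: (@ball_triangle _ _ v) => //.
  exact: ball_sym.
have cad v : additive_on c [set u | X u /\ ball v (lam / 2) u].
  move=> u w y [Xu vu] [Xw vw] [Xy vy]; rewrite /c.
  have [Xxu uB] := xxP u Xu; have [Xxw wB] := xxP w Xw.
  have E1 : g (xx u) y - g (xx w) y = g (xx u) w - g (xx w) w.
    apply: (segment_loc_const (f := fun q => g (xx u) q - g (xx w) q) (A := X)) => t t01.
      exact: convX.
    have wv : ball v (lam / 2) (w + t *: (y - w)) := ball_segment vw vy t01.
    have h := g_compat Xxu Xxw (rhoP _ Xxu) (rhoP _ Xxw)
      (uB _ (ball_half _ _ _ vu wv)) (wB _ (ball_half _ _ _ vw wv)).
    by apply: filterS h.
  by move: E1; lra.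
have loc x t : X x -> 0 <= t <= 1 -> exists2 e : R, 0 < e &
    additive_on c ((fun p : V * R => b0 + p.2 *: (p.1 - b0)) @`
      [set p | [/\ X p.1, 0 <= p.2 <= 1, ball x e p.1 & `|t - p.2| < e]]).
  move=> Xx t01; have cont : {for (x, t), continuous (fun p : V * R => b0 + p.2 *: (p.1 - b0))}.
    have c1 : {for (x, t), continuous (fun p : V * R => p.1)} by exact: cvg_fst.
    have c2 : {for (x, t), continuous (fun p : V * R => p.2)} by exact: cvg_snd.
    by apply: contD; [exact: cont_cst|apply: contZ => //; apply: contB => //; exact: cont_cst].
  have := near_cont (P := ball (b0 + t *: (x - b0)) (lam / 2)) cont (nbhsx_ballx _ _ l20).
  move=> /nbhs_ballP[e /= e0 eP]; exists e => //.
  apply: additive_onS (cad (b0 + t *: (x - b0))) => _ [[y r] /= [Xy r01 xy tr] <-].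
  by split; [exact: convX|apply: (eP (y, r))].
have [N N0 [e e0 eP]] := homotopy_lift (H := fun (x : V) (t : R) => b0 + t *: (x - b0)) cX loc.
exists (lift_along (fun x t => b0 + t *: (x - b0)) c N) => x Xx.
have H1 y : b0 + 1 *: (y - b0) = y by rewrite scale1r addrC subrK.
have H0 y : b0 + 0 *: (y - b0) = b0 by rewrite scale0r addr0.
have [Xxx xB] := xxP x Xx; have xx0 : ball x lam x by exact: ballxx.
have xr : ball x (rho x) x by have [r0 _ _ _] := rhoP x Xx; exact: ballxx.
have cmp := g_compat Xxx Xx (rhoP _ Xxx) (rhoP _ Xx) (xB _ xx0) xr.
have near_e : \forall w \near x, ball x e w by exact: nbhsx_ballx.
have main : \forall w \near x, X w ->
    lift_along (fun x t => b0 + t *: (x - b0)) c N w =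
    lift_along (fun x t => b0 + t *: (x - b0)) c N x + (g x w - g x x).
  apply: filterS2 cmp near_e => w E1 xw Xw.
  have := eP _ _ Xx Xw xw; rewrite !H1 !H0 /c.
  by move: E1; lra.
split=> [nPx|Px].
  by apply: filterS main => w /[apply] ->; rewrite !gNP// subrr addr0.
have sx0 : sd x x = 0.
  by have [er0 _ h _] := sdP Xx Px; apply/h; [exact: ballxx|exact: PE].
apply: filterS main => w /[apply] ->; rewrite !gP// sx0 lexx.
by case: ifP => _; rewrite ?subrr ?addr0// sub0r.
Qed.

End JumpFunction.

(** * Sweeping by functions of the hyperbolic distance *)

Section HyperbolicDistance.
Variable R : realType.
Implicit Types q : 'rV[R]_3.

(* The hyperbolic cosine of the distance from the horizontal projection of q to
   the point (x0, y0) of the half-plane. *)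
Definition cosh_dist (x0 y0 : R) : 'rV[R]_3 -> R :=
  lin (- x0 / y0) ((x0 ^+ 2 + y0 ^+ 2) / (2 * y0)) (2 * y0)^-1.

Variables (x0 y0 : R).
Hypothesis y0_gt0 : 0 < y0.

Lemma cosh_distE q : 0 < q 0 1 ->
  cosh_dist x0 y0 q = 1 + ((q 0 0 - x0) ^+ 2 + (q 0 1 - y0) ^+ 2) / (2 * y0 * q 0 1).
Proof.
move=> q1; have y0n : y0 != 0 by rewrite gt_eqF.
have q1n : q 0 1 != 0 by rewrite gt_eqF.
by rewrite /cosh_dist /lin; field; rewrite q1n y0n.
Qed.

Lemma cosh_dist_ge1 q : 0 < q 0 1 -> 1 <= cosh_dist x0 y0 q.
Proof.
move=> q1; rewrite cosh_distE// lerDl divr_ge0//; first by rewrite addr_ge0 ?sqr_ge0.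
by rewrite !mulr_ge0// ltW.
Qed.

Lemma cosh_dist_center c : cosh_dist x0 y0 (row3 x0 y0 c) = 1.
Proof. by rewrite cosh_distE !row3E// !subrr expr0n addr0 mul0r addr0. Qed.

Lemma cosh_dist_disc :
  (- x0 / y0) ^+ 2 - 4 * ((x0 ^+ 2 + y0 ^+ 2) / (2 * y0)) * (2 * y0)^-1 = -1.
Proof. by field; rewrite gt_eqF. Qed.

Lemma cosh_dist_lt q (L : R) : 0 < q 0 1 -> cosh_dist x0 y0 q < L ->
  [/\ `|q 0 0 - x0| < (2 * L + 2) * y0, y0 < (2 * L + 2) * q 0 1 &
      q 0 1 < (2 * L + 2) * y0].
Proof.
move=> q1 lt; have L1 : 1 < L by apply: le_lt_trans lt; exact: cosh_dist_ge1.
have yq : 0 < y0 * q 0 1 by rewrite mulr_gt0.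
have h : (q 0 0 - x0) ^+ 2 + (q 0 1 - y0) ^+ 2 < 2 * (L - 1) * (y0 * q 0 1).
  have : ((q 0 0 - x0) ^+ 2 + (q 0 1 - y0) ^+ 2) / (2 * y0 * q 0 1) < L - 1.
    by rewrite ltrBrDl -cosh_distE.
  rewrite ltr_pdivrMr; last by rewrite !mulr_gt0.
  by move=> h; apply: lt_le_trans h _; lra.
have s0 := sqr_ge0 (q 0 0 - x0); have s1 := sqr_ge0 (q 0 1 - y0).
have s2 := sqr_ge0 y0; have s3 := sqr_ge0 (q 0 1).
have up : q 0 1 < (2 * L + 2) * y0.
  rewrite -(ltr_pM2r q1) -mulrA; apply: le_lt_trans (_ : (q 0 1) ^+ 2 + y0 ^+ 2 < _); first by rewrite expr2; lra.
  move: h; rewrite [(q 0 1 - y0) ^+ 2]sqrrB; lra.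
split=> //.
  have Ly : 0 <= (2 * L + 2) * y0 by apply: mulr_ge0; [lra|exact: ltW].
  rewrite -(ltr_pXn2r (n := 2)) ?nnegrE//.
  rewrite real_normK ?num_real//.
  have : (L - 1) * (y0 * q 0 1) <= (L - 1) * (y0 * ((2 * L + 2) * y0)).
    by rewrite ler_pM2l ?subr_gt0// ler_pM2l// ltW.
  move=> h2; rewrite exprMn.
  suff : 2 * ((L - 1) * (y0 * ((2 * L + 2) * y0))) <= (2 * L + 2) ^+ 2 * y0 ^+ 2 by lra.
  rewrite -subr_ge0 (_ : _ - _ = (2 * L + 2) * 4 * y0 ^+ 2); last by ring.
  by apply: mulr_ge0 => //; lra.
rewrite -(ltr_pM2r y0_gt0) -mulrA [q 0 1 * _]mulrC.
apply: le_lt_trans (_ : (q 0 1) ^+ 2 + y0 ^+ 2 < _); first by rewrite -expr2; lra.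
move: h; rewrite [(q 0 1 - y0) ^+ 2]sqrrB; lra.
Qed.

Lemma cosh_dist_cont q : 0 < q 0 1 -> {for q, continuous (cosh_dist x0 y0)}.
Proof. exact: lin_cont. Qed.

Lemma cosh_dist_has_hessian q : 0 < q 0 1 ->
  exists P : 'rV[R]_3,
    [/\ P 0 2 = 0, dot P P = cosh_dist x0 y0 q ^+ 2 - 1 &
        has_hessian (cosh_dist x0 y0) q P (cosh_dist x0 y0 q *: horiz R)].
Proof.
move=> q1; have q1n : q 0 1 != 0 by rewrite gt_eqF.
exists (dlin (- x0 / y0) ((x0 ^+ 2 + y0 ^+ 2) / (2 * y0)) (2 * y0)^-1 q); split.
- by rewrite !row3E.
- by rewrite dlin_norm// cosh_dist_disc.
- exact: has_hessian_lin.
Qed.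

End HyperbolicDistance.

Lemma closed_le_cont (R : realType) (T : topologicalType) (f : T -> R) (c : R) :
  continuous f -> closed [set q | f q <= c].
Proof. by move=> /continuous_closedP/(_ _ (@closed_le R c)). Qed.

Lemma closed_ge_cont (R : realType) (T : topologicalType) (f : T -> R) (c : R) :
  continuous f -> closed [set q | c <= f q].
Proof. by move=> /continuous_closedP/(_ _ (@closed_ge R c)). Qed.

Section Box.
Variables (R : realType) (x0 y0 K a b : R).
Hypotheses (y0_gt0 : 0 < y0) (K_gt0 : 0 < K).

(** Scaling by [y0] follows the isometries of the half-plane, so that by [cosh_dist_lt] one [K]
    serves for hyperbolic balls with any centre. The margin 1 in height leaves room above and below
    the slab. *)
Definition box : set 'rV[R]_3 := [set q | [/\ `|q 0 0 - x0| <= K * y0,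
  y0 <= K * q 0 1, q 0 1 <= K * y0 & a - 1 <= q 0 2 <= b + 1]].

Lemma box_pos q : box q -> 0 < q 0 1.
Proof. by case=> _ h _ _; rewrite -(pmulr_rgt0 _ K_gt0); exact: lt_le_trans h. Qed.

Lemma box_convex u v (t : R) : box u -> box v -> 0 <= t <= 1 -> box (u + t *: (v - u)).
Proof.
move=> [/ler_normlP[u1 u2] u3 u4 /andP[u5 u6]] [/ler_normlP[v1 v2] v3 v4 /andP[v5 v6]] /andP[t0 t1].
rewrite /box/= !mxE; split.
- by apply/ler_normlP; split; nra.
- by nra.
- by nra.
- by apply/andP; split; nra.
Qed.

Lemma box_closed : closed box.
Proof.
have cc (i : 'I_3) : continuous (fun q : 'rV[R]_3 => q 0 i) by exact: coord_continuous.
rewrite (_ : box = [set q | `|q 0 0 - x0| <= K * y0] `&` [set q | y0 <= K * q 0 1] `&`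
  ([set q | q 0 1 <= K * y0] `&` ([set q | a - 1 <= q 0 2] `&` [set q | q 0 2 <= b + 1]))); last first.
  apply/seteqP; split => q.
    by case=> h1 h2 h3 /andP[h4 h5].
  by case=> [[h1 h2] [h3 [h4 h5]]]; split => //; apply/andP.
apply: closedI; first apply: closedI.
- apply: (closed_le_cont (f := fun q : 'rV[R]_3 => `|q 0 0 - x0|)) => q.
  by apply: (@cont_norm R _ q R (fun q : 'rV[R]_3 => q 0 0 - x0)); apply: contB; [exact: cc|exact: cont_cst].
- apply: (closed_ge_cont (f := fun q : 'rV[R]_3 => K * q 0 1)) => q.
  by apply: contM; [exact: cont_cst|exact: cc].
- apply: closedI; last apply: closedI.
  + exact: closed_le_cont (cc 1).
  + exact: closed_ge_cont (cc 2).
  + exact: closed_le_cont (cc 2).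
Qed.

Lemma box_compact : compact box.
Proof.
apply: bounded_closed_compact; last exact: box_closed.
exists (`|x0| + K * y0 + `|a| + `|b| + 1); split; first exact: num_real.
move=> M lt q [/ler_normlP[u1 u2] u3 u4 /andP[u5 u6]].
have q1 : 0 < q 0 1 by apply: box_pos; split => //; [exact/ler_normlP|exact/andP].
have := ler_norm x0; have := ler_norm (- x0); have := ler_norm a; have := ler_norm (- a).
have := ler_norm b; have := ler_norm (- b); rewrite !normrN => h1 h2 h3 h4 h5 h6.
have kp : 0 <= K * y0 by rewrite mulr_ge0 ?ltW.
have M0 : 0 <= M by lra.
rewrite /= /Num.norm/= mx_normrE; apply/bigmax_leP; split => // -[i j] _ /=.
rewrite (ord1 i).
case: j => -[|[|[|//]]] lt3.
- rewrite (_ : Ordinal lt3 = 0); last exact/val_inj.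
  by apply/ler_normlP; split; lra.
- rewrite (_ : Ordinal lt3 = 1); last exact/val_inj.
  by apply/ler_normlP; split; lra.
- rewrite (_ : Ordinal lt3 = 2); last exact/val_inj.
  by apply/ler_normlP; split; lra.
Qed.

Lemma box_interior (q : 'rV[R]_3) : `|q 0 0 - x0| < K * y0 -> y0 < K * q 0 1 -> q 0 1 < K * y0 ->
  a - 1 < q 0 2 < b + 1 -> \forall w \near q, box w.
Proof.
move=> h1 h2 h3 /andP[h4 h5].
have cc (i : 'I_3) : continuous (fun q : 'rV[R]_3 => q 0 i) by exact: coord_continuous.
have gt (f : 'rV[R]_3 -> R) (c : R) : {for (q : 'rV[R]_3), continuous f} -> c < f q ->
    \forall w \near (q : 'rV[R]_3), c < f w.
  move=> fc cf; apply: (near_cont (P := fun y : R => c < y) fc).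
  by apply: open_nbhs_nbhs; split; [exact: open_gt|].
have lt (f : 'rV[R]_3 -> R) (c : R) : {for (q : 'rV[R]_3), continuous f} -> f q < c ->
    \forall w \near (q : 'rV[R]_3), f w < c.
  move=> fc cf; apply: (near_cont (P := fun y : R => y < c) fc).
  by apply: open_nbhs_nbhs; split; [exact: open_lt|].
have n1 : \forall w \near (q : 'rV[R]_3), `|(w : 'rV[R]_3) 0 0 - x0| < K * y0.
  apply: (lt (fun w : 'rV[R]_3 => `|w 0 0 - x0|)) => //.
  by apply: (@cont_norm R _ q R (fun q : 'rV[R]_3 => q 0 0 - x0)); apply: contB; [exact: cc|exact: cont_cst].
have n2 : \forall w \near (q : 'rV[R]_3), y0 < K * (w : 'rV[R]_3) 0 1.
  by apply: (gt (fun w : 'rV[R]_3 => K * w 0 1)) => //; apply: contM; [exact: cont_cst|exact: cc].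
have n3 : \forall w \near (q : 'rV[R]_3), (w : 'rV[R]_3) 0 1 < K * y0 by apply: (lt (fun w : 'rV[R]_3 => w 0 1)) => //; exact: cc.
have n4 : \forall w \near (q : 'rV[R]_3), a - 1 < (w : 'rV[R]_3) 0 2 by apply: (gt (fun w : 'rV[R]_3 => w 0 2)) => //; exact: cc.
have n5 : \forall w \near (q : 'rV[R]_3), (w : 'rV[R]_3) 0 2 < b + 1 by apply: (lt (fun w : 'rV[R]_3 => w 0 2)) => //; exact: cc.
near=> w; split.
- by apply/ltW; near: w.
- by apply/ltW; near: w.
- by apply/ltW; near: w.
- by apply/andP; split; apply/ltW; near: w.
Unshelve. all: by end_near.
Qed.

End Box.

Lemma half_space_box (R : realType) (x : 'rV[R]_3) : 0 < x 0 1 -> exists2 K : R, 0 < K &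
  \forall w \near x, box 0 1 K (x 0 2) (x 0 2) w.
Proof.
move=> x1; exists (2 + x 0 1 + (x 0 1)^-1 + `|x 0 0|).
  have i0 : 0 < (x 0 1)^-1 by rewrite invr_gt0.
  by have := normr_ge0 (x 0 0); lra.
have i0 : 0 < (x 0 1)^-1 by rewrite invr_gt0.
have n0 := normr_ge0 (x 0 0).
apply: box_interior => //.
- by rewrite subr0 mulr1; lra.
- have h : (x 0 1)^-1 * x 0 1 = 1 by rewrite mulVf// gt_eqF.
  have p1 : 0 < 2 * x 0 1 by lra.
  have p2 : 0 <= x 0 1 * x 0 1 by rewrite mulr_ge0// ltW.
  have p3 : 0 <= `|x 0 0| * x 0 1 by rewrite mulr_ge0// ltW.
  by lra.
- by rewrite mulr1; lra.
- by apply/andP; split; lra.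
Qed.

Section TangentialTrace.
Variable R : realType.
Implicit Types (nu P : 'rV[R]_3) (B : 'M[R]_3).

(** For a unit vector [nu], the trace of [B] over the plane orthogonal to [nu]. *)
Definition ttrace nu B : R := \tr B - dot (nu *m B) nu.

Lemma ttraceD nu B B' : ttrace nu (B + B') = ttrace nu B + ttrace nu B'.
Proof. by rewrite /ttrace mxtraceD mulmxDr dotDl; ring. Qed.

Lemma ttraceZ nu (c : R) B : ttrace nu (c *: B) = c * ttrace nu B.
Proof. by rewrite /ttrace mxtraceZ -scalemxAr dotZl; ring. Qed.

Lemma ttrace0 nu : ttrace nu 0 = 0.
Proof. by rewrite -[X in ttrace _ X](scale0r (1 : 'M[R]_3)) ttraceZ mul0r. Qed.

Lemma ttrace_horiz nu : ttrace nu (horiz R) = 2 - (nu 0 0 ^+ 2 + nu 0 1 ^+ 2).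
Proof. by rewrite /ttrace trace_horiz horizE. Qed.

Lemma ttrace_outer nu P : ttrace nu (P^T *m P) = dot P P - dot nu P ^+ 2.
Proof. by rewrite /ttrace trace_outer outerE. Qed.

End TangentialTrace.

Lemma min_succ (u v : int) : u != v -> (Num.min u v + 1 <= u) = ~~ (Num.min u v + 1 <= v).
Proof.
move=> uv; rewrite !lezD1 minEle; case: (leP u v) => [le|lt]; rewrite ltxx.
  by rewrite lt_neqAle uv le.
by rewrite lt.
Qed.

Section Sweep.
Variables (R : realType) (H a b x0 y0 L : R).
Variables (E P : set 'rV[R]_3) (nrm : 'rV[R]_3 -> 'rV[R]_3).
Variables (sd : 'rV[R]_3 -> 'rV[R]_3 -> R) (er : 'rV[R]_3 -> R) (s : 'rV[R]_3 -> int).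

(* What the maximum principle says of a surface E of constant mean curvature H
   at a point y. *)
Definition cmc_at (y : 'rV[R]_3) : Prop :=
  let nu := nrm y *m frame y in dot nu nu = 1 /\
  forall phi Q B, has_hessian phi y Q B ->
    (\forall w \near y, E w -> phi w <= phi y) ->
    exists2 lam : R, Q = lam *: nu & \tr B - dot (nu *m B) nu + 2 * H * lam <= 0.

Let X := box x0 y0 (2 * L + 2) a b.

Hypotheses (H_gt0 : 0 < H) (y0_gt0 : 0 < y0) (ab : a < b) (L_gt1 : 1 < L)
  (HL : b - a < H / 2 * ln L).
Hypotheses (sdP : forall x, X x -> P x -> two_sided E nrm x (sd x) (er x))
  (PE : P `<=` E)
  (Popen : forall x, X x -> P x -> \forall w \near x, E w -> P w)
  (Pclosed : forall x, X x -> ~ P x -> \forall w \near x, ~ P w)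
  (Eslab : forall y, X y -> E y -> a <= y 0 2 <= b)
  (Pcmc : forall y, X y -> P y -> cmc_at y)
  (sP : jump_function sd X P s).

Let K_gt0 : 0 < 2 * L + 2.
Proof. by have := L_gt1; lra. Qed.

Let level_const (m : int) y : X y -> ~ (P y /\ s y = m + 1) ->
  \forall w \near y, X w -> (m + 1 <= s w) = (m + 1 <= s y).
Proof.
move=> Xy nPm; have [h1 h2] := sP Xy; have [Py|nPy] := pselect (P y).
  have sm : s y != m + 1 by apply/eqP => sm; apply: nPm.
  apply: filterS (h2 Py) => w /[apply] ->; case: ifP => // _.
  by rewrite [LHS]lerBrDr [LHS]lezD1 lt_neqAle eq_sym sm.
by apply: filterS (h1 nPy) => w /[apply] ->.
Qed.

Let crossing (m : int) := [set y | [/\ X y, P y & s y = m + 1]].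

Let near_E_zero y : X y -> P y -> \forall w \near y, E w -> sd y w = 0.
Proof.
move=> Xy Py; have [er0 _ h _] := sdP Xy Py.
by have := nbhsx_ballx y (er y) er0; apply: filterS => w yw Ew; apply/h.
Qed.

Let crossing_compact m : compact (crossing m).
Proof.
apply: subclosed_compact (box_compact (x0 := x0) (a := a) (b := b) y0_gt0 K_gt0) _; last first.
  by move=> y [].
move=> y cy; have Xy : X y.
  by apply: (box_closed (x0 := x0) (y0 := y0)) => B /cy[w [[Xw _ _] Bw]]; exists w.
have [Py|nPy] := pselect (P y); last first.
  by have [w [[_ Pw _] nPw]] := cy _ (Pclosed Xy nPy).
have h := (sP Xy).2 Py; have z := near_E_zero Xy Py.
have : nbhs y (fun w => (X w -> s w = (if 0 <= sd y w then s y else s y - 1)) /\ (E w -> sd y w = 0)).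
  by apply: filterS2 h z.
move=> /cy[w [[Xw Pw sw] [sw' Ew]]]; split=> //.
by move: (sw' Xw); rewrite (Ew (PE Pw)) lexx => <-.
Qed.

(* The first contact of the graph of sg * (H / 2) * ln cosh_dist with the points
   where s jumps from m to m + 1 is from the side opposite to the normal. *)
Let sweep_end (m : int) (sg : R) (c : 'rV[R]_3) : (sg = 1 \/ sg = -1) ->
  crossing m c -> c 0 0 = x0 -> c 0 1 = y0 ->
  ~~ (m + 1 <= s (row3 x0 y0 (if sg == 1 then b + 1 else a - 1))).
Proof.
move=> sg1 Kc c0 c1.
have H0 := H_gt0; have ab' := ab; have L1 := L_gt1.
have posX q : X q -> 0 < q 0 1 by exact: box_pos.
pose phi := fun q : 'rV[R]_3 => (sg * q 0 2 + 0) + - (H / 2) * ln (cosh_dist x0 y0 q).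
have hphi (q : 'rV[R]_3) : 0 < q 0 1 -> exists Q B, has_hessian phi q Q B /\
    exists D : 'rV[R]_3, [/\ D 0 2 = 0, dot D D = cosh_dist x0 y0 q ^+ 2 - 1,
     Q = sg *: row3 0 0 1 + (- (H / 2) / cosh_dist x0 y0 q) *: D &
     B = (sg *: 0 + 0 *: ((row3 0 0 1)^T *m row3 0 0 1)) +
         ((- (H / 2) / cosh_dist x0 y0 q) *: (cosh_dist x0 y0 q *: horiz R) +
         (- - (H / 2) / cosh_dist x0 y0 q ^+ 2) *: (D^T *m D))].
  move=> q1; have [D [D2 DD hD]] := cosh_dist_has_hessian x0 y0_gt0 q1.
  have l0 : 0 < cosh_dist x0 y0 q by apply: lt_le_trans (cosh_dist_ge1 x0 y0_gt0 q1).
  have q1n : q 0 1 != 0 by rewrite gt_eqF.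
  exists (sg *: row3 0 0 1 + (- (H / 2) / cosh_dist x0 y0 q) *: D).
  exists ((sg *: 0 + 0 *: ((row3 0 0 1)^T *m row3 0 0 1)) +
         ((- (H / 2) / cosh_dist x0 y0 q) *: (cosh_dist x0 y0 q *: horiz R) +
         (- - (H / 2) / cosh_dist x0 y0 q ^+ 2) *: (D^T *m D))).
  split; last by exists D.
  apply: has_hessianD.
    exact: (has_hessian_comp (phi := fun y : 'rV[R]_3 => y 0 2)
      (twice_derivable_affine sg 0 (q 0 2)) (has_hessian_height q1n)).
  exact: (has_hessian_comp (twice_derivable_ln (- (H / 2)) l0) hD).
have phic (q : 'rV[R]_3) : 0 < q 0 1 -> {for q, continuous phi}.
  move=> q1; have l0 : 0 < cosh_dist x0 y0 q by apply: lt_le_trans (cosh_dist_ge1 x0 y0_gt0 q1).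
  apply: contD; first by apply: contD; [apply: contM; [exact: cont_cst|exact: coord_continuous]|exact: cont_cst].
  apply: contM; first exact: cont_cst.
  apply: (cont_comp (f := cosh_dist x0 y0)); last exact: continuous_ln.
  exact: cosh_dist_cont.
have [y Ky ymax] : exists2 y, crossing m y & forall w, crossing m w -> phi w <= phi y.
  have [||y yK ymax] := @compact_EVT_max _ _ phi (crossing m) _ (@crossing_compact m).
  - by exists c.
  - apply: continuous_in_subspaceT => q; rewrite inE => -[Xq _ _].
    exact: phic (posX _ Xq).
  by exists y; [rewrite inE in yK|move=> w Kw; apply: ymax; rewrite inE].

have [Xy Py sy] := Ky; have y1 := posX y Xy; have [nu1 cmcP] := Pcmc Xy Py.
set nu := nrm y *m frame y in nu1 cmcP.
have lc : cosh_dist x0 y0 c = 1.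
  have -> : c = row3 x0 y0 (c 0 2).
    apply/rowP => -[[|[|[|//]]] lt3].
    - by rewrite (_ : Ordinal lt3 = 0) ?row3E//; exact/val_inj.
    - by rewrite (_ : Ordinal lt3 = 1) ?row3E//; exact/val_inj.
    - by rewrite (_ : Ordinal lt3 = 2) ?row3E//; exact/val_inj.
  exact: cosh_dist_center.
(* The logarithm vanishes at [c], on the vertical axis. A maximum with [cosh_dist] at least [L]
   would need a difference in height of [H / 2 * ln L], which exceeds the height of the slab. Hence
   the maximum is interior to the box. *)
have yl : cosh_dist x0 y0 y < L.
  have := ymax _ Kc; rewrite /phi lc ln1 mulr0 !addr0 => le.
  have [Xc Pc _] := Kc.
  have /andP[ya yb] := Eslab Xy (PE Py); have /andP[ca cb] := Eslab Xc (PE Pc).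
  have l1 := cosh_dist_ge1 x0 y0_gt0 y1.
  rewrite -ltr_ln ?posrE//; [|by lra|by lra].
  rewrite -(ltr_pM2l (_ : 0 < H / 2)); last by rewrite divr_gt0.
  by apply: le_lt_trans HL; case: sg1 le => ->; lra.
have nX : \forall w \near y, X w.
  have [h1 h2 h3] := cosh_dist_lt y0_gt0 y1 yl.
  apply: box_interior => //; have /andP[ya yb] := Eslab Xy (PE Py).
  by apply/andP; split; lra.
have nK : \forall w \near y, E w -> crossing m w.
  have h1 := Popen Xy Py; have h2 := near_E_zero Xy Py; have h3 := (sP Xy).2 Py.
  near=> w => Ew; have Xw : X w by near: w.
  split=> //; first by move: Ew; near: w.
  have -> : s w = if 0 <= sd y w then s y else s y - 1 by move: Xw; near: w.
  by rewrite (_ : sd y w = 0) ?lexx//; move: Ew; near: w.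
have [Q [B [hQB [D [D2 DD QE BE]]]]] := hphi y y1.
have [lam Qlam mp] : exists2 lam : R, Q = lam *: nu & \tr B - dot (nu *m B) nu + 2 * H * lam <= 0.
  by apply: cmcP hQB _; apply: filterS nK => w /[apply]; exact: ymax.
(* The vertical component of [Q] is [sg], so [lam >= 0] would imply [lam >= 1]. The tangential trace
   of [B] is at least [- H], which contradicts [mp] since [2 * H * lam >= 2 * H]. *)
have lam0 : lam < 0.
  rewrite ltNge; apply/negP => lam_ge0.
  set l := cosh_dist x0 y0 y in DD QE BE.
  have l1 : 1 <= l by exact: cosh_dist_ge1.
  have l0 : l != 0 by rewrite gt_eqF//; lra.
  have e1 := nu1; rewrite dot3E in e1.
  have dD := DD; rewrite dot3E D2 in dD.
  have lam1 : 1 <= lam.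
    have : dot Q Q = lam ^+ 2.
      by rewrite Qlam dotZl dotC dotZl nu1; ring.
    rewrite QE dot3E !mxE D2 /=.
    have sg2 : sg * sg = 1 by case: sg1 => ->; ring.
    have := sqr_ge0 (- (H / 2) / l * D 0 0); have := sqr_ge0 (- (H / 2) / l * D 0 1).
    move=> s1 s2 e2; have : 1 <= lam ^+ 2 by rewrite -e2; lra.
    by rewrite -[1 in X in X -> _](expr1n _ 2) ler_pXn2r ?nnegrE.
  move: mp; rewrite -/(ttrace nu B) BE !(ttraceD, ttraceZ, ttrace0, ttrace_horiz, ttrace_outer) DD => mp.
  have CS : dot nu D ^+ 2 <= l ^+ 2 - 1.
    rewrite -dD dot3E D2; rewrite -subr_ge0.
    have -> : D 0 0 * D 0 0 + D 0 1 * D 0 1 + 0 * 0 -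
      (nu 0 0 * D 0 0 + nu 0 1 * D 0 1 + nu 0 2 * 0) ^+ 2 =
      (nu 0 0 * D 0 1 - nu 0 1 * D 0 0) ^+ 2 + nu 0 2 ^+ 2 * (D 0 0 ^+ 2 + D 0 1 ^+ 2) +
      (1 - (nu 0 0 * nu 0 0 + nu 0 1 * nu 0 1 + nu 0 2 * nu 0 2)) * (D 0 0 ^+ 2 + D 0 1 ^+ 2) by ring.
    by rewrite e1 subrr mul0r addr0 addr_ge0 ?sqr_ge0// mulr_ge0 ?sqr_ge0// addr_ge0 ?sqr_ge0.
  have l2 : 0 < l ^+ 2 by rewrite exprn_gt0//; lra.
  have h1 : H / 2 * (dot nu D ^+ 2 / l ^+ 2) <= H / 2 * ((l ^+ 2 - 1) / l ^+ 2).
    by apply: ler_wpM2l; [lra|rewrite ler_pM2r ?invr_gt0].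
  have h2 : 0 <= H / 2 * (nu 0 0 ^+ 2 + nu 0 1 ^+ 2).
    by rewrite mulr_ge0 ?addr_ge0 ?sqr_ge0//; lra.
  have h3 : 0 <= H * (lam - 1) by rewrite mulr_ge0; lra.
  suff : H <= 0 by lra.
  have e3 : H / 2 / l * l = H / 2 by field.
  have := mp.
  set t := nu 0 0 ^+ 2 + nu 0 1 ^+ 2 in h2 *; set t' := dot nu D ^+ 2 in h1 CS *.
  rewrite !mulr0 mul0r !add0r.
  have -> : - (H / 2) / l * (l * (2 - t)) + - - (H / 2) / l ^+ 2 * (l ^+ 2 - 1 - t') + 2 * H * lam =
   - H + H / 2 * t + H / 2 * ((l ^+ 2 - 1) / l ^+ 2) - H / 2 * (t' / l ^+ 2) + 2 * H * lam by field.
  lra.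
have near_minus (B0 : set 'rV[R]_3) : (\forall w \near y, B0 w) ->
    \forall t \near (0 : R)^'+, B0 (y + (- t) *: nrm y).
  move=> nB; have cm : {for (0 : R), continuous (fun t : R => y + (- t) *: nrm y)}.
    apply: contD; [exact: cont_cst|apply: contZ; last exact: cont_cst].
    by apply: contN; exact: cont_id.
  have h : \forall t \near (0 : R), B0 (y + (- t) *: nrm y).
    by apply: (near_cont (P := B0) cm); rewrite oppr0 scale0r addr0.
  exact: cvg_within.
(* The derivative in this direction is [- lam]. So there is a point [q] just behind the surface
   where [phi] exceeds its maximum on the crossings and [s] is only [m]. *)
have up : \forall t \near (0 : R)^'+, phi y < phi (y + (- t) *: nrm y).
  have gj (i : 'I_3) : jet2 (fun t : R => (y + (- t) *: nrm y) 0 i) (y 0 i) ((- nrm y) 0 i) ((0 : 'rV[R]_3) 0 i).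
    have jt : jet2 (fun t : R => t) 0 1 0.
      split=> //; exists (fun=> 1); first by near=> t; exact: is_derive_id.
      by split => //; exact: der_cst.
    have -> : (fun t : R => (y + (- t) *: nrm y) 0 i) = (fun t => y 0 i + t * (- nrm y) 0 i).
      by apply/funext => t; rewrite !mxE; ring.
    by apply: jet2_eq (jet2D (jet2_cst (y 0 i)) (jet2M jt (jet2_cst ((- nrm y) 0 i)))) _ _ _; rewrite !mxE; ring.
  have [F0 [F' F'P [F'0 _]]] := hQB _ _ _ gj.
  have d0 := nbhs_singleton F'P; rewrite F'0 mulNmx in d0.
  have : 0 < dot (- (nrm y *m frame y)) Q.
    rewrite -scaleN1r dotZl Qlam dotC dotZl nu1 mulr1 mulN1r oppr_gt0//.
  by move=> /(der_mono d0); rewrite F0.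
have sdy := sdP Xy Py; have [er0 _ _ _] := sdy.
have yy : ball y (er y) y by exact: ballxx.
have neg := sd_posE sdy (PE Py) yy.
have jump := near_minus _ ((sP Xy).2 Py).
have nX' := near_minus _ nX.
near (0 : R)^'+ => t0.
have Xq : X (y + (- t0) *: nrm y) by near: t0.
have pq : phi y < phi (y + (- t0) *: nrm y) by near: t0.
have h1 : 0 < sd y (y + t0 *: nrm y) /\ sd y (y + (- t0) *: nrm y) < 0 by near: t0.
have h2 : X (y + (- t0) *: nrm y) -> s (y + (- t0) *: nrm y) =
  if 0 <= sd y (y + (- t0) *: nrm y) then s y else s y - 1 by near: t0.
have sq : s (y + (- t0) *: nrm y) = m.
  by rewrite h2// leNgt h1.2 /= sy addrK.
move: (y + (- t0) *: nrm y) Xq pq sq => q Xq pq sq {h1 h2}.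
(* From [q] go vertically out of the slab, along which [phi] does not decrease, then horizontally to
   the axis, where there are no points of [E]. No crossing is met, so the level [m + 1] is not
   reached at the end. *)
set e := if sg == 1 then b + 1 else a - 1.
pose v : 'rV[R]_3 := row3 (q 0 0) (q 0 1) e.
have [xq1 xq2 xq3 /andP[xq4 xq5]] := Xq.
have e_in : a - 1 <= e <= b + 1 by rewrite /e; case: ifP => _; apply/andP; split; lra.
have Xv : X v by split; rewrite ?row3E.
have ne : ~~ (a <= e <= b).
  by rewrite /e; case: ifP => _; apply/negP => /andP[]; lra.
have sge : 0 <= sg * (e - q 0 2).
  rewrite /e; case: sg1 => ->; rewrite ?eqxx; first by lra.
  by rewrite (_ : -1 == 1 :> R = false); [lra|apply/negbTE/eqP; lra].
have E1 : (m + 1 <= s v) = (m + 1 <= s q).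
  apply: (segment_loc_const (f := fun w => m + 1 <= s w) (A := X)) => t t01.
    exact: box_convex.
  move=> w; have Xw : X w by exact: box_convex.
  apply: level_const => // -[Pw sw].
  have : phi w <= phi y by apply: ymax; split.
  rewrite leNgt => /negP; apply; apply: (lt_le_trans pq).
  have w0 : w 0 0 = q 0 0 by rewrite /w !mxE /=; ring.
  have w1 : w 0 1 = q 0 1 by rewrite /w !mxE /=; ring.
  have w2 : w 0 2 = q 0 2 + t * (e - q 0 2) by rewrite /w !mxE /=; ring.
  rewrite /phi /cosh_dist /lin w0 w1 w2 lerD2r !addr0 mulrDr lerDl.
  by rewrite mulrCA mulr_ge0//; case/andP: t01.
have Xend : X (row3 x0 y0 e).
  split; rewrite ?row3E//; first by rewrite subrr normr0 mulr_ge0// ltW.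
  - by rewrite ler_peMl ?ltW//; lra.
  - by rewrite ler_peMl ?ltW//; lra.
have E2 : (m + 1 <= s (row3 x0 y0 e)) = (m + 1 <= s v).
  apply: (segment_loc_const (f := fun w => m + 1 <= s w) (A := X)) => t t01.
    exact: box_convex.
  move=> w; have Xw : X w by exact: box_convex.
  apply: level_const => // -[Pw _].
  have w2 : w 0 2 = e by rewrite /w !mxE /=; ring.
  by have := Eslab Xw (PE Pw); rewrite w2 (negbTE ne).
by rewrite E2 E1 sq -ltNge -lezD1 lexx.
Unshelve. all: by end_near.
Qed.

(** If the two values differed, with minimum [m], the vertical axis would contain a crossing of the
    level [m + 1], and [sweep_end] for both signs would put both ends below this level, although the
    larger value reaches it. *)
Lemma sweep : s (row3 x0 y0 (b + 1)) = s (row3 x0 y0 (a - 1)).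
Proof.
have ab' := ab; have L1 := L_gt1.
apply/eqP/negPn/negP => ne.
pose m := Num.min (s (row3 x0 y0 (b + 1))) (s (row3 x0 y0 (a - 1))).
have Xend e : a - 1 <= e <= b + 1 -> X (row3 x0 y0 e).
  move=> e_in; split; rewrite ?row3E//; first by rewrite subrr normr0 mulr_ge0// ltW.
  - by rewrite ler_peMl ?ltW//; lra.
  - by rewrite ler_peMl ?ltW//; lra.
have Xt : X (row3 x0 y0 (b + 1)) by apply: Xend; apply/andP; split; lra.
have Xb : X (row3 x0 y0 (a - 1)) by apply: Xend; apply/andP; split; lra.
have [c [Kc c0 c1]] : exists c, [/\ crossing m c, c 0 0 = x0 & c 0 1 = y0].
  apply: contrapT => nc.
  have : (m + 1 <= s (row3 x0 y0 (b + 1))) = (m + 1 <= s (row3 x0 y0 (a - 1))).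
    apply: (segment_loc_const (f := fun w => m + 1 <= s w) (A := X)) => t t01.
      exact: box_convex.
    move=> w; have Xw : X w by exact: box_convex.
    apply: level_const => // -[Pw sw]; apply: nc; exists w; split.
    - by split.
    - by rewrite /w !mxE /=; ring.
    - by rewrite /w !mxE /=; ring.
  by rewrite /m (min_succ ne); case: (_ <= _).
have h1 := sweep_end (or_introl erefl) Kc c0 c1.
have h2 := sweep_end (or_intror erefl) Kc c0 c1.
move: h1 h2; rewrite eqxx (_ : -1 == 1 :> R = false); last by apply/negbTE/eqP; lra.
by rewrite /m (min_succ ne); case: (_ <= _).
Qed.

End Sweep.

(** * Values of a locally constant function on the two sides *)

Section SideValues.
Variables (R : realType) (V : normedModType R).
Variables (E U : set V) (nrm : V -> V) (sd : V -> V -> R) (er : V -> R) (om : V -> bool).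
Hypotheses (sdP : forall x, U x -> E x -> two_sided E nrm x (sd x) (er x))
  (Uopen : open U) (Eclosed : forall x, U x -> ~ E x -> \forall w \near x, ~ E w)
  (omP : forall x, U x -> ~ E x -> \forall w \near x, om w = om x).

(** By [side_valueP] this is the value that [om] takes throughout the side [s] of [E] near [x]. *)
Definition side_value (s : R) (x : V) : bool :=
  `[< \forall w \near x, 0 < s * sd x w -> om w >].

Let self x : U x -> E x -> ball x (er x) x.
Proof. by move=> Ux Ex; have [r0 _ _ _] := sdP Ux Ex; exact: ballxx. Qed.

Lemma side_points (s : R) x (A : set V) : (s = 1 \/ s = -1) -> U x -> E x ->
  nbhs x A -> exists2 w, A w & 0 < s * sd x w.
Proof.
move=> s1 Ux Ex nA; have h := sd_posE (sdP Ux Ex) Ex (self Ux Ex).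
have /nbhs_ballP[d /= d0 dP] := nA.
have [d1 d10 d1P] := ball_line (nrm x) (ballxx x d0).
near (0 : R)^'+ => e.
have e0 : 0 < e by near: e; exact: nbhs_right_gt.
have ed : e <= d1 by near: e; exact: nbhs_right_le.
have [sp sn] : 0 < sd x (x + e *: nrm x) /\ sd x (x + (- e) *: nrm x) < 0 by near: e.
have xx : ball x d1 x by exact: ballxx.
case: s1 => ->; [exists (x + e *: nrm x)|exists (x + (- e) *: nrm x)].
- by apply/dP/d1P => //; rewrite gtr0_norm.
- by rewrite mul1r.
- by apply/dP/d1P => //; rewrite normrN gtr0_norm.
- by rewrite mulN1r oppr_gt0.
Unshelve. all: by end_near.
Qed.

Lemma side_valueP (s : R) x : (s = 1 \/ s = -1) -> U x -> E x ->
  \forall w \near x, 0 < s * sd x w -> om w = side_value s x.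
Proof.
move=> s1 Ux Ex.
have nU : nbhs x U by exact: open_nbhs_nbhs.
have loc : \forall w \near x, ~ E w -> \forall y \near w, om y = om w.
  by apply: filterS nU => w Uw nEw; exact: omP.
have [d d0 dP] := side_loc_const (sdP Ux Ex) Ex (self Ux Ex) s1 loc.
have nb : nbhs x (ball x d) by exact: nbhsx_ballx.
rewrite /side_value; case: asboolP => [//|nh].
apply: filterS nb => w xw sw; apply/negbTE/negP => omw; apply: nh.
by apply: filterS (nbhsx_ballx _ _ d0) => w' xw' sw'; rewrite -(dP w w').
Qed.

Lemma side_value_unique (s : R) x (v : bool) : (s = 1 \/ s = -1) -> U x -> E x ->
  (\forall w \near x, 0 < s * sd x w -> om w = v) -> side_value s x = v.
Proof.
move=> s1 Ux Ex h.
have [w [h1 h2] sw] := side_points s1 Ux Ex (filterI (side_valueP s1 Ux Ex) h).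
by rewrite -h1// h2.
Qed.

Lemma side_value_near (s : R) x : (s = 1 \/ s = -1) -> U x -> E x ->
  \forall y \near x, E y -> side_value s y = side_value s x.
Proof.
move=> s1 Ux Ex; have h := side_valueP s1 Ux Ex.
have nU : nbhs x U by exact: open_nbhs_nbhs.
have [r0 _ _ _] := sdP Ux Ex.
have nb : nbhs x (ball x (er x)) by exact: nbhsx_ballx.
have nh := near_join h.
apply: filterS3 nU nb nh => y Uy xy hy Ey.
apply: side_value_unique => //.
have ag := sides_agree (sdP Ux Ex) (sdP Uy Ey) Ey xy (self Uy Ey).
apply: filterS2 ag hy => w sg hw sw; apply: hw.
by rewrite -sgr_gt0 sgrM sg -sgrM sgr_gt0.
Qed.

End SideValues.

Section TopBottom.
Variables (R : realType) (H a b x0 y0 L : R).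
Variables (E U : set 'rV[R]_3) (nrm : 'rV[R]_3 -> 'rV[R]_3).
Variables (sd : 'rV[R]_3 -> 'rV[R]_3 -> R) (er : 'rV[R]_3 -> R).
Let X := box x0 y0 (2 * L + 2) a b.
Hypotheses (H_gt0 : 0 < H) (y0_gt0 : 0 < y0) (ab : a < b) (L_gt1 : 1 < L)
  (HL : b - a < H / 2 * ln L)
  (sdP : forall x, U x -> E x -> two_sided E nrm x (sd x) (er x))
  (Uopen : open U) (XU : X `<=` U)
  (Eclosed : forall x, U x -> ~ E x -> \forall w \near x, ~ E w)
  (Eslab : forall y, U y -> E y -> a <= y 0 2 <= b)
  (Ecmc : forall y, U y -> E y -> cmc_at H E nrm y).

(** The sweep needs jumps of one sign with respect to the normal, whereas [om] may jump up (on [P1])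
    or down (on [P2]). If [s] is a jump function for [P1], then [s - w] is one for [P2], and [sweep]
    applied to both leaves equal values of [w] at the two ends. *)
Lemma top_bottom (om : 'rV[R]_3 -> bool) :
  (forall x, U x -> ~ E x -> \forall w \near x, om w = om x) ->
  om (row3 x0 y0 (b + 1)) = om (row3 x0 y0 (a - 1)).
Proof.
move=> omP; have L1 := L_gt1; have K0 : 0 < 2 * L + 2 by lra.
have ab' := ab; have y0' := y0_gt0.
pose pl := side_value sd om 1; pose mi := side_value sd om (-1).
have s1 : (1 : R) = 1 \/ (1 : R) = -1 by left.
have s2 : (-1 : R) = 1 \/ (-1 : R) = -1 by right.
pose P1 := [set x | [/\ U x, E x, pl x & ~~ mi x]].
pose P2 := [set x | [/\ U x, E x, ~~ pl x & mi x]].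
have nearpm x : U x -> E x -> \forall w \near x, [/\ U w, E w -> pl w = pl x, E w -> mi w = mi x,
    0 < sd x w -> om w = pl x & sd x w < 0 -> om w = mi x] /\ (E w <-> sd x w = 0).
  move=> Ux Ex; have [r0 _ h _] := sdP Ux Ex.
  have nb : nbhs x (ball x (er x)) by exact: nbhsx_ballx.
  have h1 := side_value_near sdP Uopen omP s1 Ux Ex.
  have h2 := side_value_near sdP Uopen omP s2 Ux Ex.
  have h3 := side_valueP sdP Uopen omP s1 Ux Ex.
  have h4 := side_valueP sdP Uopen omP s2 Ux Ex.
  have nU : nbhs x U by exact: open_nbhs_nbhs.
  near=> w; split; last by split=> ?; apply/h => //; near: w.
  split; [by near: w|by near: w|by near: w| |].
  - have h3w : 0 < 1 * sd x w -> om w = pl x by near: w.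
    by rewrite mul1r in h3w.
  - have h4w : 0 < -1 * sd x w -> om w = mi x by near: w.
    by rewrite mulN1r oppr_gt0 in h4w.
have cX : compact X by exact: box_compact.
have convX u v (t : R) : X u -> X v -> 0 <= t <= 1 -> X (u + t *: (v - u)) by exact: box_convex.
have Xend e : a - 1 <= e <= b + 1 -> X (row3 x0 y0 e).
  move=> e_in; split; rewrite ?row3E//; first by rewrite subrr normr0 mulr_ge0// ltW.
    by rewrite ler_peMl// ?ltW//; lra.
  by rewrite ler_peMl// ?ltW//; lra.
have X0 : X !=set0 by exists (row3 x0 y0 (a - 1)); apply: Xend; lra.
have clopen (P : set 'rV[R]_3) : P `<=` U `&` E ->
    (forall x y, U x -> E x -> U y -> E y -> pl y = pl x -> mi y = mi x -> P x -> P y) ->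
    (forall x, X x -> P x -> \forall w \near x, E w -> P w) /\
    (forall x, X x -> ~ P x -> \forall w \near x, ~ P w).
  move=> PUE PP; split=> x Xx Px.
    have [Ux Ex] := PUE _ Px.
    by apply: filterS (nearpm x Ux Ex) => w [[Uw h1 h2 _ _] _] Ew; apply: (PP x) => //; [exact: h1|exact: h2].
  have Ux := XU Xx; have [Ex|nEx] := pselect (E x).
    apply: filterS (nearpm x Ux Ex) => w [[Uw h1 h2 _ _] _] Pw; apply: Px.
    have [_ Ew] := PUE _ Pw.
    by apply: (PP w) => //; apply/esym; [exact: h1|exact: h2].
  by apply: filterS (Eclosed Ux nEx) => w nEw Pw; apply: nEw; have [] := PUE _ Pw.
have P1UE : P1 `<=` U `&` E by move=> x [].
have P2UE : P2 `<=` U `&` E by move=> x [].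
have [P1o P1c] : (forall x, X x -> P1 x -> \forall w \near x, E w -> P1 w) /\
    (forall x, X x -> ~ P1 x -> \forall w \near x, ~ P1 w).
  by apply: clopen => // x y Ux Ex Uy Ey e1 e2 [_ _ ? ?]; split; rewrite ?e1 ?e2.
have [P2o P2c] : (forall x, X x -> P2 x -> \forall w \near x, E w -> P2 w) /\
    (forall x, X x -> ~ P2 x -> \forall w \near x, ~ P2 w).
  by apply: clopen => // x y Ux Ex Uy Ey e1 e2 [_ _ ? ?]; split; rewrite ?e1 ?e2.
have sd1 x : X x -> P1 x -> two_sided E nrm x (sd x) (er x) by move=> _ [Ux Ex _ _]; exact: sdP.
have sd2 x : X x -> P2 x -> two_sided E nrm x (sd x) (er x) by move=> _ [Ux Ex _ _]; exact: sdP.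
have P1E : P1 `<=` E by move=> x [].
have P2E : P2 `<=` E by move=> x [].
have [s sP] := jump_function_exists cX convX sd1 P1E P1o P1c X0.
have Xslab y : X y -> E y -> a <= y 0 2 <= b by move=> /XU; exact: Eslab.
have c1 y : X y -> P1 y -> cmc_at H E nrm y by move=> _ [Uy Ey _ _]; exact: Ecmc.
have c2 y : X y -> P2 y -> cmc_at H E nrm y by move=> _ [Uy Ey _ _]; exact: Ecmc.
have sw1 := sweep H_gt0 y0_gt0 ab L_gt1 HL sd1 P1E P1o P1c Xslab c1 sP.
(* On [E] the value of the positive side is taken, as in [jump_function], where [sd = 0] counts as
   positive. *)
pose w (x : 'rV[R]_3) : int := if (if `[< E x >] then pl x else om x) then 1 else 0.
have sP2 : jump_function sd X P2 (fun x => s x - w x).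
  move=> x Xx; have Ux := XU Xx; have [Ex|nEx] := pselect (E x); last first.
    split; last by case.
    have nP1 : ~ P1 x by case.
    have := (sP x Xx).1 nP1; have := Eclosed Ux nEx; have := omP x Ux nEx => h1 h2 h3 _.
    apply: filterS3 h1 h2 h3 => y h1 h2 h3 Xy.
    by rewrite h3// /w !asboolF// h1.
  have nx := nearpm x Ux Ex.
  have wE y : (E y <-> sd x y = 0) -> [/\ U y, E y -> pl y = pl x, E y -> mi y = mi x,
    0 < sd x y -> om y = pl x & sd x y < 0 -> om y = mi x] ->
    w y = if (if 0 <= sd x y then pl x else mi x) then 1 else 0.
    move=> Ey [_ h1 h2 h3 h4]; rewrite /w.
    have [sl|sg|sz] := ltgtP 0 (sd x y).
    - by rewrite asboolF ?h3// => /Ey sy; rewrite sy ltxx in sl.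
    - by rewrite asboolF ?h4// => /Ey sy; rewrite sy ltxx in sg.
    - by rewrite asboolT ?h1//; apply/Ey.
  have wx : w x = if pl x then 1 else 0 by rewrite /w asboolT.
  have [P1x|nP1x] := pselect (P1 x).
    case: (P1x) => _ _ p1 m1; split; last by case; rewrite p1.
    move=> _; apply: filterS2 ((sP x Xx).2 P1x) nx => y hs [/[dup] h /wE + Ey] Xy.
    move=> /(_ Ey) ->; rewrite hs// wx p1 (negbTE m1).
    by case: ifP => _ //=; rewrite subr0.
  have [P2x|nP2x] := pselect (P2 x).
    case: (P2x) => _ _ p1 m1; split=> // _.
    apply: filterS2 ((sP x Xx).1 nP1x) nx => y hs [/[dup] h /wE + Ey] Xy.
    move=> /(_ Ey) ->; rewrite hs// wx m1 (negbTE p1).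
    by case: (0 <= sd x y); rewrite /= ?subr0.
  split=> // _.
  apply: filterS2 ((sP x Xx).1 nP1x) nx => y hs [/[dup] h /wE + Ey] Xy.
  move=> /(_ Ey) ->; rewrite hs// wx.
  have -> : mi x = pl x.
    case p: (pl x); case m: (mi x) => //; last by case: nP2x; split; rewrite ?p ?m.
    by case: nP1x; split; rewrite ?p ?m.
  by rewrite if_same.
have sw2 := sweep H_gt0 y0_gt0 ab L_gt1 HL sd2 P2E P2o P2c Xslab c2 sP2.
have nE e : a - 1 <= e <= b + 1 -> (e < a \/ b < e) -> ~ E (row3 x0 y0 e).
  move=> e1 e2 Ee; have := Xslab _ (Xend e e1) Ee; rewrite row3E /=; case: e2; lra.
have n1 : ~ E (row3 x0 y0 (b + 1)) by apply: nE; [lra|right; lra].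
have n2 : ~ E (row3 x0 y0 (a - 1)) by apply: nE; [lra|left; lra].
move: sw2; rewrite sw1 /w !asboolF//.
by case: (om _); case: (om _) => // /addrI.
Unshelve. all: by end_near.
Qed.

End TopBottom.

(** * The parity of intersections with vertical rays *)

Section ParityCocycle.
Variable R : realType.
Implicit Types (q a u w : 'rV[R]_3) (c e : 'rV[R]_3 -> 'rV[R]_3 -> bool).

Definition additive_at c a := exists2 A, nbhs a A & additive_on (G := bool) c A.

(* Whether the step from u to w crosses the half-plane x > x0, y = y0. *)
Definition crosses (x0 y0 : R) u w : bool :=
  ((y0 <= u 0 1) (+) (y0 <= w 0 1)) && (x0 < u 0 0).

Lemma near_cmp a (i : 'I_3) (r : R) : \forall u \near a,
  (a 0 i < r -> (u : 'rV[R]_3) 0 i < r) /\ (r < a 0 i -> r < u 0 i).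
Proof.
have ci : {for a, continuous (fun q : 'rV[R]_3 => q 0 i)} by exact: coord_continuous.
have [lt|gt|eq] := ltgtP (a 0 i) r.
- have := near_cont (P := fun y : R => y < r) ci (open_nbhs_nbhs (conj (@open_lt R r) lt)).
  by apply: filterS.
- have := near_cont (P := fun y : R => r < y) ci (open_nbhs_nbhs (conj (@open_gt R r) gt)).
  by apply: filterS.
- by near=> u.
Unshelve. all: by end_near.
Qed.

Let nbhsI a (A B : set 'rV[R]_3) : nbhs a A -> nbhs a B -> nbhs a (A `&` B).
Proof. by move=> nA nB; exact: filterI. Qed.

Lemma additive_at_cob c a (P : set 'rV[R]_3) (f : 'rV[R]_3 -> bool) :
  nbhs a P -> (forall u w, P u -> P w -> c u w = f u (+) f w) -> additive_at c a.
Proof.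
move=> nP cf; exists P => // u v w Pu Pv Pw; rewrite !cf//.
by case: (f u); case: (f v); case: (f w).
Qed.

Lemma additive_atD c e a : additive_at c a -> additive_at e a ->
  additive_at (fun u w => c u w (+) e u w) a.
Proof.
move=> [A nA cA] [B nB eB]; exists (A `&` B); first exact: filterI.
move=> u v w [Au Bu] [Av Bv] [Aw Bw]; rewrite -(cA u v w)// -(eB u v w)//.
change (fun x y : bool => x + y) with addb.
by case: (c u v); case: (c v w); case: (e u v); case: (e v w).
Qed.

Lemma additive_at_ext c e a : (forall u w, c u w = e u w) -> additive_at c a -> additive_at e a.
Proof. by move=> ce [A nA cA]; exists A => // u v w *; rewrite -!ce; exact: cA. Qed.

Lemma crosses_additive x0 y0 a : (a 0 0 != x0) || (a 0 1 != y0) ->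
  additive_at (crosses x0 y0) a.
Proof.
move=> ne; have h := nbhsI (near_cmp a 0 x0) (near_cmp a 1 y0).
have [lt|gt|eq] := ltgtP (a 0 0) x0.
- apply: (additive_at_cob (f := fun=> false) h) => u w [[/(_ lt) h1 _] _] _.
  by rewrite /crosses [x0 < _]ltNge (ltW h1) andbF.
- apply: (additive_at_cob (f := fun u => y0 <= u 0 1) h) => u w [[_ /(_ gt) h1] _] _.
  by rewrite /crosses h1 andbT.
- have {ne} : a 0 1 != y0 by rewrite eq eqxx in ne.
  rewrite neq_lt => /orP[lt|gt].
  + apply: (additive_at_cob (f := fun=> false) h) => u w [_ [/(_ lt) h1 _]] [_ [/(_ lt) h2 _]].
    by rewrite /crosses !leNgt h1 h2.
  + apply: (additive_at_cob (f := fun=> false) h) => u w [_ [_ /(_ gt) h1]] [_ [_ /(_ gt) h2]].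
    by rewrite /crosses !ltW.
Qed.

Variables (x0 y0 : R) (E U : set 'rV[R]_3).

Let ray q a : bool := [&& a 0 0 == q 0 0, a 0 1 == q 0 1 & q 0 2 <= a 0 2].

Let cross q := crosses (q 0 0) (q 0 1).

(** At the points of [E] on the upward ray from [q] the cochain [c] fails to be additive exactly as
    [cross q] does, and it is additive at the other points of [E]. Below the surface [crosses x0 y0]
    has this property; above it the ray misses [E] and [c] is a cocycle. *)
Let good q := exists c, forall a, E a ->
  additive_at (fun u w => c u w (+) (ray q a && cross q u w)) a /\
  (~ U a -> exists2 A, nbhs a A & forall u w, A u -> A w -> c u w = crosses x0 y0 u w).

(** A correction without effect off [U] that trades the defect along the ray from [q] for the defect
    along the ray from [q']. *)
Let transfer e q q' :=
  (forall a, E a -> additive_at (fun u w => e u w (+)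
     ((ray q a && cross q u w) (+) (ray q' a && cross q' u w))) a) /\
  (forall a, E a -> ~ U a -> exists2 A, nbhs a A & forall u w, A u -> A w -> e u w = false).

Let transfer_sym e q q' : transfer e q q' -> transfer e q' q.
Proof.
move=> [h1 h2]; split=> // a Ea; apply: additive_at_ext (h1 a Ea) => u w.
by rewrite [X in _ (+) X]addbC.
Qed.

Let good_transfer e q q' : transfer e q q' -> good q -> good q'.
Proof.
move=> [h1 h2] [c cP]; exists (fun u w => c u w (+) e u w) => a Ea.
have [ca cU] := cP a Ea; split=> [|nU].
  apply: additive_at_ext (additive_atD ca (h1 a Ea)) => u w.
  by case: (c u w); case: (e u w); case: (_ && _); case: (_ && _).
have [A nA cA] := cU nU; have [B nB eB] := h2 a Ea nU.
exists (A `&` B); first exact: filterI.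
by move=> u w [Au Bu] [Aw Bw]; rewrite cA// eB// addbF.
Qed.

Hypothesis U_cylinder : forall u w, u 0 0 = w 0 0 -> u 0 1 = w 0 1 -> U u -> U w.

Let zero_near e a (P : set 'rV[R]_3) : nbhs a P ->
  (forall u w, P u -> P w -> e u w = false) ->
  exists2 A, nbhs a A & forall u w, A u -> A w -> e u w = false.
Proof. by move=> nP eP; exists P. Qed.

(** The witness detects crossings of the vertical half-strip above the segment from [q] to [q']. The
    edge of the half-strip consists of the two rays and this segment, and the segment misses [E]. *)
Let move_x q q' : q 0 0 < q' 0 0 -> q' 0 1 = q 0 1 -> q' 0 2 = q 0 2 ->
  (forall u, q 0 0 <= u 0 0 <= q' 0 0 -> u 0 1 = q 0 1 -> u 0 2 = q 0 2 -> U u /\ ~ E u) ->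
  exists e, transfer e q q'.
Proof.
move=> lt e1 e2 seg.
exists (fun u w => [&& (q 0 1 <= u 0 1) (+) (q 0 1 <= w 0 1), q 0 0 < u 0 0, u 0 0 <= q' 0 0 & q 0 2 < u 0 2]).
have nP a := nbhsI (nbhsI (near_cmp a 0 (q 0 0)) (near_cmp a 0 (q' 0 0)))
  (nbhsI (near_cmp a 1 (q 0 1)) (near_cmp a 2 (q 0 2))).
have off a : ~ U a -> a 0 1 = q 0 1 -> ~ (q 0 0 <= a 0 0 <= q' 0 0).
  move=> nU a1 a0; have [|||Us _] := seg (row3 (a 0 0) (q 0 1) (q 0 2)); rewrite ?row3E//.
  by apply: nU; apply: U_cylinder Us; rewrite row3E.
split=> a Ea; last first.
  move=> nU; apply: (zero_near (nP a)) => u w [[u0 u0'] [u1 u2]] [_ [w1 w2]].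
  have [l|l|a1] := ltgtP (a 0 1) (q 0 1).
  - by rewrite !leNgt (u1.1 l) (w1.1 l).
  - by rewrite (ltW (u1.2 l)) (ltW (w1.2 l)).
  - have := off a nU a1; have [l0 _|l0 /=] := ltP (a 0 0) (q 0 0).
      by rewrite [q 0 0 < _]ltNge (ltW (u0.1 l0)) andbF.
    by move/negP; rewrite -ltNge => l0'; rewrite [_ <= q' 0 0]leNgt (u0'.2 l0') /= !andbF.
rewrite /cross /crosses /ray e1 e2.
have [l|l|a1] := ltgtP (a 0 1) (q 0 1).
- apply: (additive_at_cob (f := fun=> false) (nP a)) => u w [_ [u1 _]] [_ [w1 _]].
  by rewrite !andbF /= !leNgt (u1.1 l) (w1.1 l).
- apply: (additive_at_cob (f := fun=> false) (nP a)) => u w [_ [u1 _]] [_ [w1 _]].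
  by rewrite !andbF /= (ltW (u1.2 l)) (ltW (w1.2 l)).
have [l|l|a2] := ltgtP (a 0 2) (q 0 2).
- apply: (additive_at_cob (f := fun=> false) (nP a)) => u w [_ [_ u2]] _.
  by rewrite !andbF /= [q 0 2 < _]ltNge (ltW (u2.1 l)) !andbF.
- have [l0|l0|a0] := ltgtP (a 0 0) (q 0 0).
  + apply: (additive_at_cob (f := fun=> false) (nP a)) => u w [[u0 _] _] _.
    by rewrite [q 0 0 < u 0 0]ltNge (ltW (u0.1 l0)) /= !andbF lt_eqF//= (lt_trans l0).
  + have [l0'|l0'|a0'] := ltgtP (a 0 0) (q' 0 0).
    * apply: (additive_at_cob (f := fun u => q 0 1 <= u 0 1) (nP a)) => u w [[u0 u0'] [_ u2]] _.
      by rewrite (u0.2 l0) (ltW (u0'.1 l0')) (u2.2 l) /= !andbT !addbF.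
    * apply: (additive_at_cob (f := fun=> false) (nP a)) => u w [[u0 u0'] [_ u2]] _.
      by rewrite [_ <= q' 0 0]leNgt (u0'.2 l0') /= !andbF.
    * apply: (additive_at_cob (f := fun u => q 0 1 <= u 0 1) (nP a)) => u w [[u0 u0'] [_ u2]] _.
      rewrite (u0.2 l0) (u2.2 l) /= andbT [u 0 0 <= _]leNgt.
      by case: (q' 0 0 < u 0 0); rewrite /= ?andbT ?andbF ?addbF.
  + rewrite a0 (lt_eqF lt) /=.
    apply: (additive_at_cob (f := fun=> false) (nP a)) => u w [[_ u0'] [_ u2]] _.
    have lt' : a 0 0 < q' 0 0 by rewrite a0.
    by rewrite (ltW (u0'.1 lt')) (u2.2 l) /= addbF !andbT addbb.
- have out : ~ (q 0 0 <= a 0 0 <= q' 0 0) by move=> /seg/(_ a1 a2)[_]; exact.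
  have [l0|l0] := ltP (a 0 0) (q 0 0).
    apply: (additive_at_cob (f := fun=> false) (nP a)) => u w [[u0 _] _] _.
    by rewrite [q 0 0 < u 0 0]ltNge (ltW (u0.1 l0)) /= !andbF !lt_eqF//= (lt_trans l0).
  move: out; rewrite l0 /= => /negP; rewrite -ltNge => l0'.
  apply: (additive_at_cob (f := fun=> false) (nP a)) => u w [[_ u0'] _] _.
  by rewrite [_ <= q' 0 0]leNgt (u0'.2 l0') /= !andbF !gt_eqF//= (lt_trans lt).
Qed.

(** Here the half-strip is transverse to the half-planes of [crosses]. Testing the range of the
    coordinate 1 at [w], while [crosses] tests the coordinate 0 at [u], makes the product rule for
    coboundaries exact: the coboundary of [f g] is [(f u + f w) g w + f u (g u + g w)]. *)
Let move_y q q' : q' 0 0 = q 0 0 -> q 0 1 < q' 0 1 -> q' 0 2 = q 0 2 ->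
  (forall u, u 0 0 = q 0 0 -> q 0 1 <= u 0 1 <= q' 0 1 -> u 0 2 = q 0 2 -> U u /\ ~ E u) ->
  exists e, transfer e q q'.
Proof.
move=> e0 lt e2 seg.
exists (fun u w => [&& (q 0 0 < u 0 0) (+) (q 0 0 < w 0 0), q 0 1 <= w 0 1, w 0 1 < q' 0 1 & q 0 2 < u 0 2]).
have nP a := nbhsI (nbhsI (near_cmp a 1 (q 0 1)) (near_cmp a 1 (q' 0 1)))
  (nbhsI (near_cmp a 0 (q 0 0)) (near_cmp a 2 (q 0 2))).
have off a : ~ U a -> a 0 0 = q 0 0 -> ~ (q 0 1 <= a 0 1 <= q' 0 1).
  move=> nU a0 a1; have [|||Us _] := seg (row3 (q 0 0) (a 0 1) (q 0 2)); rewrite ?row3E//.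
  by apply: nU; apply: U_cylinder Us; rewrite row3E.
split=> a Ea; last first.
  move=> nU; apply: (zero_near (nP a)) => u w [_ [u0 u2]] [[w1 w1'] [w0 w2]].
  have [l|l|a0] := ltgtP (a 0 0) (q 0 0).
  - by rewrite !ltNge (ltW (u0.1 l)) (ltW (w0.1 l)).
  - by rewrite (u0.2 l) (w0.2 l).
  - have := off a nU a0; have [l0 _|l0 /=] := ltP (a 0 1) (q 0 1).
      by rewrite [q 0 1 <= _]leNgt (w1.1 l0) andbF.
    by move/negP; rewrite -ltNge => l0'; rewrite [_ < q' 0 1]ltNge (ltW (w1'.2 l0')) /= !andbF.
rewrite /cross /crosses /ray e0 e2.
have [l|l|a0] := ltgtP (a 0 0) (q 0 0).
- apply: (additive_at_cob (f := fun=> false) (nP a)) => u w [_ [u0 _]] [_ [w0 _]].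
  by rewrite /= !ltNge (ltW (u0.1 l)) (ltW (w0.1 l)).
- apply: (additive_at_cob (f := fun=> false) (nP a)) => u w [_ [u0 _]] [_ [w0 _]].
  by rewrite /= (u0.2 l) (w0.2 l).
have [l|l|a2] := ltgtP (a 0 2) (q 0 2).
- apply: (additive_at_cob (f := fun=> false) (nP a)) => u w [_ [_ u2]] _.
  by rewrite !andbF /= [q 0 2 < _]ltNge (ltW (u2.1 l)) !andbF.
- have [l0|l0|a1] := ltgtP (a 0 1) (q 0 1).
  + apply: (additive_at_cob (f := fun=> false) (nP a)) => u w [[u1 _] _] [[w1 _] _].
    by rewrite [q 0 1 <= w 0 1]leNgt (w1.1 l0) /= !andbF lt_eqF//= (lt_trans l0).
  + have [l0'|l0'|a1'] := ltgtP (a 0 1) (q' 0 1).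
    * apply: (additive_at_cob (f := fun u => q 0 0 < u 0 0) (nP a)) => u w [_ [_ u2]] [[w1 w1'] _].
      by rewrite (ltW (w1.2 l0)) (w1'.1 l0') (u2.2 l) /= !andbT !addbF.
    * apply: (additive_at_cob (f := fun=> false) (nP a)) => u w _ [[w1 w1'] _].
      by rewrite [_ < q' 0 1]ltNge (ltW (w1'.2 l0')) /= !andbF.
    * apply: (additive_at_cob (f := fun u => (q 0 0 < u 0 0) && (u 0 1 < q' 0 1)) (nP a)) => u w [_ [_ u2]] [[w1 w1'] _].
      rewrite (ltW (w1.2 l0)) (u2.2 l) /= andbT !ltNge.
      by case: (q' 0 1 <= u 0 1); case: (q' 0 1 <= w 0 1); case: (u 0 0 <= q 0 0); case: (w 0 0 <= q 0 0).
  + rewrite a1 (lt_eqF lt) /=.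
    apply: (additive_at_cob (f := fun u => (q 0 0 < u 0 0) && (q 0 1 <= u 0 1)) (nP a)) => u w [_ [_ u2]] [[_ w1'] _].
    have lt' : a 0 1 < q' 0 1 by rewrite a1.
    rewrite (w1'.1 lt') (u2.2 l) /= addbF andbT.
    by case: (q 0 1 <= u 0 1); case: (q 0 1 <= w 0 1); case: (q 0 0 < u 0 0); case: (q 0 0 < w 0 0).
- have out : ~ (q 0 1 <= a 0 1 <= q' 0 1) by move=> /(seg _ a0)/(_ a2)[_]; exact.
  have [l0|l0] := ltP (a 0 1) (q 0 1).
    apply: (additive_at_cob (f := fun=> false) (nP a)) => u w [[u1 _] _] [[w1 _] _].
    by rewrite [q 0 1 <= w 0 1]leNgt (w1.1 l0) /= !andbF !lt_eqF//= (lt_trans l0).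
  move: out; rewrite l0 /= => /negP; rewrite -ltNge => l0'.
  apply: (additive_at_cob (f := fun=> false) (nP a)) => u w _ [[_ w1'] _].
  by rewrite [_ < q' 0 1]ltNge (ltW (w1'.2 l0')) /= !andbF !gt_eqF//= (lt_trans lt).
Qed.

Let move_t q q' : q' 0 0 = q 0 0 -> q' 0 1 = q 0 1 -> q 0 2 < q' 0 2 ->
  (forall u, u 0 0 = q 0 0 -> u 0 1 = q 0 1 -> q 0 2 <= u 0 2 <= q' 0 2 -> ~ E u) ->
  exists e, transfer e q q'.
Proof.
move=> e0 e1 lt seg; exists (fun _ _ => false); split=> a Ea; last by exists setT => //; exact: filterT.
apply: (additive_at_cob (P := setT) (f := fun=> false)) => [|u w _ _]; first exact: filterT.
rewrite /cross /ray e0 e1 /=; have [/eqP a0|//] := boolP (a 0 0 == _).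
have [/eqP a1|//] /= := boolP (a 0 1 == _).
have [l|l] := leP (q' 0 2) (a 0 2); first by rewrite (le_trans (ltW lt) l) addbb.
have [l'|//] := leP (q 0 2) (a 0 2).
by case: (seg a a0 a1) => //; rewrite l' ltW.
Qed.

Hypotheses (Uopen : open U)
  (Eclosed : forall x, U x -> ~ E x -> \forall w \near x, ~ E w).

Let good_iff q q' : (exists e, transfer e q q') -> good q <-> good q'.
Proof.
by move=> [e h]; split; [exact: good_transfer h|exact: good_transfer (transfer_sym h)].
Qed.

Let row3_eta q : q = row3 (q 0 0) (q 0 1) (q 0 2).
Proof.
apply/rowP => -[[|[|[|//]]] i]; rewrite mxE /=.
- by congr (q 0 _); exact/val_inj.
- by congr (q 0 _); exact/val_inj.
- by congr (q 0 _); exact/val_inj.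
Qed.

Let between (x x' u d : R) (c : R) : `|c - x| < d -> `|c - x'| < d -> x <= u <= x' -> `|c - u| < d.
Proof. by rewrite !ltr_distl => /andP[? ?] /andP[? ?] /andP[? ?]; lra. Qed.

Let good_near q : U q -> ~ E q -> \forall q' \near q, good q' <-> good q.
Proof.
move=> Uq nEq.
have := nbhsI (open_nbhs_nbhs (conj Uopen Uq)) (Eclosed Uq nEq).
move=> /nbhs_ballP[d /= d0 dP].
have cube u : `|q 0 0 - u 0 0| < d -> `|q 0 1 - u 0 1| < d -> `|q 0 2 - u 0 2| < d -> U u /\ ~ E u.
  move=> h0 h1 h2; apply: dP; split=> // i j; rewrite (ord1 i); case: j => -[|[|[|//]]] lt3.
  - by rewrite (_ : Ordinal lt3 = 0) //; exact/val_inj.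
  - by rewrite (_ : Ordinal lt3 = 1) //; exact/val_inj.
  - by rewrite (_ : Ordinal lt3 = 2) //; exact/val_inj.
have cc (r : R) : `|r - r| < d by rewrite subrr normr0.
have gx x x' y t : `|q 0 0 - x| < d -> `|q 0 0 - x'| < d -> `|q 0 1 - y| < d ->
    `|q 0 2 - t| < d -> x < x' -> good (row3 x y t) <-> good (row3 x' y t).
  move=> hx hx' hy ht lt; apply/good_iff/move_x; rewrite ?row3E// => u u0 u1 u2.
  by apply: cube; rewrite ?u1 ?u2//; exact: between u0.
have gy x y y' t : `|q 0 0 - x| < d -> `|q 0 1 - y| < d -> `|q 0 1 - y'| < d ->
    `|q 0 2 - t| < d -> y < y' -> good (row3 x y t) <-> good (row3 x y' t).
  move=> hx hy hy' ht lt; apply/good_iff/move_y; rewrite ?row3E// => u u0 u1 u2.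
  by apply: cube; rewrite ?u0 ?u2//; exact: between u1.
have gt x y t t' : `|q 0 0 - x| < d -> `|q 0 1 - y| < d -> `|q 0 2 - t| < d ->
    `|q 0 2 - t'| < d -> t < t' -> good (row3 x y t) <-> good (row3 x y t').
  move=> hx hy ht ht' lt; apply/good_iff/move_t; rewrite ?row3E// => u u0 u1 u2.
  by have [] // : U u /\ ~ E u; apply: cube; rewrite ?u0 ?u1//; exact: between u2.
apply: filterS (nbhsx_ballx q d d0) => w qw.
have [w0 w1 w2] : [/\ `|q 0 0 - w 0 0| < d, `|q 0 1 - w 0 1| < d & `|q 0 2 - w 0 2| < d].
  by case: qw => _ qw; split; exact: qw.
rewrite [in good w](row3_eta w) [in good q](row3_eta q).
apply: (iff_trans (B := good (row3 (w 0 0) (w 0 1) (q 0 2)))).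
  have [l|l|->//] := ltgtP (w 0 2) (q 0 2); first exact: gt.
  by apply: iff_sym; apply: gt.
apply: (iff_trans (B := good (row3 (w 0 0) (q 0 1) (q 0 2)))).
  have [l|l|->//] := ltgtP (w 0 1) (q 0 1); first exact: gy.
  by apply: iff_sym; apply: gy.
have [l|l|->//] := ltgtP (w 0 0) (q 0 0); first exact: gx.
by apply: iff_sym; apply: gx.
Qed.

(* The parity of the intersection of E with the vertical ray going up from q can
   be twisted to a cocycle on E, and it does not change as q moves off E. *)
Lemma parity_cocycle (ta tb : R) :
  (forall y, E y -> y 0 0 = x0 -> y 0 1 = y0 -> ta < y 0 2 < tb) ->
  (forall om : 'rV[R]_3 -> bool,
     (forall x, U x -> ~ E x -> \forall w \near x, om w = om x) ->
     om (row3 x0 y0 tb) = om (row3 x0 y0 ta)) ->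
  U (row3 x0 y0 ta) ->
  exists c, (forall x, E x -> additive_at c x) /\
    forall x, E x -> ~ U x -> exists2 A, nbhs x A &
      forall u w, A u -> A w -> c u w = crosses x0 y0 u w.
Proof.
move=> Eline top Ubot.
have gbot : good (row3 x0 y0 ta).
  exists (crosses x0 y0) => a Ea; split; last by exists setT => //; exact: filterT.
  rewrite /cross /ray !row3E /=.
  have [/orP ne|] := boolP ((a 0 0 != x0) || (a 0 1 != y0)).
    apply: additive_at_ext (crosses_additive (introT orP ne)) => u w.
    by case: ne => /negbTE -> /=; rewrite ?andbF addbF.
  rewrite negb_or !negbK => /andP[/eqP a0 /eqP a1].
  have /andP[ta2 _] := Eline a Ea a0 a1.
  apply: (additive_at_cob (P := setT) (f := fun=> false)) => [|u w _ _]; first exact: filterT.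
  by rewrite a0 a1 !eqxx ltW//= addbb.
have [c cP] : good (row3 x0 y0 tb).
  have := top (fun q => `[< good q >]); rewrite [X in _ -> _ = X]asboolT// => h.
  apply/asboolP/h => x Ux nEx; apply: filterS (good_near Ux nEx) => w e.
  exact: asbool_equiv_eq.
exists c; split=> x Ex; have [h1 h2] := cP x Ex => //.
apply: additive_at_ext h1 => u w; rewrite /ray !row3E /=.
have [/eqP e0|] := boolP (x 0 0 == x0); last by rewrite addbF.
have [/eqP e1|] := boolP (x 0 1 == y0); last by rewrite addbF.
by have /andP[_ lt] := Eline x Ex e0 e1; rewrite leNgt lt addbF.
Qed.

End ParityCocycle.

(** * Vertical cylinders over parts of the half-plane *)

Section Columns.
Variable R : realType.
Implicit Types q u w : 'rV[R]_3.

Lemma cosh_dist_sumE (x0 y0 : R) q : 0 < y0 -> 0 < q 0 1 ->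
  cosh_dist x0 y0 q = ((q 0 0 - x0) ^+ 2 + q 0 1 ^+ 2 + y0 ^+ 2) / (2 * y0 * q 0 1).
Proof.
by move=> y0p q1; rewrite cosh_distE//; field; rewrite !gt_eqF.
Qed.

(** The triangle inequality combined with [cosh (s + t) <= 2 cosh s cosh t]; after clearing
    denominators the difference is a sum of squares. *)
Lemma cosh_dist_triangle (x0 y0 x1 y1 t : R) q : 0 < y0 -> 0 < y1 -> 0 < q 0 1 ->
  cosh_dist x0 y0 (row3 x1 y1 t) <= 2 * cosh_dist x0 y0 q * cosh_dist x1 y1 q.
Proof.
move=> y0p y1p q1; rewrite !cosh_dist_sumE ?row3E// -subr_ge0.
set al := q 0 0 - x0; set be := q 0 0 - x1.
have -> : x1 - x0 = al - be by rewrite /al /be; ring.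
set D := _ - _; have -> : D = ((al * be + q 0 1 ^+ 2) ^+ 2 + al ^+ 2 * y1 ^+ 2 +
   be ^+ 2 * y0 ^+ 2 + y0 ^+ 2 * y1 ^+ 2) / (2 * y0 * y1 * q 0 1 ^+ 2).
  by rewrite /D; field; rewrite !gt_eqF.
apply: divr_ge0; first by rewrite -!exprMn !addr_ge0 ?sqr_ge0.
by rewrite !mulr_ge0 ?sqr_ge0 ?ltW.
Qed.

Definition column (x0 y0 K : R) : set 'rV[R]_3 :=
  [set q | [/\ `|q 0 0 - x0| < K * y0, y0 < K * q 0 1 & q 0 1 < K * y0]].

Lemma column_open x0 y0 K : open (column x0 y0 K).
Proof.
have cc (i : 'I_3) : continuous (fun q : 'rV[R]_3 => q 0 i) by exact: coord_continuous.
have ol (f : 'rV[R]_3 -> R) c : continuous f -> open [set q | f q < c].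
  by move=> fc; apply: (open_comp _ (@open_lt R c)) => q _; exact: fc.
have og (f : 'rV[R]_3 -> R) c : continuous f -> open [set q | c < f q].
  by move=> fc; apply: (open_comp _ (@open_gt R c)) => q _; exact: fc.
rewrite (_ : column x0 y0 K = [set q | `|q 0 0 - x0| < K * y0] `&`
  ([set q | y0 < K * q 0 1] `&` [set q | q 0 1 < K * y0])); last first.
  by apply/seteqP; split=> q; [case=> ? ? ?|case=> ? [? ?]].
apply: openI; last apply: openI.
- apply: (ol (fun q => `|q 0 0 - x0|)) => q.
  by apply: (@cont_norm R _ q R (fun q : 'rV[R]_3 => q 0 0 - x0)); apply: contB; [exact: cc|exact: cont_cst].
- by apply: (og (fun q => K * q 0 1)) => q; apply: contM; [exact: cont_cst|exact: cc].
- exact: ol (cc 1).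
Qed.

Lemma column_cylinder x0 y0 K u w : u 0 0 = w 0 0 -> u 0 1 = w 0 1 ->
  column x0 y0 K u -> column x0 y0 K w.
Proof. by move=> e0 e1; rewrite /column /= e0 e1. Qed.

Lemma column_cosh_dist x0 y0 K q : 0 < y0 -> 1 <= K -> column x0 y0 K q ->
  cosh_dist x0 y0 q <= 1 + K ^+ 3.
Proof.
move=> y0p K1 [h0 h1 h2]; have K0 : 0 < K by lra.
have q1 : 0 < q 0 1 by rewrite -(pmulr_rgt0 _ K0); exact: lt_trans h1.
rewrite cosh_distE// lerD2l ler_pdivrMr; last by rewrite !mulr_gt0.
have s0 : (q 0 0 - x0) ^+ 2 <= K ^+ 2 * y0 ^+ 2.
  by rewrite -real_normK ?num_real// -exprMn ler_pXn2r ?nnegrE ?mulr_ge0 ?(ltW K0) ?(ltW y0p)// ltW.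
have s1 : (q 0 1 - y0) ^+ 2 <= K ^+ 2 * y0 ^+ 2.
  have : y0 <= K * y0 by rewrite ler_peMl// ltW.
  rewrite -real_normK ?num_real// -exprMn ler_pXn2r ?nnegrE ?mulr_ge0 ?(ltW K0) ?(ltW y0p)// => h.
  by apply/ler_normlP; split; lra.
have -> : K ^+ 3 * (2 * y0 * q 0 1) = 2 * (K ^+ 2 * y0 * (K * q 0 1)) by ring.
have : K ^+ 2 * y0 * y0 <= K ^+ 2 * y0 * (K * q 0 1).
  have k2 : 0 < K ^+ 2 * y0 by rewrite mulr_gt0// exprn_gt0.
  by rewrite ler_pM2l// ltW.
have -> : K ^+ 2 * y0 * y0 = K ^+ 2 * y0 ^+ 2 by ring.
lra.
Qed.

Lemma column_double x0 y0 x1 y1 K : 0 < y0 -> 1 <= K -> `|x1 - x0| <= y0 -> y0 <= y1 <= 2 * y0 ->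
  (x1 = x0 \/ y1 = y0) -> column x1 y1 K `<=` column x0 y0 (2 * K).
Proof.
move=> y0p K1 xx /andP[yy1 yy2] e q [h0 h1 h2].
have q1 : 0 < q 0 1 by rewrite -(pmulr_rgt0 _ (lt_le_trans ltr01 K1)); lra.
have k1 : K * y1 <= K * (2 * y0) by rewrite ler_pM2l//; lra.
have k2 : y0 <= K * y0 by rewrite ler_peMl// ltW.
split; last by lra.
  rewrite (_ : q 0 0 - x0 = (q 0 0 - x1) + (x1 - x0)); last by ring.
  apply: le_lt_trans (ler_normD _ _) _.
  by case: e => e; [rewrite e subrr normr0; rewrite e in h0|rewrite e in h0]; lra.
have : 0 < K * q 0 1 by rewrite mulr_gt0//; lra.
lra.
Qed.

(* Near points off the segment, the crossings of the half-lines from its two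
   ends differ by a coboundary. *)
Lemma crosses_horizontal (x0 x1 y0 : R) q : x0 <= x1 ->
  ~ (q 0 1 = y0 /\ x0 <= q 0 0 <= x1) ->
  \forall u \near q, \forall w \near q, crosses x0 y0 u w (+) crosses x1 y0 u w = false.
Proof.
move=> xx off; rewrite /crosses.
have [l|l|e] := ltgtP (q 0 1) y0.
- have h := near_cmp q 1 y0.
  by apply: filterS (h) => u [/(_ l) u1 _]; apply: filterS h => w [/(_ l) w1 _]; rewrite !leNgt u1 w1.
- have h := near_cmp q 1 y0.
  by apply: filterS (h) => u [_ /(_ l) u1]; apply: filterS h => w [_ /(_ l) w1]; rewrite !ltW.
- have h := near_cmp q 0 x0; have h' := near_cmp q 0 x1.
  have [l|l] := ltP (q 0 0) x0.
    have l' : q 0 0 < x1 by exact: lt_le_trans xx.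
    apply: filterS2 (h) (h') => u [/(_ l) u0 _] [/(_ l') u0' _]; near=> w.
    by rewrite ![_ < u 0 0]ltNge (ltW u0) (ltW u0') !andbF.
  have [l'|l'] := ltP x1 (q 0 0); last by case: off; split=> //; rewrite l.
  have l'' : x0 < q 0 0 by exact: le_lt_trans l'.
  apply: filterS2 (h) (h') => u [_ /(_ l'') u0] [_ /(_ l') u0']; near=> w.
  by rewrite u0 u0' addbb.
Unshelve. all: by end_near.
Qed.

(** The region between the half-planes attached to the two ends of a vertical edge, half-open so
    that consecutive edges add up. *)
Definition strip_ind (x0 y0 y1 : R) q : bool := (x0 < q 0 0) && ((y0 <= q 0 1) && (q 0 1 < y1)).

Lemma crosses_vertical (x0 y0 y1 : R) q : y0 <= y1 ->
  ~ (q 0 0 = x0 /\ y0 <= q 0 1 <= y1) ->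
  \forall u \near q, \forall w \near q, crosses x0 y0 u w (+) crosses x0 y1 u w =
     strip_ind x0 y0 y1 u (+) strip_ind x0 y0 y1 w.
Proof.
move=> yy off; rewrite /crosses /strip_ind.
have J (u : 'rV[R]_3) : (y0 <= u 0 1) && (u 0 1 < y1) = (y0 <= u 0 1) (+) (y1 <= u 0 1).
  rewrite ltNge; have [h|h] := leP y1 (u 0 1); last by rewrite /= andbT addbF.
  by rewrite (le_trans yy h).
have [l|l|e] := ltgtP (q 0 0) x0.
- have h := near_cmp q 0 x0.
  apply: filterS (h) => u [/(_ l) u0 _]; apply: filterS h => w [/(_ l) w0 _].
  by rewrite ![x0 < _]ltNge (ltW u0) (ltW w0) !andbF.
- have h := near_cmp q 0 x0.
  apply: filterS (h) => u [_ /(_ l) u0]; apply: filterS h => w [_ /(_ l) w0].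
  rewrite u0 w0 !J !andbT /=.
  by case: (y0 <= u 0 1); case: (y0 <= w 0 1); case: (y1 <= u 0 1); case: (y1 <= w 0 1).
- have h := near_cmp q 1 y0; have h' := near_cmp q 1 y1.
  have [l|l] := ltP (q 0 1) y0.
    have l' : q 0 1 < y1 by exact: lt_le_trans yy.
    apply: filterS2 (h) (h') => u [/(_ l) u0 _] [/(_ l') u0' _].
    apply: filterS2 h h' => w [/(_ l) w0 _] [/(_ l') w0' _].
    by rewrite ![y0 <= _]leNgt ![y1 <= _]leNgt u0 u0' w0 w0' /= !andbF.
  have [l'|l'] := ltP y1 (q 0 1); last by case: off; split=> //; rewrite l.
  have l'' : y0 < q 0 1 by exact: le_lt_trans l'.
  apply: filterS2 (h) (h') => u [_ /(_ l'') u0] [_ /(_ l') u0'].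
  apply: filterS2 h h' => w [_ /(_ l'') w0] [_ /(_ l') w0'].
  by rewrite ![_ < y1]ltNge (ltW u0) (ltW u0') (ltW w0) (ltW w0') /= !andbF.
Unshelve. all: by end_near.
Qed.

End Columns.

(** * Bounded pieces of an end *)

Section CoshDist.
Variable R : realType.

Lemma cosh_dist_sym (x0 y0 x1 y1 t t' : R) : 0 < y0 -> 0 < y1 ->
  cosh_dist x0 y0 (row3 x1 y1 t) = cosh_dist x1 y1 (row3 x0 y0 t').
Proof.
move=> y0p y1p; rewrite !cosh_dist_sumE ?row3E//; field; rewrite !gt_eqF//.
Qed.

Lemma cosh_dist_triangle_center (x0 y0 x1 y1 t : R) (q : 'rV[R]_3) :
  0 < y0 -> 0 < y1 -> 0 < q 0 1 ->
  cosh_dist x0 y0 q <= 2 * cosh_dist x1 y1 (row3 x0 y0 t) * cosh_dist x1 y1 q.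
Proof.
move=> y0p y1p q1.
have qE u v : 0 < v -> cosh_dist u v q = cosh_dist u v (row3 (q 0 0) (q 0 1) t).
  by move=> v0; rewrite !cosh_dist_sumE ?row3E.
rewrite !qE// (cosh_dist_sym _ _ t t)//.
have r1 : 0 < row3 x1 y1 t 0 1 by rewrite row3E.
rewrite (cosh_dist_sym x1 x0 t t)// (cosh_dist_sym x1 (q 0 0) t t)//.
by rewrite mulrAC; exact: cosh_dist_triangle.
Qed.

End CoshDist.

Section End.
Variables (R : realType) (H a b L : R).
Variables (E E0 : set 'rV[R]_3) (nrm : 'rV[R]_3 -> 'rV[R]_3).
Variables (sd : 'rV[R]_3 -> 'rV[R]_3 -> R) (er : 'rV[R]_3 -> R).

Let orig : 'rV[R]_3 -> R := cosh_dist 0 1.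

(* E can be pushed along itself arbitrarily far away, fixing its far points. *)
Definition pushes_off := forall m : R, exists (G : 'rV[R]_3 -> R -> 'rV[R]_3) (M : R),
  forall x, E x -> [/\ G x 1 = x, forall t : R, 0 <= t <= 1 -> E (G x t), m < orig (G x 0),
    M < orig x -> forall t : R, 0 <= t <= 1 -> G x t = x &
    forall (t : R) (A : set 'rV[R]_3), 0 <= t <= 1 -> nbhs (G x t) A -> exists2 e : R, 0 < e &
      forall (x' : 'rV[R]_3) (t' : R), E x' -> 0 <= t' <= 1 -> ball x e x' -> `|t - t'| < e -> A (G x' t')].

Hypotheses (H_gt0 : 0 < H) (ab : a < b) (L_gt1 : 1 < L) (HL : b - a < H / 2 * ln L).
Hypotheses (Epos : forall x, E x -> 0 < x 0 1)
  (Eslab : forall x, E x -> a <= x 0 2 <= b)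
  (Eclosed : forall x : 'rV[R]_3, 0 < x 0 1 -> ~ E x -> \forall w \near x, ~ E w)
  (E0E : E0 `<=` E) (cE : connected E) (cE0 : connected E0) (E0n : E0 !=set0)
  (M0 : R) (E0M : forall x, E0 x -> orig x < M0)
  (Efar : forall m : R, exists2 x, E x & m < orig x)
  (Epush : pushes_off)
  (sdP : forall x, E x -> ~ E0 x -> two_sided E nrm x (sd x) (er x))
  (Ecmc : forall x, E x -> ~ E0 x -> cmc_at H E nrm x).

(** One more than the factor of the box in [top_bottom], so that the closed box lies over the open
    column. *)
Let K : R := 2 * L + 3.
(** The bound of [column_cosh_dist] for the doubled column, which by [column_double] contains the
    columns of a grid point and of its neighbours. *)
Definition carry_radius : R := 1 + (2 * K) ^+ 3.

Let K1 : 1 <= K. Proof. by have := L_gt1; rewrite /K; lra. Qed.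

Lemma ray_cocycle x0 y0 : 0 < y0 -> (forall x, E0 x -> ~ column x0 y0 K x) ->
  exists c, (forall x, E x -> additive_at c x) /\
    forall x, E x -> ~ column x0 y0 K x -> exists2 A, nbhs x A &
      forall u w, A u -> A w -> c u w = crosses x0 y0 u w.
Proof.
move=> y0p off; have ab' := ab; have L1 := L_gt1; have K1' := K1.
have Upos x : column x0 y0 K x -> 0 < x 0 1.
  by case=> _ h _; rewrite -(pmulr_rgt0 _ (lt_le_trans ltr01 K1')); exact: lt_trans h.
have Ucl x : column x0 y0 K x -> ~ E x -> \forall w \near x, ~ E w.
  by move=> /Upos; exact: Eclosed.
have nE0 x : column x0 y0 K x -> E x -> ~ E0 x by move=> Ux _ /off.
have oU := @column_open R x0 y0 K.
apply: (parity_cocycle (@column_cylinder R x0 y0 K) oU Ucl (ta := a - 1) (tb := b + 1)).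
- by move=> y /Eslab /andP[h1 h2] _ _; apply/andP; split; lra.
- have p1 x : column x0 y0 K x -> E x -> two_sided E nrm x (sd x) (er x).
    by move=> Ux Ex; apply: sdP => //; exact: nE0 Ux Ex.
  have p2 : box x0 y0 (2 * L + 2) a b `<=` column x0 y0 K.
    move=> x [h1 h2 h3 _]; have q1 : 0 < x 0 1.
      rewrite -(pmulr_rgt0 (x := 2 * L + 2)); [exact: lt_le_trans h2|lra].
    rewrite /column /K /=; split; lra.
  have p3 x : column x0 y0 K x -> E x -> a <= x 0 2 <= b by move=> _; exact: Eslab.
  have p4 x : column x0 y0 K x -> E x -> cmc_at H E nrm x.
    by move=> Ux Ex; apply: Ecmc => //; exact: nE0 Ux Ex.
  by move=> om; exact: (top_bottom H_gt0 y0p ab L_gt1 HL p1 oU p2 Ucl p3 p4).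
- have ky : y0 < K * y0 by rewrite ltr_pMl//; rewrite /K; lra.
  by split; rewrite !row3E// subrr normr0 (lt_trans y0p ky).
Qed.

Let orig_gt x m : E x -> m < orig x -> \forall y \near x, m < orig y.
Proof.
move=> /Epos x1 lt; have c := @cosh_dist_cont R 0 1 x x1; apply: (near_cont (P := fun r : R => m < r) c).
by apply: open_nbhs_nbhs; split; [exact: open_gt|].
Qed.

Let orig_lt x m : E x -> orig x < m -> \forall y \near x, orig y < m.
Proof.
move=> /Epos x1 lt; have c := @cosh_dist_cont R 0 1 x x1; apply: (near_cont (P := fun r : R => r < m) c).
by apply: open_nbhs_nbhs; split; [exact: open_lt|].
Qed.

Lemma truncation_compact m : compact [set x | E x /\ orig x <= m].
Proof.
have [m1|m1] := ltP m 1.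
  rewrite (_ : [set _ | _] = set0); first exact: compact0.
  apply/seteqP; split=> // x [Ex]; rewrite leNgt => /negP; apply.
  by apply: lt_le_trans m1 _; apply: cosh_dist_ge1 => //; exact: Epos.
have K0 : 0 < 2 * (m + 1) + 2 by lra.
apply: subclosed_compact (box_compact (x0 := 0) (y0 := 1) (a := a) (b := b) ltr01 K0) _; last first.
  move=> x [Ex om]; have om' : orig x < m + 1 by lra.
  have [h0 h1 h2] := cosh_dist_lt ltr01 (Epos Ex) om'.
  by case/andP: (Eslab Ex) => h3 h4; split; [exact: ltW|exact: ltW|exact: ltW|apply/andP; split; lra].
move=> x cx; have Bx : box 0 1 (2 * (m + 1) + 2) a b x.
  apply: (box_closed (x0 := 0) (y0 := 1)) => B /cx[w [[Ew om] Bw]]; exists w; split=> //.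
  have om' : orig w < m + 1 by lra.
  have [h0 h1 h2] := cosh_dist_lt ltr01 (Epos Ew) om'.
  by case/andP: (Eslab Ew) => h3 h4; split; [exact: ltW|exact: ltW|exact: ltW|apply/andP; split; lra].
have x1 := box_pos ltr01 K0 Bx.
have Ex : E x.
  by apply: contrapT => nEx; have [w [[Ew _] /(_ Ew)]] := cx _ (Eclosed x1 nEx).
split=> //; rewrite leNgt; apply/negP => lt.
by have [w [[_ om]]] := cx _ (orig_gt Ex lt); rewrite ltNge om.
Qed.

(* Integrate c along the paths that push E off the support of c. *)
Lemma cocycle_primitive (c : 'rV[R]_3 -> 'rV[R]_3 -> bool) (m : R) :
  (forall x, E x -> additive_at c x) ->
  (forall x, E x -> m < orig x -> \forall u \near x, \forall w \near x, c u w = false) ->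
  exists k : 'rV[R]_3 -> bool, (forall x, E x -> \forall y \near x, E y -> k y = k x (+) c x y) /\
    exists M, forall x, E x -> M < orig x -> k x = false.
Proof.
move=> cad czero.
have [G [M GP]] := Epush m.
(* Below [M1] the values of [k] are compared by [homotopy_lift]; from [M1] on, both [k] and [c]
   vanish near the point. *)
pose M1 := Num.max M m + 1.
have M1M : M < M1 /\ m < M1.
  by rewrite /M1; split; apply: (@le_lt_trans _ _ (Num.max M m)); rewrite ?le_max ?lexx ?orbT// ltrDl.
have loc x t : [set x | E x /\ orig x <= M1] x -> 0 <= t <= 1 -> exists2 e : R, 0 < e &
     additive_on (G := bool) c ((fun p : 'rV[R]_3 * R => G p.1 p.2) @`
       [set p | [/\ [set x | E x /\ orig x <= M1] p.1, 0 <= p.2 <= 1, ball x e p.1 & `|t - p.2| < e]]).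
  move=> [Ex _] t01; have [_ GE _ _ Gc] := GP x Ex.
  have [A nA Aad] := cad _ (GE t t01).
  have [e e0 eP] := Gc t A t01 nA; exists e => //.
  apply: additive_onS Aad => _ [[y r] /= [[Ey _] r01 xy tr] <-]; exact: eP.
have [N N0 [e e0 eP]] := homotopy_lift (H := G) (truncation_compact (m := M1)) loc.
have cxx x : E x -> c x x = false.
  by move=> Ex; have [A /nbhs_singleton Ax Aad] := cad x Ex; exact: additive_on_id Aad Ax.
have j01 (j : nat) : (j <= N)%N -> 0 <= (j%:R / N%:R : R) <= 1.
  by move=> jN; rewrite divr_ge0//= ler_pdivrMr ?ltr0n// mul1r ler_nat.
have kfar x : E x -> M < orig x -> lift_along (G := bool) G c N x = false.
  move=> Ex lt; have [_ _ _ Gx _] := GP x Ex.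
  rewrite /lift_along big1// => j _; rewrite !(Gx lt) ?j01//; [exact: cxx|exact: ltnW].
exists (lift_along (G := bool) G c N); split; last by exists M.
move=> x Ex; have [lt|le] := ltP (orig x) M1.
- have h1 := orig_lt Ex lt; have h2 := nbhsx_ballx x e e0.
  have [Gx1 GE Gx0 _ Gc] := GP x Ex.
  have z01 : 0 <= (0 : R) <= 1 by rewrite lexx ler01.
  have hz := czero _ (GE 0 z01) Gx0.
  have hz1 := nbhs_singleton hz.
  have [d d0 dP] := Gc 0 _ z01 hz1; have h3 := nbhsx_ballx x d d0.
  apply: filterS3 h1 h2 h3 => y h1 h2 h3 Ey.
  have [Gy1 _ _ _ _] := GP y Ey.
  have := eP x y (conj Ex (ltW lt)) (conj Ey (ltW h1)) h2; rewrite Gx1 Gy1.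
  rewrite (dP y 0)//; last by rewrite subrr normr0.
  by case: (lift_along _ _ _ y); case: (lift_along _ _ _ x); case: (c x y).
- have lt1 : M < orig x by apply: lt_le_trans le; case: M1M.
  have lt2 : m < orig x by apply: lt_le_trans le; case: M1M.
  apply: filterS2 (orig_gt Ex lt1) (nbhs_singleton (czero x Ex lt2)) => y hy hc Ey.
  by rewrite !kfar// hc.
Qed.

(* A bounded part of E that contains E0 and whose frontier in E is near the
   vertical line over (x0, y0). *)
Definition carries (x0 y0 : R) (B : set 'rV[R]_3) :=
  [/\ E0 `<=` B /\ B `<=` E, exists M, forall x, B x -> orig x <= M,
      forall x, B x -> carry_radius < cosh_dist x0 y0 x,
      forall x, B x -> \forall y \near x, E y -> B y &
      forall x, E x -> ~ B x -> carry_radius < cosh_dist x0 y0 x -> \forall y \near x, ~ B y].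

Section Rectangle.
Variables (nu : R) (gam : R -> R -> 'rV[R]_3 -> 'rV[R]_3 -> bool).
(** The second clause makes the grid step [nu^-1] admissible at height [y0]; the third says that the
    hyperbolic cosine of the distance to [(0, 1)] is at least [nu / 2]. *)
Let far x0 y0 := [/\ 0 < y0, nu^-1 <= y0 & nu * y0 <= x0 ^+ 2 + y0 ^+ 2 + 1].
Hypotheses (nu_gt0 : 0 < nu) (nu_large : 4 * carry_radius * M0 < nu)
  (gamP : forall x0 y0, far x0 y0 -> (forall x, E x -> additive_at (gam x0 y0) x) /\
    forall x, E x -> ~ column x0 y0 K x -> exists2 A, nbhs x A &
      forall u w, A u -> A w -> gam x0 y0 u w = crosses x0 y0 u w)
  (no_carry : forall x0 y0 B, far x0 y0 -> ~ carries x0 y0 B).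

(** The two cocycles, corrected by the coboundary of [h], are cohomologous relative to [E0] and to
    infinity. *)
Let joined x0 y0 x1 y1 (h : 'rV[R]_3 -> bool) := exists k : 'rV[R]_3 -> bool,
  [/\ forall x, E x -> \forall y \near x, E y ->
        k y = k x (+) (gam x0 y0 x y (+) gam x1 y1 x y (+) (h x (+) h y)),
      exists M, forall x, E x -> M < orig x -> k x = false &
      forall x, E0 x -> k x = false].

Let joined_trans x0 y0 x1 y1 x2 y2 h h' h'' : joined x0 y0 x1 y1 h -> joined x1 y1 x2 y2 h' ->
  (forall x, h'' x = h x (+) h' x) -> joined x0 y0 x2 y2 h''.
Proof.
move=> [k [k1 [M k2] k3]] [k' [k1' [M' k2'] k3']] hE.
exists (fun x => k x (+) k' x); split.
- move=> x Ex; apply: filterS2 (k1 x Ex) (k1' x Ex) => y e e' Ey.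
  rewrite e// e'// !hE; case: (k x); case: (k' x); case: (gam _ _ _ _); case: (gam _ _ _ _);
  by case: (gam _ _ _ _); case: (h x); case: (h' x); case: (h y); case: (h' y).
- exists (Num.max M M') => x Ex; rewrite gt_max => /andP[l l'].
  by rewrite k2// k2'.
- by move=> x E0x; rewrite k3// k3'.
Qed.

Let joined_refl x0 y0 h : (forall x, h x = false) -> joined x0 y0 x0 y0 h.
Proof.
move=> h0; exists (fun=> false); split=> //.
- by move=> x Ex; near=> y; rewrite !h0 addbb.
- by exists 0.
Unshelve. all: by end_near.
Qed.

(** Otherwise the triangle inequality would give [nu / 2 <= 2 * M0 * carry_radius]; this is the
    origin of the lower bound on [nu]. *)
Lemma far_carry x0 y0 x : far x0 y0 -> E0 x -> carry_radius < cosh_dist x0 y0 x.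
Proof.
move=> [y0p _ f] E0x; rewrite ltNge; apply/negP => le.
have x1 : 0 < x 0 1 by exact/Epos/E0E.
have := cosh_dist_triangle 0 x0 0 ltr01 y0p x1.
have h : nu / 2 <= cosh_dist 0 1 (row3 x0 y0 0).
  by rewrite cosh_dist_sumE ?row3E// ler_pdivlMr ?mulr_gt0//; lra.
have o1 : 1 <= orig x by apply: cosh_dist_ge1.
have oM := E0M E0x; have r0 : 0 < cosh_dist x0 y0 x by apply: lt_le_trans (cosh_dist_ge1 x0 y0p x1).
have : orig x * cosh_dist x0 y0 x <= M0 * carry_radius.
  by apply: ler_pM => //; [lra|exact: ltW|exact: ltW].
by have := nu_large; rewrite /orig; lra.
Qed.

(** Off the columns both cocycles are [crosses], so their corrected sum vanishes away from
    [(x0, y0)] and has a primitive [k] that is zero far out. Since [E0] is connected, if [k] were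
    true somewhere on [E0], the set where [k] is true outside the carry radius would contain [E0]
    and be excluded by [no_carry]. *)
Let edge x0 y0 x1 y1 h : far x0 y0 -> far x1 y1 -> `|x1 - x0| <= y0 -> y0 <= y1 <= 2 * y0 ->
  (x1 = x0 \/ y1 = y0) ->
  (forall x, E x -> ~ column x0 y0 K x -> \forall u \near x, \forall w \near x,
     crosses x0 y0 u w (+) crosses x1 y1 u w = h u (+) h w) ->
  joined x0 y0 x1 y1 h.
Proof.
move=> f0 f1 xx yy xy hP; have y0p : 0 < y0 by case: f0.
have [ad0 off0] := gamP f0; have [ad1 off1] := gamP f1.
have K1' := K1; have K2 : 1 <= 2 * K by lra.
pose c u w := gam x0 y0 u w (+) gam x1 y1 u w (+) (h u (+) h w).
have near_col x : E x -> carry_radius < cosh_dist x0 y0 x ->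
    ~ column x0 y0 K x /\ ~ column x1 y1 K x.
  move=> Ex lt; have nD : ~ column x0 y0 (2 * K) x.
    by move=> /(column_cosh_dist y0p K2); rewrite leNgt -/carry_radius lt.
  have y00 : `|x0 - x0| <= y0 by rewrite subrr normr0 ltW.
  have y01 : y0 <= y0 <= 2 * y0 by rewrite lexx; lra.
  split=> cx; apply: nD; first exact: column_double y0p K1' y00 y01 (or_introl erefl) _ cx.
  exact: column_double y0p K1' xx yy xy _ cx.
have czero x : E x -> carry_radius < cosh_dist x0 y0 x ->
    \forall u \near x, \forall w \near x, c u w = false.
  move=> Ex lt; have [n0 n1] := near_col x Ex lt.
  have [A nA cA] := off0 x Ex n0; have [B nB cB] := off1 x Ex n1.
  apply: filterS3 (nA) (nB) (hP x Ex n0) => u Au Bu hu.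
  apply: filterS3 (nA) (nB) hu => w Aw Bw hu.
  by rewrite /c cA// cB// hu addbb.
have far_radius x : E x -> 2 * carry_radius * cosh_dist x0 y0 (row3 0 1 0) < orig x ->
    carry_radius < cosh_dist x0 y0 x.
  move=> Ex; rewrite mulrAC => lt; have l := cosh_dist_triangle_center 0 x0 0 ltr01 y0p (Epos Ex).
  have d0 : 0 < 2 * cosh_dist x0 y0 (row3 0 1 0).
    rewrite mulr_gt0//; apply: lt_le_trans (cosh_dist_ge1 x0 y0p _) => //; by rewrite row3E.
  by rewrite -(ltr_pM2l d0); exact: lt_le_trans lt l.
have cad x : E x -> additive_at c x.
  move=> Ex; apply: additive_atD; first exact: additive_atD (ad0 x Ex) (ad1 x Ex).
  by apply: (additive_at_cob (P := setT) (f := h)) => //; exact: filterT.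
have [] := cocycle_primitive (m := 2 * carry_radius * cosh_dist x0 y0 (row3 0 1 0)) cad.
  by move=> x Ex lt; apply: czero => //; exact: far_radius.
move=> k [kP [M kM]]; exists k; split=> //; first by exists M.
move=> x E0x; apply/negP => kx; apply: (no_carry (B := [set x | [/\ E x, k x & carry_radius < cosh_dist x0 y0 x]]) f0).
have kloc z : E z -> carry_radius < cosh_dist x0 y0 z -> \forall y \near z, E y -> k y = k z.
  move=> Ez lt; apply: filterS2 (kP z Ez) (nbhs_singleton (czero z Ez lt)) => y h1 h2 Ey.
  by rewrite h1// -/(c z y) h2 addbF.
have near_r z : E z -> carry_radius < cosh_dist x0 y0 z -> \forall y \near z, carry_radius < cosh_dist x0 y0 y.
  move=> Ez lt; apply: (near_cont (P := fun r : R => carry_radius < r) (@cosh_dist_cont R x0 y0 z (Epos Ez))).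
  by apply: open_nbhs_nbhs; split; [exact: open_gt|].
split.
- split=> [z E0z|z []//]; have lt := far_carry f0 E0z; split=> //; first exact: E0E.
  have -> // : k z = k x; apply: (loc_const_connected cE0) => // w E0w.
  apply: filterS (kloc w (E0E E0w) (far_carry f0 E0w)) => y hy /E0E; exact: hy.
- by exists M => z [Ez kz _]; rewrite leNgt; apply/negP => /(kM z Ez); rewrite kz.
- by move=> z [].
- move=> z [Ez kz lt]; apply: filterS2 (kloc z Ez lt) (near_r z Ez lt) => y h1 h2 Ey.
  by split=> //; rewrite h1.
- move=> z Ez nB lt; apply: filterS (kloc z Ez lt) => y h1 [Ey ky _]; apply: nB.
  by split=> //; rewrite -h1.
Qed.

Let side_horizontal (d : R) n x0 y0 : 0 < d <= y0 -> (forall j, (j <= n)%N -> far (x0 + j%:R * d) y0) ->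
  joined x0 y0 (x0 + n%:R * d) y0 (fun=> false).
Proof.
move=> /andP[d0 dy]; have K1' := K1.
elim: n => [|n IHn] hf; first by rewrite mul0r addr0; exact: joined_refl.
have f1 := hf n (leqnSn n); have f2 := hf n.+1 (leqnn _).
have IH := IHn (fun j jn => hf j (leqW jn)).
have e : x0 + n.+1%:R * d = x0 + n%:R * d + d by rewrite -natr1; ring.
have xx : `|x0 + n.+1%:R * d - (x0 + n%:R * d)| <= y0 by rewrite e addrAC subrr add0r gtr0_norm.
have y0p : 0 < y0 by lra.
have yy : y0 <= y0 <= 2 * y0 by rewrite lexx; lra.
apply: (joined_trans IH) => //; apply: edge f1 f2 xx yy (or_intror erefl) _.
move=> q Eq nc.
have le : x0 + n%:R * d <= x0 + n.+1%:R * d by rewrite e; lra.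
have ky : y0 < K * y0 by rewrite ltr_pMl//; rewrite /K; have := L_gt1; lra.
have := crosses_horizontal (q := q) (y0 := y0) le; apply => -[q1 q0].
apply: nc; rewrite /column /= q1; split=> //.
by apply/ltr_normlP; move: q0; rewrite e => /andP[]; split; lra.
Qed.

Let side_vertical (d : R) n x0 y0 : 0 < d <= y0 -> (forall j, (j <= n)%N -> far x0 (y0 + j%:R * d)) ->
  joined x0 y0 x0 (y0 + n%:R * d) (strip_ind x0 y0 (y0 + n%:R * d)).
Proof.
move=> /andP[d0 dy]; have L1 := L_gt1.
elim: n => [|n IHn] hf.
  rewrite mul0r addr0; apply: joined_refl => x.
  by rewrite /strip_ind [_ < y0]ltNge andbN andbF.
have f1 := hf n (leqnSn n); have f2 := hf n.+1 (leqnn _).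
have IH := IHn (fun j jn => hf j (leqW jn)).
set y1 := y0 + n%:R * d in f1 IH *; set y2 := y0 + n.+1%:R * d in f2 *.
have e : y2 = y1 + d by rewrite /y2 /y1 -natr1; ring.
have nd : 0 <= n%:R * d by rewrite mulr_ge0// ltW.
have y01 : y0 <= y1 by rewrite lerDl.
have xx : `|x0 - x0| <= y1 by rewrite subrr normr0; lra.
have yy : y1 <= y2 <= 2 * y1 by rewrite e; apply/andP; split; lra.
have le : y1 <= y2 by case/andP: yy.
apply: (joined_trans (h' := strip_ind x0 y1 y2) IH).
  apply: edge f1 f2 xx yy (or_introl erefl) _ => q Eq nc.
  have := crosses_vertical (q := q) (x0 := x0) le; apply => -[q0 q1].
  have ky z : 0 < z -> 4 * z < K * z by move=> z0; rewrite ltr_pM2r//; rewrite /K; lra.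
  case/andP: q1 => q1 q1'; have q10 : 0 < q 0 1 by lra.
  have k1 := ky _ q10; have y10 : 0 < y1 by lra.
  have k2 := ky _ y10.
  by apply: nc; rewrite /column /= q0 subrr normr0; split; lra.
move=> q; rewrite /strip_ind; case: (x0 < q 0 0) => //=.
have [l|l] := ltP (q 0 1) y1.
  by rewrite (lt_le_trans l le) /= addbF.
by rewrite (le_trans y01 l) /=.
Qed.

Let loop_sum (k k' g p p' q q' : bool) :
  (k (+) (g (+) (p (+) p'))) (+) (k' (+) (g (+) (q (+) q'))) (+) (p' (+) q') =
  k (+) k' (+) (p (+) q).
Proof. by case: k; case: k'; case: g; case: p; case: p'; case: q; case: q'. Qed.

(* The boundary of a large rectangle around the origin of the half-plane: its
   two halves join opposite corners, and strip_ind of the vertical sides sum to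
   the indicator of the rectangle. *)
Lemma rectangle_absurd n : nu = n%:R -> 2 * M0 + 2 <= nu -> False.
Proof.
move=> nuE nuM; have n0 : nu != 0 by rewrite gt_eqF.
have nuV : 0 < nu^-1 by rewrite invr_gt0.
have M01 : 1 < M0.
  have [x E0x] := E0n; apply: le_lt_trans (E0M E0x).
  by apply: cosh_dist_ge1 => //; exact/Epos/E0E.
have nu1 : 1 < nu by lra.
have nV1 : nu^-1 < 1 by rewrite invf_lt1.
have dV : 0 < nu^-1 <= nu^-1 by rewrite nuV lexx.
have dn : 0 < nu^-1 <= nu by rewrite nuV /=; lra.
have ex : - nu + (2 * n * n)%:R * nu^-1 = nu by rewrite !natrM -nuE; field.
(* The vertical sides start at height [nu^-1], already one step above 0, hence one step less. *)
have ey : nu^-1 + (n * n).-1%:R * nu^-1 = nu.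
  have nn : (0 < n * n)%N by rewrite muln_gt0 andbb -(ltr0n R) -nuE.
  by rewrite -subn1 natrB// natrM -nuE; field.
have fb x : far x nu^-1.
  by split=> //; rewrite mulfV//; have := sqr_ge0 x; have := sqr_ge0 (nu^-1); lra.
have ft x : far x nu.
  by split=> //; [lra|rewrite -expr2; have := sqr_ge0 x; lra].
have fs x j : x = nu \/ x = - nu -> far x (nu^-1 + j%:R * nu^-1).
  move=> xnu; have xE : x ^+ 2 = nu ^+ 2 by case: xnu => ->; rewrite ?sqrrN.
  have j0 : 0 <= j%:R * nu^-1 by rewrite mulr_ge0// ltW.
  split; [lra|lra|rewrite xE].
  by have := sqr_ge0 (nu - (nu^-1 + j%:R * nu^-1)); have := sqr_ge0 (nu + (nu^-1 + j%:R * nu^-1)); nra.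
have hb := side_horizontal (x0 := - nu) dV (fun j (_ : (j <= 2 * n * n)%N) => fb _).
have ht := side_horizontal (x0 := - nu) dn (fun j (_ : (j <= 2 * n * n)%N) => ft _).
have vr := side_vertical dV (fun j (_ : (j <= (n * n).-1)%N) => fs nu j (or_introl erefl)).
have vl := side_vertical dV (fun j (_ : (j <= (n * n).-1)%N) => fs (- nu) j (or_intror erefl)).
rewrite ex in hb ht; rewrite ey in vr vl.
have [k1 [k1d [N1 k1f] k10]] := joined_trans hb vr (fun=> erefl).
have [k2 [k2d [N2 k2f] k20]] := joined_trans vl ht (fun=> erefl).
pose h x := strip_ind nu nu^-1 nu x (+) strip_ind (- nu) nu^-1 nu x.
have [z0 E0z] := E0n.
(* The last entry bounds [cosh_dist 0 1] on the rectangle, so a point beyond [m] is outside it, and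
   both [k1] and [k2] vanish there. *)
pose m := Num.max (Num.max N1 N2) (nu * (2 * nu ^+ 2 + 1)).
have [z1 Ez1] := Efar m.
rewrite /m !gt_max => /andP[/andP[l1 l2] l3].
(* Around the closed loop the cocycles cancel, so the sum is locally constant on the connected [E];
   yet it is true at [z0], inside the rectangle, and false at [z1]. *)
have : k1 z1 (+) k2 z1 (+) h z1 = k1 z0 (+) k2 z0 (+) h z0.
  apply: (loc_const_connected (f := fun x => k1 x (+) k2 x (+) h x) cE) => //; last exact: E0E.
  move=> x Ex; apply: filterS2 (k1d x Ex) (k2d x Ex) => y e1 e2 Ey.
  rewrite e1// e2// /h /= !addbF; move: (_ (+) gam _ _ _ _) => g; exact: loop_sum.
rewrite k1f// k2f// k10// k20// /h /strip_ind /=.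
have z0p : 0 < z0 0 1 by exact/Epos/E0E.
have [/ltr_normlP[b1 b2] b3 b4] := cosh_dist_lt ltr01 z0p (E0M E0z).
rewrite [nu < z0 0 0]ltNge (_ : z0 0 0 <= nu); last by lra.
rewrite (_ : - nu < z0 0 0); last by lra.
rewrite (_ : nu^-1 <= z0 0 1); last first.
  rewrite -(ler_pM2l nu_gt0) mulfV//; apply: le_trans (ltW b3) _.
  by rewrite ler_pM2r.
rewrite (_ : z0 0 1 < nu) /=; last by lra.
case Bz : ((nu^-1 <= z1 0 1) && (z1 0 1 < nu)); last by rewrite !andbF.
rewrite !andbT; case/andP: Bz => c1 c2.
case r1 : (nu < z1 0 0) => /=; first by rewrite (_ : - nu < z1 0 0)//; lra.
case r2 : (- nu < z1 0 0) => // _.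
have z1p := Epos Ez1.
move: l3; rewrite /orig cosh_dist_sumE// ltNge => /negP; apply.
rewrite ler_pdivrMr; last by rewrite !mulr_gt0.
rewrite subr0 expr1n !mulr1.
have a1 : z1 0 0 ^+ 2 <= nu ^+ 2.
  rewrite -real_normK ?num_real// ler_pXn2r ?nnegrE ?(ltW nu_gt0)//.
  by apply/ler_normlP; move/negbT: r1; rewrite -leNgt; split; lra.
have a2 : z1 0 1 ^+ 2 <= nu ^+ 2 by rewrite ler_pXn2r ?nnegrE ?(ltW nu_gt0) ?(ltW z1p)// ltW.
have a3 : 1 <= nu * z1 0 1 by rewrite -(mulfV n0) ler_pM2l.
have a4 : 0 <= 2 * nu ^+ 2 + 1 by have := sqr_ge0 nu; lra.
have := ler_wpM2l a4 a3; lra.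
Qed.

End Rectangle.

Lemma carries_far m : exists x0 y0 B,
  [/\ 0 < y0, m < cosh_dist 0 1 (row3 x0 y0 0) & carries x0 y0 B].
Proof.
apply: contrapT => nc.
(* In this order: [E0] is beyond the carry radius of the grid points, [E0] lies inside the
   rectangle, the grid points are farther than [m], and [nu] is positive. Taking [nu] an integer
   makes the grid close up. *)
pose z := Num.max (Num.max (4 * carry_radius * M0) (2 * M0 + 2)) (Num.max (2 * m) 1).
have [n zn] : exists n : nat, z < n%:R.
  by exists (Num.bound `|z|); apply: le_lt_trans (ler_norm _) (archi_boundP (normr_ge0 _)).
pose nu : R := n%:R.
move: zn; rewrite /z !gt_max -/nu => /andP[/andP[z1 z2] /andP[z3 z4]].
have nu0 : 0 < nu by lra.
pose far x0 y0 := [/\ 0 < y0, nu^-1 <= y0 & nu * y0 <= x0 ^+ 2 + y0 ^+ 2 + 1].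
have ex x0 y0 : far x0 y0 -> exists c, (forall x, E x -> additive_at c x) /\
    forall x, E x -> ~ column x0 y0 K x -> exists2 A, nbhs x A &
      forall u w, A u -> A w -> c u w = crosses x0 y0 u w.
  move=> f; have y0p : 0 < y0 by case: f.
  apply: ray_cocycle => // x E0x cx.
  have K1' := K1; have K2 : 1 <= 2 * K by lra.
  have := far_carry z1 f E0x; rewrite ltNge; move/negP; apply.
  apply: column_cosh_dist => //; apply: column_double cx => //.
  - by rewrite subrr normr0 ltW.
  - by rewrite lexx; lra.
  - by left.
have [gam gamP] : exists gam : R -> R -> 'rV[R]_3 -> 'rV[R]_3 -> bool,
    forall x0 y0, far x0 y0 -> (forall x, E x -> additive_at (gam x0 y0) x) /\
    forall x, E x -> ~ column x0 y0 K x -> exists2 A, nbhs x A &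
      forall u w, A u -> A w -> gam x0 y0 u w = crosses x0 y0 u w.
  exists (fun x0 y0 => if pselect (far x0 y0) is left f then sval (cid (ex x0 y0 f)) else fun _ _ => false).
  by move=> x0 y0 f; case: pselect => // f'; exact: svalP (cid (ex x0 y0 f')).
apply: (rectangle_absurd nu0 z1 gamP _ (erefl nu) (ltW z2)).
move=> x0 y0 B f cB; apply: nc; exists x0, y0, B; split=> //; first by case: f.
case: f => y0p _ f; rewrite cosh_dist_sumE ?row3E//.
rewrite ltr_pdivlMr; last by rewrite !mulr_gt0.
rewrite subr0 expr1n !mulr1; apply: lt_le_trans f.
have -> : m * (2 * y0) = (2 * m) * y0 by ring.
by rewrite ltr_pM2r.
Qed.
End End.

(** * The piece between two distant vertical lines *)

Section LinearFunctions.
Variable R : realType.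
Implicit Types (q nu D W : 'rV[R]_3).

(** With this normalization [lin] is the hyperbolic sine of the signed distance to a geodesic
    through [(x0, y0)], and this distance is at most the distance to the point. *)
Lemma lin_vanish_le (x0 y0 a b c : R) q : 0 < y0 -> 0 < q 0 1 ->
  a * x0 + b + c * (x0 ^+ 2 + y0 ^+ 2) = 0 -> a ^+ 2 - 4 * b * c = 1 ->
  1 + lin a b c q ^+ 2 <= cosh_dist x0 y0 q ^+ 2.
Proof.
move=> y0p q1 z disc; have y0n : y0 != 0 by rewrite gt_eqF.
have q1n : q 0 1 != 0 by rewrite gt_eqF.
have bE : b = - (a * x0 + c * (x0 ^+ 2 + y0 ^+ 2)) by move: z; lra.
rewrite -subr_ge0 cosh_dist_sumE//.
pose X := (q 0 0 - x0) / q 0 1.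
pose M := ((q 0 0 - x0) ^+ 2 + q 0 1 ^+ 2 - y0 ^+ 2) / (2 * y0 * q 0 1).
rewrite (_ : _ - _ = (1 - (a ^+ 2 - 4 * b * c)) * (X ^+ 2 + M ^+ 2) +
   (2 * c * y0 * X - (a + 2 * c * x0) * M) ^+ 2); last first.
  by rewrite /lin /X /M bE; field; rewrite y0n q1n.
by rewrite disc subrr mul0r add0r sqr_ge0.
Qed.

(** The coefficients are the cross product of the vectors of the two points in the hyperboloid
    model, divided by its norm. The last identity is the Gram determinant of three points; it
    relates the distance to the geodesic with the distances to the two points. *)
Lemma geodesic_equation (x1 y1 x2 y2 t : R) : 0 < y1 -> 0 < y2 ->
  let d := cosh_dist x1 y1 (row3 x2 y2 t) in 1 < d ->
  exists a b c, [/\ a * x1 + b + c * (x1 ^+ 2 + y1 ^+ 2) = 0,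
    a * x2 + b + c * (x2 ^+ 2 + y2 ^+ 2) = 0, a ^+ 2 - 4 * b * c = 1 &
    forall q, 0 < q 0 1 -> (1 + lin a b c q ^+ 2) * (d ^+ 2 - 1) =
      2 * d * cosh_dist x1 y1 q * cosh_dist x2 y2 q - cosh_dist x1 y1 q ^+ 2 - cosh_dist x2 y2 q ^+ 2].
Proof.
move=> y1p y2p d d1; have y1n : y1 != 0 by rewrite gt_eqF.
have y2n : y2 != 0 by rewrite gt_eqF.
pose n1 := x1 ^+ 2 + y1 ^+ 2; pose n2 := x2 ^+ 2 + y2 ^+ 2.
have d2 : 0 < d ^+ 2 - 1 by rewrite subr_gt0 -(expr1n _ 2) ltr_pXn2r// nnegrE; lra.
pose s := Num.sqrt (d ^+ 2 - 1).
have s2 : s ^+ 2 = d ^+ 2 - 1 by rewrite sqr_sqrtr// ltW.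
have s0 : 0 < s by rewrite sqrtr_gt0.
have sn : s != 0 by rewrite gt_eqF.
have dE : d = ((x2 - x1) ^+ 2 + y2 ^+ 2 + y1 ^+ 2) / (2 * y1 * y2).
  by rewrite /d cosh_dist_sumE ?row3E.
pose r := 2 * y1 * y2 * s.
have rn : r != 0 by rewrite gt_eqF// !mulr_gt0.
have r2 : r ^+ 2 = 4 * y1 ^+ 2 * y2 ^+ 2 * (d ^+ 2 - 1) by rewrite /r -s2; ring.
exists ((n2 - n1) / r), ((n1 * x2 - n2 * x1) / r), ((x1 - x2) / r); split.
- by rewrite /n1 /n2; field.
- by rewrite /n1 /n2; field.
- rewrite (_ : _ - _ = ((n2 - n1) ^+ 2 - 4 * (n1 * x2 - n2 * x1) * (x1 - x2)) / r ^+ 2); last by field.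
  have -> : (n2 - n1) ^+ 2 - 4 * (n1 * x2 - n2 * x1) * (x1 - x2) = r ^+ 2.
    by rewrite r2 dE /n1 /n2; field; rewrite y1n y2n.
  by rewrite divff// expf_neq0.
- move=> q q1; have qn : q 0 1 != 0 by rewrite gt_eqF.
  rewrite mulrDl mul1r.
  rewrite (_ : lin _ _ _ q ^+ 2 * _ = lin (n2 - n1) (n1 * x2 - n2 * x1) (x1 - x2) q ^+ 2 / (4 * y1 ^+ 2 * y2 ^+ 2)).
    by rewrite !cosh_dist_sumE// dE /lin /n1 /n2; field; rewrite y1n y2n qn.
  have dn : d ^+ 2 - 1 != 0 by rewrite gt_eqF.
  rewrite (_ : lin _ _ _ q ^+ 2 = lin (n2 - n1) (n1 * x2 - n2 * x1) (x1 - x2) q ^+ 2 / r ^+ 2); last first.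
    by rewrite /lin; field; rewrite rn qn.
  by rewrite r2; field; rewrite y1n y2n dn.
Qed.

(** The sum is again of the form [lin], with negative discriminant, so [dlin_norm] bounds its
    gradient by its value. *)
Lemma cosh_distD_disc (x1 y1 x2 y2 : R) q : 0 < y1 -> 0 < y2 -> 0 < q 0 1 ->
  exists W : 'rV[R]_3, [/\ W 0 2 = 0,
    dot W W <= (cosh_dist x1 y1 q + cosh_dist x2 y2 q) ^+ 2 &
    has_hessian (fun q => cosh_dist x1 y1 q + cosh_dist x2 y2 q) q W
      ((cosh_dist x1 y1 q + cosh_dist x2 y2 q) *: horiz R)].
Proof.
move=> y1p y2p q1; have y1n : y1 != 0 by rewrite gt_eqF.
have y2n : y2 != 0 by rewrite gt_eqF.
have qn : q 0 1 != 0 by rewrite gt_eqF.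
pose a := - x1 / y1 + - x2 / y2.
pose b := (x1 ^+ 2 + y1 ^+ 2) / (2 * y1) + (x2 ^+ 2 + y2 ^+ 2) / (2 * y2).
pose c := (2 * y1)^-1 + (2 * y2)^-1.
have sE : (fun q => cosh_dist x1 y1 q + cosh_dist x2 y2 q) = lin a b c.
  by apply/funext => u; rewrite /cosh_dist /lin /a /b /c -mulrDl; congr (_ / _); ring.
exists (dlin a b c q); split; first by rewrite row3E.
  rewrite dlin_norm// -[X in X q ^+ 2]sE gerDl.
  rewrite (_ : _ - _ = - (2 + ((x1 - x2) ^+ 2 + y1 ^+ 2 + y2 ^+ 2) / (y1 * y2))); last first.
    by rewrite /a /b /c; field; rewrite y1n y2n.
  by rewrite oppr_le0 addr_ge0// divr_ge0 ?addr_ge0 ?sqr_ge0// mulr_ge0 ?ltW.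
by rewrite sE; have := has_hessian_lin a b c qn; rewrite -[X in X q *: _]sE.
Qed.

End LinearFunctions.

(** * The inequalities at a contact with the comparison functions *)

Section ContactAlgebra.
Variables (R : realType) (H : R).
Hypotheses (H_ge0 : 0 <= H) (H_le : H <= 1 / 2).
Implicit Types (nu D W : 'rV[R]_3).

Lemma dot_horizontal nu D : D 0 2 = 0 -> dot nu D = nu 0 0 * D 0 0 + nu 0 1 * D 0 1.
Proof. by move=> h; rewrite dot3E h mulr0 addr0. Qed.

(** The form in which [H <= 1 / 2] enters the contact arguments, whatever the sign of [lam]. *)
Lemma cube_bound (lam : R) : - `|lam| ^+ 3 <= 2 * H * lam ^+ 3.
Proof.
have a3 : `|lam ^+ 3| = `|lam| ^+ 3 by rewrite normrX.
have b3 : `|2 * H * lam ^+ 3| <= `|lam| ^+ 3.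
  have H0 := H_ge0; have H1 := H_le.
  rewrite normrM a3 ger0_norm ?mulr_ge0//.
  by apply: ler_piMl; [exact: exprn_ge0|lra].
by have := ler_norm (- (2 * H * lam ^+ 3)); rewrite normrN; lra.
Qed.

(** Contact with a level set of [ln (cosh s) + kap t ^ 2 / 2], where [v = sinh s]. The cylinder at
    distance [s] from the geodesic has mean curvature [tanh s / 2], slightly less than [1 / 2]; the
    height term makes up for the defect, of order [eta], once [kap >= 4 * eta]. The unsimplified
    coefficients are those that [has_hessian_comp] produces. *)
Lemma hull_absurd (v t kap l lam : R) D nu : D 0 2 = 0 -> dot D D = v ^+ 2 + 1 ->
  dot nu nu = 1 -> `|t| <= l -> 0 < kap -> kap * (l ^+ 2 + 1) <= 1 / 2 -> 4 <= kap * (1 + v ^+ 2) ->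
  (v / (1 + v ^+ 2)) *: D + (2 * (2^-1 * kap) * (t - 0)) *: row3 0 0 1 = lam *: nu ->
  ttrace nu (((v / (1 + v ^+ 2)) *: (v *: horiz R) + ((1 - v ^+ 2) / (1 + v ^+ 2) ^+ 2) *: (D^T *m D)) +
   ((2 * (2^-1 * kap) * (t - 0)) *: 0 + (2 * (2^-1 * kap)) *: ((row3 0 0 1)^T *m row3 0 0 1)))
   + 2 * H * lam <= 0 -> False.
Proof.
move=> D2 DD nn tl k0 kl kv Pe.
have H0 := H_ge0; have H1 := H_le.
pose C := 1 + v ^+ 2; have C0 : 0 < C by rewrite ltr_pwDl// sqr_ge0.
have Cn : C != 0 by rewrite gt_eqF.
have e0 : v / C * D 0 0 = lam * nu 0 0.
  by have := congr1 (fun u : 'rV[R]_3 => u 0 0) Pe; rewrite !mxE /= mulr0 addr0.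
have e1 : v / C * D 0 1 = lam * nu 0 1.
  by have := congr1 (fun u : 'rV[R]_3 => u 0 1) Pe; rewrite !mxE /= mulr0 addr0.
have e2 : kap * t = lam * nu 0 2.
  have := congr1 (fun u : 'rV[R]_3 => u 0 2) Pe; rewrite !mxE /= D2 mulr0 add0r => <-.
  by field.
have DE : D 0 0 ^+ 2 + D 0 1 ^+ 2 = C by rewrite /C [RHS]addrC -DD dot_horizontal// !expr2.
have nE : nu 0 0 ^+ 2 + nu 0 1 ^+ 2 + nu 0 2 ^+ 2 = 1 by rewrite -nn dot3E !expr2.
rewrite !ttraceD !ttraceZ !ttrace0 !ttrace_horiz !ttrace_outer DD.
rewrite (dot_horizontal _ D2) !dot3E !row3E !mulr0 !mulr1 !add0r -/C => rel.
have v2 : v ^+ 2 = C - 1 by rewrite /C addrC addKr.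
pose eta := C^-1; have eta0 : 0 < eta by rewrite invr_gt0.
have Ceta : C * eta = 1 by rewrite mulfV.
pose ta := kap * t.
have hs : lam ^+ 2 * (nu 0 0 ^+ 2 + nu 0 1 ^+ 2) = 1 - eta.
  rewrite mulrDr -!exprMn -e0 -e1 !exprMn -mulrDr DE v2 /eta; field.
  by rewrite Cn.
have hd : lam * (nu 0 0 * D 0 0 + nu 0 1 * D 0 1) = v.
  rewrite (_ : _ * _ = v / C * (D 0 0 ^+ 2 + D 0 1 ^+ 2)); last first.
    by rewrite mulrDr !mulrA -e0 -e1; ring.
  rewrite DE; field.
  by rewrite Cn.
have hl : lam ^+ 2 = 1 - eta + ta ^+ 2.
  have := congr1 (fun z => lam ^+ 2 * z) nE.
  by rewrite /= mulr1 mulrDr hs -exprMn -e2 -/ta => <-.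
set d := nu 0 0 * D 0 0 + nu 0 1 * D 0 1 in hd rel.
set hh := nu 0 0 ^+ 2 + nu 0 1 ^+ 2 in hs rel.
(* After multiplication by [lam ^+ 2] the relation contains [nu] only through [lam *: nu], which the
   contact equation determines. *)
have main : lam ^+ 2 + (1 - eta) * (kap - eta) + 2 * H * lam ^+ 3 <= 0.
  have l2 := sqr_ge0 lam.
  have := mulr_ge0_le0 l2 rel.
  set L := lam ^+ 2 * _; have -> // : L = lam ^+ 2 + (1 - eta) * (kap - eta) + 2 * H * lam ^+ 3.
  rewrite /L.
  have n22 : lam ^+ 2 * nu 0 2 ^+ 2 = ta ^+ 2 by rewrite -exprMn -e2.
  have d2 : lam ^+ 2 * d ^+ 2 = C - 1 by rewrite -exprMn hd.
  have -> : lam ^+ 2 * (v / C * (v * (2 - hh)) + (1 - v ^+ 2) / C ^+ 2 * (v ^+ 2 + 1 - d ^+ 2) +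
     2 * (2^-1 * kap) * (1 - nu 0 2 ^+ 2) + 2 * H * lam) =
     v ^+ 2 / C * (2 * lam ^+ 2 - lam ^+ 2 * hh) + (1 - v ^+ 2) / C ^+ 2 * (lam ^+ 2 * (v ^+ 2 + 1) - lam ^+ 2 * d ^+ 2)
     + kap * (lam ^+ 2 - lam ^+ 2 * nu 0 2 ^+ 2) + 2 * H * lam ^+ 3.
    by field; rewrite Cn.
  rewrite hs d2 n22 v2 hl.
  have -> : C = eta^-1 by rewrite /eta invrK.
  by field; rewrite gt_eqF.
have l0 : 0 <= `|lam| by [].
have n2 : `|lam| ^+ 2 = lam ^+ 2 by rewrite real_normK ?num_real.
have n3 := cube_bound lam.
have k1 : kap <= 1 / 2 by have := mulr_ge0 (ltW k0) (sqr_ge0 l); lra.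
have ek : 4 * eta <= kap by rewrite -(ler_pM2l C0) mulrCA Ceta mulr1 [C * _]mulrC.
have t2 : ta ^+ 2 <= kap / 2.
  have tl2 : t ^+ 2 <= l ^+ 2.
    by rewrite -(real_normK (num_real t)) ler_pXn2r ?nnegrE// (le_trans _ tl).
  have kt : kap * t ^+ 2 <= kap * l ^+ 2 by rewrite ler_pM2l.
  have : kap * (kap * t ^+ 2) <= kap * (1 / 2) by rewrite ler_pM2l//; lra.
  rewrite /ta exprMn; lra.
set m := `|lam| in l0 n2 n3.
have t0 := sqr_ge0 ta.
(* The bound [2 * m <= m ^+ 2 + 1] removes the odd power of [lam]. *)
have s1 : m ^+ 3 - m ^+ 2 <= (m ^+ 2) * (m ^+ 2 - 1) / 2.
  rewrite -subr_ge0 (_ : _ - _ = m ^+ 2 * (m - 1) ^+ 2 / 2); last by field.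
  by rewrite divr_ge0// mulr_ge0 ?sqr_ge0.
rewrite n2 hl in s1.
have s3 : (1 - eta) * (kap - eta) <= (1 - eta + ta ^+ 2) * (ta ^+ 2 - eta) / 2.
  by move: main n3 s1; rewrite hl; lra.
have s4 : (1 - eta + ta ^+ 2) * (ta ^+ 2 - eta) <= 5 / 4 * ta ^+ 2 by clear -t0 t2 k1 eta0 ek; nra.
have s5 : 7 / 8 * (3 / 4 * kap) <= (1 - eta) * (kap - eta).
  by clear -k0 k1 ek eta0; apply: ler_pM; lra.
by clear -s3 s4 s5 t2 k0; lra.
Qed.

End ContactAlgebra.

Section PinchAlgebra.
Variable R : realType.

(** For [e = 0] the expression is identically zero. Its first order term is [- 2 * C * e], and the
    rest is at most [e ^+ 2 * (6 * V ^+ 4)], which the choice of [e] makes equal to [e]. *)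
Lemma pinch_unperturbed (V : R) : 1 <= V -> exists2 e : R, 0 < e <= 1 &
  forall v C g : R, 0 < C -> C ^+ 2 = 1 + v ^+ 2 -> C ^+ 2 <= V -> g = v * (C^-1 + e) ->
    (1 + g ^+ 2 * C ^+ 2) ^+ 2 + C ^+ 2 * (1 + g ^+ 2 * C ^+ 2) -
    2 * C * (g * v * (2 + g ^+ 2 * C ^+ 2) + (C ^- 3 + e) * C ^+ 2) <= - e.
Proof.
move=> V1; have V4 : 1 <= V ^+ 4 by rewrite exprn_ege1.
have p6 : 0 < 6 * V ^+ 4 by lra.
exists ((6 * V ^+ 4)^-1).
  by rewrite invr_gt0 p6 invf_le1//; lra.
set e := (6 * V ^+ 4)^-1; have e0 : 0 < e by rewrite invr_gt0.
have e1 : e <= 1 by rewrite invf_le1//; lra.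
have eV : e * (6 * V ^+ 4) = 1 by rewrite mulVf// gt_eqF.
move=> v C g C0 C2 CV gE; have Cn : C != 0 by rewrite gt_eqF.
have x0 := sqr_ge0 v; pose x := v ^+ 2.
have xV : x <= V by rewrite /x; lra.
have C1 : 1 <= C.
  rewrite leNgt; apply/negP => C1; have : C * C < 1 * 1 by apply: ltr_pM => //; apply: ltW.
  by rewrite -expr2 C2 mulr1 => l; lra.
have gg : g ^+ 2 = x * (C^-1 + e) ^+ 2 by rewrite gE exprMn.
have gv : g * v = x * (C^-1 + e) by rewrite gE /x; ring.
rewrite gg gv.
have xE : x = C ^+ 2 - 1 by rewrite C2 /x; ring.
rewrite (_ : _ - _ = - (2 * C * e - e ^+ 2 * (3 * x * C ^+ 4 - 2 * x ^+ 2 * C ^+ 2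
   + 2 * e * (x ^+ 2 * C ^+ 3) + e ^+ 2 * (x ^+ 2 * C ^+ 4)))); last first.
  by rewrite xE; field.
have V0 : 0 <= V by lra.
have xx0 : 0 <= x by [].
have C40 : 0 <= C ^+ 4 by rewrite exprn_ge0// ltW.
have C4 : C ^+ 4 <= V ^+ 2.
  by rewrite (exprM C 2 2) ler_pXn2r// nnegrE exprn_ge0// ltW.
have C3 : C ^+ 3 <= C ^+ 4 by rewrite [C ^+ 4]exprSr ler_peMr// exprn_ge0// ltW.
have C30 : 0 <= C ^+ 3 by rewrite exprn_ge0// ltW.
have x2 : x ^+ 2 <= V ^+ 2 by rewrite ler_pXn2r// nnegrE.
have x20 := sqr_ge0 x.
have V3 : V ^+ 3 <= V ^+ 4 by rewrite [V ^+ 4]exprSr ler_peMr// exprn_ge0.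
have m1 : x * C ^+ 4 <= V ^+ 3 by rewrite exprS; apply: ler_pM.
have m2 : x ^+ 2 * C ^+ 4 <= V ^+ 4 by rewrite (exprD V 2 2); apply: ler_pM.
have m3 : x ^+ 2 * C ^+ 3 <= V ^+ 4 by apply: le_trans m2; rewrite ler_wpM2l.
have m30 : 0 <= x ^+ 2 * C ^+ 3 by rewrite mulr_ge0.
have m4 : 0 <= x ^+ 2 * C ^+ 2 by rewrite mulr_ge0// sqr_ge0.
have m20 : 0 <= x ^+ 2 * C ^+ 4 by rewrite mulr_ge0.
have e2 : e ^+ 2 <= 1 by rewrite expr_le1// ltW.
have m5 : e * (x ^+ 2 * C ^+ 3) <= V ^+ 4 by apply: le_trans m3; rewrite ler_piMl.
have m6 : e ^+ 2 * (x ^+ 2 * C ^+ 4) <= V ^+ 4 by apply: le_trans m2; rewrite ler_piMl.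
set Z := 3 * x * C ^+ 4 - _ + _ + _.
have ZV : Z <= 6 * V ^+ 4 by rewrite /Z -[3 * x * _]mulrA -[2 * e * _]mulrA -[2 * x ^+ 2 * _]mulrA; lra.
have : e ^+ 2 * Z <= e ^+ 2 * (6 * V ^+ 4) by rewrite ler_wpM2l// sqr_ge0.
have -> : e ^+ 2 * (6 * V ^+ 4) = e by rewrite expr2 -mulrA eV mulr1.
have : e <= C * e by rewrite ler_peMl// ltW.
lra.
Qed.

Let bndD (x y A B : R) : `|x| <= A -> `|y| <= B -> `|x + y| <= A + B.
Proof. by move=> xA yB; apply: le_trans (ler_normD _ _) _; exact: lerD. Qed.

Let bndN (x A : R) : `|x| <= A -> `| - x| <= A.
Proof. by rewrite normrN. Qed.

Let bndM (x y A B : R) : `|x| <= A -> `|y| <= B -> `|x * y| <= A * B.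
Proof. by move=> xA yB; rewrite normrM; exact: ler_pM. Qed.

Let bndX (x A : R) : `|x| <= A -> `|x ^+ 2| <= A * A.
Proof. by move=> xA; rewrite expr2; exact: bndM. Qed.

(* The increment, divided by eps, of the expression in pinch_unperturbed when
   - eps * ln w is added to the function; d and o are the inner products of dw / w
   with dv and with itself. *)
Lemma pinch_perturbation (V : R) : exists2 K : R, 0 <= K &
  forall g C d o h v eps Y X0 X : R, `|g| <= V -> `|C| <= V -> `|d| <= V -> `|o| <= V -> `|h| <= V ->
  `|v| <= V -> `|eps| <= V ->
  Y = - 2 * g * d + eps * o -> X0 = 1 + g ^+ 2 * C ^+ 2 -> X = X0 + eps * Y ->
  `| 2 * X0 * Y + eps * Y ^+ 2 + C ^+ 2 * Y -
   2 * C * (g * v * Y + h * (C ^+ 2 * Y + 2 * g * C ^+ 2 * d - eps * d ^+ 2) -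
     (X + 1 - (o * X - (g * d - eps * o) ^+ 2)))| <= K.
Proof.
have [K KP] : exists K : R,
  forall g C d o h v eps Y X0 X : R, `|g| <= V -> `|C| <= V -> `|d| <= V -> `|o| <= V -> `|h| <= V ->
  `|v| <= V -> `|eps| <= V ->
  Y = - 2 * g * d + eps * o -> X0 = 1 + g ^+ 2 * C ^+ 2 -> X = X0 + eps * Y ->
  `| 2 * X0 * Y + eps * Y ^+ 2 + C ^+ 2 * Y -
   2 * C * (g * v * Y + h * (C ^+ 2 * Y + 2 * g * C ^+ 2 * d - eps * d ^+ 2) -
     (X + 1 - (o * X - (g * d - eps * o) ^+ 2)))| <= K.
  (* The constant is left to unification: the rules follow the syntax of the expression and assemble
     a bound that depends on [V] only. *)
  eexists=> g C d o h v eps Y X0 X bg bC bd bo bh bv be -> -> ->.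
  have b1 : `|1 : R| <= 1 by rewrite normr1.
  have b2 : `|2 : R| <= 2 by rewrite normr_nat.
  repeat first [exact: bg | exact: bC | exact: bd | exact: bo | exact: bh | exact: bv | exact: be | exact: b1 | exact: b2
    | apply: bndX | apply: bndN | apply: bndD | apply: bndM].
exists (Num.max K 0); first by rewrite le_max lexx orbT.
move=> g C d o h v eps Y X0 X bg bC bd bo bh bv be YE X0E XE.
by rewrite le_max KP.
Qed.

End PinchAlgebra.

Section Pinch.
Variables (R : realType) (H : R).
Hypotheses (H_ge0 : 0 <= H) (H_le : H <= 1 / 2).
Implicit Types (nu D W : 'rV[R]_3).

Let pinch_bounds (V e eps C v d o : R) : 1 <= V -> 0 < e <= 1 -> 0 < eps <= 1 -> 1 <= C ->
  C ^+ 2 <= V -> v ^+ 2 <= C ^+ 2 -> d ^+ 2 <= C ^+ 2 -> 0 <= o <= 1 ->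
  [/\ `|v * (C^-1 + e)| <= 2 * V, `|C| <= 2 * V, `|d| <= 2 * V, `|o| <= 2 * V &
    [/\ `|C ^- 3 + e| <= 2 * V, `|v| <= 2 * V & `|eps| <= 2 * V]].
Proof.
move=> V1 /andP[e0 e1] /andP[eps0 eps1] C1 C2V vC dC /andP[ o0 o1].
have C0 : 0 < C by lra.
have CV : C <= V by apply: le_trans C2V; rewrite expr2 ler_peMl// ltW.
have nv : `|v| <= C by rewrite -(ler_pXn2r (n := 2)) ?nnegrE ?(ltW C0)// real_normK ?num_real.
have nd : `|d| <= C by rewrite -(ler_pXn2r (n := 2)) ?nnegrE ?(ltW C0)// real_normK ?num_real.
have iC : C^-1 <= 1 by rewrite invf_le1.
have iC0 : 0 < C^-1 by rewrite invr_gt0.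
have i3 : C ^- 3 <= 1 by rewrite -exprVn exprn_ile1// ltW.
have i30 : 0 <= C ^- 3 by rewrite -exprVn exprn_ge0// ltW.
split; last split.
- rewrite normrM [X in _ * X]ger0_norm; last by lra.
  by rewrite mulrC; apply: ler_pM => //; lra.
- by rewrite gtr0_norm//; lra.
- lra.
- by rewrite ger0_norm//; lra.
- by rewrite ger0_norm; lra.
- lra.
- by rewrite gtr0_norm//; lra.
Qed.

(* The level sets of t + sqrt (1 + v ^ 2) have mean curvature exactly 1 / 2, so
   that for me = (0, 0) the last inequality is an equality; the term in me.1 makes
   it fail by a margin that absorbs the term in me.2. *)
Lemma pinch_absurd (V : R) : 1 <= V -> exists2 me : R * R, 0 < me.1 <= 1 /\ 0 < me.2 &
  forall (v w lam : R) D W nu, D 0 2 = 0 -> W 0 2 = 0 -> dot D D = v ^+ 2 + 1 -> 1 + v ^+ 2 <= V ->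
  0 < w -> dot W W <= w ^+ 2 -> dot nu nu = 1 ->
  (1 *: row3 0 0 1 + (v / Num.sqrt (1 + v ^+ 2) + 2 * me.1 * v) *: D) + (- me.2 / w) *: W = lam *: nu ->
  ttrace nu (((1 *: 0 + 0 *: ((row3 0 0 1)^T *m row3 0 0 1)) +
     ((v / Num.sqrt (1 + v ^+ 2) + 2 * me.1 * v) *: (v *: horiz R) +
      (Num.sqrt (1 + v ^+ 2) ^- 3 + 2 * me.1) *: (D^T *m D))) +
     ((- me.2 / w) *: (w *: horiz R) + (- - me.2 / w ^+ 2) *: (W^T *m W))) + 2 * H * lam <= 0 -> False.
Proof.
move=> V1; have [e /andP[e0 e1] eP] := pinch_unperturbed V1.
have [K K0 KP] := pinch_perturbation (2 * V).
have K1 : 0 < 2 * (K + 1) by lra.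
(* The perturbation costs at most [eps * K], less than half of the margin [e]. *)
pose eps := e / (2 * (K + 1)); have eps0 : 0 < eps by rewrite divr_gt0.
have epsK : 2 * (K + 1) * eps = e by rewrite mulrC divfK// gt_eqF.
have eps1 : eps <= 1 by have := mulr_ge0 K0 (ltW eps0); lra.
(* The derivative of [m * v ^+ 2] is [2 * m * v], hence [m = e / 2]. *)
exists (e / 2, eps) => /=; first by split=> //; lra.
move=> v w lam D W nu D2 W2 DD vV w0 WW nn Pe.
set C := Num.sqrt (1 + v ^+ 2) in Pe *.
have p1 : 0 < 1 + v ^+ 2 by rewrite ltr_pwDl// sqr_ge0.
have C0 : 0 < C by rewrite sqrtr_gt0.
have C2 : C ^+ 2 = 1 + v ^+ 2 by rewrite sqr_sqrtr// ltW.
have Cn : C != 0 by rewrite gt_eqF.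
have wn : w != 0 by rewrite gt_eqF.
have x0 := sqr_ge0 v.
have C1 : 1 <= C.
  rewrite leNgt; apply/negP => C1; have : C * C < 1 * 1 by apply: ltr_pM => //; apply: ltW.
  by rewrite -expr2 C2 mulr1; lra.
have e2E : 2 * (e / 2) = e by field.
rewrite e2E in Pe *.
pose g := v * (C^-1 + e); have gE : v / C + e * v = g by rewrite /g; ring.
pose h := C ^- 3 + e; rewrite gE in Pe *; rewrite -/h.
pose o := dot W W / w ^+ 2; pose d := dot D W / w.
have w2 : 0 < w ^+ 2 by rewrite exprn_gt0.
have WE : dot W W = o * w ^+ 2 by rewrite /o divfK// gt_eqF.
have o0 : 0 <= o by rewrite divr_ge0 ?dot_ge0// ltW.
have o1 : o <= 1 by rewrite ler_pdivrMr// mul1r.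
have dE : dot D W = d * w by rewrite /d divfK.
have E0 : g * D 0 0 - eps / w * W 0 0 = lam * nu 0 0.
  have := congr1 (fun u : 'rV[R]_3 => u 0 0) Pe; rewrite !mxE /= => <-; ring.
have E1 : g * D 0 1 - eps / w * W 0 1 = lam * nu 0 1.
  have := congr1 (fun u : 'rV[R]_3 => u 0 1) Pe; rewrite !mxE /= => <-; ring.
have E2 : 1 = lam * nu 0 2.
  have := congr1 (fun u : 'rV[R]_3 => u 0 2) Pe; rewrite !mxE /= D2 W2 => <-; ring.
have DE : D 0 0 ^+ 2 + D 0 1 ^+ 2 = C ^+ 2 by rewrite C2 [RHS]addrC -DD dot_horizontal// !expr2.
have WWE : W 0 0 ^+ 2 + W 0 1 ^+ 2 = o * w ^+ 2 by rewrite -WE dot_horizontal// !expr2.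
have DWE : D 0 0 * W 0 0 + D 0 1 * W 0 1 = d * w by rewrite -dE dot_horizontal.
have nE : nu 0 0 ^+ 2 + nu 0 1 ^+ 2 + nu 0 2 ^+ 2 = 1 by rewrite -nn dot3E !expr2.
have dC : d ^+ 2 <= C ^+ 2.
  have : (d * w) ^+ 2 <= C ^+ 2 * (o * w ^+ 2).
    rewrite -DWE -DE -WWE -subr_ge0 (_ : _ - _ = (D 0 0 * W 0 1 - D 0 1 * W 0 0) ^+ 2); last by ring.
    exact: sqr_ge0.
  rewrite [(d * w) ^+ 2]exprMn [C ^+ 2 * (o * _)]mulrA (ler_pM2r w2) => le; apply: le_trans le _.
  by rewrite ler_piMr// sqr_ge0.
pose Y := - 2 * g * d + eps * o; pose X0 := 1 + g ^+ 2 * C ^+ 2; pose X := X0 + eps * Y.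
have hs : lam ^+ 2 * (nu 0 0 ^+ 2 + nu 0 1 ^+ 2) = X - 1.
  rewrite mulrDr -!exprMn -E0 -E1.
  rewrite [LHS](_ : _ = g ^+ 2 * (D 0 0 ^+ 2 + D 0 1 ^+ 2) - 2 * g * eps / w * (D 0 0 * W 0 0 + D 0 1 * W 0 1) +
    eps ^+ 2 / w ^+ 2 * (W 0 0 ^+ 2 + W 0 1 ^+ 2)); last by field.
  by rewrite DE WWE DWE /X /X0 /Y; field.
have hl : lam ^+ 2 = X.
  have := congr1 (fun z => lam ^+ 2 * z) nE.
  by rewrite /= mulr1 mulrDr hs -exprMn -E2 expr1n subrK.
have hD : lam * (nu 0 0 * D 0 0 + nu 0 1 * D 0 1) = g * C ^+ 2 - eps * d.
  rewrite mulrDr [lam * (nu 0 0 * _)]mulrA [lam * (nu 0 1 * _)]mulrA -E0 -E1.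
  rewrite [LHS](_ : _ = g * (D 0 0 ^+ 2 + D 0 1 ^+ 2) - eps / w * (D 0 0 * W 0 0 + D 0 1 * W 0 1)); last by ring.
  by rewrite DE DWE; field.
have hW : lam * (nu 0 0 * W 0 0 + nu 0 1 * W 0 1) = (g * d - eps * o) * w.
  rewrite mulrDr [lam * (nu 0 0 * _)]mulrA [lam * (nu 0 1 * _)]mulrA -E0 -E1.
  rewrite [LHS](_ : _ = g * (D 0 0 * W 0 0 + D 0 1 * W 0 1) - eps / w * (W 0 0 ^+ 2 + W 0 1 ^+ 2)); last by ring.
  by rewrite WWE DWE; field.
rewrite !ttraceD !ttraceZ !ttrace0 !ttrace_horiz !ttrace_outer DD WE.
rewrite (dot_horizontal nu D2) (dot_horizontal nu W2) !mulr0 mul0r !add0r => rel.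
set nD := nu 0 0 * D 0 0 + _ in hD rel; set nW := nu 0 0 * W 0 0 + _ in hW rel.
set hh := nu 0 0 ^+ 2 + _ in hs rel.
pose T := g * v * (X + 1) + h * (C ^+ 2 * X - (g * C ^+ 2 - eps * d) ^+ 2) -
  eps * (X + 1 - (o * X - (g * d - eps * o) ^+ 2)).
have main : T + 2 * H * lam ^+ 3 <= 0.
  have := mulr_ge0_le0 (sqr_ge0 lam) rel; set L := lam ^+ 2 * _.
  have -> // : L = T + 2 * H * lam ^+ 3.
  have nD2 : lam ^+ 2 * nD ^+ 2 = (g * C ^+ 2 - eps * d) ^+ 2 by rewrite -exprMn hD.
  have nW2 : lam ^+ 2 * nW ^+ 2 = ((g * d - eps * o) * w) ^+ 2 by rewrite -exprMn hW.
  rewrite /L (_ : lam ^+ 2 * _ = g * v * (2 * lam ^+ 2 - lam ^+ 2 * hh) +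
    h * (lam ^+ 2 * (v ^+ 2 + 1) - lam ^+ 2 * nD ^+ 2) - eps * (2 * lam ^+ 2 - lam ^+ 2 * hh)
    + eps / w ^+ 2 * (lam ^+ 2 * (o * w ^+ 2) - lam ^+ 2 * nW ^+ 2) + 2 * H * lam ^+ 3); last by field.
  by rewrite hs nD2 nW2 hl /T C2; field.
have l0 : 0 <= `|lam| by [].
have n2 : `|lam| ^+ 2 = X by rewrite real_normK ?num_real.
have X0' : 0 <= X by rewrite -hl sqr_ge0.
have n3 := cube_bound H_ge0 H_le lam.
(* This is [2 * C * m <= m ^+ 2 + C ^+ 2] for the absolute value [m] of [lam]. It is an equality for
   the unperturbed function, where [m = C], so nothing of the margin is lost. *)
have s1 : 2 * C * `|lam| ^+ 3 <= X * (X + C ^+ 2).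
  rewrite -n2 -subr_ge0 (_ : _ - _ = `|lam| ^+ 2 * (`|lam| - C) ^+ 2); last by ring.
  by rewrite mulr_ge0 ?sqr_ge0.
have fin : 0 <= X ^+ 2 + C ^+ 2 * X - 2 * C * T.
  have : 2 * C * T <= 2 * C * `|lam| ^+ 3 by apply: ler_wpM2l; [rewrite mulr_ge0// ltW|lra].
  move=> hT; rewrite subr_ge0; apply: le_trans hT (le_trans s1 _).
  by rewrite (_ : X * (X + C ^+ 2) = X ^+ 2 + C ^+ 2 * X) ?lexx//; ring.
have C2V : C ^+ 2 <= V by rewrite C2.
have := eP v C g C0 C2 C2V erefl; rewrite -/h => base.
have [bg bC bd bo [bh bv be]] : [/\ `|g| <= 2 * V, `|C| <= 2 * V, `|d| <= 2 * V, `|o| <= 2 * V &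
    [/\ `|h| <= 2 * V, `|v| <= 2 * V & `|eps| <= 2 * V]].
  have vC : v ^+ 2 <= C ^+ 2 by rewrite C2 lerDr.
  by apply: pinch_bounds => //; rewrite ?o0 ?e0 ?eps0.
have := KP g C d o h v eps Y X0 X bg bC bd bo bh bv be erefl erefl erefl.
set Z := `|_| => ZK.
have := ler_norm (2 * X0 * Y + eps * Y ^+ 2 + C ^+ 2 * Y -
   2 * C * (g * v * Y + h * (C ^+ 2 * Y + 2 * g * C ^+ 2 * d - eps * d ^+ 2) -
     (X + 1 - (o * X - (g * d - eps * o) ^+ 2)))).
rewrite -/Z => le1; have le2 := le_trans le1 ZK.
have := ler_wpM2l (ltW eps0) le2.
have E3 : X ^+ 2 + C ^+ 2 * X - 2 * C * T = ((1 + g ^+ 2 * C ^+ 2) ^+ 2 + C ^+ 2 * (1 + g ^+ 2 * C ^+ 2) -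
    2 * C * (g * v * (2 + g ^+ 2 * C ^+ 2) + h * C ^+ 2)) + eps * (2 * X0 * Y + eps * Y ^+ 2 + C ^+ 2 * Y -
   2 * C * (g * v * Y + h * (C ^+ 2 * Y + 2 * g * C ^+ 2 * d - eps * d ^+ 2) -
     (X + 1 - (o * X - (g * d - eps * o) ^+ 2)))).
  by rewrite /T /X /X0; ring.
move: fin; rewrite E3; set Q := 2 * X0 * Y + _ => h1 h2; clear -h1 h2 base epsK eps0 e0; lra.
Qed.

End Pinch.

(** * Comparison of two bounded pieces of the end *)

Section NoEnd.
Variables (R : realType) (H a b L : R).
Variables (E E0 : set 'rV[R]_3) (nrm : 'rV[R]_3 -> 'rV[R]_3).
Variables (sd : 'rV[R]_3 -> 'rV[R]_3 -> R) (er : 'rV[R]_3 -> R).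

Hypotheses (H_gt0 : 0 < H) (H_le : H <= 1 / 2) (ab : a < b) (L_gt1 : 1 < L)
  (HL : b - a < H / 2 * ln L)
  (Epos : forall x, E x -> 0 < x 0 1)
  (Eslab : forall x, E x -> a <= x 0 2 <= b)
  (Eclosed : forall x : 'rV[R]_3, 0 < x 0 1 -> ~ E x -> \forall w \near x, ~ E w)
  (E0E : E0 `<=` E) (cE : connected E) (cE0 : connected E0) (E0n : E0 !=set0)
  (M0 : R) (E0M : forall x, E0 x -> cosh_dist 0 1 x < M0)
  (Efar : forall m : R, exists2 x, E x & m < cosh_dist 0 1 x)
  (Epush : pushes_off E)
  (sdP : forall x, E x -> ~ E0 x -> two_sided E nrm x (sd x) (er x))
  (Ecmc : forall x, E x -> ~ E0 x -> cmc_at H E nrm x).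

Let rho : R := carry_radius L.

Let rho1 : 1 <= rho.
Proof.
rewrite /rho /carry_radius lerDl exprn_ge0// mulr_ge0// addr_ge0// mulr_ge0//.
by have := L_gt1; lra.
Qed.

Let near_gt (x0 y0 : R) x (m : R) : E x -> m < cosh_dist x0 y0 x -> \forall y \near x, m < cosh_dist x0 y0 y.
Proof.
move=> Ex lt; apply: (near_cont (P := fun r : R => m < r) (@cosh_dist_cont R x0 y0 x (Epos Ex))).
by apply: open_nbhs_nbhs; split; [exact: open_gt|].
Qed.

Let slab_radius : R := `|a| + `|b|.
Let kap : R := (2 * (slab_radius ^+ 2 + 1))^-1.
(** At the maximum considered in [hull], [1 + v ^ 2] is at most [4 / kap] by [hull_absurd], or at
    most [rho ^+ 2] by nearness to one of the lines. *)
Let M1 : R := Num.max (4 / kap) (rho ^+ 2).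
(** The exponential is the price, in terms of the height, of passing from that maximum to an
    arbitrary point. *)
Let V : R := M1 * expR (kap * slab_radius ^+ 2).

Let height_le x : E x -> `|x 0 2| <= slab_radius.
Proof.
move=> /Eslab /andP[h1 h2]; rewrite /slab_radius; apply/ler_normlP.
have := ler_norm b; have := ler_norm (- a); rewrite normrN.
by have := normr_ge0 a; have := normr_ge0 b; split; lra.
Qed.

Let kap_gt0 : 0 < kap.
Proof. by rewrite invr_gt0 mulr_gt0// ltr_wpDl// sqr_ge0. Qed.

Let kap_le : kap * (slab_radius ^+ 2 + 1) <= 1 / 2.
Proof.
rewrite /kap invfM mulfVK ?mul1r//.
by rewrite gt_eqF// ltr_wpDl// sqr_ge0.
Qed.

Let M1_ge1 : 1 <= M1.
Proof. by rewrite le_max; apply/orP; right; rewrite exprn_ege1. Qed.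

Let V_ge1 : 1 <= V.
Proof.
apply: mulr_ege1 => //; rewrite -[leLHS]expR0 ler_expR.
by rewrite mulr_ge0 ?sqr_ge0// ltW.
Qed.

Let me : R * R := s2val (cid2 (pinch_absurd (ltW H_gt0) H_le V_ge1)).
Let m := me.1.
Let eps := me.2.
(** In [middle_pinch], [b - a] bounds the variation of the height and [2 * V] that of the function
    of [v]. *)
Let G : R := b - a + 2 * V.
(** Beyond the first entry no point is near both lines; the second is the upper bound of
    [middle_pinch]. *)
Let d_min : R := Num.max (2 * rho ^+ 2) (16 * rho ^+ 2 * V * expR (2 * (G / eps))).

Section TwoLines.
Variables (x1 y1 x2 y2 : R) (B1 B2 : set 'rV[R]_3).
Let l1 := cosh_dist x1 y1.
Let l2 := cosh_dist x2 y2.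
Let d := cosh_dist x1 y1 (row3 x2 y2 0).
Hypotheses (y1_gt0 : 0 < y1) (y2_gt0 : 0 < y2) (c1 : carries L E E0 x1 y1 B1)
  (c2 : carries L E E0 x2 y2 B2) (sep : forall x, B1 x -> rho < l2 x) (d_large : 2 * rho ^+ 2 < d).

Let l1_ge1 x : E x -> 1 <= l1 x. Proof. by move=> /Epos; exact: cosh_dist_ge1. Qed.
Let l2_ge1 x : E x -> 1 <= l2 x. Proof. by move=> /Epos; exact: cosh_dist_ge1. Qed.

Let d_le x : E x -> d <= 2 * l1 x * l2 x.
Proof. by move=> /Epos x1p; exact: cosh_dist_triangle. Qed.

Let far_one x : E x -> l2 x <= rho -> rho < l1 x.
Proof.
move=> Ex le; rewrite ltNge; apply/negP => le1.
have := d_le Ex; have : l1 x * l2 x <= rho * rho.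
  by apply: ler_pM => //; [have := l1_ge1 Ex; lra|have := l2_ge1 Ex; lra].
by have := d_large; rewrite expr2; lra.
Qed.

(* The part of E between the two vertical lines. *)
Definition middle : set 'rV[R]_3 := [set x | [/\ E x, ~ B1 x & B2 x \/ l2 x <= rho]].

Let middle_compact : compact middle.
Proof.
have [M MP] : exists M, middle `<=` [set x | E x /\ cosh_dist 0 1 x <= M].
  have [_ [M2 M2P] _ _ _] := c2.
  exists (Num.max M2 (2 * cosh_dist x2 y2 (row3 0 1 0) * rho)) => x [Ex _ [B2x|le]]; split=> //.
    by rewrite le_max M2P.
  rewrite le_max; apply/orP; right.
  apply: le_trans (cosh_dist_triangle_center 0 x2 0 ltr01 y2_gt0 (Epos Ex)) _.
  rewrite ler_wpM2l// mulr_ge0//; apply: le_trans ler01 _; apply: cosh_dist_ge1 => //.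
  by rewrite row3E.
have cT := truncation_compact Epos Eslab Eclosed (m := M).
apply: subclosed_compact (cT) (MP) => x cx.
have [Ex _] : [set x | E x /\ cosh_dist 0 1 x <= M] x.
  by apply: (compact_closed (@norm_hausdorff _ _) cT) => A /cx[w [/MP hw Aw]]; exists w.
have [[_ B2E] _ _ B2o B2c] := c2; have [_ _ _ B1o _] := c1.
split=> //.
  move=> B1x; have [w [[Ew nB _] hw]] := cx _ (B1o x B1x).
  by apply: nB; exact: hw.
apply: contrapT => /not_orP[nB2 /negP]; rewrite -ltNge => lt.
have [w [[Ew _ h] [h1 h2]]] := cx _ (filterI (B2c x Ex nB2 lt) (near_gt Ex lt)).
by case: h => // le; move: h2; rewrite ltNge le.
Qed.

(** Since [B1] and [B2] have their frontiers near their lines only, a point of the middle away from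
    both lines has a neighbourhood in [E] inside the middle, so a maximum there is a local maximum
    on [E]. It avoids [E0] because [E0] is contained in [B1]. *)
Lemma middle_max (phi : 'rV[R]_3 -> R) z : middle z ->
  (forall x : 'rV[R]_3, 0 < x 0 1 -> {for x, continuous phi}) ->
  exists y, [/\ middle y, phi z <= phi y & (l1 y <= rho \/ l2 y <= rho) \/
    [/\ E y, ~ E0 y & \forall w \near y, E w -> phi w <= phi y]].
Proof.
move=> Wz phic.
have Wc : {within middle, continuous phi}.
  apply: continuous_in_subspaceT => x; rewrite inE => -[Ex _ _].
  by apply: phic; exact: Epos.
have W0 : middle !=set0 by exists z.
have [y Wy ymax] := compact_EVT_max W0 middle_compact Wc.
exists y; rewrite inE in Wy; split=> //; first by apply: ymax; rewrite inE.
have [le1|lt1] := leP (l1 y) rho; first by left; left.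
have [le2|lt2] := leP (l2 y) rho; first by left; right.
right; have [Ey nB1 h] := Wy.
have B2y : B2 y by case: h => // h; move: lt2; rewrite ltNge h.
have [[E0B1 _] _ _ _ B1c] := c1; have [_ _ _ B2o _] := c2.
split=> //; first by move=> /E0B1.
apply: filterS2 (B1c y Ey nB1 lt1) (B2o y B2y) => w nB1w hw Ew.
by apply: ymax; rewrite inE; split=> //; left; exact: hw.
Qed.

(* Otherwise B2 restricted to B1 and to the points closer to the first line would
   be a component of the unbounded connected set E. *)
Lemma middle_equidistant : exists2 z, middle z & l1 z = l2 z.
Proof.
apply: contrapT => no.
have [[E0B1 _] _ _ B1o B1c] := c1; have [[E0B2 B2E] [M2 M2P] B2far B2o B2c] := c2.
pose S := [set x | B2 x /\ (B1 x \/ l1 x < l2 x)].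
have [z0 E0z0] := E0n.
have nlt x : E x -> l1 x < l2 x -> \forall y \near x, l1 y < l2 y.
  move=> Ex lt; have c : {for x, continuous (fun q => l2 q - l1 q)}.
    by apply: contB; apply: cosh_dist_cont; exact: Epos.
  have c0 : 0 < l2 x - l1 x by rewrite subr_gt0.
  have := near_cont (P := fun r : R => 0 < r) c (open_nbhs_nbhs (conj (@open_gt R 0) c0)).
  by apply: filterS => y; rewrite subr_gt0.
have ngt x : E x -> l2 x < l1 x -> \forall y \near x, l2 y < l1 y.
  move=> Ex lt; have c : {for x, continuous (fun q => l1 q - l2 q)}.
    by apply: contB; apply: cosh_dist_cont; exact: Epos.
  have c0 : 0 < l1 x - l2 x by rewrite subr_gt0.
  have := near_cont (P := fun r : R => 0 < r) c (open_nbhs_nbhs (conj (@open_gt R 0) c0)).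
  by apply: filterS => y; rewrite subr_gt0.
have S_loc x : E x -> \forall y \near x, E y -> `[< S y >] = `[< S x >].
  move=> Ex; have [Sx|nSx] := pselect (S x).
    rewrite (asboolT Sx); case: Sx => B2x [B1x|lt].
      by apply: filterS2 (B2o x B2x) (B1o x B1x) => y h1 h2 Ey; apply/asboolT; split; [exact: h1|left; exact: h2].
    by apply: filterS2 (B2o x B2x) (nlt x Ex lt) => y h1 h2 Ey; apply/asboolT; split; [exact: h1|right].
  rewrite (asboolF nSx).
  have nBy : l2 x < l1 x -> ~ B1 x -> rho < l1 x -> \forall y \near x, E y -> `[< S y >] = false.
    move=> lt nB1 lr; apply: filterS2 (B1c x Ex nB1 lr) (ngt x Ex lt) => y h1 h2 Ey.
    by apply/asboolF => -[_ [//|h3]]; move: h2; rewrite ltNge ltW.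
  have [B2x|nB2x] := pselect (B2 x).
    have nB1 : ~ B1 x by move=> B1x; apply: nSx; split=> //; left.
    have le : l2 x <= l1 x by rewrite leNgt; apply/negP => lt; apply: nSx; split=> //; right.
    have lt : l2 x < l1 x.
      rewrite lt_neqAle le andbT; apply/eqP => e; apply: no; exists x => //.
      by split=> //; left.
    by apply: nBy => //; apply: lt_trans lt; exact: B2far.
  have [le|lt] := leP (l2 x) rho; last first.
    by apply: filterS (B2c x Ex nB2x lt) => y nB Ey; apply/asboolF => -[].
  have lr := far_one Ex le; apply: nBy => //; first exact: le_lt_trans lr.
  by move=> /sep; rewrite ltNge le.
have [zf Ezf lt] := Efar M2.
have := loc_const_connected cE S_loc (E0E E0z0) Ezf.
rewrite [RHS]asboolT; last by split; [exact: E0B2|left; exact: E0B1].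
by move=> /asboolP[/M2P]; rewrite leNgt lt.
Qed.

Section Geodesic.
Variables (p q r : R).
Hypotheses (v1 : p * x1 + q + r * (x1 ^+ 2 + y1 ^+ 2) = 0)
  (v2 : p * x2 + q + r * (x2 ^+ 2 + y2 ^+ 2) = 0) (disc : p ^+ 2 - 4 * q * r = 1).
Let v := lin p q r.

Let pos x : 0 < 1 + v x ^+ 2. Proof. by rewrite ltr_pwDl// sqr_ge0. Qed.

Let v_hess (x : 'rV[R]_3) : 0 < x 0 1 -> [/\ dlin p q r x 0 2 = 0,
  dot (dlin p q r x) (dlin p q r x) = v x ^+ 2 + 1 & has_hessian v x (dlin p q r x) (v x *: horiz R)].
Proof.
move=> x1p; have xn : x 0 1 != 0 by rewrite gt_eqF.
by split; [rewrite row3E|rewrite dlin_norm// disc|exact: has_hessian_lin].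
Qed.

(* The distance to the geodesic is bounded independently of d. *)
Let hull z : middle z -> 1 + v z ^+ 2 <= V.
Proof.
move=> Wz; have k0 := kap_gt0.
pose phi (x : 'rV[R]_3) := 2^-1 * ln (1 + v x ^+ 2) + 2^-1 * kap * (x 0 2 - 0) ^+ 2.
have phic (x : 'rV[R]_3) : 0 < x 0 1 -> {for x, continuous phi}.
  move=> x1p; apply: contD; apply: contM; try exact: cont_cst.
    apply: (cont_comp (f := fun x => 1 + v x ^+ 2)); last exact: continuous_ln.
    by apply: contD; [exact: cont_cst|apply: contX; exact: lin_cont].
  by apply: contX; apply: contB; [exact: coord_continuous|exact: cont_cst].
have [y [Wy zy alt]] := middle_max Wz phic.
have [Ey _ _] := Wy; have yp := Epos Ey.
have vy : 1 + v y ^+ 2 <= M1.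
  rewrite le_max; case: alt => [[le|le]|[_ nE0 ymax]].
  - apply/orP; right; apply: le_trans (lin_vanish_le y1_gt0 yp v1 disc) _.
    by have h := l1_ge1 Ey; rewrite -/(l1 y) ler_pXn2r// nnegrE; have := rho1; lra.
  - apply/orP; right; apply: le_trans (lin_vanish_le y2_gt0 yp v2 disc) _.
    by have h := l2_ge1 Ey; rewrite -/(l2 y) ler_pXn2r// nnegrE; have := rho1; lra.
  - apply/orP; left; rewrite leNgt; apply/negP => gt.
    have big : 4 <= kap * (1 + v y ^+ 2).
      by move: gt; rewrite ltr_pdivrMr// mulrC; exact: ltW.
    have [D2 DD hv] := v_hess yp.
    have yn : y 0 1 != 0 by rewrite gt_eqF.
    have ht := has_hessian_comp (phi := fun y : 'rV[R]_3 => y 0 2)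
      (twice_derivable_sqr (2^-1 * kap) 0 (y 0 2)) (has_hessian_height yn).
    have hphi := has_hessianD (has_hessian_comp (twice_derivable_log_cosh (v y)) hv) ht.
    have [nn rel] := Ecmc Ey nE0; have [lam PE le] := rel phi _ _ hphi ymax.
    exact: (hull_absurd (ltW H_gt0) H_le D2 DD nn (height_le Ey) k0 kap_le big PE le).
have vM : ln (1 + v y ^+ 2) <= ln M1.
  by rewrite ler_ln ?posrE//; apply: lt_le_trans ltr01 M1_ge1.
have ty : kap * (y 0 2) ^+ 2 <= kap * slab_radius ^+ 2.
  rewrite ler_pM2l// -(real_normK (num_real (y 0 2))) ler_pXn2r ?nnegrE//.
    exact: height_le.
  by rewrite addr_ge0.
have tz : 0 <= kap * (z 0 2) ^+ 2 by rewrite mulr_ge0 ?sqr_ge0// ltW.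
have lz : ln (1 + v z ^+ 2) <= ln M1 + kap * slab_radius ^+ 2.
  by move: zy; rewrite /phi !subr0; lra.
rewrite -(@lnK R (1 + v z ^+ 2)) ?posrE//.
rewrite /V -{1}(@lnK R M1) ?posrE; last by apply: lt_le_trans ltr01 M1_ge1.
by rewrite -expRD ler_expR.
Qed.

(** By [pinch_absurd] the maximum of [phi] on the middle is near one of the lines, where [w] is at
    least [d / (2 * rho)]. At the equidistant point [w] is of the order of the square root of [d]
    only. As the rest of [phi] varies by at most [G], the logarithmic term bounds [d]. *)
Lemma middle_pinch : (forall x : 'rV[R]_3, 0 < x 0 1 -> (1 + v x ^+ 2) * (d ^+ 2 - 1) =
    2 * d * l1 x * l2 x - l1 x ^+ 2 - l2 x ^+ 2) ->
  d <= 16 * rho ^+ 2 * V * expR (2 * (G / eps)).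
Proof.
move=> mid; have k0 := kap_gt0; have r1 := rho1; have V1 := V_ge1.
have d2 := d_large.
have r2 : 1 <= rho ^+ 2 by rewrite exprn_ege1.
have [/andP[m0 m1] eps0] : 0 < m <= 1 /\ 0 < eps := s2valP (cid2 (pinch_absurd (ltW H_gt0) H_le V_ge1)).
have [z Wz zz] := middle_equidistant.
have [Ez _ _] := Wz; have zp := Epos Ez.
pose w x := l1 x + l2 x.
have w0 x : E x -> 0 < w x.
  by move=> Ex; have := l1_ge1 Ex; have := l2_ge1 Ex; rewrite /w; lra.
have w0' (x : 'rV[R]_3) : 0 < x 0 1 -> 0 < w x.
  move=> xp; rewrite /w; have := cosh_dist_ge1 x1 y1_gt0 xp; have := cosh_dist_ge1 x2 y2_gt0 xp.
  by rewrite -/(l1 x) -/(l2 x); lra.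
pose g y := Num.sqrt (1 + y ^+ 2) + m * y ^+ 2.
pose phi (x : 'rV[R]_3) := (1 * x 0 2 + 0) + g (v x) + - eps * ln (w x).
have phic (x : 'rV[R]_3) : 0 < x 0 1 -> {for x, continuous phi}.
  move=> xp; have vc : {for x, continuous v} by exact: lin_cont.
  apply: contD; first apply: contD.
  - by apply: contD; [apply: contM; [exact: cont_cst|exact: coord_continuous]|exact: cont_cst].
  - apply: contD; last by apply: contM; [exact: cont_cst|exact: contX].
    apply: (cont_comp (f := fun x => 1 + v x ^+ 2)); last exact: sqrt_continuous.
    by apply: contD; [exact: cont_cst|exact: contX].
  - apply: contM; first exact: cont_cst.
    apply: (cont_comp (f := w)); last by apply: continuous_ln; exact: w0'.
    by apply: contD; exact: cosh_dist_cont.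
have [y [Wy zy alt]] := middle_max Wz phic.
have [Ey _ _] := Wy; have yp := Epos Ey.
have near_line : l1 y <= rho \/ l2 y <= rho.
  case: alt => // -[_ nE0 ymax]; exfalso.
  have [D2 DD hv] := v_hess yp.
  have yn : y 0 1 != 0 by rewrite gt_eqF.
  have [W [W2 WW hw]] := cosh_distD_disc x1 x2 y1_gt0 y2_gt0 yp.
  have ht := has_hessian_comp (phi := fun y : 'rV[R]_3 => y 0 2)
    (twice_derivable_affine 1 0 (y 0 2)) (has_hessian_height yn).
  have hg := has_hessian_comp (twice_derivable_sqrt_sqr m (v y)) hv.
  have hl := has_hessian_comp (twice_derivable_ln (- eps) (w0 y Ey)) hw.
  have hphi := has_hessianD (has_hessianD ht hg) hl.
  have [nn rel] := Ecmc Ey nE0; have [lam PE le] := rel phi _ _ hphi ymax.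
  exact: (s2valP' (cid2 (pinch_absurd (ltW H_gt0) H_le V_ge1)) _ _ _ _ _ _ D2 W2 DD (hull Wy) (w0 y Ey) WW nn PE le).
have dy := d_le Ey.
have wy : d <= 2 * rho * w y.
  have h1 := l1_ge1 Ey; have h2 := l2_ge1 Ey.
  apply: le_trans dy _; rewrite /w; case: near_line => h.
    have : l1 y * l2 y <= rho * l2 y by rewrite ler_wpM2r//; lra.
    by have : 0 <= rho * l1 y by [apply: mulr_ge0; lra]; lra.
  have : l1 y * l2 y <= l1 y * rho by rewrite ler_wpM2l//; lra.
  by have : 0 <= rho * l2 y by [apply: mulr_ge0; lra]; lra.
(* For [l1 z = l2 z] the Gram identity becomes [2 * l1 z ^+ 2 = (1 + v z ^+ 2) * (d + 1)], and
   [hull] bounds the first factor. *)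
have wz : w z ^+ 2 <= 4 * V * d.
  have := mid z zp; rewrite -zz => e.
  have hz := l1_ge1 Ez.
  have d1 : 0 < d - 1 by lra.
  have e2 : 2 * l1 z ^+ 2 = (1 + v z ^+ 2) * (d + 1).
    apply: (mulIf (lt0r_neq0 d1)); rewrite [RHS](_ : _ = (1 + v z ^+ 2) * (d ^+ 2 - 1)); last by ring.
    by rewrite e; ring.
  have -> : w z ^+ 2 = 2 * (2 * l1 z ^+ 2) by rewrite /w -zz; ring.
  rewrite e2; have := hull Wz => hV.
  have : (1 + v z ^+ 2) * (d + 1) <= V * (2 * d) by apply: ler_pM => //; [exact: ltW|lra|lra].
  lra.
have gz : 0 <= g (v z) by rewrite addr_ge0 ?sqrtr_ge0// mulr_ge0 ?sqr_ge0// ltW.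
have gy : g (v y) <= 2 * V.
  have hV := hull Wy; have vy0 := sqr_ge0 (v y).
  have s0 := sqrtr_ge0 (1 + v y ^+ 2).
  have s2 : Num.sqrt (1 + v y ^+ 2) ^+ 2 = 1 + v y ^+ 2 by rewrite sqr_sqrtr// ltW.
  have s1 : Num.sqrt (1 + v y ^+ 2) <= V.
    rewrite -(ler_pXn2r (n := 2)) ?nnegrE//; last by lra.
    by rewrite s2; apply: le_trans hV _; rewrite expr2 ler_peMl//; lra.
  have : m * v y ^+ 2 <= v y ^+ 2 by rewrite ler_piMl.
  by rewrite /g; lra.
have lnwy : ln (w y) - ln (w z) <= G / eps.
  rewrite ler_pdivlMr//; move: zy; rewrite /phi /G.
  case/andP: (Eslab Ey) => _ ?; case/andP: (Eslab Ez) => ? _; lra.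
have wyz : w y <= w z * expR (G / eps).
  rewrite -(@lnK R (w y)) ?posrE ?w0// -{1}(@lnK R (w z)) ?posrE ?w0//.
  by rewrite -expRD ler_expR; lra.
have w2 : w y ^+ 2 <= 4 * V * d * expR (2 * (G / eps)).
  have e2 : expR (2 * (G / eps)) = expR (G / eps) ^+ 2 by exact: expRM_natl.
  apply: (@le_trans _ _ ((w z * expR (G / eps)) ^+ 2)).
    by rewrite ler_pXn2r ?nnegrE// ?mulr_ge0 ?expR_ge0// ltW// w0.
  by rewrite exprMn e2 ler_wpM2r// sqr_ge0.
have d0 : 0 < d by lra.
have : d ^+ 2 <= (2 * rho * w y) ^+ 2.
  by rewrite ler_pXn2r ?nnegrE ?(ltW d0)// !mulr_ge0// ltW//; [lra|exact: w0].
rewrite (_ : (2 * rho * w y) ^+ 2 = 2 ^+ 2 * rho ^+ 2 * w y ^+ 2) => [dd|]; last by ring.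
have := ler_wpM2l (_ : 0 <= 2 ^+ 2 * rho ^+ 2) w2.
rewrite mulr_ge0 ?sqr_ge0// => /(_ erefl) h.
have := le_trans dd h.
rewrite (_ : _ * (4 * V * d * _) = d * (16 * rho ^+ 2 * V * expR (2 * (G / eps)))); last by ring.
by rewrite expr2 ler_pM2l.
Qed.

End Geodesic.

Lemma two_carriers : d_min < d -> False.
Proof.
rewrite /d_min gt_max => /andP[_ lt].
have r2 : 1 <= rho ^+ 2 by rewrite exprn_ege1.
have d1 : 1 < d by have := d_large; lra.
have [p [q [r [v1 v2 disc mid]]]] := geodesic_equation y1_gt0 y2_gt0 d1.
by have := middle_pinch v1 v2 disc mid; rewrite leNgt lt.
Qed.

End TwoLines.

Lemma no_cmc_end : False.
Proof.
have cf := carries_far H_gt0 ab L_gt1 HL Epos Eslab Eclosed E0E cE cE0 E0n E0M Efar Epush sdP Ecmc.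
have [x1 [y1 [B1 [y1p _ c1]]]] := cf 1.
have [_ [N NP] _ _ _] := c1.
pose o1 := cosh_dist x1 y1 (row3 0 1 0).
have o10 : 0 < o1 by apply: lt_le_trans ltr01 _; apply: cosh_dist_ge1; rewrite ?row3E.
(* The first entry keeps [B1], which is bounded by [N], away from the second line; the second puts
   the two lines farther apart than [d_min]. *)
have [x2 [y2 [B2 [y2p + c2]]]] := cf (Num.max (2 * N * rho) (2 * o1 * d_min)).
rewrite gt_max => /andP[f1 f2].
have r0 : 0 < rho by apply: lt_le_trans ltr01 rho1.
have sep x : B1 x -> rho < cosh_dist x2 y2 x.
  move=> B1x; have Ex : E x by case: c1 => -[_ h] _ _ _ _; exact: h.
  rewrite ltNge; apply/negP => le.
  have := cosh_dist_triangle 0 x2 0 ltr01 y2p (Epos Ex).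
  have l0 := cosh_dist_ge1 0 ltr01 (Epos Ex); have l20 := cosh_dist_ge1 x2 y2p (Epos Ex).
  have : cosh_dist 0 1 x * cosh_dist x2 y2 x <= N * rho.
    by apply: ler_pM => //; [lra|lra|exact: NP].
  by move: f1; lra.
have dl : d_min < cosh_dist x1 y1 (row3 x2 y2 0).
  have xp : 0 < row3 x2 y2 0 0 1 by rewrite row3E.
  have := cosh_dist_triangle_center 0 x1 0 ltr01 y1p xp; rewrite -/o1 => h.
  have := lt_le_trans f2 h; rewrite ltr_pM2l// mulr_gt0//.
apply: (two_carriers y1p y2p c1 c2 sep _ dl).
by apply: le_lt_trans dl; rewrite le_max lexx.
Qed.

End NoEnd.

(** * Surfaces in charts *)

Section PlaneMaps.
Variable R : realType.

Lemma ball_row2 (a b : 'rV[R]_2) (e : R) : 0 < e ->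
  `|a 0 0 - b 0 0| < e -> `|a 0 1 - b 0 1| < e -> ball a e b.
Proof.
move=> e0 h0 h1; split=> // i j; rewrite (ord1 i); case: j => -[|[|//]] lt2.
- by rewrite (_ : Ordinal lt2 = 0) //; exact/val_inj.
- by rewrite (_ : Ordinal lt2 = 1) //; exact/val_inj.
Qed.

Lemma disc_coord (rho : R) p : 0 < rho -> disc rho p -> `|p.1| <= rho /\ `|p.2| <= rho.
Proof.
move=> r0 pr; split; rewrite -(ler_pXn2r (n := 2)) ?nnegrE ?(ltW r0)// real_normK ?num_real//;
  apply: le_trans pr; by rewrite ?lerDl ?lerDr sqr_ge0.
Qed.

Lemma row_invariance_of_domain (phi : R * R -> 'rV[R]_2) (rho : R) : 0 < rho ->
  (forall p, disc rho p -> {for p, continuous phi}) ->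
  (forall p q, disc rho p -> disc rho q -> phi p = phi q -> p = q) ->
  \forall b \near phi 0, exists2 p, disc rho p & phi p = b.
Proof.
move=> r0 phic phii; pose psi p := (phi p 0 0, phi p 0 1).
have psic : {in disc rho, continuous psi}.
  by move=> p /set_mem dp; apply: cont_pair; apply: cont_coord; exact: phic.
have rowP2 (u w : 'rV[R]_2) : u 0 0 = w 0 0 -> u 0 1 = w 0 1 -> u = w.
  by move=> h0 h1; rewrite (row2E u) (row2E w) h0 h1.
have psii : {in disc rho &, injective psi}.
  by move=> p q /set_mem dp /set_mem dq [h0 h1]; apply: phii => //; exact: rowP2.
have [e e0 eP] := plane_invariance_of_domain r0 psic psii.
apply: filterS (nbhsx_ballx (phi 0) e e0) => b [_ hb].
have [|p dp [h0 h1]] := eP (b 0 0, b 0 1); first by split; exact: hb.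
by exists p => //; exact: rowP2.
Qed.

Lemma row_local_surjection (u : 'rV[R]_2 -> 'rV[R]_2) (a : 'rV[R]_2) (r : R) : 0 < r ->
  (forall b, ball a r b -> {for b, continuous u}) ->
  (forall b b', ball a r b -> ball a r b' -> u b = u b' -> b = b') ->
  \forall q \near u a, exists2 b, ball a r b & u b = q.
Proof.
move=> r0 uc ui; have r20 : 0 < r / 2 by rewrite divr_gt0.
pose g (p : R * R) : 'rV[R]_2 := a + (p.1 *: delta_mx 0 0 + p.2 *: delta_mx 0 1).
have g0 p : g p 0 0 = a 0 0 + p.1 by rewrite /g !mxE /= mulr1 mulr0 addr0.
have g1 p : g p 0 1 = a 0 1 + p.2 by rewrite /g !mxE /= mulr1 mulr0 add0r.
have gc p : {for p, continuous g}.
  apply: contD; first exact: cont_cst.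
  by apply: contD; apply: contZ; try exact: cont_cst; [exact: cvg_fst|exact: cvg_snd].
have gb p : disc (r / 2) p -> ball a r (g p).
  move=> /(disc_coord r20)[h0 h1]; apply: ball_row2 => //; rewrite ?g0 ?g1 opprD addrA subrr sub0r normrN; lra.
have E0 : g 0 = a by rewrite /g /= !scale0r !addr0.
have := @row_invariance_of_domain (fun p => u (g p)) (r / 2) r20; rewrite E0 => h.
have h1 p : disc (r / 2) p -> {for p, continuous (fun p => u (g p))}.
  by move=> dp; apply: (cont_comp (gc p)); apply: uc; exact: gb.
have h2 p q : disc (r / 2) p -> disc (r / 2) q -> u (g p) = u (g q) -> p = q.
  move=> dp dq /(ui _ _ (gb p dp) (gb q dq)) e.
  have := congr1 (fun w : 'rV[R]_2 => w 0 0) e; have := congr1 (fun w : 'rV[R]_2 => w 0 1) e.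
  rewrite /= !g0 !g1 => /addrI e1 /addrI e2.
  by case: p q e1 e2 {dp dq e} => p1 p2 [q1 q2] /= -> ->.
by apply: filterS (h h1 h2) => q [p dp <-]; exists (g p) => //; exact: gb.
Qed.

Lemma mulmx_bound m n (Q : 'M[R]_(m, n)) : exists2 K : R, 0 < K & forall v : 'rV_m, `|v *m Q| <= K * `|v|.
Proof.
pose K := \sum_i \sum_j `|Q i j|.
have K0 : 0 <= K by rewrite sumr_ge0// => i _; rewrite sumr_ge0.
exists (K + 1); first by lra.
move=> v; rewrite {1}/Num.norm /= mx_normrE; apply/bigmax_leP; split.
  by rewrite mulr_ge0//; lra.
case=> i j _ /=; rewrite (ord1 i) mxE.
apply: le_trans (ler_norm_sum _ _ _) _.
apply: le_trans (_ : K * `|v| <= _); last by rewrite ler_wpM2r//; lra.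
rewrite /K mulr_suml; apply: ler_sum => k _; rewrite normrM mulrC.
apply: ler_pM => //; last exact: normr_coord.
by rewrite (bigD1 j)//= lerDl sumr_ge0.
Qed.

End PlaneMaps.

Lemma lipschitz_cont (R : realType) (V V' : normedModType R) (f : V -> V') (x : V) (K : R) : 0 < K ->
  (\forall y \near x, `|f y - f x| <= K * `|y - x|) -> {for x, continuous f}.
Proof.
move=> K0 lip; apply/cvgrPdist_lt => e e0; have eK : 0 < e / K by rewrite divr_gt0.
apply: filterS2 lip (nbhsx_ballx x _ eK) => y le; rewrite -ball_normE /= distrC => lt.
by rewrite distrC; apply: le_lt_trans le _; rewrite mulrC -ltr_pdivlMr.
Qed.

(** * Local equations of a parametrized surface *)

Section Graph.
Variables (R : realType) (E : set 'rV[R]_3) (nrm : 'rV[R]_3 -> 'rV[R]_3).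
Variables (X : 'rV[R]_2 -> 'rV[R]_3) (a : 'rV[R]_2) (M : 'M[R]_(2, 3)) (n0 : 'rV[R]_3).
Hypotheses (strict : forall e : R, 0 < e -> exists2 d : R, 0 < d & forall b b',
     ball a d b -> ball a d b' -> `|X b' - X b - (b' - b) *m M| <= e * `|b' - b|)
  (transversal : row_free (col_mx M n0))
  (XE : \forall b \near a, E (X b))
  (EX : forall O, nbhs a O -> \forall y \near X a, E y -> exists2 b, O b & X b = y)
  (nrm_near : forall e : R, 0 < e -> \forall z \near X a, E z -> `|nrm z - n0| <= e).

(* In the coordinates dual to the rows of M and n0, E is the graph of a function
   with small Lipschitz constant. *)
Lemma graph_two_sided : exists sd er, two_sided E nrm (X a) sd er.
Proof.
pose Q : 'M[R]_(2 + 1) := invmx (col_mx M n0).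
have unit : (col_mx M n0 : 'M[R]_(2 + 1)) \in unitmx by rewrite -row_free_unit.
pose A := lsubmx Q; pose W := rsubmx Q.
have MQ : col_mx M n0 *m row_mx A W = block_mx 1%:M 0 0 1%:M.
  by rewrite hsubmxK mulmxV// -scalar_mx_block.
rewrite mul_col_row in MQ.
have [MA MW nA nW] := eq_block_mx MQ.
have inj (v : 'rV[R]_3) : v *m A = 0 -> v *m W = 0 -> v = 0.
  move=> vA vW; have : (v : 'rV_(2 + 1)) *m Q = 0.
    by rewrite -[Q]hsubmxK mul_mx_row vA vW row_mx0.
  by move/(congr1 (mulmxr (col_mx M n0))) => /=; rewrite -mulmxA mulVmx// mulmx1 mul0mx.
have [KA KA0 KAP] := mulmx_bound A; have [KW KW0 KWP] := mulmx_bound W.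
pose K := KA + KW; have K0 : 0 < K by rewrite addr_gt0.
have AK (v : 'rV[R]_3) : `|v *m A| <= K * `|v| by apply: le_trans (KAP v) _; rewrite ler_wpM2r// lerDl ltW.
have WK (v : 'rV[R]_3) : `|(v *m W) 0 0| <= K * `|v|.
  by apply: le_trans (normr_coord _ _) (le_trans (KWP v) _); rewrite ler_wpM2r// lerDr ltW.
(* With this error [u] differs from a translation by a [1 / 4]-Lipschitz map and [w] is
   [1 / 4]-Lipschitz, so the graph function [h] is [1 / 3]-Lipschitz. A step [t] along [nrm z]
   raises [om] by at least [3 / 4 * t], while [h] changes by at most [t / 12]. *)
have e40 : 0 < (4 * K)^-1 by rewrite invr_gt0 mulr_gt0.
have e4K : K * (4 * K)^-1 = 4^-1 by field; rewrite gt_eqF.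
have [d1 d10 strict1] := strict e40.
have /nbhs_ballP[d2 /= d20 XE2] := XE.
pose d := Num.min d1 d2; have d0 : 0 < d by rewrite lt_min d10.
have dd1 b : ball a d b -> ball a d1 b by apply: le_ball; rewrite ge_min lexx.
have dd2 b : ball a d b -> E (X b) by move=> h; apply: XE2; apply: le_ball h; rewrite ge_min lexx orbT.
pose al (y : 'rV[R]_3) : 'rV[R]_2 := (y - X a) *m A.
pose wl (v : 'rV[R]_3) : R := (v *m W) 0 0.
have wlB v v' : wl (v - v') = wl v - wl v' by rewrite /wl mulmxBl !mxE.
pose om (y : 'rV[R]_3) : R := wl (y - X a).
have alB y y' : al y' - al y = (y' - y) *m A by rewrite /al -mulmxBl opprB addrA subrK.
have omB y y' : om y' - om y = wl (y' - y) by rewrite /om -wlB opprB addrA subrK.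
have alE y (t : R) v : al (y + t *: v) = al y + t *: (v *m A).
  by rewrite -[LHS](subrK (al y)) alB [y + _]addrC addrK -scalemxAl addrC.
pose u b := al (X b); pose w b := om (X b).
have uB b b' : ball a d b -> ball a d b' -> `|u b' - u b - (b' - b)| <= 4^-1 * `|b' - b|.
  move=> ab ab'; rewrite /u alB.
  rewrite (_ : _ - _ = (X b' - X b - (b' - b) *m M) *m A); last first.
    by rewrite [RHS]mulmxBl -[_ *m M *m A]mulmxA MA mulmx1.
  apply: le_trans (AK _) _; rewrite -e4K -mulrA ler_pM2l//.
  by apply: strict1; exact: dd1.
have wB b b' : ball a d b -> ball a d b' -> `|w b' - w b| <= 4^-1 * `|b' - b|.
  move=> ab ab'; rewrite /w omB.
  rewrite (_ : wl _ = wl (X b' - X b - (b' - b) *m M)); last first.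
    have z : wl ((b' - b) *m M) = 0 by rewrite /wl -mulmxA MW mulmx0 mxE.
    by rewrite [RHS]wlB z subr0.
  apply: le_trans (WK _) _; rewrite -e4K -mulrA ler_pM2l//.
  by apply: strict1; exact: dd1.
have uexp b b' : ball a d b -> ball a d b' -> `|b' - b| <= 4 / 3 * `|u b' - u b|.
  move=> ab ab'; have := uB _ _ ab ab'.
  have := ler_distD (u b' - u b) (b' - b) 0; rewrite !subr0 distrC => h1 h2; lra.
have ulip b b' : ball a d b -> ball a d b' -> `|u b' - u b| <= 2 * `|b' - b|.
  move=> ab ab'; have := uB _ _ ab ab'.
  have := ler_distD (b' - b) (u b' - u b) 0; rewrite !subr0 => h1 h2.
  have := normr_ge0 (b' - b); lra.
have uc b : ball a d b -> {for b, continuous u}.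
  move=> ab; apply: (@lipschitz_cont _ _ _ _ _ 2) => //.
  have no : nbhs b (ball a d) by apply: open_nbhs_nbhs; split; [exact: ball_open|].
  by apply: filterS no => b'; exact: ulip.
have uinj b b' : ball a d b -> ball a d b' -> u b = u b' -> b = b'.
  move=> ab ab' e; have := uexp _ _ ab ab'; rewrite e subrr normr0 mulr0 normr_le0 subr_eq0.
  by move/eqP.
have ua : u a = 0 by rewrite /u /al subrr mul0mx.
have := row_local_surjection d0 uc uinj; rewrite ua => /nbhs_ballP[e /= e0 eP].
have [be beP] : exists be : 'rV[R]_2 -> 'rV[R]_2, forall q, ball 0 e q -> ball a d (be q) /\ u (be q) = q.
  exists (fun q => if pselect (ball 0 e q) is left h then s2val (cid2 (eP q h)) else 0).
  by move=> q h; case: pselect => // h'; split; [exact: s2valP (cid2 (eP q h'))|exact: s2valP' (cid2 (eP q h'))].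
pose h q := w (be q).
have hlip q q' : ball 0 e q -> ball 0 e q' -> `|h q' - h q| <= 3^-1 * `|q' - q|.
  move=> bq bq'; have [d1' uq] := beP q bq; have [d2' uq'] := beP q' bq'.
  have := wB _ _ d1' d2'; have := uexp _ _ d1' d2'; rewrite uq uq' -/(h q) -/(h q') => h1 h2.
  lra.
have near_d : nbhs a (ball a d) by exact: nbhsx_ballx.
have n1 := EX near_d.
have n2 := nrm_near e40.
have /nbhs_ballP[r /= r0 rP] : nbhs (X a) (fun y => (E y -> exists2 b, ball a d b & X b = y) /\
    (E y -> `|nrm y - n0| <= (4 * K)^-1)).
  by apply: filterS2 n1 n2.
have eK : 0 < e / K by rewrite divr_gt0.
exists (fun y => om y - h (al y)), (Num.min r (e / K)).
have al_e y : ball (X a) (Num.min r (e / K)) y -> ball 0 e (al y).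
  move=> /le_ball-/(_ (e / K)); rewrite ge_min lexx orbT => /(_ isT).
  rewrite -ball_normE /= -ball_normE /= sub0r normrN distrC => lt.
  apply: le_lt_trans (AK _) _; by rewrite mulrC -ltr_pdivlMr.
split.
- by rewrite lt_min r0.
- move=> y ye; apply: contB.
    apply: (@lipschitz_cont _ _ _ _ _ K) => //.
    by apply: filterS (nbhsx_ballx y _ ltr01) => y' _; rewrite omB; exact: WK.
  have alc : {for y, continuous al}.
    apply: (@lipschitz_cont _ _ _ _ _ K) => //.
    by apply: filterS (nbhsx_ballx y _ ltr01) => y' _; rewrite alB; exact: AK.
  apply: (cont_comp alc); apply: (@lipschitz_cont _ _ _ _ _ 3^-1) => //.
  have no : nbhs (al y) (ball 0 e) by apply: open_nbhs_nbhs; split; [exact: ball_open|exact: al_e].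
  by apply: filterS no => q; exact/hlip/al_e.
- move=> y ye; have bal := al_e y ye; have [d1' uq] := beP _ bal.
  have [rE _] : (E y -> exists2 b, ball a d b & X b = y) /\ (E y -> `|nrm y - n0| <= (4 * K)^-1).
    by apply: rP; apply: le_ball ye; rewrite ge_min lexx.
  split=> [/eqP|/rE[b ab Xb]]; last first.
    have e1 : be (al y) = b by apply: uinj => //; rewrite uq /u Xb.
    by rewrite /h e1 /w Xb subrr.
  rewrite subr_eq0 => /eqP oy.
  suff -> : y = X (be (al y)) by exact: dd2.
  apply/eqP; rewrite -subr_eq0; apply/eqP/inj.
    by rewrite -alB -/(u _) uq subrr.
  by apply/rowP => i; rewrite (ord1 i) -/(wl _) -omB oy -/(h _) /h /w subrr mxE.
- move=> z y t Ez ze ye t0 yte.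
  have [_ rN] : (E z -> exists2 b, ball a d b & X b = z) /\ (E z -> `|nrm z - n0| <= (4 * K)^-1).
    by apply: rP; apply: le_ball ze; rewrite ge_min lexx.
  have nz := rN Ez.
  have nA' : `|nrm z *m A| <= 4^-1.
    rewrite -[nrm z](subrK n0) mulmxDl nA addr0 -e4K; apply: le_trans (AK _) _.
    by rewrite ler_pM2l.
  have nW' : `|wl (nrm z) - 1| <= 4^-1.
    have wn : wl n0 = 1 by rewrite /wl nW mxE.
    have : `|wl (nrm z - n0)| <= 4^-1 by rewrite -e4K; apply: le_trans (WK _) _; rewrite ler_pM2l.
    by rewrite wlB wn.
  have o1 : om (y + t *: nrm z) - om y = t * wl (nrm z).
    by rewrite omB [y + _]addrC addrK /wl -scalemxAl mxE.
  have := hlip _ _ (al_e _ ye) (al_e _ yte).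
  rewrite alE [al y + _]addrC addrK normrZ gtr0_norm// => h1.
  have h2 : t * `|nrm z *m A| <= t * 4^-1 by rewrite ler_pM2l.
  have h3 : t * (3 / 4) <= t * wl (nrm z).
    by rewrite ler_pM2l//; move/ler_normlP: nW' => [? ?]; lra.
  rewrite addrC in h1; move: h1; rewrite [t *: _ + _]addrC -alE => h1.
  have := ler_norm (h (al (y + t *: nrm z)) - h (al y)); lra.
Qed.

End Graph.

Section InteriorChart.
Variables (R : realType) (H : R) (E : set 'rV[R]_3) (nrm : 'rV[R]_3 -> 'rV[R]_3).
Variables (U : set 'rV[R]_2) (X : 'rV[R]_2 -> 'rV[R]_3) (a : 'rV[R]_2) (N : 'rV[R]_3).
Let M : 'M[R]_(2, 3) := \matrix_(i < 2) partial i X a.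
Hypotheses (oU : open U) (Ua : U a) (sX : smooth_on U X) (Mfree : row_free M)
  (N1 : inner (X a) N N = 1) (NX : forall i, inner (X a) N (partial i X a) = 0)
  (XH : mean_curvature_vector X a = H *: N) (Xpos : 0 < X a 0 1)
  (nrmN : nrm (X a) = N)
  (XE : \forall b \near a, E (X b))
  (EX : forall O, nbhs a O -> \forall y \near X a, E y -> exists2 b, O b & X b = y)
  (nrm_near : forall e : R, 0 < e -> \forall z \near X a, E z -> `|nrm z - N| <= e).

Let rowM (w : 'rV[R]_2) : w *m M = \sum_i w 0 i *: partial i X a.
Proof. by rewrite mulmx_sum_row; apply: eq_bigr => i _; rewrite rowK. Qed.

Lemma strictly_differentiable (e : R) : 0 < e -> exists2 d : R, 0 < d & forall b b',
     ball a d b -> ball a d b' -> `|X b' - X b - (b' - b) *m M| <= e * `|b' - b|.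
Proof.
move=> e0; have [r r0 rU] := smooth_radius oU Ua.
have dX k (b : 'rV[R]_2) i : ball a r b -> is_derive b (delta_mx 0 i) (fun q => X q 0 k) (partial i X b 0 k).
  by move=> /rU Ub; apply: der_coord; exact: (smooth_derivable sX).
have cX k i : {for a, continuous (fun b => partial i X b 0 k)}.
  by apply: cont_coord; exact: (smooth_continuous (smooth_partial sX i)).
have ex k := C1_strict r0 (dX k) (cX k) e0.
pose d k := s2val (cid2 (ex k)).
have d0 k : 0 < d k := s2valP (cid2 (ex k)).
have dP k := s2valP' (cid2 (ex k)).
exists (\big[Num.min/1]_k d k).
  by elim/big_ind: _ => // x y x0 y0; rewrite lt_min x0.
move=> b b' ab ab'; rewrite {1}/Num.norm /= mx_normrE; apply/bigmax_leP; split.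
  by rewrite mulr_ge0// ltW.
case=> i k _ /=; rewrite (ord1 i) !mxE.
have dk : \big[Num.min/1]_k d k <= d k by exact: bigmin_le.
apply: le_trans (dP k b b' (le_ball dk ab) (le_ball dk ab')).
rewrite le_eqVlt; apply/orP; left; apply/eqP; congr `| _ - _ |.
by apply: eq_bigr => j _; rewrite !mxE.
Qed.

Lemma normal_transversal : row_free (col_mx M N).
Proof.
apply: inj_row_free => v; rewrite -[v](@hsubmxK _ _ 2 1) mul_row_col => e0.
set l := lsubmx v in e0 *; set r := rsubmx v in e0 *.
have rE : r *m N = r 0 0 *: N by rewrite [r in LHS]mx11_scalar mul_scalar_mx.
have r0 : r 0 0 = 0.
  have := congr1 (fun u => inner (X a) u N) e0.
  rewrite !inner_frame mul0mx rowM rE mulmxDl dotDl mulmx_suml dot_suml big1 => [|i _].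
    by rewrite add0r -scalemxAl dotZl -inner_frame N1 mulr1 dotE big1// => i _; rewrite mxE mul0r.
  by rewrite -scalemxAl dotZl dotC -inner_frame NX mulr0.
have rz : r = 0 by apply/rowP => i; rewrite (ord1 i) r0 mxE.
have lz : l = 0.
  by apply: (row_free_inj Mfree); move: e0; rewrite rz mul0mx addr0 mul0mx.
by rewrite lz rz row_mx0.
Qed.

Lemma chart_two_sided : exists sd er, two_sided E nrm (X a) sd er.
Proof.
exact: graph_two_sided strictly_differentiable normal_transversal XE EX nrm_near.
Qed.

Lemma chart_cmc_at : cmc_at H E nrm (X a).
Proof.
rewrite /cmc_at nrmN; split; first by rewrite -inner_frame.
move=> phi Q B hphi phimax.
apply: (cmc_max_principle oU Ua sX Mfree N1 NX XH hphi Xpos).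
have := near_cont (smooth_continuous sX Ua) phimax.
by apply: filterS2 XE => b Eb; exact.
Qed.

End InteriorChart.

(** * Annular ends *)

Section HalfSpace.
Variable R : realType.

Lemma coords_continuous : continuous (@coords R).
Proof. exact: initial_continuous. Qed.

Lemma coords_inj : injective (@coords R).
Proof. exact: val_inj. Qed.

Lemma coords_pos (q : H2R R) : 0 < coords q 0 1.
Proof. exact: (set_valP q). Qed.

Lemma open_coords (V : set (H2R R)) : open V -> exists2 V' : set 'rV[R]_3, open V' & V = @coords R @^-1` V'.
Proof. by case=> V' oV' <-; exists V'. Qed.

Lemma compact_coords (K : set 'rV[R]_3) : compact K -> K `<=` @half_space R ->
  compact (@coords R @^-1` K).
Proof.
move=> cK KH F FF FK.
have PF : ProperFilter (@coords R @ F) by exact: fmap_proper_filter.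
have [p [Kp clp]] := cK (@coords R @ F) PF FK.
have Hp : p \in @half_space R by apply/mem_set/KH.
exists (exist _ p Hp); split=> // A B FA /=.
move=> [V [/open_coords[V' oV' ->] /= V'p VB]].
have nV : nbhs p V' by apply: open_nbhs_nbhs.
have FcA : (@coords R @ F) (@coords R @` A).
  apply: (@filterS _ F _ A) FA => x Ax; by exists x.
have [_ [[x Ax <-] V'x]] := clp _ _ FcA nV.
by exists x; split=> //; exact: VB.
Qed.

End HalfSpace.

Section Annulus.
Variable R : realType.

Definition circ (t : R) : @circle R :=
  exist _ (cos t, sin t) (mem_set (cos2Dsin2 t : @circle R (cos t, sin t))).

Let max0 (s : R) : @half_line R (Num.max s 0).
Proof. by rewrite /half_line /= le_max lexx orbT. Qed.

(** Clamping at 0 makes [ann] a map defined on the whole plane. *)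
Definition ray (s : R) : @half_line R := exist _ (Num.max s 0) (mem_set (max0 s)).

Definition ann (p : R * R) : half_open_annulus R := (circ p.1, ray p.2).

Definition radius (q : half_open_annulus R) : R := set_val q.2.

Lemma circ_continuous : continuous circ.
Proof.
apply: continuous_comp_initial => t.
by apply: cont_pair; [exact: continuous_cos|exact: continuous_sin].
Qed.

Lemma ray_continuous : continuous ray.
Proof.
apply: continuous_comp_initial => s; apply: (@lipschitz_cont R R R _ _ 1) => //.
apply: filterS (nbhsx_ballx s _ ltr01) => y _ /=; rewrite mul1r; change (`|Num.max y 0 - Num.max s 0| <= `|y - s|).
have := ler_norm (y - s); have := ler_norm (- (y - s)); rewrite normrN => h1 h2.
by have [y0|y0] := leP y 0; have [s0|s0] := leP s 0; apply/ler_normlP; split; lra.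
Qed.

Lemma ann_continuous : continuous ann.
Proof.
move=> p; have c1 : {for p, continuous (fun p : R * R => circ p.1)}.
  by apply: (cont_comp (f := fst)); [exact: cvg_fst|exact: circ_continuous].
have c2 : {for p, continuous (fun p : R * R => ray p.2)}.
  by apply: (cont_comp (f := snd)); [exact: cvg_snd|exact: ray_continuous].
exact: (cont_pair c1 c2).
Qed.

Lemma radius_continuous : continuous radius.
Proof.
move=> q; apply: (cont_comp (f := snd)); first exact: cvg_snd.
exact: initial_continuous.
Qed.

Lemma radius_ge0 q : 0 <= radius q.
Proof. exact: (set_valP q.2). Qed.

Lemma radius_ann t s : radius (ann (t, s)) = Num.max s 0.
Proof. by []. Qed.

Lemma ann_surj q : exists2 t : R, `|t| <= pi & q = ann (t, radius q).
Proof.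
case: q => -[[x y] zP] [s sP]; have := zP; rewrite inE /circle /= => xy.
have x1 : -1 <= x <= 1.
  have y0 := sqr_ge0 y; have x0 := sqr_ge0 (x - 1); have x2 := sqr_ge0 (x + 1); apply/andP; split; nra.
have y2 : 1 - x ^+ 2 = y ^+ 2 by lra.
have c0 := acosK _; have xI : x \in `[(-1), 1] by rewrite in_itv.
have p0 := acos_ge0 x1; have p1 := acos_lepi x1.
have sx : Num.max s 0 = s.
  by apply/max_idPl; move: sP; rewrite inE.
have mk t : cos t = x -> sin t = y -> (exist _ (x, y) zP, exist _ s sP) = ann (t, s) :> half_open_annulus R.
  move=> ct st; rewrite /ann /=; congr pair; apply: val_inj => /=; first by rewrite ct st.
  by rewrite sx.
have [y0|y0] := leP 0 y.
  exists (acos x); first by rewrite ger0_norm.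
  by apply: mk; rewrite ?acosK// sin_acos// y2 sqrtr_sqr ger0_norm.
exists (- acos x); first by rewrite normrN ger0_norm.
by apply: mk; rewrite ?cosN ?sinN ?acosK// sin_acos// y2 sqrtr_sqr ltr0_norm// opprK.
Qed.

Lemma truncated_annulus_compact (r : R) : compact [set q | radius q <= r].
Proof.
have cK : compact ([set` `[- pi, pi]] `*` [set` `[0, r]] : set (R * R)).
  by apply: compact_setX; exact: segment_compact.
rewrite (_ : [set q | _] = ann @` ([set` `[- pi, pi]] `*` [set` `[0, r]])).
  by apply: continuous_compact => //; apply: continuous_subspaceT; exact: ann_continuous.
apply/seteqP; split=> [q /= qr|_ [[t s] /= [_ hs] <-]].
  have [t tp ->] := ann_surj q; exists (t, radius q) => //=.
  by rewrite !in_itv /= radius_ge0 qr -ler_norml.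
by move: hs; rewrite in_itv /= radius_ann => /andP[s0 sr]; rewrite (max_idPl s0).
Qed.

Variables (f : half_open_annulus R -> 'rV[R]_3) (fc : continuous f).

Lemma connected_boundary : connected (f @` [set q | radius q = 0]).
Proof.
rewrite (_ : _ @` _ = (fun t : R => f (ann (t, 0))) @` `[- pi, pi]).
  apply: connected_continuous_connected; first exact: segment_connected.
  apply: continuous_subspaceT => t; apply: (cont_comp (f := fun t : R => ann (t, 0))); last exact: fc.
  apply: (cont_comp (f := fun t : R => (t, 0 : R))); last exact: ann_continuous.
  by apply: cont_pair; [exact: cont_id|exact: cont_cst].
apply/seteqP; split=> [_ [q /= q0 <-]|_ [t _ <-]].
  have [t tp ->] := ann_surj q; rewrite q0; exists t => //=.
  by rewrite in_itv /= -ler_norml.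
by exists (ann (t, 0)) => //=; rewrite radius_ann maxxx.
Qed.

Lemma connected_annulus : connected (range f).
Proof.
have [t0 _ q0E] := ann_surj (ann (0, 0)); pose S t := f @` [set q | radius q = 0] `|`
  (fun s : R => f (ann (t, s))) @` `[0, +oo[.
rewrite (_ : range f = \bigcup_(t in [set: R]) S t); last first.
  apply/seteqP; split=> [_ [q _ <-]|_ [t _ [[q _ <-]|[s _ <-]]]]; [|by exists q|by exists (ann (t, s))].
  have [t _ ->] := ann_surj q; exists t => //; right; exists (radius q) => //.
  by rewrite /= in_itv /= radius_ge0.
apply: bigcup_connected.
  by exists (f (ann (0, 0))) => t _; left; exists (ann (0, 0)) => //=; rewrite radius_ann maxxx.
move=> t _; apply: connectedU; last 1 first.
- apply: connected_continuous_connected; first exact/connected_intervalP/interval_is_interval.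
  apply: continuous_subspaceT => s; apply: (cont_comp (f := fun s : R => ann (t, s))); last exact: fc.
  apply: (cont_comp (f := fun s : R => (t, s))); last exact: ann_continuous.
  by apply: cont_pair; [exact: cont_cst|exact: cont_id].
- exists (f (ann (t, 0))); split; first by exists (ann (t, 0)) => //=; rewrite radius_ann maxxx.
  by exists 0 => //=; rewrite in_itv /= lexx.
- exact: connected_boundary.
Qed.

End Annulus.

(** * Topology of a properly embedded end *)

Section EndTopology.
Variables (R : realType) (a b : R) (T : topologicalType) (f : T -> H2R R).
Variable e : half_open_annulus R -> T.
Hypotheses (emb : embedding (f \o e)) (prop : proper_map (f \o e))
  (fe_slab : range f `<=` slab a b).

Definition end_map (q : half_open_annulus R) : 'rV[R]_3 := coords (f (e q)).
Let F := end_map.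
Definition end_set : set 'rV[R]_3 := range end_map.
Definition end_boundary : set 'rV[R]_3 := end_map @` [set q | radius q = 0].
Let E := end_set.

Lemma end_map_continuous : continuous end_map.
Proof.
move=> q; have [fc _] := prop; apply: (cont_comp (f := f \o e)); first exact: fc.
exact: coords_continuous.
Qed.

Lemma end_map_inj : injective end_map.
Proof. by have [_ inj _] := emb => q q' /coords_inj /inj. Qed.

Lemma end_pos x : E x -> 0 < x 0 1.
Proof. by move=> [q _ <-]; exact: coords_pos. Qed.

Lemma end_slab x : E x -> a <= x 0 2 <= b.
Proof. by move=> [q _ <-]; apply: fe_slab; exists (e q). Qed.

Lemma end_map_open q A : nbhs q A ->
  \forall x \near end_map q, E x -> exists2 q', A q' & end_map q' = x.
Proof.
move=> nA; have [_ _ op] := emb.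
have [V oV VE] := op _ (open_interior A).
have [V' oV' V'E] := open_coords oV.
have Vq : V' (F q).
  have : (V `&` range (f \o e)) (f (e q)) by rewrite -VE; exists q.
  by rewrite V'E => -[].
apply: filterS (open_nbhs_nbhs (conj oV' Vq)) => x V'x [q' _ xE].
have : (V `&` range (f \o e)) (f (e q')) by rewrite V'E; split; [rewrite /= -/(end_map q') xE|exists q'].
rewrite -VE => -[q2 /interior_subset Aq2 e2]; exists q2 => //.
by rewrite -xE /end_map -e2.
Qed.

Lemma end_map_proper (K : set 'rV[R]_3) : compact K -> K `<=` @half_space R -> compact (end_map @^-1` K).
Proof. by move=> cK KH; have [_ pr] := prop; exact: (pr _ (compact_coords cK KH)). Qed.

(** Properness concerns compact sets of the half-space only, so the argument takes place in a
    compact box around [x], in which [E] is compact. *)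
Lemma end_closed (x : 'rV[R]_3) : 0 < x 0 1 -> ~ E x -> \forall w \near x, ~ E w.
Proof.
move=> x1 nEx; have [K K0 n2] := half_space_box x1.
set A := box _ _ _ _ _ in n2.
have cA : compact A by exact: box_compact.
have AH : A `<=` @half_space R by move=> y; exact: box_pos.
have cEA : compact (F @` (F @^-1` A)).
  apply: continuous_compact; last exact: end_map_proper.
  by apply: continuous_subspaceT; exact: end_map_continuous.
have clEA := compact_closed (@norm_hausdorff _ _) cEA.
have nEA : ~ (F @` (F @^-1` A)) x by move=> [q _ qx]; apply: nEx; exists q.
have n1 : \forall w \near x, ~ (F @` (F @^-1` A)) w.
  by apply: open_nbhs_nbhs; split; [exact: closed_openC|].
by apply: filterS2 n1 n2 => w nw Aw [q _ qw]; apply: nw; exists q => //; rewrite /= /F qw.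
Qed.

Let orig : 'rV[R]_3 -> R := cosh_dist 0 1.

Let orig_cont : continuous (fun q => orig (F q)).
Proof.
move=> q; apply: (cont_comp (f := F)); first exact: end_map_continuous.
by apply: cosh_dist_cont; exact: coords_pos.
Qed.

Let bounded_on (g : half_open_annulus R -> R) A : continuous g -> compact A -> exists M, forall q, A q -> g q <= M.
Proof.
move=> gc cA; have [[q0 Aq0]|] := pselect (A !=set0); last first.
  by move=> A0; exists 0 => q Aq; case: A0; exists q.
have [|q1 _ q1P] := compact_EVT_max (ex_intro _ q0 Aq0) cA (f := g).
  exact: continuous_subspaceT.
by exists (g q1) => q Aq; apply: q1P; rewrite inE.
Qed.

Lemma radius_bounded (m : R) : exists r, forall q, orig (F q) <= m -> radius q <= r.
Proof.
pose K := 2 * (`|m| + 2) + 2; have m0 := normr_ge0 m; have K0 : 0 < K by rewrite /K; lra.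
have cA : compact (F @^-1` box 0 1 K a b).
  by apply: end_map_proper; [exact: box_compact|move=> y; exact: box_pos].
have [r rP] := bounded_on (@radius_continuous R) cA.
exists r => q le; apply: rP.
have lt : orig (F q) < `|m| + 2 by have := ler_norm m; lra.
have Eq : E (F q) by exists q.
have [h0 h1 h2] := cosh_dist_lt ltr01 (end_pos Eq) lt.
case/andP: (end_slab Eq) => h3 h4.
by split; [exact: ltW|exact: ltW|exact: ltW|apply/andP; split; lra].
Qed.

Lemma end_far (m : R) : exists2 x, E x & m < orig x.
Proof.
have [r rP] := radius_bounded m; exists (F (ann (0, Num.max r 0 + 1))); first by exists (ann (0, Num.max r 0 + 1)).
rewrite ltNge; apply/negP => /rP; rewrite radius_ann.
have : r <= Num.max r 0 by rewrite le_max lexx.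
have : 0 <= Num.max r 0 by rewrite le_max lexx orbT.
by move=> h1 h2; rewrite (max_idPl _); lra.
Qed.

Lemma dist_bounded (r : R) : exists M, forall q, radius q <= r -> orig (F q) <= M.
Proof. exact: (bounded_on orig_cont (@truncated_annulus_compact R r)). Qed.

Lemma end_boundary_sub : end_boundary `<=` E.
Proof. by move=> _ [q _ <-]; exists q. Qed.

Lemma end_boundary_nonempty : end_boundary !=set0.
Proof. by exists (F (ann (0, 0))); exists (ann (0, 0)) => //=; rewrite radius_ann maxxx. Qed.

Lemma end_connected : connected E.
Proof. exact: connected_annulus end_map_continuous. Qed.

Lemma end_boundary_connected : connected end_boundary.
Proof. exact: connected_boundary end_map_continuous. Qed.

Definition end_inv (x : 'rV[R]_3) : half_open_annulus R :=
  if pselect (E x) is left h then s2val (cid2 h) else ann (0, 0).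

Lemma end_invK x : E x -> end_map (end_inv x) = x.
Proof. by move=> Ex; rewrite /end_inv; case: pselect => // h; exact: s2valP' (cid2 h). Qed.

Lemma end_mapK : cancel end_map end_inv.
Proof. by move=> q; apply: end_map_inj; apply: end_invK; exists q. Qed.

Lemma end_inv_near x A : E x -> nbhs (end_inv x) A -> \forall y \near x, E y -> A (end_inv y).
Proof.
move=> Ex /end_map_open; rewrite end_invK//.
by apply: filterS => y /[apply] -[q Aq <-]; rewrite end_mapK.
Qed.

Let slide (r : R) (p : half_open_annulus R * R) : half_open_annulus R :=
  (p.1.1, ray (radius p.1 + (1 - p.2) * Num.max 0 (r - radius p.1))).

Let slide_fix r q t : (r <= radius q \/ t = 1) -> slide r (q, t) = q.
Proof.
move=> h; rewrite /slide /=; have -> : (1 - t) * Num.max 0 (r - radius q) = 0.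
  case: h => [le|->]; last by rewrite subrr mul0r.
  by rewrite (max_idPl _) ?mulr0// subr_le0.
rewrite addr0 [RHS]surjective_pairing; congr pair; apply: val_inj => /=.
by apply/max_idPl; exact: radius_ge0.
Qed.

Let slide_cont r : continuous (slide r).
Proof.
move=> p; have c1 : {for p, continuous (fun p : half_open_annulus R * R => p.1.1)}.
  by apply: (cont_comp (f := fst) (g := fst)); exact: cvg_fst.
have cr : {for p, continuous (fun p : half_open_annulus R * R => radius p.1)}.
  by apply: (cont_comp (f := fst)); [exact: cvg_fst|exact: radius_continuous].
have c2 : {for p, continuous (fun p : half_open_annulus R * R =>
    radius p.1 + (1 - p.2) * Num.max 0 (r - radius p.1))}.
  apply: contD => //; apply: contM; first by apply: contB; [exact: cont_cst|exact: cvg_snd].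
  apply: (cont_comp (f := fun p : half_open_annulus R * R => r - radius p.1) (g := fun s : R => Num.max 0 s)).
    by apply: contB => //; exact: cont_cst.
  apply: (@lipschitz_cont R R R _ _ 1) => //.
  apply: filterS (nbhsx_ballx _ _ ltr01) => y _; rewrite mul1r /=; move: (r - radius p.1) => s.
  have := ler_norm (y - s); have := ler_norm (- (y - s)); rewrite normrN => h1 h2.
  by have [y0|y0] := leP 0 y; have [s0|s0] := leP 0 s; apply/ler_normlP; split; lra.
have c3 := cont_comp c2 (@ray_continuous R _).
exact: (cont_pair c1 c3).
Qed.

(** Points of radius less than [r] are pushed outwards along their radii to radius [r], the others
    are fixed; time runs backwards, from the pushed point at [0] to the point itself at [1]. *)
Lemma end_pushes_off : pushes_off E.
Proof.
move=> m; have [r0 r0P] := radius_bounded m.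
(* Beyond radius [r0] the end is farther than [m]; [M] bounds the distance up to radius [r], where
   points may move. *)
pose r := Num.max r0 0 + 1; have [M MP] := dist_bounded r.
have rr0 : r0 < r.
  by rewrite /r; apply: (@le_lt_trans _ _ (Num.max r0 0)); [rewrite le_max lexx|rewrite ltrDl].
have r_gt0 : 0 < r.
  by rewrite /r; apply: (@le_lt_trans _ _ (Num.max r0 0)); [rewrite le_max lexx orbT|rewrite ltrDl].
exists (fun x t => F (slide r (end_inv x, t))), M => x Ex; split.
- by rewrite slide_fix; [exact: end_invK|right].
- by move=> t _; exists (slide r (end_inv x, t)).
- rewrite ltNge; apply/negP => /r0P; apply/negP; rewrite -ltNge.
  apply: (lt_le_trans rr0); rewrite /slide /radius /= subr0 mul1r.
  rewrite le_max; apply/orP; left; rewrite -/(radius (end_inv x)).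
  have : r - radius (end_inv x) <= Num.max 0 (r - radius (end_inv x)) by rewrite le_max lexx orbT.
  lra.
- move=> lt t _; rewrite slide_fix; first exact: end_invK.
  left; rewrite leNgt; apply/negP => lt'.
  by have := MP _ (ltW lt'); rewrite /F end_invK// leNgt lt.
- move=> t A t01 nA.
  have c : {for (end_inv x, t), continuous (fun p => F (slide r p))}.
    by apply: (cont_comp (f := slide r)); [exact: slide_cont|exact: end_map_continuous].
  have [[B C] /= [nB nC] BC] := near_cont c nA.
  have /nbhs_ballP[e1 /= e10 e1P] := end_inv_near Ex nB.
  have /nbhs_ballP[e2 /= e20 e2P] := nC.
  exists (Num.min e1 e2); first by rewrite lt_min e10.
  move=> x' t' Ex' t'01 xx' tt'; apply: (BC (end_inv x', t')); split.
    by apply: e1P => //; apply: le_ball xx'; rewrite ge_min lexx.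
  by apply: e2P; rewrite -ball_normE /=; apply: lt_le_trans tt' _; rewrite ge_min lexx orbT.
Qed.

End EndTopology.

Section ChartInverse.
Variables (R : realType) (T : topologicalType) (D U : set 'rV[R]_2) (c : 'rV[R]_2 -> T).
Hypothesis chart : is_chart D U c.

Definition chart_inv (t : T) : 'rV[R]_2 :=
  if pselect ((c @` (U `&` D)) t) is left h then s2val (cid2 h) else 0.

Lemma chart_invP t : (c @` (U `&` D)) t -> (U `&` D) (chart_inv t) /\ c (chart_inv t) = t.
Proof.
move=> h; rewrite /chart_inv; case: pselect => // h'.
by split; [exact: s2valP (cid2 h')|exact: s2valP' (cid2 h')].
Qed.

Lemma chart_invK b : (U `&` D) b -> chart_inv (c b) = b.
Proof.
move=> UDb; have [h1 h2] := @chart_invP (c b) (ex_intro2 _ _ b UDb erefl).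
by case: chart => _ _ inj _; apply: inj => //; rewrite inE.
Qed.

Lemma chart_open : open (c @` (U `&` D)).
Proof. by case: chart => _ _ _ op; have := op setT openT; rewrite setTI. Qed.

Lemma chart_inv_continuous t : (c @` (U `&` D)) t -> {for t, continuous chart_inv}.
Proof.
move=> Wt A nA; have [UDa ca] := chart_invP Wt.
case: chart => _ _ _ op; have := op _ (open_interior A) => oA.
have At : (c @` (A^° `&` (U `&` D))) t by exists (chart_inv t).
apply: filterS (open_nbhs_nbhs (conj oA At)) => _ [b [/interior_subset Ab UDb] <-].
by rewrite /= chart_invK.
Qed.

End ChartInverse.

(** * The end in the charts of the surface *)

Section EndCharts.
Variables (R : realType) (H a b : R) (T : topologicalType) (f : T -> H2R R).
Variable e : half_open_annulus R -> T.
Hypotheses (ec : continuous e) (emb : embedding (f \o e)) (prop : proper_map (f \o e))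
  (fe_slab : range f `<=` slab a b)
  (param : forall x, parametrized_at f setT x \/ parametrized_at f (@half_plane R) x)
  (N : T -> 'rV[R]_3) (Nc : continuous N)
  (NP : forall D U c X, D = setT \/ D = @half_plane R ->
      local_parametrization f D U c X ->
      forall a, (U `&` D) a ->
        [/\ inner (X a) (N (c a)) (N (c a)) = 1,
            forall i, inner (X a) (N (c a)) (partial i X a) = 0 &
            mean_curvature_vector X a = H *: N (c a)]).

Definition end_normal (x : 'rV[R]_3) : 'rV[R]_3 := N (e (end_inv f e x)).

Let ann_inj (p q : R * R) : 0 < p.2 -> 0 < q.2 -> `|p.1 - q.1| <= 1 -> ann p = ann q -> p = q.
Proof.
case: p q => [t r] [t' r'] /= r0 r0' tt' E.
have rE : r = r'.
  have := congr1 (@radius R) E; rewrite !radius_ann.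
  by rewrite (max_idPl (ltW r0)) (max_idPl (ltW r0')).
have ctE : cos t = cos t' by have := congr1 (fun z : half_open_annulus R => (set_val z.1).1) E.
have stE : sin t = sin t' by have := congr1 (fun z : half_open_annulus R => (set_val z.1).2) E.
have s0 : sin (t - t') = 0 by rewrite sinB ctE stE mulrC subrr.
have pi1 : 1 < pi :> R by have := pi_ge2 R; lra.
have [lt|gt|->] := ltgtP t t'; last by rewrite rE.
- have : 0 < sin (t' - t).
    by apply: sin_gt0_pi; move/ler_normlP: tt' => [? ?]; apply/andP; split; lra.
  by rewrite -opprB sinN s0 oppr0 ltxx.
- have : 0 < sin (t - t').
    by apply: sin_gt0_pi; move/ler_normlP: tt' => [? ?]; apply/andP; split; lra.
  by rewrite s0 ltxx.
Qed.

Let e_inj : injective e.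
Proof. by move=> q q' E; apply: (end_map_inj emb); rewrite /end_map E. Qed.

Let chart_at q D U c X x : D = setT \/ D = @half_plane R -> local_parametrization f D U c X ->
  (U `&` D) x -> c x = e q -> 0 < radius q ->
  (exists sd er, two_sided (end_set f e) end_normal (end_map f e q) sd er) /\
  cmc_at H (end_set f e) end_normal (end_map f e q).
Proof.
move=> DE lp UDx cx q0; have [ch sX Xf] := lp.
have oU : open U by case: ch.
have [XE Xfree] := Xf x UDx; have Ux : U x by case: UDx.
have [N1 NX XH] := NP DE lp UDx.
have XqE : X x = end_map f e q by rewrite XE cx.
have eqW : (c @` (U `&` D)) (e q) by exists x.
(* Invariance of domain: the annulus near [q], read in the chart, covers a full neighbourhood of [x]
   in the plane even if [D] is the half-plane. Hence an interior point of the end is not on the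
   boundary of the surface. *)
have nXE : \forall y \near x, end_set f e (X y).
  have [t0 _ qE] := ann_surj q; set r0 := radius q in q0 qE.
  pose g (p : R * R) := (t0 + p.1, r0 + p.2).
  have gc : continuous g.
    move=> p; have c1 : {for p, continuous (fun p : R * R => t0 + p.1)}.
      by apply: contD; [exact: cont_cst|exact: cvg_fst].
    have c2 : {for p, continuous (fun p : R * R => r0 + p.2)}.
      by apply: contD; [exact: cont_cst|exact: cvg_snd].
    exact: (cont_pair c1 c2).
  have g0 : g 0 = (t0, r0) by rewrite /g /= !addr0.
  have egc : continuous (fun p => e (ann (g p))).
    move=> p; apply: (cont_comp (f := fun p => ann (g p))); last exact: ec.
    by apply: (cont_comp (f := g)); [exact: gc|exact: ann_continuous].
  have nW : \forall p \near (0 : R * R), (c @` (U `&` D)) (e (ann (g p))).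
    apply: (near_cont (egc 0)); apply: open_nbhs_nbhs; split; first exact: chart_open ch.
    by rewrite g0 -qE.
  have /nbhs_ballP[d /= d0 dP] := nW.
  (* The three bounds keep the disc inside the chart, the angles within 1 of each other as [ann_inj]
     requires, and the radii positive. *)
  pose rho := Num.min (Num.min (d / 2) 2^-1) (r0 / 2).
  have [rd r12 r02] : [/\ rho <= d / 2, rho <= 2^-1 & rho <= r0 / 2].
    by rewrite /rho; split; rewrite ?ge_min ?lexx ?orbT.
  have rho0 : 0 < rho by rewrite /rho !lt_min; apply/andP; split; [apply/andP; split|]; lra.
  have inW p : disc rho p -> (c @` (U `&` D)) (e (ann (g p))).
    move=> /(disc_coord rho0)[h1 h2]; apply: dP.
    by split; rewrite /ball/= sub0r normrN; lra.
  have gpos p : disc rho p -> 0 < (g p).2.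
    by move=> /(disc_coord rho0)[_ /ler_normlP[h2 h3]]; rewrite /g /=; lra.
  pose phi p := chart_inv D U c (e (ann (g p))).
  have phic p : disc rho p -> {for p, continuous phi}.
    move=> /inW Wp; apply: (cont_comp (f := fun p => e (ann (g p)))); first exact: egc.
    exact: chart_inv_continuous ch _ Wp.
  have phii p p' : disc rho p -> disc rho p' -> phi p = phi p' -> p = p'.
    move=> dp dp' E.
    have [_ h1] := chart_invP (inW _ dp); have [_ h2] := chart_invP (inW _ dp').
    have : e (ann (g p)) = e (ann (g p')) by rewrite -h1 -h2 -/(phi p) E.
    move=> /e_inj/ann_inj; move: (dp) (dp') => /(disc_coord rho0)[/ler_normlP[? ?] _] /(disc_coord rho0)[/ler_normlP[? ?] _].
    have gg : `|(g p).1 - (g p').1| <= 1 by rewrite /g /=; apply/ler_normlP; split; lra.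
    move=> /(_ (gpos _ dp) (gpos _ dp') gg); rewrite /g => -[/addrI e1 /addrI e2].
    by rewrite (surjective_pairing p) (surjective_pairing p') e1 e2.
  have := row_invariance_of_domain rho0 phic phii.
  have -> : phi 0 = x by rewrite /phi g0 -qE -cx (chart_invK ch).
  apply: filterS => y [p dp <-]; have [UDy cy] := chart_invP (inW _ dp).
  have [-> _] := Xf _ UDy; rewrite cy.
  by exists (ann (g p)).
have nEX O : nbhs x O -> \forall y \near X x, end_set f e y -> exists2 z, O z & X z = y.
  move=> nO; have [_ _ _ op] := ch; have oO := op _ (open_interior O).
  have nA : nbhs q [set q' | (c @` (O^° `&` (U `&` D))) (e q')].
    by apply: (near_cont (ec (x := q))); apply: open_nbhs_nbhs; split=> //; exists x.
  rewrite XqE; apply: filterS (end_map_open emb nA) => y h /h[q' [z [/interior_subset Oz UDz] cz] <-].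
  by exists z => //; have [-> _] := Xf z UDz; rewrite cz.
have nrmN : end_normal (X x) = N (c x) by rewrite /end_normal XqE (end_mapK emb) cx.
have Eq : end_set f e (end_map f e q) by exists q.
have nn (s : R) : 0 < s -> \forall z \near X x, end_set f e z -> `|end_normal z - N (c x)| <= s.
  move=> s0; rewrite XqE.
  have Nec : {for q, continuous (fun q => N (e q))} by apply: (cont_comp (f := e)); [exact: ec|exact: Nc].
  have nA : nbhs (end_inv f e (end_map f e q)) [set q' | ball (N (e q)) s (N (e q'))].
    by rewrite (end_mapK emb); apply: (near_cont Nec); exact: nbhsx_ballx.
  apply: filterS (end_inv_near emb Eq nA) => z h /h.
  by rewrite -ball_normE /= /end_normal cx distrC => /ltW.
have Xpos : 0 < X x 0 1 by rewrite XqE; exact: coords_pos.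
rewrite -XqE; split.
- exact: (chart_two_sided oU Ux sX Xfree N1 NX nXE nEX nn).
- exact: (chart_cmc_at oU Ux sX Xfree N1 NX XH Xpos nrmN nXE).
Qed.

Lemma end_geometry x : end_set f e x -> ~ end_boundary f e x ->
  (exists sd er, two_sided (end_set f e) end_normal x sd er) /\
  cmc_at H (end_set f e) end_normal x.
Proof.
move=> [q _ <-] nb.
have q0 : 0 < radius q.
  rewrite lt_neqAle radius_ge0 andbT; apply/eqP => r0; apply: nb.
  by exists q => //=; rewrite -r0.
have [[U [c [X [lp [y UDy cy]]]]]|[U [c [X [lp [y UDy cy]]]]]] := param (e q).
- by apply: chart_at lp UDy cy q0; left.
- by apply: chart_at lp UDy cy q0; right.
Qed.

Lemma no_end_in_slab : 0 < H -> H <= 1 / 2 -> a < b -> False.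
Proof.
move=> H0 H1 ab.
(* Then [H / 2 * ln L] equals [b - a + H / 2]. *)
pose L := expR (2 * (b - a) / H + 1).
have h0 : 0 < 2 * (b - a) / H + 1.
  by rewrite ltr_wpDl// divr_ge0 ?(ltW H0)// mulr_ge0// subr_ge0 ltW.
have L1 : 1 < L by rewrite /L expR_gt1.
have HL : b - a < H / 2 * ln L.
  rewrite /L expRK mulrDr mulr1.
  have -> : H / 2 * (2 * (b - a) / H) = b - a by field; rewrite gt_eqF.
  by rewrite ltrDl divr_gt0.
have [M MP] := dist_bounded prop 0.
pose sd x := if pselect (end_set f e x /\ ~ end_boundary f e x) is left h then
  sval (cid (end_geometry h.1 h.2).1) else fun=> 0.
have sd_ex x : end_set f e x -> ~ end_boundary f e x -> exists er, two_sided (end_set f e) end_normal x (sd x) er.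
  move=> Ex nbx; rewrite /sd; case: pselect => [h|[]//].
  exact: svalP (cid (end_geometry h.1 h.2).1).
pose er x := if pselect (end_set f e x /\ ~ end_boundary f e x) is left h then
  sval (cid (sd_ex x h.1 h.2)) else 0.
have sdP x : end_set f e x -> ~ end_boundary f e x -> two_sided (end_set f e) end_normal x (sd x) (er x).
  move=> Ex nbx; rewrite /er; case: pselect => [h|[]//].
  exact: svalP (cid (sd_ex x h.1 h.2)).
apply: (@no_cmc_end R H a b L (end_set f e) (end_boundary f e) end_normal sd er H0 H1 ab L1 HL
  (@end_pos _ _ f e) (@end_slab _ _ _ _ f e fe_slab) (@end_closed _ _ f e prop)
  (@end_boundary_sub _ _ f e) (@end_connected _ _ f e prop)
  (@end_boundary_connected _ _ f e prop) (@end_boundary_nonempty _ _ f e) (M + 1) _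
  (@end_far _ _ _ _ f e prop fe_slab) (@end_pushes_off _ _ _ _ f e emb prop fe_slab) sdP _).
- move=> _ [q /= q0 <-]; have qr : radius q <= 0 by rewrite q0.
  by have := MP q qr; lra.
- by move=> x Ex nbx; have [] := end_geometry Ex nbx.
Qed.

End EndCharts.

(** * Surfaces of finite topology *)

Section Embeddings.

Lemma embedding_lift_continuous (S T Z : topologicalType) (h : T -> S) (k : Z -> S) (g : Z -> T) (z : Z) :
  embedding h -> {for z, continuous k} -> (forall w, h (g w) = k w) -> {for z, continuous g}.
Proof.
move=> [_ inj op] kc hg A nA; have [V oV VE] := op _ (open_interior A).
have Vk : V (k z).
  have : (h @` A^°) (h (g z)) by exists (g z).
  by rewrite VE -hg => -[].
apply: filterS (near_cont kc (open_nbhs_nbhs (conj oV Vk))) => w Vw.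
have : (V `&` range h) (h (g w)) by split; [rewrite hg|exists (g w)].
by rewrite -VE => -[t /interior_subset At /inj E]; rewrite /= -E.
Qed.

Variable R : realType.

Lemma proper_embedding (Z : topologicalType) (g : Z -> H2R R) : proper_map g -> injective g -> embedding g.
Proof.
move=> [gc gp] inj; split=> // O oO.
exists (~` (g @` ~` O)); last first.
  apply/seteqP; split=> [_ [z Oz <-]|y [nO [z _ zE]]].
    by split; [move=> [z' nO /inj zz]; apply: nO; rewrite zz|exists z].
  by exists z => //; apply: contrapT => nOz; apply: nO; exists z.
rewrite openE => p np; rewrite /interior.
pose G z := coords (g z).
have Gc : continuous G.
  by move=> z; apply: (cont_comp (f := g)); [exact: gc|exact: coords_continuous].
have [K K0 nK] := half_space_box (coords_pos p); set B := box _ _ _ _ _ in nK.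
have cB : compact B by exact: box_compact.
have cgB : compact (g @^-1` (@coords R @^-1` B)).
  by apply: gp; apply: compact_coords => // y; exact: box_pos.
have cC : compact (g @^-1` (@coords R @^-1` B) `&` ~` O).
  by apply: compact_closedI => //; exact: open_closedC.
have clC : closed (G @` (g @^-1` (@coords R @^-1` B) `&` ~` O)).
  apply: compact_closed; first exact: norm_hausdorff.
  by apply: continuous_compact => //; exact: continuous_subspaceT.
have nC : (~` (G @` (g @^-1` (@coords R @^-1` B) `&` ~` O))) (coords p).
  by move=> [z [_ nO] /coords_inj zp]; apply: np; exists z.
have n1 : nbhs p (@coords R @^-1` (~` (G @` (g @^-1` (@coords R @^-1` B) `&` ~` O)))).
  by apply: (near_cont (coords_continuous (x := p))); apply: open_nbhs_nbhs; split=> //; exact: closed_openC.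
have n2 : nbhs p (@coords R @^-1` B) := near_cont (coords_continuous (x := p)) nK.
apply: filterS2 n1 n2 => y ny By [z nO zy]; apply: ny; exists z; last by rewrite /G zy.
by split; rewrite //= zy.
Qed.

End Embeddings.

(** * Properly embedded surfaces without boundary *)

Section NoBoundary.
Variables (R : realType) (H a b : R) (T : topologicalType) (f : T -> H2R R).
Hypotheses (H_gt0 : 0 < H) (H_le : H <= 1 / 2) (ab : a < b)
  (prop : proper_map f) (finj : injective f) (f_slab : range f `<=` slab a b)
  (param : forall x, parametrized_at f setT x)
  (N : T -> 'rV[R]_3) (Nc : continuous N)
  (NP : forall D U c X, D = setT \/ D = @half_plane R ->
      local_parametrization f D U c X ->
      forall a, (U `&` D) a ->
        [/\ inner (X a) (N (c a)) (N (c a)) = 1,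
            forall i, inner (X a) (N (c a)) (partial i X a) = 0 &
            mean_curvature_vector X a = H *: N (c a)]).

(* The distance to a vertical line has no local maximum on T, because geodesic
   circles have curvature larger than 1. *)
Lemma not_compact : [set: T] !=set0 -> ~ compact [set: T].
Proof.
move=> T0 cT; pose F t := coords (f t).
have Fc : continuous F.
  move=> t; have [fc _] := prop; apply: (cont_comp (f := f)); [exact: fc|exact: coords_continuous].
have Fpos t : 0 < F t 0 1 by exact: coords_pos.
have oc : continuous (fun t => cosh_dist 0 1 (F t)).
  by move=> t; apply: (cont_comp (f := F)); [exact: Fc|exact: cosh_dist_cont].
have [|t _ tmax] := compact_EVT_max T0 cT (f := fun t => cosh_dist 0 1 (F t)).
  exact: continuous_subspaceT.
have [U [c [X [lp [y UDy cy]]]]] := param t.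
have [ch sX Xf] := lp; have [XE Xfree] := Xf y UDy.
have oU : open U by case: ch.
have Uy : U y by case: UDy.
have [N1 NX XH] := NP (or_introl erefl) lp UDy.
have XyE : X y = F t by rewrite XE cy.
have Xpos : 0 < X y 0 1 by rewrite XyE.
have [P [P2 PP hP]] := cosh_dist_has_hessian 0 ltr01 Xpos.
have Xmax : \forall z \near y, cosh_dist 0 1 (X z) <= cosh_dist 0 1 (X y).
  apply: filterS (open_nbhs_nbhs (conj oU Uy)) => z Uz.
  have [-> _] := Xf z (conj Uz I); rewrite XyE; apply: tmax; exact: mem_set.
have [lam PE] := cmc_max_principle oU Uy sX Xfree N1 NX XH hP Xpos Xmax.
set nu := N (c y) *m _ in PE *; set l := cosh_dist 0 1 (X y) in PP *.
have nn : dot nu nu = 1 by rewrite -inner_frame.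
have l1 : 1 <= l by exact: cosh_dist_ge1.
rewrite -/(ttrace nu _) ttraceZ ttrace_horiz => rel.
have nE : nu 0 0 ^+ 2 + nu 0 1 ^+ 2 + nu 0 2 ^+ 2 = 1 by rewrite -nn dot3E !expr2.
have lam2 : lam ^+ 2 = l ^+ 2 - 1.
  by rewrite -PP PE dotZl dotC dotZl nn mulr1 expr2.
have n2 := sqr_ge0 (nu 0 2).
have h1 : l <= l * (2 - (nu 0 0 ^+ 2 + nu 0 1 ^+ 2)) by rewrite ler_peMr//; lra.
have h2 : `|lam| < l.
  rewrite -(ltr_pXn2r (n := 2)) ?nnegrE//; last by lra.
  by rewrite real_normK ?num_real// lam2; lra.
have h3 : `|2 * H * lam| <= `|lam|.
  have H0 := H_gt0; have H1 := H_le.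
  by rewrite normrM ger0_norm ?mulr_ge0 ?(ltW H0)//; apply: ler_piMl => //; lra.
by have := ler_norm (- (2 * H * lam)); rewrite normrN; lra.
Qed.

Section Puncture.
Variables (S : topologicalType) (F : set S) (h : T -> S) (x0 : S).
Hypotheses (Shaus : hausdorff_space S) (Ffin : finite_set F) (hemb : embedding h)
  (hrange : range h = ~` F) (Fx0 : F x0).
Variables (U : set 'rV[R]_2) (c : 'rV[R]_2 -> S) (a0 : 'rV[R]_2).
Hypotheses (ch : is_chart setT U c) (Ua0 : U a0) (ca0 : c a0 = x0).

Let c_cont y : U y -> {for y, continuous c}.
Proof.
case: ch => oU cc _ _ Uy; rewrite setIT in cc.
by have := cc; rewrite continuous_open_subspace// => h1; apply: h1; rewrite inE.
Qed.

Let c_inj y y' : U y -> U y' -> c y = c y' -> y = y'.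
Proof. by case: ch => _ _ inj _ Uy Uy'; apply: inj; rewrite inE setIT. Qed.

Let radius_exists : exists2 r : R, 0 < r & forall y, ball a0 r y -> U y /\ (F (c y) -> y = a0).
Proof.
have oU : open U by case: ch.
have cl : closed (F `\ x0).
  have /accessible_finite_set_closed := hausdorff_accessible Shaus; apply.
  exact: finite_setD.
have nx : nbhs x0 (~` (F `\ x0)).
  by apply: open_nbhs_nbhs; split; [exact: closed_openC|move=> [_]; exact].
have n1 : \forall y \near a0, (~` (F `\ x0)) (c y).
  by apply: near_cont; [exact: c_cont|rewrite ca0].
have n2 : nbhs a0 U by exact: open_nbhs_nbhs.
have : nbhs a0 (fun y => (~` (F `\ x0)) (c y) /\ U y) by apply: filterS2 n1 n2.
move=> /nbhs_ballP[r /= r0 rP]; exists r => // y /rP[nF Uy]; split=> // Fc.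
by apply: c_inj => //; rewrite ca0; apply: contrapT => ne; apply: nF; split.
Qed.

Let r : R := s2val (cid2 radius_exists).
Let r_gt0 : 0 < r := s2valP (cid2 radius_exists).
Let rP := s2valP' (cid2 radius_exists).

(** Decreasing in the radius and less than [r]: the annulus becomes a punctured disc of the chart
    whose puncture is the infinite end. *)
Let scale (q : half_open_annulus R) : R := r / (2 * (1 + radius q)).

Let scale_gt0 q : 0 < scale q.
Proof. by rewrite divr_gt0// mulr_gt0// ltr_pwDl// radius_ge0. Qed.

Let k (q : half_open_annulus R) : 'rV[R]_2 :=
  a0 + scale q *: ((set_val q.1).1 *: delta_mx 0 0 + (set_val q.1).2 *: delta_mx 0 1).

Let k0 q : k q 0 0 = a0 0 0 + scale q * (set_val q.1).1.
Proof. by rewrite /k !mxE /= mulr1 mulr0 addr0. Qed.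

Let k1 q : k q 0 1 = a0 0 1 + scale q * (set_val q.1).2.
Proof. by rewrite /k !mxE /= mulr1 mulr0 add0r. Qed.

Let circP (z : @circle R) : (set_val z).1 ^+ 2 + (set_val z).2 ^+ 2 = 1.
Proof. exact: (set_valP z). Qed.

Let k_near q (d : R) : scale q < d -> ball a0 d (k q).
Proof.
move=> lt; have s0 := scale_gt0 q; have zE := circP q.1.
have c1 : `|(set_val q.1).1| <= 1.
  by rewrite -(ler_pXn2r (n := 2)) ?nnegrE// real_normK ?num_real// expr1n -zE lerDl sqr_ge0.
have c2 : `|(set_val q.1).2| <= 1.
  by rewrite -(ler_pXn2r (n := 2)) ?nnegrE// real_normK ?num_real// expr1n -zE lerDr sqr_ge0.
apply: ball_row2; first exact: lt_trans lt.
- rewrite k0 opprD addrA subrr sub0r normrN normrM gtr0_norm//.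
  by apply: le_lt_trans lt; rewrite ler_piMr// ltW.
- rewrite k1 opprD addrA subrr sub0r normrN normrM gtr0_norm//.
  by apply: le_lt_trans lt; rewrite ler_piMr// ltW.
Qed.

Let scale_lt q : scale q < r.
Proof.
rewrite ltr_pdivrMr; last by rewrite mulr_gt0// ltr_pwDl// radius_ge0.
by rewrite ltr_pMr//; have := radius_ge0 q; lra.
Qed.

Let kU q : U (k q). Proof. by have [] := rP (k_near (scale_lt q)). Qed.

Let k_inj : injective k.
Proof.
move=> q q' E.
have e0 : scale q * (set_val q.1).1 = scale q' * (set_val q'.1).1.
  by have := congr1 (fun v : 'rV[R]_2 => v 0 0) E; rewrite !k0 => /addrI.
have e1 : scale q * (set_val q.1).2 = scale q' * (set_val q'.1).2.
  by have := congr1 (fun v : 'rV[R]_2 => v 0 1) E; rewrite !k1 => /addrI.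
have s2 : scale q ^+ 2 = scale q' ^+ 2.
  by rewrite -[LHS]mulr1 -[RHS]mulr1 -{1}(circP q.1) -(circP q'.1) !mulrDr -!exprMn e0 e1.
have sE : scale q = scale q'.
  by apply/eqP; rewrite -(eqrXn2 (n := 2)) ?s2// ltW.
have sn : scale q' != 0 by rewrite gt_eqF.
have rE : radius q = radius q'.
  have p (z : half_open_annulus R) : 0 < 1 + radius z by rewrite ltr_pwDl// radius_ge0.
  have sr (z : half_open_annulus R) : 1 + radius z = r / (2 * scale z).
    by rewrite /scale; field; rewrite !gt_eqF.
  by have := sr q; rewrite sE -sr => /addrI.
rewrite sE in e0 e1; move/(mulfI sn): e0 => e0; move/(mulfI sn): e1 => e1.
rewrite (surjective_pairing q) (surjective_pairing q'); congr pair; apply: val_inj => //.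
by rewrite (surjective_pairing (\val q.1)) (surjective_pairing (\val q'.1)); congr pair.
Qed.

Let k_cont : continuous k.
Proof.
move=> q; have c0 : {for q, continuous scale}.
  apply: contM; first exact: cont_cst.
  apply: contV; first by rewrite gt_eqF// mulr_gt0// ltr_pwDl// radius_ge0.
  by apply: contM; [exact: cont_cst|apply: contD; [exact: cont_cst|exact: radius_continuous]].
have cz : {for q, continuous (fun q : half_open_annulus R => set_val q.1)}.
  by apply: (cont_comp (f := fst)); [exact: cvg_fst|exact: initial_continuous].
have z1 : {for q, continuous (fun q : half_open_annulus R => (set_val q.1).1)}.
  by apply: (cont_comp cz); exact: cvg_fst.
have z2 : {for q, continuous (fun q : half_open_annulus R => (set_val q.1).2)}.
  by apply: (cont_comp cz); exact: cvg_snd.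
have cc (v : 'rV[R]_2) : {for q, continuous (fun _ : half_open_annulus R => v)} by exact: cont_cst.
exact: (contD (cc a0) (contZ c0 (contD (contZ z1 (cc (delta_mx 0 0))) (contZ z2 (cc (delta_mx 0 1)))))).
Qed.

Let puncture_ex q : exists t, h t = c (k q).
Proof.
have : (~` F) (c (k q)).
  have [_ kF] := rP (k_near (scale_lt q)); move=> /kF kq.
  have e0 : scale q * (set_val q.1).1 = 0.
    by have := congr1 (fun v : 'rV[R]_2 => v 0 0) kq; rewrite k0 => /eqP; rewrite -subr_eq0 addrAC subrr add0r => /eqP.
  have e1 : scale q * (set_val q.1).2 = 0.
    by have := congr1 (fun v : 'rV[R]_2 => v 0 1) kq; rewrite k1 => /eqP; rewrite -subr_eq0 addrAC subrr add0r => /eqP.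
  have sn : scale q != 0 by rewrite gt_eqF.
  have z0 : (set_val q.1).1 = 0 by apply: (mulfI sn); rewrite mulr0.
  have z1 : (set_val q.1).2 = 0 by apply: (mulfI sn); rewrite mulr0.
  have := circP q.1; rewrite z0 z1 expr0n addr0 => /esym/eqP.
  by rewrite oner_eq0.
by rewrite -hrange => -[t _ tE]; exists t.
Qed.

Let e q : T := sval (cid (puncture_ex q)).
Let he q : h (e q) = c (k q). Proof. exact: svalP (cid (puncture_ex q)). Qed.

Let e_cont : continuous e.
Proof.
move=> q; apply: (embedding_lift_continuous (k := fun q => c (k q)) hemb) => //.
by apply: (cont_comp (f := k)); [exact: k_cont|exact: c_cont].
Qed.

Let e_inj : injective e.
Proof. by move=> q q' E; apply: k_inj; apply: c_inj => //; rewrite -!he E. Qed.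

(** The preimage of a compact set under [f] is compact, so its image in [S] is closed and avoids a
    disc around the puncture; this bounds the radius on the preimage under [f \o e]. *)
Let fe_proper : proper_map (f \o e).
Proof.
have [fc fp] := prop; split.
  by move=> q; apply: (cont_comp (f := e)); [exact: e_cont|exact: fc].
move=> K cK; have cK' := fp K cK.
have hc : continuous h by case: hemb.
have chK : compact (h @` (f @^-1` K)) by apply: continuous_compact => //; exact: continuous_subspaceT.
have nx0 : (~` (h @` (f @^-1` K))) x0.
  move=> [t _ tx0]; have : (~` F) (h t) by rewrite -hrange; exists t.
  by rewrite tx0.
have n1 : \forall y \near a0, (~` (h @` (f @^-1` K))) (c y).
  apply: near_cont; first exact: c_cont.
  have clKh : closed (h @` (f @^-1` K)) by exact: compact_closed.
  by rewrite ca0; apply: open_nbhs_nbhs; split=> //; exact: closed_openC.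
have /nbhs_ballP[d /= d0 dP] := n1.
have bnd : (f \o e) @^-1` K `<=` [set q | radius q <= r / d].
  move=> q Kq; rewrite /= leNgt; apply/negP => lt.
  have sd : scale q < d.
    rewrite ltr_pdivrMr; last by rewrite mulr_gt0// ltr_pwDl// radius_ge0.
    move: lt; rewrite ltr_pdivrMr// mulrC => lt.
    have := mulr_ge0 (ltW d0) (radius_ge0 q); lra.
  by apply: (dP _ (k_near sd)); exists (e q).
apply: subclosed_compact (@truncated_annulus_compact R (r / d)) bnd.
have clK : closed (@coords R @` K).
  apply: compact_closed; first exact: norm_hausdorff.
  by apply: continuous_compact => //; apply: continuous_subspaceT; exact: coords_continuous.
have -> : (f \o e) @^-1` K = (fun q => coords (f (e q))) @^-1` (@coords R @` K).
  apply/seteqP; split=> [q Kq|q [p Kp /coords_inj pE]]; first by exists (f (e q)).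
  by rewrite /= -pE.
apply: closed_comp clK => q _; apply: (cont_comp (f := f \o e)); last exact: coords_continuous.
by apply: (cont_comp (f := e)); [exact: e_cont|exact: fc].
Qed.

Lemma no_puncture : False.
Proof.
have inj : injective (f \o e) by move=> q q' /finj/e_inj.
apply: (no_end_in_slab e_cont (proper_embedding fe_proper inj) fe_proper f_slab _ Nc NP) => //.
by move=> x; left; exact: param.
Qed.

End Puncture.

Lemma no_finite_topology : [set: T] !=set0 -> ~ finite_topology R T.
Proof.
move=> T0 [S [F [h [[Sh _ Sc] cS Ff hemb hr]]]].
have [F0|] := eqVneq F set0; last first.
  move=> /set0P[x0 Fx0]; have [U [c [ch [a0 Ua0 ca0]]]] := Sc x0.
  exact: (no_puncture Sh Ff hemb hr Fx0 ch Ua0 ca0).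
(* Without punctures [h] is a homeomorphism, so [T] is compact like [S]. *)
have ex s : exists t, h t = s.
  have : range h s by rewrite hr F0 setC0.
  by move=> [t _ tE]; exists t.
pose g s := sval (cid (ex s)).
have hg s : h (g s) = s by exact: svalP (cid (ex s)).
have gc : continuous g.
  by move=> s; apply: (embedding_lift_continuous (k := id) hemb) => //; exact: cont_id.
apply: (not_compact T0); rewrite (_ : [set: T] = g @` [set: S]).
  by apply: continuous_compact => //; exact: continuous_subspaceT.
apply/seteqP; split=> // t _; exists (h t) => //.
by case: hemb => _ inj _; apply: inj; rewrite hg.
Qed.

End NoBoundary.

Theorem theorem1 (R : realType) (H : R) (H_gt0 : 0 < H) (H_le : H <= 1 / 2) :
  (forall (T : topologicalType) (f : T -> H2R R),
      immersed_surface f ->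
      has_constant_mean_curvature f H ->
      (exists E : set (H2R R), properly_embedded_annular_end f E) ->
      forall L : R, 0 < L -> ~ (range f `<=` slab 0 L))
  /\
  ~ (exists M : set (H2R R),
      [/\ M !=set0,
          immersed_surface_without_boundary (@set_val _ M),
          proper_map (@set_val _ M),
          has_constant_mean_curvature (@set_val _ M) H &
          finite_topology R M /\
          exists a b : R, a < b /\ M `<=` slab a b]).
Proof.
split.
  move=> T f [_ _ param] [N Nc NP] [_ [e [ec emb prop _]]] L L0 f_slab.
  exact: (no_end_in_slab ec emb prop f_slab param Nc NP H_gt0 H_le L0).
move=> [M [[x Mx] [_ _ param] prop [N Nc NP] [ft [a [b [ab Mab]]]]]].
have M_slab : range (@set_val _ M) `<=` slab a b.
  by move=> _ [y _ <-]; apply: Mab; exact: set_valP.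
apply: (no_finite_topology H_gt0 H_le ab prop (@val_inj _ _ _) M_slab param Nc NP _ ft).
by exists (exist _ x (mem_set Mx)).
Qed.
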